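(* Let $\alpha_0=\frac12$, $s>2$, $T>0$ and $\omega_0\in H^{s+1}(\mathbb{R}^2)\cap L^1(\mathbb{R}^2)$. Let $\omega^{\alpha_0}$ be a solution, for $0\le t\le T$, of the SQG equation $\omega^{\alpha_0}_t+u^{\alpha_0}\cdot\nabla\omega^{\alpha_0}=0$ with $u^{\alpha_0}=\nabla^{\perp}(-\Delta)^{-1+\alpha_0}\omega^{\alpha_0}=\nabla^\perp(-\Delta)^{-1/2}\omega^{\alpha_0}$ and $\omega^{\alpha_0}(\cdot,0)=\omega_0$. Then there exists $\delta>0$ depending on $T$ and $\int_0^T\|\omega^{\alpha_0}(t)\|_{H^{s+1}\cap L^1}\,dt$ such that for every $0<\alpha<\frac12$ with $0<\frac12-\alpha<\delta$, the solution $\omega^{\alpha}$ of the generalized SQG equation $\omega^{\alpha}_t+u^{\alpha}\cdot\nabla\omega^{\alpha}=0$ with $u^{\alpha}=\nabla^{\perp}(-\Delta)^{-1+\alpha}\omega^{\alpha}$ and the same initial data $\omega^\alpha(\cdot,0)=\omega_0$ is smooth on $[0,T]$. Moreover, for $t\in[0,T]$, $$\|\omega^{\alpha}(t)-\omega^{\alpha_0}(t)\|_{H^{s}}\le C\left(\Big(\tfrac12-\alpha\Big)+\Big(\tfrac12-\alpha\Big)\log^2\Big(\tfrac12-\alpha\Big)\right),$$ where $C>0$ is a constant depending on $T$ and $\int_0^T\|\omega^{\alpha_0}(t)\|_{H^{s+1}\cap L^1}\,dt$.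
   Context: All equations are posed for $(x,t)\in\mathbb{R}^2\times\mathbb{R}^+$, with $\omega$ a scalar unknown. $\nabla^\perp=(-\partial_{x_2},\partial_{x_1})$, and $(-\Delta)^{-1+\alpha}$ is the Fourier multiplier with symbol $|\xi|^{-2+2\alpha}$; thus $u$ is divergence free and, up to a multiplicative constant that the paper omits, $u(x)=\int_{\mathbb{R}^2}\frac{(x-y)^\perp}{|x-y|^{2+2\alpha}}\omega(y)\,dy$ (principal value when $\alpha=\frac12$). $H^r=H^r(\mathbb{R}^2)$ has norm $\|f\|_{H^r}=\|(I-\Delta)^{r/2}f\|_{L^2}$, and $\|f\|_{H^{s+1}\cap L^1}=\|f\|_{H^{s+1}}+\|f\|_{L^1}$. ''Solution for $0\le t\le T$'' and ''smooth on $[0,T]$'' mean that $\omega$ belongs to $C([0,T];H^{s+1}(\mathbb{R}^2))$ and satisfies the equation there (since $u$ is divergence free, such solutions also stay in $L^1$ when $\omega_0\in L^1$); ''the solution $\omega^\alpha$'' is the unique solution in this class given by local well-posedness, and the assertion is that it exists on all of $[0,T]$. The parameter $s$ is fixed. *)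

(* Defs.v *)
From HB Require Import structures.
From mathcomp Require Import all_boot all_order all_algebra.
From mathcomp Require Import all_classical all_reals all_analysis.
From mathcomp Require Import complex.

Set Implicit Arguments.
Unset Strict Implicit.
Unset Printing Implicit Defensive.

Import Order.TTheory GRing.Theory Num.Theory.
Import numFieldNormedType.Exports.
Import Normc.

Local Open Scope classical_set_scope.
Local Open Scope ring_scope.

Notation plane R := (measurableTypeR R * measurableTypeR R)%type.
Notation leb2 := (lebesgue_measure \x lebesgue_measure)%E.

Section GeneralizedSQG.
Context {R : realType}.
Implicit Types (x xi : R * R) (f : R * R -> R) (r alpha : R).

Definition dot x xi : R := x.1 * xi.1 + x.2 * xi.2.

Definition expi (t : R) : R[i] := (cos t +i* sin t)%C.

Definition cintegral (D : set (R * R)) (g : R * R -> R[i]) : R[i] :=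
  ((\int[leb2]_(x in D) complex.Re (g x))%R +i*
   (\int[leb2]_(x in D) complex.Im (g x))%R)%C.

(* The unitary normalisation (2 pi)^-1 of the Fourier transform on the plane
   is used, so that the L^2 transform is an isometry. *)
Definition truncated_fourier f (n : nat) xi : R[i] :=
  ((2 * pi)^-1)%:C%C *
  cintegral [set x | dot x x <= n%:R ^+ 2]
    (fun x => expi (- dot x xi) * (f x)%:C%C).

(* [g] is the Fourier-Plancherel transform of [f]: the limit in L^2 of the
   transforms of the truncations of [f] to balls. *)
Definition is_fourier f (g : R * R -> R[i]) : Prop :=
  [/\ measurable_fun setT ((fun xi => complex.Re (g xi)) : plane R -> R),
      measurable_fun setT ((fun xi => complex.Im (g xi)) : plane R -> R) &
      Lnorm leb2 2%:E
        (fun xi => (normc (g xi - truncated_fourier f n xi))%:E)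
        @[n --> \oo] --> 0%E].

(* Every [f] in L^2 has a transform, unique up to a null set; all the notions
   below are insensitive to the version that is picked here. *)
Definition fourier f : R * R -> R[i] := xget (fun=> 0) (is_fourier f).

(* || (I - Delta)^(r/2) f ||_{L^2}, computed on the Fourier side. *)
Definition Hnorm r f : \bar R :=
  Lnorm leb2 2%:E
    (fun xi => ((1 + dot xi xi) `^ (r / 2) * normc (fourier f xi))%:E).

Definition in_H r f : Prop := f \in Lfun leb2 2%:E /\ (Hnorm r f < +oo)%E.

Definition in_L1 f : Prop := f \in Lfun leb2 1%E.

Definition L1norm f : \bar R := Lnorm leb2 1%E (EFin \o f).

Definition inverse_fourier (g : R * R -> R[i]) x : R[i] :=
  ((2 * pi)^-1)%:C%C * cintegral setT (fun xi => expi (dot x xi) * g xi).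

(* Symbol |xi|^(-2 + 2 alpha) of (- Delta)^(-1 + alpha). *)
Definition fraclap_symbol alpha xi : R :=
  Num.sqrt (dot xi xi) `^ (-2 + 2 * alpha).

(* u = (- d_2, d_1) (- Delta)^(-1 + alpha) f.  For f in H^r with r > 1 and
   0 < alpha <= 1/2, the transform of u is integrable, so that the inversion
   integral converges absolutely at every point; it is real valued. *)
Definition velocity alpha f x : R * R :=
  (complex.Re (inverse_fourier
     (fun xi => (0 +i* - xi.2)%C * (fraclap_symbol alpha xi)%:C%C
                * fourier f xi) x),
   complex.Re (inverse_fourier
     (fun xi => (0 +i* xi.1)%C * (fraclap_symbol alpha xi)%:C%C
                * fourier f xi) x)).

Definition gradient f x : R * R :=
  ('D_((1, 0) : R * R) f x, 'D_((0, 1) : R * R) f x).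

Definition in_CtH (T r : R) (w : R -> R * R -> R) : Prop :=
  (forall t : R, t \in `[0, T] -> in_H r (w t)) /\
  (forall t : R, t \in `[0, T] ->
     Hnorm r (fun x => w tau x - w t x)
       @[tau --> within [set` `[0, T]] (nbhs t)] --> 0%E).

(* [w] is a solution on [0, T], in C([0, T]; H^(s+1)), of
   w_t + u . grad w = 0, u = grad^perp (- Delta)^(-1 + alpha) w, w(0) = w0.
   As s > 2, every class of H^(s+1) has a unique continuous representative,
   which is C^1: [w t] is required to be that representative, and the equation
   is understood pointwise, the time derivative being one-sided at 0 and T.
   The datum [w0] is only a class modulo null sets. *)
Definition gSQG_solution (alpha s T : R) (w0 : R * R -> R)
    (w : R -> R * R -> R) : Prop :=
  [/\ in_CtH T (s + 1) w,
      forall t : R, t \in `[0, T] -> continuous (w t),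
      {ae leb2, forall x, w 0 x = w0 x} &
      forall (t : R) x, t \in `[0, T] ->
        (tau - t)^-1 * (w tau x - w t x)
          @[tau --> within [set` `[0, T]] t^'] -->
        - dot (velocity alpha (w t) x) (gradient (w t) x)].

Definition HL1_integral (s T : R) (w : R -> R * R -> R) : \bar R :=
  (\int[@lebesgue_measure R]_(t in `[0%R, T]%classic)
     (Hnorm (s + 1) (w t) + L1norm (w t)))%E.

End GeneralizedSQG.

(* Main.v *)
(* On the transform side the equation is F_t = B(F, F), where B(F, G) integrates the bilinear kernel
   (zeta^perp . eta) m(zeta) F(zeta) G(eta) over zeta + eta = xi.  The kernel is odd under the exchange of
   xi and eta, so in every weighted L^2 norm with a weight between the first and a fixed power of <xi> only
   the commutator with the weight contributes to the energy; the resulting estimates are uniform for alpha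
   in [3/8, 1/2].  The symbols for alpha and for 1/2 differ by O(1/2 - alpha) at the cost of one power of
   <xi>, which the H^(s+1) bound of the SQG solution pays for.  Comparing the Galerkin-Euler iterates of
   the alpha-equation with the SQG solution, by a discrete Gronwall argument bootstrapped on the smallness
   of the error (this is where delta comes from), yields existence, uniqueness and an H^s distance
   C (1/2 - alpha), even without the logarithm.  The constants depend on the supremum of the H^(s+1) norm,
   which is bounded through T and the time integral because the logarithm of that norm varies by at most
   a multiple of its integral.  This needs the integral to be finite: the nonlinear term u . grad w is a
   product of two L^2 functions, so the solution stays in L^1. *)
From HB Require Import structures.
Require Import Defs.
From mathcomp Require Import all_boot all_order all_algebra.
From mathcomp Require Import all_classical all_reals all_analysis.
From mathcomp Require Import measurable_realfun complex ring lra.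

Set Implicit Arguments.
Unset Strict Implicit.
Unset Printing Implicit Defensive.

Import Order.TTheory GRing.Theory Num.Theory.
Import numFieldNormedType.Exports.
Import Normc.

Local Open Scope classical_set_scope.
Local Open Scope ring_scope.

(** * Square integrable functions *)

(** The transform used is the Hartley transform, real and involutive, so that only real functions
    are integrated. Its integral converges only for integrable functions, so Plancherel is derived
    from Abel summation, tested on rectangles. Two obstacles shape the rest. The term u . grad w
    costs one derivative, so the explicit scheme is stable only when its iterates are cut at a
    frequency [N] with [h * (1 + N) ^+ 2 <= 1]; the cut commutes with every weight and leaves the
    energy cancellation intact. Moreover the scheme converges in H^s only, while a solution must be
    continuous in time with values in H^(s+1): this is recovered by compactness, propagating a whole
    sequence of weights slightly stronger than <xi>^(s+1) that the datum already satisfies. The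
    range [3/8, 1/2] keeps |xi| times the symbol below |xi|^(-1/4) near the origin, which leaves
    room for a logarithm inside the locally square integrable |xi|^(-1/2). Solutions are given
    pointwise in x; Riemann sums of the right-hand side turn them into curves differentiable in
    H^s. *)

Section SquareIntegrable.
Context d (T : measurableType d) (R : realType) (mu : {measure set T -> \bar R}).
Implicit Types (f g h : T -> R) (c : R).

Definition L1 f : Prop := mu.-integrable setT (EFin \o f).
Definition L2 f : Prop :=
  measurable_fun setT f /\ (\int[mu]_x ((f x) ^+ 2)%:E < +oo)%E.
Definition ip f g : R := \int[mu]_x (f x * g x).
Definition nrm f : R := Num.sqrt (ip f f).

Lemma L1_meas f : L1 f -> measurable_fun setT f.
Proof. by move=> /integrableP[/measurable_EFinP]. Qed.

Lemma L1P f : measurable_fun setT f ->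
  L1 f <-> (\int[mu]_x `|f x|%:E < +oo)%E.
Proof.
move=> mf; split; first by move=> /integrableP[].
by move=> h; apply/integrableP; split => //; exact/measurable_EFinP.
Qed.

Lemma L1_dom f g : measurable_fun setT f -> (forall x, `|f x| <= `|g x|) ->
  L1 g -> L1 f.
Proof.
move=> mf fg ig; apply: le_integrable ig => //; first exact/measurable_EFinP.
by move=> x _; rewrite lee_fin.
Qed.

Lemma L1D f g : L1 f -> L1 g -> L1 (fun x => f x + g x).
Proof. by move=> If Ig; exact: (integrableD measurableT If Ig). Qed.

Lemma L1B f g : L1 f -> L1 g -> L1 (fun x => f x - g x).
Proof. by move=> If Ig; exact: (integrableB measurableT If Ig). Qed.

Lemma L1Z c f : L1 f -> L1 (fun x => c * f x).
Proof. by move=> If; exact: (integrableZl measurableT c If). Qed.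

Lemma L1N f : L1 f -> L1 (fun x => - f x).
Proof.
move=> /(L1Z (-1)); suff -> : (fun x => -1 * f x) = (fun x => - f x) by [].
by apply/funext => x; ring.
Qed.

Lemma L1_abs f : L1 f -> L1 (fun x => `|f x|).
Proof. exact: integrable_norm. Qed.

Lemma L1_0 : L1 (fun=> 0).
Proof. exact: integrable0. Qed.

Lemma L2_meas f : L2 f -> measurable_fun setT f.
Proof. by case. Qed.

Lemma L2_sqr f : L2 f -> L1 (fun x => f x ^+ 2).
Proof.
move=> [mf lf]; apply/L1P; first exact: measurable_funX.
by under eq_integral do rewrite ger0_norm ?sqr_ge0//.
Qed.

Lemma L2P f : measurable_fun setT f -> L1 (fun x => f x ^+ 2) -> L2 f.
Proof.
move=> mf /(L1P (measurable_funX 2 mf)) H; split => //; move: H.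
by under eq_integral do rewrite ger0_norm ?sqr_ge0//.
Qed.

Lemma L2_mul f g : L2 f -> L2 g -> L1 (fun x => f x * g x).
Proof.
move=> Lf Lg; have := L1D (L2_sqr Lf) (L2_sqr Lg); apply: L1_dom => [|x].
  by apply: measurable_funM; apply: L2_meas.
rewrite [leRHS]ger0_norm ?addr_ge0 ?sqr_ge0//.
have h (a b : R) : `|a * b| <= a ^+ 2 + b ^+ 2.
  rewrite ler_norml; apply/andP; split; nra.
exact: h.
Qed.

Lemma L2_dom f g : measurable_fun setT f -> (forall x, `|f x| <= `|g x|) ->
  L2 g -> L2 f.
Proof.
move=> mf fg Lg; apply: L2P => //; apply: L1_dom (L2_sqr Lg) => [|x].
  exact: measurable_funX.
by rewrite !normrX lerXn2r ?nnegrE.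
Qed.

Lemma L2D f g : L2 f -> L2 g -> L2 (fun x => f x + g x).
Proof.
move=> Lf Lg; apply: L2P; first by apply: measurable_funD; apply: L2_meas.
have := L1D (L1D (L2_sqr Lf) (L2_sqr Lg)) (L1Z 2 (L2_mul Lf Lg)).
by apply: eq_integrable => // x _ /=; congr EFin; ring.
Qed.

Lemma L2Z c f : L2 f -> L2 (fun x => c * f x).
Proof.
move=> Lf; apply: L2P.
  by apply: measurable_funM => //; apply: L2_meas.
have := L1Z (c ^+ 2) (L2_sqr Lf).
by apply: eq_integrable => // x _ /=; congr EFin; ring.
Qed.

Lemma L2N f : L2 f -> L2 (fun x => - f x).
Proof.
move=> /(L2Z (-1)); suff -> : (fun x => -1 * f x) = (fun x => - f x) by [].
by apply/funext => x; ring.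
Qed.

Lemma L2B f g : L2 f -> L2 g -> L2 (fun x => f x - g x).
Proof. by move=> Lf /L2N; apply: L2D. Qed.

Lemma L2_0 : L2 (fun=> 0).
Proof.
split => //; under eq_integral do rewrite expr0n/=.
by rewrite integral0.
Qed.

Lemma L2_abs f : L2 f -> L2 (fun x => `|f x|).
Proof.
move=> Lf; apply: (L2_dom _ _ Lf) => [|x]; last by rewrite normr_id.
exact: measurableT_comp (@normr_measurable R setT) (L2_meas Lf).
Qed.

Lemma ipC f g : ip f g = ip g f.
Proof. by rewrite /ip; under eq_Rintegral do rewrite mulrC. Qed.

Lemma ipDl f g h : L2 f -> L2 g -> L2 h ->
  ip (fun x => f x + g x) h = ip f h + ip g h.
Proof.
move=> Lf Lg Lh; rewrite /ip -RintegralD//; try exact: L2_mul.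
by under eq_Rintegral do rewrite mulrDl.
Qed.

Lemma ipZl c f h : L2 f -> L2 h -> ip (fun x => c * f x) h = c * ip f h.
Proof.
move=> Lf Lh; rewrite /ip -RintegralZl//; try exact: L2_mul.
by under eq_Rintegral do rewrite -mulrA.
Qed.

Lemma ipBl f g h : L2 f -> L2 g -> L2 h ->
  ip (fun x => f x - g x) h = ip f h - ip g h.
Proof.
move=> Lf Lg Lh; rewrite /ip -RintegralB//; try exact: L2_mul.
by under eq_Rintegral do rewrite mulrBl.
Qed.

Lemma ipDr f g h : L2 f -> L2 g -> L2 h ->
  ip h (fun x => f x + g x) = ip h f + ip h g.
Proof. by move=> *; rewrite ipC ipDl// ipC (ipC g). Qed.

Lemma ipZr c f h : L2 f -> L2 h -> ip h (fun x => c * f x) = c * ip h f.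
Proof. by move=> *; rewrite ipC ipZl// ipC. Qed.

Lemma ipBr f g h : L2 f -> L2 g -> L2 h ->
  ip h (fun x => f x - g x) = ip h f - ip h g.
Proof. by move=> *; rewrite ipC ipBl// ipC (ipC g). Qed.

Lemma ip_ge0 f : 0 <= ip f f.
Proof. by apply: Rintegral_ge0 => x _; rewrite -expr2 sqr_ge0. Qed.

Lemma nrm_ge0 f : 0 <= nrm f.
Proof. exact: sqrtr_ge0. Qed.

Lemma nrm_sqr f : nrm f ^+ 2 = ip f f.
Proof. by rewrite sqr_sqrtr// ip_ge0. Qed.

Lemma nrm_sqrE f : L2 f -> (nrm f ^+ 2)%:E = (\int[mu]_x (f x ^+ 2)%:E)%E.
Proof.
move=> Lf; rewrite nrm_sqr /ip /Rintegral; under eq_integral do rewrite -expr2.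
rewrite fineK//; exact: (integrable_fin_num measurableT (L2_sqr Lf)).
Qed.

Lemma nrm_eqE f g : (forall x, f x ^+ 2 = g x ^+ 2) -> nrm f = nrm g.
Proof.
move=> fg; congr Num.sqrt; rewrite /ip; apply: eq_Rintegral => x _.
by rewrite -!expr2.
Qed.

Lemma nrmN f : nrm (fun x => - f x) = nrm f.
Proof. by apply: nrm_eqE => x; rewrite sqrrN. Qed.

Lemma nrm_abs f : nrm (fun x => `|f x|) = nrm f.
Proof. by apply: nrm_eqE => x; rewrite real_normK ?num_real. Qed.

Lemma nrm0 : nrm (fun=> 0) = 0.
Proof. by rewrite /nrm /ip; under eq_Rintegral do rewrite mul0r; rewrite Rintegral_cst// mul0r sqrtr0. Qed.

Lemma nrmZ c f : L2 f -> nrm (fun x => c * f x) = `|c| * nrm f.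
Proof.
move=> Lf; rewrite /nrm ipZl ?ipZr//; last exact: L2Z.
by rewrite mulrA -expr2 sqrtrM ?sqr_ge0// sqrtr_sqr.
Qed.

(** The squared norm of [t * f - g] is a nonnegative quadratic polynomial in [t]. *)
Lemma cauchy_schwarz f g : L2 f -> L2 g -> ip f g <= nrm f * nrm g.
Proof.
move=> Lf Lg.
have H (t : R) : 0 <= t ^+ 2 * nrm f ^+ 2 - 2 * t * ip f g + nrm g ^+ 2.
  have Lt := L2Z t Lf.
  have := ip_ge0 (fun x => t * f x - g x); rewrite ipBl ?ipBr//; last exact: L2B.
  rewrite !ipZl// !ipZr// (ipC g f) !nrm_sqr.
  set a := ip f f; set b := ip f g; set e := ip g g => h.
  by have -> : t ^+ 2 * a - 2 * t * b + e = t * (t * a) - t * b - (t * b - e) by ring.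
have f0 := nrm_ge0 f; have g0 := nrm_ge0 g.
move: H; rewrite leNgt; set a := nrm f in f0 *; set b := nrm g in g0 *.
set i := ip f g => H; apply/negP => abi.
have i0 : 0 < i by apply: le_lt_trans abi; exact: mulr_ge0.
have := f0; rewrite le_eqVlt => /predU1P[f00|fp].
  (* When [nrm f = 0] the polynomial is affine in [t], and at this value it equals -1. *)
  have := H ((b ^+ 2 + 1) / (2 * i)); rewrite -f00.
  have -> : 2 * ((b ^+ 2 + 1) / (2 * i)) * i = b ^+ 2 + 1.
    by field; rewrite gt_eqF.
  by rewrite expr0n/= mulr0; lra.
have := H (i / a ^+ 2).
have -> : (i / a ^+ 2) ^+ 2 * a ^+ 2 - 2 * (i / a ^+ 2) * i + b ^+ 2 =
    ((a * b) ^+ 2 - i ^+ 2) / a ^+ 2 by field; rewrite gt_eqF.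
rewrite pmulr_lge0 ?invr_gt0 ?exprn_gt0// subr_ge0 leNgt => /negP; apply.
by rewrite ltr_pXn2r ?nnegrE ?mulr_ge0// ltW.
Qed.

Lemma cauchy_schwarz_abs f g : L2 f -> L2 g -> `|ip f g| <= nrm f * nrm g.
Proof.
move=> Lf Lg; rewrite ler_norml cauchy_schwarz// andbT lerNl -(nrmN f).
have -> : - ip f g = ip (fun x => - f x) g.
  rewrite -mulN1r -ipZl//; congr ip; apply/funext => x; ring.
by apply: cauchy_schwarz => //; exact: L2N.
Qed.

Lemma nrmD f g : L2 f -> L2 g -> nrm (fun x => f x + g x) <= nrm f + nrm g.
Proof.
move=> Lf Lg; have LD := L2D Lf Lg.
rewrite -(@ler_pXn2r _ 2) ?nnegrE ?addr_ge0 ?nrm_ge0// nrm_sqr.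
rewrite ipDl// !ipDr// (ipC g f) sqrrD !nrm_sqr.
have := cauchy_schwarz Lf Lg; lra.
Qed.

Lemma nrmB f g : L2 f -> L2 g -> nrm (fun x => f x - g x) <= nrm f + nrm g.
Proof. by move=> Lf Lg; rewrite -(nrmN g); apply: nrmD => //; exact: L2N. Qed.

Lemma nrm_distC f g : nrm (fun x => f x - g x) = nrm (fun x => g x - f x).
Proof. by rewrite -nrmN; congr nrm; apply/funext => x; rewrite opprB. Qed.

Lemma nrm_triangle f g h : L2 f -> L2 g -> L2 h ->
  nrm (fun x => f x - h x) <=
  nrm (fun x => f x - g x) + nrm (fun x => g x - h x).
Proof.
move=> Lf Lg Lh; apply: le_trans (nrmD (L2B Lf Lg) (L2B Lg Lh)).
by rewrite le_eqVlt; apply/orP; left; apply/eqP; congr nrm; apply/funext => x; ring.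
Qed.

Lemma nrm_le f g : measurable_fun setT f -> (forall x, `|f x| <= `|g x|) ->
  L2 g -> nrm f <= nrm g.
Proof.
move=> mf fg Lg; have Lf := L2_dom mf fg Lg.
apply: ler_wsqrtr; apply: le_Rintegral => //; try exact: L2_mul.
move=> x _; rewrite -!expr2 -(real_normK (num_real (f x))).
by rewrite -(real_normK (num_real (g x))) lerXn2r ?nnegrE.
Qed.

Lemma ae_eq_ip f f' g g' : {ae mu, forall x, f x = f' x} ->
  {ae mu, forall x, g x = g' x} ->
  measurable_fun setT f -> measurable_fun setT f' ->
  measurable_fun setT g -> measurable_fun setT g' -> ip f g = ip f' g'.
Proof.
move=> ff gg mf mf' mg mg'; rewrite /ip /Rintegral; congr fine.
apply: ae_eq_integral => //.
- by apply/measurable_EFinP; exact: measurable_funM.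
- by apply/measurable_EFinP; exact: measurable_funM.
- by apply: filterS2 ff gg => x -> ->.
Qed.

Lemma ae_eq_nrm f f' : {ae mu, forall x, f x = f' x} ->
  measurable_fun setT f -> measurable_fun setT f' -> nrm f = nrm f'.
Proof. by move=> *; congr Num.sqrt; exact: ae_eq_ip. Qed.

Lemma ae_eq_L2 f f' : {ae mu, forall x, f x = f' x} -> L2 f ->
  measurable_fun setT f' -> L2 f'.
Proof.
move=> ff [mf lf] mf'; split => //.
rewrite (@ae_eq_integral _ _ _ mu setT (fun x => (f x ^+ 2)%:E))//.
- by apply/measurable_EFinP; exact: measurable_funX.
- by apply/measurable_EFinP; exact: measurable_funX.
- by apply: filterS ff => x ->.
Qed.

Lemma nrm0_ae f : L2 f -> nrm f = 0 -> {ae mu, forall x, f x = 0}.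
Proof.
move=> Lf f0; have := nrm_sqrE Lf; rewrite f0 expr0n/= => /esym h.
have := (@ae_eq_integral_abs _ _ _ mu setT measurableT (fun x => (f x ^+ 2)%:E)).
have mf2 : measurable_fun setT (fun x => (f x ^+ 2)%:E).
  by apply/measurable_EFinP; apply: measurable_funX; exact: L2_meas.
move=> /(_ mf2)[+ _]; have -> : (\int[mu]_x `|(f x ^+ 2)%:E|)%E = 0%E.
  rewrite -[RHS]h; apply: eq_integral => x _.
  by rewrite gee0_abs// lee_fin sqr_ge0.
move=> /(_ erefl); apply: filterS => x /(_ I)/= -[] /eqP.
by rewrite expf_eq0/= => /eqP.
Qed.


Lemma cvg_limn_einfE (u : nat -> \bar R) l : u @ \oo --> l -> limn_einf u = l.
Proof.
move=> ul; rewrite is_cvg_limn_einfE; last exact: cvgP ul.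
exact: (cvg_lim _ ul).
Qed.

Lemma limn_einf_le (u : nat -> \bar R) l : (forall n, u n <= l)%E -> (limn_einf u <= l)%E.
Proof.
move=> ul; rewrite limn_einf_lim; apply: lime_le; first exact: is_cvg_einfs.
apply: nearW => n; apply: le_trans (ul n); apply: ereal_inf_lbound.
by exists n => //=.
Qed.

(** Fatou for the squares. It yields membership and the bound at once, which is how completeness,
    Bessel and the semicontinuity of weighted norms are obtained. *)
Lemma nrm_fatou (f_ : nat -> T -> R) f C : (forall n, L2 (f_ n)) ->
  (forall n, nrm (f_ n) <= C) -> measurable_fun setT f ->
  {ae mu, forall x, f_ n x @[n --> \oo] --> f x} -> L2 f /\ nrm f <= C.
Proof.
move=> Lf_ fC mf ff.
have C0 : 0 <= C by apply: le_trans (fC 0%N); exact: nrm_ge0.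
have mf_ n : measurable_fun setT (fun x => (f_ n x ^+ 2)%:E).
  by apply/measurable_EFinP; apply: measurable_funX; exact: L2_meas.
have H : (\int[mu]_x (f x ^+ 2)%:E <= (C ^+ 2)%:E)%E.
  have -> : (\int[mu]_x (f x ^+ 2)%:E =
             \int[mu]_x limn_einf (fun n => (f_ n x ^+ 2)%:E))%E.
    apply: ae_eq_integral => //.
    - by apply/measurable_EFinP; exact: measurable_funX.
    - apply: (measurableT_comp (@oppe_measurable R setT)).
      apply: measurable_fun_limn_esup => n.
      exact: (measurableT_comp (@oppe_measurable R setT)).
    - apply: filterS ff => x fx _; apply/esym/cvg_limn_einfE.
      by apply/cvg_EFin; [exact: nearW|exact: (cvgM fx fx)].
  apply: (le_trans (@fatou _ _ _ mu setT measurableT _ mf_ _)).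
    by move=> n x _; rewrite lee_fin sqr_ge0.
  apply: limn_einf_le => n.
  by rewrite -nrm_sqrE// lee_fin lerXn2r ?nnegrE ?nrm_ge0.
have Lf : L2 f by split => //; apply: le_lt_trans H _; rewrite ltry.
split => //; rewrite -(@ler_pXn2r _ 2) ?nnegrE ?nrm_ge0//.
by rewrite -lee_fin nrm_sqrE.
Qed.

Lemma nrm_sum_le (f_ : nat -> T -> R) (a : nat -> R) n : (forall k, L2 (f_ k)) ->
  (forall k, nrm (f_ k) <= a k) ->
  L2 (fun x => \sum_(0 <= k < n) f_ k x) /\
  nrm (fun x => \sum_(0 <= k < n) f_ k x) <= \sum_(0 <= k < n) a k.
Proof.
move=> Lf fa; elim: n => [|n [IL IH]].
  rewrite big_nil; have -> : (fun x => \sum_(0 <= k < 0) f_ k x) = (fun=> 0).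
    by apply/funext => x; rewrite big_nil.
  by rewrite nrm0; split => //; exact: L2_0.
have -> : (fun x => \sum_(0 <= k < n.+1) f_ k x) =
    (fun x => \sum_(0 <= k < n) f_ k x + f_ n x).
  by apply/funext => x; rewrite big_nat_recr.
split; first exact: L2D.
by rewrite big_nat_recr//=; apply: le_trans (nrmD _ _) _ => //; exact: lerD.
Qed.

(** Riesz-Fischer for a fast Cauchy sequence: the partial sums [G] of the absolute increments have
    norm at most the geometric sum 2, so by monotone convergence their limit is finite almost
    everywhere, and there the sequence converges absolutely. *)
Lemma L2_complete_fast (f_ : nat -> T -> R) : (forall n, L2 (f_ n)) ->
  (forall n, nrm (fun x => f_ n.+1 x - f_ n x) <= 2^-1 ^+ n) ->
  exists f, L2 f /\ {ae mu, forall x, f_ n x @[n --> \oo] --> f x}.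
Proof.
move=> Lf_ fast.
pose G n x := \sum_(0 <= k < n) `|f_ k.+1 x - f_ k x|.
have LGn n : L2 (G n) /\ nrm (G n) <= 2.
  have [||h1 h2] := @nrm_sum_le (fun k x => `|f_ k.+1 x - f_ k x|)
      (fun k => 2^-1 ^+ k) n.
  - by move=> k; apply/L2_abs/L2B.
  - by move=> k; rewrite (nrm_abs (fun x => f_ k.+1 x - f_ k x)).
  split => //; apply: (le_trans h2).
  have -> : \sum_(0 <= k < n) 2^-1 ^+ k = 2 - 2 * 2^-1 ^+ n :> R.
    elim: n {h1 h2} => [|n IH]; first by rewrite big_nil expr0; ring.
    by rewrite big_nat_recr//= IH exprS; field.
  by rewrite gerBl mulr_ge0// exprn_ge0.
have Gge0 n x : 0 <= G n x by apply: sumr_ge0.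
have Gnd x : nondecreasing_seq (fun n => G n x).
  by apply/nondecreasing_seqP => n; rewrite /G big_nat_recr//= lerDl.
pose S x := limn (fun n => (G n x ^+ 2)%:E).
have mG n : measurable_fun setT (fun x => (G n x ^+ 2)%:E).
  by apply/measurable_EFinP/measurable_funX/L2_meas; case: (LGn n).
have ndG x : nondecreasing_seq (fun n => (G n x ^+ 2)%:E).
  move=> m n mn; rewrite lee_fin lerXn2r ?nnegrE ?Gge0//; exact: Gnd.
have iS : (\int[mu]_x S x < +oo)%E.
  rewrite monotone_convergence//; last by move=> n x _; rewrite lee_fin sqr_ge0.
  apply: (@le_lt_trans _ _ (2 ^+ 2)%:E); last by rewrite ltry.
    apply: lime_le.
      apply: ereal_nondecreasing_is_cvgn => m n mn.
      apply: ge0_le_integral => //; try by move=> x _; rewrite lee_fin sqr_ge0.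
      by move=> x _; exact: ndG.
    apply: nearW => n; have [L h] := LGn n.
    by rewrite -nrm_sqrE// lee_fin lerXn2r ?nnegrE ?nrm_ge0.
have mS : measurable_fun setT S.
  apply: (@emeasurable_fun_cvg _ _ _ _ (fun n x => (G n x ^+ 2)%:E)) => // x _.
  exact: ereal_nondecreasing_is_cvgn.
have S0 x : (0 <= S x)%E.
  apply: lime_ge; first exact: ereal_nondecreasing_is_cvgn.
  by apply: nearW => n; rewrite lee_fin sqr_ge0.
have iSi : mu.-integrable setT S.
  by apply/integrableP; split => //; under eq_integral do rewrite gee0_abs//.
pose D := [set x | S x \is a fin_num].
have mD : measurable D.
  by rewrite -[D]setTI; exact: emeasurable_fin_num.
have cvD x : D x -> cvgn (fun n => f_ n x).
  move=> Dx.
  have : cvgn (fun n => G n x).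
    apply: nondecreasing_is_cvgn => //.
    exists (fine (S x) + 1) => _ [n _ <-].
    have : ((G n x ^+ 2)%:E <= S x)%E.
      apply: lime_ge; first exact: ereal_nondecreasing_is_cvgn.
      by exists n => // m /= nm; exact: ndG.
    rewrite -(fineK Dx) lee_fin; have := Gge0 n x.
    by move: (G n x) (fine (S x)) => a b ? ?; rewrite /=; nra.
  move=> /(@normed_cvg _ R) h.
  have -> : (fun n => f_ n x) =
    (fun n => f_ 0%N x + series (fun k => f_ k.+1 x - f_ k x) n).
    apply/funext => n; rewrite /series/= telescope_sumr//; ring.
  by apply: is_cvgD => //; exact: is_cvg_cst.
(* Cutting to the convergence set [D] makes the limit exist at every point, hence measurable. *)
pose g n x := f_ n x * \1_D x.
have mg n : measurable_fun setT (g n).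
  by apply: measurable_funM; [exact: L2_meas|exact: measurable_indic].
have cg x : cvgn (fun n => g n x).
  rewrite /g indicE; case: (boolP (x \in D)) => [/set_mem Dx|_].
    by under eq_fun do rewrite mulr1; exact: cvD.
  by under eq_fun do rewrite mulr0; exact: is_cvg_cst.
exists (fun x => limn (fun n => g n x)).
have mlim : measurable_fun setT (fun x => limn (fun n => g n x)).
  by apply: (@measurable_fun_cvg _ _ _ _ g) => // x _; exact: cg.
have ae : {ae mu, forall x, f_ n x @[n --> \oo] --> limn (fun n => g n x)}.
  have := integrable_ae measurableT iSi; apply: filterS => x /(_ I) Dx.
  have -> : (fun n => g n x) = (fun n => f_ n x).
    by apply/funext => n; rewrite /g indicE mem_set// mulr1.
  exact: cvD.
split => //.
suff [] : L2 (fun x => limn (fun n => g n x)) /\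
   nrm (fun x => limn (fun n => g n x)) <= nrm (f_ 0%N) + 2 by [].
apply: (@nrm_fatou f_) => // n.
have -> : f_ n = (fun x => f_ 0%N x + \sum_(0 <= k < n) (f_ k.+1 x - f_ k x)).
  apply/funext => x; rewrite telescope_sumr//; ring.
have [||h1 h2] := @nrm_sum_le (fun k x => f_ k.+1 x - f_ k x)
      (fun k => nrm (fun x => f_ k.+1 x - f_ k x)) n => //.
  by move=> k; exact: L2B.
apply: le_trans (nrmD _ _) _ => //; rewrite lerD2l.
have [L] := LGn n; apply: le_trans; apply: nrm_le => //; first exact: L2_meas.
by move=> x; rewrite [leRHS]ger0_norm ?Gge0// ler_norm_sum.
Qed.

Lemma L2_complete (f_ : nat -> T -> R) : (forall n, L2 (f_ n)) ->
  (forall e, 0 < e -> exists N, forall m n, (N <= m)%N -> (N <= n)%N ->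
     nrm (fun x => f_ m x - f_ n x) <= e) ->
  exists f, L2 f /\ (forall e, 0 < e -> exists N, forall n, (N <= n)%N ->
     nrm (fun x => f_ n x - f x) <= e).
Proof.
move=> Lf_ cau.
have /choice[N_ HN] : forall k : nat, exists N, forall m n, (N <= m)%N -> (N <= n)%N ->
     nrm (fun x => f_ m x - f_ n x) <= 2^-1 ^+ k.
  by move=> k; apply: cau; rewrite exprn_gt0.
(* Adding [i] forces [n_] to tend to infinity even if [N_] is bounded, and the maximum makes it
   monotone. *)
pose n_ k := (\max_(i < k.+1) (N_ i + i))%N.
have Nn k : (N_ k + k <= n_ k)%N.
  exact: (@leq_bigmax _ (fun i : 'I_k.+1 => N_ i + i)%N ord_max).
have nn k : (n_ k <= n_ k.+1)%N.
  by rewrite /n_ [leqRHS]big_ord_recr/= leq_max leqnn.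
have Nn' k : (N_ k <= n_ k)%N by apply: leq_trans (Nn k); exact: leq_addr.
have [|n|f [Lf cf]] := @L2_complete_fast (fun k => f_ (n_ k)).
- by [].
- by apply: HN => //; exact: leq_trans (Nn' n) (nn n).
exists f; split => // e e0.
have [N HN'] := cau e e0; exists N => m Nm.
(* Fatou along the subsequence, with [m] fixed, turns the Cauchy bound into a bound against the
   limit. *)
have [] := @nrm_fatou (fun k x => f_ m x - f_ (n_ (k + N)%N) x)
  (fun x => f_ m x - f x) e => //.
- by move=> n; exact: L2B.
- move=> n; apply: HN' => //; apply: leq_trans (Nn _).
  by rewrite addnA leq_addl.
- by apply: measurable_funB; exact: L2_meas.
- apply: filterS cf => x cf; apply: cvgB; first exact: cvg_cst.
  by rewrite (cvg_shiftn N (fun k => f_ (n_ k) x)).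
Qed.

End SquareIntegrable.

(** * Measure preserving maps *)

Section MeasurePreserving.
Context d (T : measurableType d) (R : realType) (mu : {measure set T -> \bar R}).
Context (phi : T -> T).

Definition measure_preserving : Prop := measurable_fun setT phi /\
  forall A, measurable A -> mu (phi @^-1` A) = mu A.

Context (mp : measure_preserving).

Lemma mp_meas (d' : measure_display) (U : measurableType d') (f : T -> U) : measurable_fun setT f -> measurable_fun setT (f \o phi).
Proof. by move=> mf; apply: measurableT_comp => //; case: mp. Qed.

Lemma mp_ge0_integral (f : T -> \bar R) : measurable_fun setT f ->
  (forall x, 0 <= f x)%E -> (\int[mu]_x f (phi x) = \int[mu]_x f x)%E.
Proof.
move=> mf f0; have [mphi H] := mp.
transitivity (\int[pushforward mu phi]_y f y)%E.
  by rewrite ge0_integral_pushforward//.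
by apply: eq_measure_integral => A mA _; exact: H.
Qed.

Lemma mp_integral (f : T -> \bar R) : measurable_fun setT f ->
  (\int[mu]_x f (phi x) = \int[mu]_x f x)%E.
Proof.
move=> mf; rewrite integralE [RHS]integralE; congr (_ - _)%E.
- rewrite -(mp_ge0_integral (f := f^\+%E))//; last exact: measurable_funepos.
  by apply: eq_integral => x _; rewrite unlock.
- rewrite -(mp_ge0_integral (f := f^\-%E))//; last exact: measurable_funeneg.
  by apply: eq_integral => x _; rewrite unlock.
Qed.

Lemma mp_Rintegral (f : T -> R) : measurable_fun setT f ->
  \int[mu]_x f (phi x) = \int[mu]_x f x.
Proof.
move=> mf; rewrite /Rintegral; congr fine.
by rewrite (mp_integral (f := EFin \o f))//; exact/measurable_EFinP.
Qed.

Lemma mp_L1 (f : T -> R) : L1 mu f -> L1 mu (f \o phi).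
Proof.
move=> Lf; have mf := L1_meas Lf; apply/L1P; first exact: mp_meas.
rewrite (mp_ge0_integral (f := fun x => `|f x|%:E))//.
  by move/L1P : Lf; exact.
by apply/measurable_EFinP; exact: measurableT_comp.
Qed.

Lemma mp_L2 (f : T -> R) : L2 mu f -> L2 mu (f \o phi).
Proof.
move=> [mf lf]; split; first exact: mp_meas.
rewrite (mp_ge0_integral (f := fun x => (f x ^+ 2)%:E))//.
  by apply/measurable_EFinP; exact: measurable_funX.
by move=> x; rewrite lee_fin sqr_ge0.
Qed.

Lemma mp_ip (f g : T -> R) : measurable_fun setT f -> measurable_fun setT g ->
  ip mu (f \o phi) (g \o phi) = ip mu f g.
Proof.
move=> mf mg; rewrite /ip (mp_Rintegral (f := fun x => f x * g x))//.
exact: measurable_funM.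
Qed.

Lemma mp_nrm (f : T -> R) : measurable_fun setT f ->
  nrm mu (f \o phi) = nrm mu f.
Proof. by move=> mf; rewrite /nrm mp_ip. Qed.

Lemma mp_ae (Q : T -> Prop) : {ae mu, forall x, Q x} ->
  {ae mu, forall x, Q (phi x)}.
Proof.
move=> [B [mB B0 QB]]; have [mphi H] := mp.
exists (phi @^-1` B); split.
- by rewrite -[_ @^-1` _]setTI; exact: mphi.
- by rewrite /= H.
- by move=> x /= nQ; apply: QB.
Qed.

End MeasurePreserving.

(** * Fubini and Young on the plane *)

(* No measurability is needed: the integral of a nonnegative function is a supremum over the
   simple functions below it. *)
Lemma ge0_integral_le d (X : measurableType d) (R : realType) (mu : {measure set X -> \bar R})
  (D : set X) (f g : X -> \bar R) : (forall x, D x -> (0 <= f x)%E) -> (forall x, D x -> (f x <= g x)%E) ->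
  (\int[mu]_(x in D) f x <= \int[mu]_(x in D) g x)%E.
Proof.
move=> f0 fg; have g0 x : D x -> (0 <= g x)%E by move=> Dx; exact: le_trans (f0 x Dx) (fg x Dx).
rewrite !ge0_integralE//; apply: le_ereal_sup => _ [h hf <-]; exists h => // x.
apply: le_trans (hf x) _; rewrite /patch; case: ifPn => //; rewrite inE; exact: fg.
Qed.

Section Plane.
Context {R : realType}.
Local Notation P := (plane R).
Local Notation mu1 := (@lebesgue_measure R).
Local Notation mu := (@lebesgue_measure R \x @lebesgue_measure R)%E.

(** The translated measure agrees with Lebesgue measure on half-open intervals, which determines
    it. *)
Lemma mp_shift1 (a : R) :
  measure_preserving mu1 ((fun x => x + a) : measurableTypeR R -> measurableTypeR R).
Proof.
have mphi : measurable_fun setT ((fun x => x + a) : measurableTypeR R -> measurableTypeR R).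
  by apply: measurable_funD.
split => // A mA; apply/esym.
have := @lebesgue_measure_unique R (pushforward mu1 ((fun x => x + a) : measurableTypeR R -> measurableTypeR R)).
apply => // _ [[b c]] _ <-.
transitivity (mu1 `](b - a), (c - a)]%classic); last first.
  congr (mu1 _); apply/seteqP; split => x /=.
    by rewrite !in_itv/= ltrBlDr lerBrDr.
  by rewrite !in_itv/= ltrBlDr lerBrDr.
rewrite !lebesgue_measure_itv/= !lte_fin ltrD2r; case: ifP => // _.
by rewrite -!EFinD; congr EFin; ring.
Qed.

Lemma mp_opp1 : measure_preserving mu1 (-%R : measurableTypeR R -> measurableTypeR R).
Proof.
split; first exact: oppr_measurable.
by move=> A mA; exact: lebesgue_measureN.
Qed.

Lemma mp_prod (f g : measurableTypeR R -> measurableTypeR R) :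
  measure_preserving mu1 f -> measure_preserving mu1 g ->
  measure_preserving mu ((fun x => (f x.1, g x.2)) : P -> P).
Proof.
move=> [mf Hf] [mg Hg].
have mphi : measurable_fun setT ((fun x => (f x.1, g x.2)) : P -> P).
  apply: measurable_fun_pair.
    exact: (measurableT_comp mf measurable_fst).
  exact: (measurableT_comp mg measurable_snd).
split => // A mA; apply/esym.
pose phi : {mfun P >-> P} := mfun_Sub (mem_set mphi).
apply: (@product_measure_unique _ _ _ _ _ mu1 mu1 (pushforward mu phi)) => // C D mC mD.
transitivity (mu ((f @^-1` C) `*` (g @^-1` D))).
  by congr (mu _); apply/seteqP; split => x.
rewrite product_measure1E ?Hf ?Hg//.
  by rewrite -[_ @^-1` _]setTI; exact: mf.
by rewrite -[_ @^-1` _]setTI; exact: mg.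
Qed.

Lemma mp_shift (a : R * R) : measure_preserving mu ((fun x => x + a) : P -> P).
Proof. exact: (mp_prod (mp_shift1 a.1) (mp_shift1 a.2)). Qed.

Lemma mp_opp : measure_preserving mu ((fun x => - x) : P -> P).
Proof. exact: (mp_prod mp_opp1 mp_opp1). Qed.


Lemma measurable_sub2 : measurable_fun setT ((fun p => p.1 - p.2) : P * P -> P).
Proof.
apply: measurable_fun_pair.
  apply: measurable_funB.
    exact: (measurableT_comp measurable_fst measurable_fst).
  exact: (measurableT_comp measurable_fst measurable_snd).
apply: measurable_funB.
  exact: (measurableT_comp measurable_snd measurable_fst).
exact: (measurableT_comp measurable_snd measurable_snd).
Qed.

Lemma measurable_add2 : measurable_fun setT ((fun p => p.1 + p.2) : P * P -> P).
Proof.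
apply: measurable_fun_pair.
  apply: measurable_funD.
    exact: (measurableT_comp measurable_fst measurable_fst).
  exact: (measurableT_comp measurable_fst measurable_snd).
apply: measurable_funD.
  exact: (measurableT_comp measurable_snd measurable_fst).
exact: (measurableT_comp measurable_snd measurable_snd).
Qed.

Lemma measurable_dot : measurable_fun setT ((fun p => dot p.1 p.2) : P * P -> R).
Proof.
apply: measurable_funD; apply: measurable_funM.
- exact: (measurableT_comp measurable_fst measurable_fst).
- exact: (measurableT_comp measurable_fst measurable_snd).
- exact: (measurableT_comp measurable_snd measurable_fst).
- exact: (measurableT_comp measurable_snd measurable_snd).
Qed.

Lemma measurable_dotr (x : R * R) : measurable_fun setT ((fun z => dot x z) : P -> R).
Proof. by apply: measurable_funD; apply: measurable_funM. Qed.

Lemma measurable_dotd : measurable_fun setT ((fun z => dot z z) : P -> R).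
Proof. by apply: measurable_funD; apply: measurable_funM. Qed.

Lemma measurable_diff2 (f : P -> R) : measurable_fun setT f ->
  measurable_fun setT (fun p : P * P => f (p.1 - p.2)).
Proof. by move=> mf; exact: (measurableT_comp mf measurable_sub2). Qed.

(* The sigma-finiteness of a product is only inferred by the library for
   subprobabilities. *)
Let leb2_sigma_finite : sigma_finite setT (mu : set P -> \bar R).
Proof.
have /sigma_finiteP[F [TF ndF Foo]] := sigma_finiteT mu1.
exists (fun n => F n `*` F n).
  rewrite -setXTT TF predeqE => -[x y]; split.
    move=> [/= [n _ Fnx] [k _ Gky]]; exists (maxn n k) => //; split.
    - by move: x Fnx; exact/subsetPset/ndF/leq_maxl.
    - by move: y Gky; exact/subsetPset/ndF/leq_maxr.
  by move=> [n _ []/= ? ?]; split; exists n.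
move=> k; have [? ?] := Foo k.
split; first exact: measurableX.
by rewrite product_measure1E// lte_mul_pinfty// ge0_fin_numE.
Qed.

Definition leb2_copy : set P -> \bar R := mu.
HB.instance Definition _ := Measure.copy leb2_copy mu.
HB.instance Definition _ := Measure_isSigmaFinite.Build _ _ _ leb2_copy leb2_sigma_finite.
Definition leb2_sf : {sigma_finite_measure set P -> \bar R} := leb2_copy.

Lemma tonelliP (k : P * P -> \bar R) : measurable_fun setT k ->
  (forall p, 0 <= k p)%E ->
  (\int[mu]_x \int[mu]_y k (x, y) = \int[mu]_y \int[mu]_x k (x, y))%E.
Proof. by move=> mk k0; exact: (@fubini_tonelli _ _ P P R leb2_sf leb2_sf k mk). Qed.

Lemma measurable_tonelliP (k : P * P -> \bar R) : measurable_fun setT k ->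
  (forall p, 0 <= k p)%E -> measurable_fun setT (fun x => \int[mu]_y k (x, y))%E.
Proof. by move=> mk k0; exact: (@measurable_fun_fubini_tonelli_F _ _ P P R leb2_sf k mk). Qed.

Lemma measurable_slice1 (d' : measure_display) (U : measurableType d') (k : P * P -> U) x :
  measurable_fun setT k -> measurable_fun setT (fun y => k (x, y)).
Proof. by move=> mk; exact: (measurableT_comp mk (measurable_pair1 x)). Qed.

Lemma measurable_slice2 (d' : measure_display) (U : measurableType d') (k : P * P -> U) y :
  measurable_fun setT k -> measurable_fun setT (fun x => k (x, y)).
Proof. by move=> mk; exact: (measurableT_comp mk (measurable_pair2 y)). Qed.

(** Integrability over pairs of points of the plane, stated through the iterated integral, which
    bounds of Tonelli type control directly. *)
Definition L1P2 (k : P * P -> R) := measurable_fun setT k /\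
  (\int[mu]_x \int[mu]_y `|k (x, y)|%:E < +oo)%E.

Let L1P2_integrable (k : P * P -> R) : L1P2 k ->
  (leb2_sf \x leb2_sf)%E.-integrable setT (EFin \o k).
Proof.
move=> [mk ik]; apply/(@integrable12ltyP _ _ P P R leb2_sf leb2_sf) => //.
exact/measurable_EFinP.
Qed.

(** The inner real integral may take a junk value, but only on a null set of [x]; off this set it
    equals the extended one, so Fubini transfers to real integrals. *)
Lemma fubini_L1 (k : P * P -> R) : L1P2 k ->
  L1 mu (fun x => \int[mu]_y k (x, y)) /\
  \int[mu]_x \int[mu]_y k (x, y) = fine (\int[mu]_x \int[mu]_y (k (x, y))%:E)%E.
Proof.
move=> Lk; have ik := L1P2_integrable Lk.
pose F x := (\int[mu]_y (k (x, y))%:E)%E.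
have hF : mu.-integrable setT F := integrable_fubini_F ik.
have mF : measurable_fun setT F by case/integrableP : hF.
have mf : measurable_fun setT (EFin \o (fine \o F)).
  by apply/measurable_EFinP; exact: measurableT_comp.
have ae : ae_eq mu setT F (EFin \o (fine \o F)).
  have := integrable_ae measurableT hF; apply: filterS => x h /h Fx.
  by rewrite /= fineK.
split; last by rewrite /Rintegral; congr fine; apply/esym/ae_eq_integral.
apply/integrableP; split => //.
have <- : (\int[mu]_x `|F x| = \int[mu]_x `|(EFin \o (fine \o F)) x|)%E.
  apply: ae_eq_integral => //; [exact: measurableT_comp|exact: measurableT_comp|].
  by apply: filterS ae => x h /h /= ->.
by case/integrableP : hF.
Qed.

Lemma L1P2_swap (k : P * P -> R) : L1P2 k -> L1P2 (fun p => k (p.2, p.1)).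
Proof.
move=> [mk ik]; split.
  by apply: measurableT_comp mk _; apply: measurable_fun_pair.
rewrite -(@tonelliP (fun p => `|k p|%:E))//.
by apply/measurable_EFinP; exact: measurableT_comp.
Qed.

Lemma L1P2_dom (k k' : P * P -> R) : measurable_fun setT k ->
  (forall p, `|k p| <= `|k' p|) -> L1P2 k' -> L1P2 k.
Proof.
move=> mk kk' [mk' ik']; split; first exact: mk.
apply: le_lt_trans ik'; apply: ge0_integral_le => x _; first exact: integral_ge0.
by apply: ge0_integral_le => y _; rewrite lee_fin.
Qed.

Lemma L1P2D (k k' : P * P -> R) : L1P2 k -> L1P2 k' -> L1P2 (fun p => k p + k' p).
Proof.
move=> [mk ik] [mk' ik']; split; first exact: measurable_funD.
have m (f : P * P -> R) : measurable_fun setT f ->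
    measurable_fun setT (fun p => `|f p|%:E).
  by move=> mf; apply/measurable_EFinP; exact: measurableT_comp.
have mt (f : P * P -> R) : measurable_fun setT f ->
    measurable_fun setT (fun x => \int[mu]_y `|f (x, y)|%:E)%E.
  move=> mf; apply: (@measurable_tonelliP (fun p => `|f p|%:E) (m _ mf)) => p.
  by rewrite lee_fin.
apply: (@le_lt_trans _ _ (\int[mu]_x (\int[mu]_y `|k (x, y)|%:E +
                           \int[mu]_y `|k' (x, y)|%:E))%E).
  apply: ge0_integral_le => x _; first exact: integral_ge0.
  rewrite -ge0_integralD//; last 2 first.
  - exact: (@measurable_slice1 _ _ (fun p => `|k p|%:E) _ (m _ mk)).
  - exact: (@measurable_slice1 _ _ (fun p => `|k' p|%:E) _ (m _ mk')).
  by apply: ge0_integral_le => y _; [rewrite lee_fin|rewrite -EFinD lee_fin ler_normD].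
rewrite ge0_integralD//.
- by apply: lte_add_pinfty; [exact: ik|exact: ik'].
- by move=> x _; apply: integral_ge0.
- exact: (mt _ mk).
- by move=> x _; apply: integral_ge0.
- exact: (mt _ mk').
Qed.

Lemma fubini_swap (k : P * P -> R) : L1P2 k ->
  \int[mu]_x \int[mu]_y k (x, y) = \int[mu]_y \int[mu]_x k (x, y).
Proof.
move=> Lk; have [_ ->] := fubini_L1 Lk.
have [_ ->] := fubini_L1 (L1P2_swap Lk); congr fine => /=.
exact: (Fubini (L1P2_integrable Lk)).
Qed.

(** Young's inequality in trilinear form: after the translation [z = xi - eta] the integrand is
    [a z] times a product that Cauchy-Schwarz controls for each [z]. *)
Lemma young_trilinear (a b c : P -> R) : L1 mu a -> L2 mu b -> L2 mu c ->
  (\int[mu]_xi \int[mu]_eta (`|a (xi - eta)%R * b eta * c xi|)%:E <=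
   (\int[mu]_z `|a z|)%:E * (nrm mu b * nrm mu c)%:E)%E.
Proof.
move=> La Lb Lc.
have ma := L1_meas La; have mb := L2_meas Lb; have mc := L2_meas Lc.
pose k (p : P * P) := (`|a (p.1 - p.2) * b p.2 * c p.1|)%:E.
have mk : measurable_fun setT k.
  apply/measurable_EFinP; apply: measurableT_comp => //.
  apply: measurable_funM; first apply: measurable_funM.
  - exact: measurable_diff2.
  - exact: (measurableT_comp mb measurable_snd).
  - exact: (measurableT_comp mc measurable_fst).
have k0 p : (0 <= k p)%E by rewrite lee_fin.
rewrite (tonelliP mk k0).
(* [k] after the substitution [xi = z + eta], as a function of the pair [(eta, z)]. *)
pose k' (p : P * P) := (`|a p.2 * b p.1 * c (p.2 + p.1)|)%:E.
have mk' : measurable_fun setT k'.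
  apply/measurable_EFinP; apply: measurableT_comp => //.
  apply: measurable_funM; first apply: measurable_funM.
  - exact: (measurableT_comp ma measurable_snd).
  - exact: (measurableT_comp mb measurable_fst).
  - rewrite (_ : (fun x : P * P => _) = (fun x => c (x.1 + x.2))).
      exact: (measurableT_comp mc measurable_add2).
    by apply/funext => x; rewrite addrC.
have -> : (\int[mu]_y \int[mu]_x k (x, y) = \int[mu]_y \int[mu]_x k' (y, x))%E.
  apply: eq_integral => y _.
  rewrite -(mp_ge0_integral (mp_shift y) (f := fun x => k (x, y)))//.
    by apply: eq_integral => x _; rewrite /k/k'/= addrK.
  exact: measurableT_comp mk (measurable_pair2 _).
have k'0 p : (0 <= k' p)%E by rewrite lee_fin.
rewrite (tonelliP mk' k'0).
have -> : (\int[mu]_z `|a z|)%:E = (\int[mu]_z `|a z|%:E)%E.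
  by rewrite /Rintegral fineK//; exact: (integrable_fin_num measurableT (L1_abs La)).
have n0 : (0 <= (nrm mu b * nrm mu c)%:E)%E by rewrite lee_fin mulr_ge0// nrm_ge0.
have maE : measurable_fun setT (fun z => `|a z|%:E).
  by apply/measurable_EFinP; exact: measurableT_comp.
rewrite -(@ge0_integralZr _ _ _ mu setT measurableT (fun z => `|a z|%:E) maE)//.
apply: ge0_le_integral => //.
- by move=> x _; apply: integral_ge0 => y _; exact: k'0.
- apply: (@measurable_tonelliP (fun p => k' (p.2, p.1))) => [|p]; last exact: k'0.
  by apply: (measurableT_comp mk'); apply: measurable_fun_pair.
- exact: emeasurable_funM.
move=> z _.
have Lc' : L2 mu (fun y => c (y + z)) := mp_L2 (mp_shift z) Lc.
have H : (\int[mu]_x k' (x, z) = \int[mu]_x (`|a z|%:E * (`|b x| * `|c (x + z)|)%:E))%E.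
  by apply: eq_integral => x _; rewrite /k'/= -EFinM !normrM mulrA addrC.
rewrite H ge0_integralZl//; last first.
- apply/measurable_EFinP; apply: measurable_funM; apply: measurableT_comp => //.
  exact: (L2_meas Lc').
rewrite lee_wpmul2l ?lee_fin//.
have := cauchy_schwarz (L2_abs Lb) (L2_abs Lc').
rewrite !nrm_abs (mp_nrm (mp_shift z) mc) => cs.
rewrite -(@fineK _ (\int[mu]_x _)%E); first by rewrite lee_fin.
exact: (integrable_fin_num measurableT (L2_mul (L2_abs Lb) (L2_abs Lc'))).
Qed.


Lemma L1P2_le (k : P * P -> R) C : measurable_fun setT k ->
  (\int[mu]_x \int[mu]_y `|k (x, y)|%:E <= C%:E)%E ->
  L1P2 k /\ `|\int[mu]_x \int[mu]_y k (x, y)| <= C.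
Proof.
move=> mk kC.
have Lk : L1P2 k by split => //; apply: le_lt_trans kC _; rewrite ltry.
split => //; have [_ ->] := fubini_L1 Lk; have ik := L1P2_integrable Lk.
have hF := integrable_fubini_F ik.
have mF : measurable_fun setT (fun x => \int[mu]_y (k (x, y))%:E)%E by case/integrableP : hF.
have mkE : measurable_fun setT (fun p => (k p)%:E) by exact/measurable_EFinP.
have H : (`|\int[mu]_x \int[mu]_y (k (x, y))%:E| <= C%:E)%E.
  apply: le_trans kC; apply: le_trans (le_abse_integral mu measurableT mF) _.
  apply: ge0_integral_le => x _; first exact: abse_ge0.
  exact: (le_abse_integral mu measurableT (@measurable_slice1 _ _ (fun p => (k p)%:E) x mkE)).
move: H; case: (\int[mu]_x _)%E => [r| |] /=; rewrite ?lee_fin// ?leye_eq//.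
Qed.

Lemma young_bound (k : P * P -> R) (a b c : P -> R) :
  measurable_fun setT k -> L1 mu a -> L2 mu b -> L2 mu c ->
  (forall xi eta, `|k (xi, eta)| <= `|a (xi - eta) * b eta * c xi|) ->
  L1P2 k /\ `|\int[mu]_x \int[mu]_y k (x, y)| <=
     (\int[mu]_z `|a z|) * (nrm mu b * nrm mu c).
Proof.
move=> mk La Lb Lc kabc; apply: L1P2_le => //; rewrite EFinM.
apply: le_trans (young_trilinear La Lb Lc).
apply: ge0_integral_le => x _; first exact: integral_ge0.
by apply: ge0_integral_le => y _; rewrite lee_fin.
Qed.

(** The bracket <z>, the modulus |z| and a weight for the embedding. For 3/8 <= alpha <= 1/2 the
    symbol times |z| is at most |z|^(-1/4) near the origin; the exponent -1/2 in [lam] leaves room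
    for the logarithm carried by a difference of two symbols, while its square 1/|z| is still
    integrable there. *)
Definition jb (z : R * R) : R := Num.sqrt (1 + dot z z).
Definition rad (z : R * R) : R := Num.sqrt (dot z z).
Definition lam (z : R * R) : R := jb z + rad z `^ (- 2^-1).

Lemma dot_ge0 (z : R * R) : 0 <= dot z z.
Proof. by rewrite /dot addr_ge0// -expr2 sqr_ge0. Qed.

Lemma jb_ge1 z : 1 <= jb z.
Proof. by rewrite /jb -[leLHS]sqrtr1 ler_wsqrtr// lerDl dot_ge0. Qed.

Lemma jb_gt0 z : 0 < jb z.
Proof. exact: lt_le_trans (jb_ge1 z). Qed.

Lemma rad_ge0 z : 0 <= rad z.
Proof. exact: sqrtr_ge0. Qed.

Lemma jb_sqr z : jb z ^+ 2 = 1 + dot z z.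
Proof. by rewrite sqr_sqrtr// addr_ge0// dot_ge0. Qed.

Lemma rad_sqr z : rad z ^+ 2 = dot z z.
Proof. by rewrite sqr_sqrtr// dot_ge0. Qed.

Lemma measurable_jb : measurable_fun setT (jb : P -> R).
Proof.
apply: measurableT_comp; first exact: (@continuous_measurable_fun R _ (@sqrt_continuous R)).
by apply: measurable_funD => //; exact: measurable_dotd.
Qed.

Lemma measurable_rad : measurable_fun setT (rad : P -> R).
Proof.
by apply: measurableT_comp; [exact: (@continuous_measurable_fun R _ (@sqrt_continuous R))|exact: measurable_dotd].
Qed.

Lemma measurable_radpow a : measurable_fun setT ((fun z => rad z `^ a) : P -> R).
Proof.
exact: (measurableT_comp (@measurable_powR R a) measurable_rad).
Qed.

Lemma measurable_jbpow a : measurable_fun setT ((fun z => jb z `^ a) : P -> R).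
Proof.
exact: (measurableT_comp (@measurable_powR R a) measurable_jb).
Qed.

Lemma measurable_lam : measurable_fun setT (lam : P -> R).
Proof.
by apply: measurable_funD; [exact: measurable_jb|exact: measurable_radpow].
Qed.

Lemma powR_ge1 (a r : R) : 1 <= a -> 0 <= r -> 1 <= a `^ r.
Proof.
move=> a1 r0; rewrite (_ : 1 = 1 `^ r); last by rewrite powR1.
by apply: ge0_ler_powR; rewrite ?nnegrE ?(le_trans ler01 a1).
Qed.

Lemma L1_prod (p q : R -> R) : L1 mu1 p -> L1 mu1 q ->
  L1 mu (fun z : P => p z.1 * q z.2).
Proof.
move=> Lp Lq; have mp := L1_meas Lp; have mq := L1_meas Lq.
have mpq : measurable_fun setT (fun z : P => p z.1 * q z.2).
  by apply: measurable_funM; apply: measurableT_comp.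
apply/(@integrable12ltyP _ _ _ _ R mu1 mu1); first exact/measurable_EFinP.
under eq_integral => x _.
  under eq_integral => y _ do rewrite /= normrM EFinM.
  rewrite ge0_integralZl//; last first.
    by apply/measurable_EFinP; apply: measurableT_comp.
  over.
rewrite ge0_integralZr//; last 2 first.
- by apply/measurable_EFinP; apply: measurableT_comp.
- by apply: integral_ge0.
by apply: lte_mul_pinfty; [exact: integral_ge0|
  rewrite ge0_fin_numE; [exact/L1P|exact: integral_ge0]|exact/L1P].
Qed.


Lemma L1_indic (f : R -> R) A : measurable_fun setT f -> (forall x, 0 <= f x) ->
  measurable A -> (\int[mu1]_(x in A) (f x)%:E < +oo)%E ->
  L1 mu1 (fun x => f x * \1_A x).
Proof.
move=> mf f0 mA fi; apply/L1P; first exact: measurable_funM.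
under eq_integral => x _ do rewrite ger0_norm ?mulr_ge0// EFinM.
rewrite (_ : (fun x => _) = (EFin \o f) \_ A); first by rewrite -integral_mkcond.
by apply/funext => x; rewrite patchE indicE; case: ifPn => _; rewrite ?mule1 ?mule0.
Qed.

Lemma L1_even (f g : R -> R) : measurable_fun setT f -> L1 mu1 g ->
  (forall x, 0 <= g x) -> (forall x, 0 <= x -> `|f x| <= g x) ->
  (forall x, f (- x) = f x) -> L1 mu1 f.
Proof.
move=> mf Lg g0 fg fN.
have := L1D Lg (mp_L1 mp_opp1 Lg); apply: L1_dom => // x.
rewrite [leRHS]ger0_norm ?addr_ge0//=.
have [x0|x0] := leP 0 x; first by rewrite ler_wpDr// fg.
by rewrite -fN ler_wpDl// fg// oppr_ge0 ltW.
Qed.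

Lemma powR_integrable_y p : 1 < p ->
  (\int[mu1]_(x in `[1%R, +oo[) (x `^ (- p))%:E < +oo)%E.
Proof.
move=> p1; have d0 : 1 - p != 0 by rewrite subr_eq0 lt_eqF.
pose F (x : R) := (1 - p)^-1 * x `^ (1 - p).
have dF (x : R) : 0 < x -> is_derive x 1 F (x `^ (- p)).
  move=> x0; have := is_deriveZ (1 - p)^-1 (is_derive1_powR (1 - p) x0).
  by rewrite scalerA mulVf// scale1r addrAC subrr add0r.
have cp (q x : R) : 0 < x -> {for x, continuous (fun x => x `^ q)}.
  move=> x0; apply/differentiable_continuous/derivable1_diffP.
  exact: (@ex_derive _ _ _ _ _ _ _ (is_derive1_powR q x0)).
rewrite (@ge0_continuous_FTC2y _ _ F 1 0).
- by rewrite sub0e -EFinN ltry.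
- by move=> x _; exact: powR_ge0.
- apply: continuous_in_subspaceT => x; rewrite inE/= in_itv/= andbT => x1.
  by apply: cp; exact: lt_le_trans x1.
- rewrite -(mulr0 (1 - p)^-1); apply: cvgM; first exact: cvg_cst.
  have -> : (fun x : R => x `^ (1 - p)) = (fun x => (x `^ (p - 1))^-1).
    by apply/funext => x; rewrite -powRN opprB.
  apply/gtr0_cvgV0; first by near=> x; rewrite powR_gt0//; near: x; exact: nbhs_pinfty_gt.
  apply/cvgryPge => A.
  near=> x.
  have x0 : 0 < x by near: x; exact: nbhs_pinfty_gt.
  rewrite (@le_trans _ _ (Num.max A 1))// ?le_max ?lexx//.
  have M0 : 0 <= Num.max A 1 by rewrite le_max ler01 orbT.
  have -> : Num.max A 1 = ((Num.max A 1) `^ (p - 1)^-1) `^ (p - 1).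
    by rewrite -powRrM mulVf ?powRr1// subr_eq0 gt_eqF.
  apply: ge0_ler_powR; rewrite ?nnegrE ?powR_ge0//.
  - by rewrite subr_ge0 ltW.
- by move=> x x1; apply: (@ex_derive _ _ _ _ _ _ _ (dF _ (lt_trans ltr01 x1))).
- apply: cvg_at_right_filter; apply: differentiable_continuous.
  apply/derivable1_diffP; exact: (@ex_derive _ _ _ _ _ _ _ (dF _ ltr01)).
- move=> x; rewrite in_itv/= andbT => x1.
  have := dF _ (lt_trans ltr01 x1) => dFx.
  by rewrite derive1E derive_val.
Unshelve. all: by end_near. Qed.

Lemma powR_integrable_0 :
  (\int[mu1]_(x in `]0%R, 1%R]) (x `^ (- 2^-1))%:E < +oo)%E.
Proof.
pose F (x : R) := 2 * x `^ (2^-1).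
have dF (x : R) : 0 < x -> is_derive x 1 F (x `^ (- 2^-1)).
  move=> x0; have := is_deriveZ 2 (is_derive1_powR 2^-1 x0).
  rewrite scalerA mulfV// scale1r.
  by have -> : 2^-1 - 1 = - 2^-1 :> R by field.
have cp (q x : R) : 0 < x -> {for x, continuous (fun x => x `^ q)}.
  move=> x0; apply/differentiable_continuous/derivable1_diffP.
  exact: (@ex_derive _ _ _ _ _ _ _ (is_derive1_powR q x0)).
(* [n.+2] rather than [n.+1] keeps the intervals nondegenerate, as the fundamental theorem of
   calculus is applied with a strict inequality. *)
pose A n := `[(n.+2%:R)^-1, 1%R]%classic : set (measurableTypeR R).
have A0 n : 0 < n.+2%:R^-1 :> R by rewrite invr_gt0.
have A1 n : n.+2%:R^-1 < 1 :> R by rewrite invf_lt1// ltr1n.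
have AU : `]0%R, 1%R]%classic = \bigcup_n A n.
  apply/seteqP; split => x /=; rewrite in_itv/=.
    move=> /andP[x0 x1]; exists (Num.truncn x^-1) => //.
    rewrite /A/= in_itv/= x1 andbT -[leRHS]invrK lef_pV2 ?posrE ?invr_gt0//.
    by apply: (ltW (lt_le_trans (truncnS_gt _) _)); rewrite ler_nat.
  by move=> [n _]; rewrite /A/= in_itv/= => /andP[h ->]; rewrite (lt_le_trans _ h).
have mp : measurable_fun setT (fun x : R => x `^ (- 2^-1)) by exact: measurable_powR.
rewrite AU.
have cv : ((\int[mu1]_(x in A n) (x `^ (- 2^-1))%:E) @[n --> \oo] -->
    \int[mu1]_(x in \bigcup_n A n) (x `^ (- 2^-1))%:E)%E.
  apply: ge0_nondecreasing_set_cvg_integral.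
  - apply/nondecreasing_seqP => n; rewrite subsetEset => x; rewrite /A/= !in_itv/=.
    move=> /andP[h ->]; rewrite andbT (le_trans _ h)// lef_pV2 ?posrE// ler_nat.
    by rewrite ltnW.
  - by move=> i; exact: measurable_itv.
  - by move=> i; apply/measurable_EFinP; exact: measurable_funTS.
  - by move=> i x _; rewrite lee_fin powR_ge0.
rewrite -(cvg_lim _ cv)//.
apply: (@le_lt_trans _ _ 2%:E); last by rewrite ltry.
apply: lime_le; first exact: cvgP cv.
apply: nearW => n; rewrite (@continuous_FTC2 _ _ F)//.
- rewrite /F powR1 mulr1 -EFinB lee_fin gerBl mulr_ge0// powR_ge0.
- apply: continuous_in_subspaceT => x; rewrite inE/= in_itv/= => /andP[x1 _].
  by apply: cp; exact: lt_le_trans x1.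
- split.
  + move=> x; rewrite in_itv/= => /andP[x0 _].
    apply: (@ex_derive _ _ _ _ _ _ _ (dF _ (lt_trans (A0 n) x0))).
  + apply: cvg_at_right_filter; apply: differentiable_continuous.
    apply/derivable1_diffP; exact: (@ex_derive _ _ _ _ _ _ _ (dF _ (A0 n))).
  + apply: cvg_at_left_filter; apply: differentiable_continuous.
    apply/derivable1_diffP; exact: (@ex_derive _ _ _ _ _ _ _ (dF _ ltr01)).
- move=> x; rewrite in_itv/= => /andP[x0 _].
  have dFx := dF _ (lt_trans (A0 n) x0).
  by rewrite derive1E derive_val.
Qed.

Lemma L1_jap1 (r : R) : 2^-1 < r -> L1 mu1 (fun x => (1 + x ^+ 2) `^ (- r)).
Proof.
move=> r2.
have pos (x : R) : 0 < 1 + x ^+ 2 by rewrite ltr_wpDr// sqr_ge0.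
have mf : measurable_fun setT (fun x : R => (1 + x ^+ 2) `^ (- r)).
  by apply: (measurableT_comp (@measurable_powR R (- r))); apply: measurable_funD.
have h1 : L1 mu1 (fun x : R => 1 * \1_`[0%R, 1%R] x).
  apply: L1_indic => //; rewrite integral_cst//= lebesgue_measure_itv/= lte_fin ltr01.
  by rewrite mul1e -EFinB ltry.
have h2 : L1 mu1 (fun x : R => x `^ (- (2 * r)) * \1_`[1%R, +oo[ x).
  apply: L1_indic => //; last by apply: powR_integrable_y; lra.
  by move=> x; exact: powR_ge0.
apply: (L1_even mf (L1D h1 h2)) => [x|x x0|x]; last by rewrite sqrrN.
  by rewrite addr_ge0// mulr_ge0// powR_ge0.
rewrite ger0_norm ?powR_ge0// !indicE.
have [x1|x1] := leP x 1.
  rewrite mem_set/=; last by rewrite in_itv/= x0.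
  rewrite mulr1 ler_wpDr ?mulr_ge0 ?powR_ge0// powRN invf_le1 ?powR_gt0//.
  by rewrite powR_ge1 ?lerDl ?sqr_ge0//; lra.
have -> : (x \in `[1%R, +oo[%classic) = true by rewrite mem_set//= in_itv/= andbT ltW.
rewrite ler_wpDl// mulr1 !powRN lef_pV2 ?posrE ?powR_gt0//; last exact: le_lt_trans x1.
rewrite powRrM powR_mulrn//.
by apply: ge0_ler_powR; rewrite ?nnegrE ?sqr_ge0 ?(ltW (pos _))// ?lerDr//; lra.
Qed.

Lemma L1_sing1 : L1 mu1 (fun x => `|x| `^ (- 2^-1) * \1_`[(-1)%R, 1%R] x).
Proof.
have mf : measurable_fun setT (fun x : R => `|x| `^ (- 2^-1) * \1_`[(-1)%R, 1%R] x).
  apply: measurable_funM => //.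
  by apply: (measurableT_comp (@measurable_powR R (- 2^-1))).
have h : L1 mu1 (fun x : R => x `^ (- 2^-1) * \1_`]0%R, 1%R] x).
  apply: L1_indic => //; last exact: powR_integrable_0.
  by move=> x; exact: powR_ge0.
apply: (L1_even mf h) => [x|x x0|x]; first by rewrite mulr_ge0// powR_ge0.
  rewrite ger0_norm ?mulr_ge0 ?powR_ge0// ger0_norm// !indicE.
  (* [powR] sends 0 to 0 for a nonzero exponent, so the endpoint missing from []0, 1]] costs
     nothing. *)
  have [->|xn0] := eqVneq x 0; first by rewrite powR0 ?mul0r// oppr_eq0 invr_neq0.
  rewrite ler_wpM2l ?powR_ge0//.
  case: (boolP (x \in `[(-1)%R, 1%R]%classic)) => [|_]; last by case: (_ \in _).
  rewrite inE/= in_itv/= => /andP[_ x1].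
  by rewrite mem_set//= in_itv/= x1 lt_neqAle eq_sym xn0 x0.
rewrite normrN; congr (_ * _); rewrite !indicE; congr (_%:R); congr nat_of_bool.
by apply/idP/idP; rewrite !inE/= !in_itv/= => /andP[? ?]; apply/andP; split; lra.
Qed.


(** A negative power of 0 is 0 here, so on the axes the product bound for 1/|z| used in [L1_rad_jb]
    is false; they must be discarded as a null set. *)
Lemma ae_off_axes : {ae mu, forall z : P, z.1 != 0 /\ z.2 != 0}.
Proof.
have m0 : measurable ([set 0%R] : set (measurableTypeR R)) by exact: measurable_set1.
exists (([set 0%R] `*` setT) `|` (setT `*` [set 0%R])); split.
- by apply: measurableU; apply: measurableX.
- apply: null_set_setU; try by apply: measurableX.
    by apply: etrans (product_measure1E mu1 mu1 m0 measurableT) _; rewrite [X in (X * _)%E](_ : _ = 0%E) ?mul0e//; exact: lebesgue_measure_set1.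
  by apply: etrans (product_measure1E mu1 mu1 measurableT m0) _; rewrite [X in (_ * X)%E](_ : _ = 0%E) ?mule0//; exact: lebesgue_measure_set1.
- move=> [x y] /= /not_andP[] /negP; rewrite negbK => /eqP ->; [left|right] => //.
Qed.

(** <z>^4 dominates (1 + x^2)(1 + y^2), which reduces integrability on the plane to the line. *)
Lemma jap_dom (q : R) (z : R * R) : 0 <= q ->
  jb z `^ (- (4 * q)) <= (1 + z.1 ^+ 2) `^ (- q) * (1 + z.2 ^+ 2) `^ (- q).
Proof.
move=> q0.
have pos (x : R) : 0 < 1 + x ^+ 2 by rewrite ltr_wpDr// sqr_ge0.
rewrite -powRM ?(ltW (pos _))// !powRN lef_pV2 ?posrE ?powR_gt0 ?mulr_gt0 ?jb_gt0//.
rewrite (_ : 4 * q = (2 * 2) * q); last by ring.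
rewrite !powRrM !powR_mulrn ?powR_ge0 ?(ltW (jb_gt0 _))// ?jb_sqr ?(addr_ge0 ler01 (dot_ge0 _))//.
apply: ge0_ler_powR => //; rewrite ?nnegrE ?sqr_ge0 ?mulr_ge0// ?(ltW (pos _))//.
rewrite /dot; move: z.1 z.2 => x y; have := sqr_ge0 x; have := sqr_ge0 y.
by rewrite !expr2; nra.
Qed.

Lemma L1_jb_pow (q : R) : 2 < q -> L1 mu (fun z : P => jb z `^ (- q)).
Proof.
move=> q2; have h : 2^-1 < q / 4 by lra.
have := L1_prod (L1_jap1 h) (L1_jap1 h); apply: L1_dom => [|z].
  exact: measurable_jbpow.
rewrite ger0_norm ?powR_ge0// ger0_norm ?mulr_ge0 ?powR_ge0//.
have := @jap_dom (q / 4) z; rewrite mulrCA mulfV// mulr1; apply; lra.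
Qed.

(** In the unit disc |z|^2 >= |x| |y| bounds 1/|z| by a product of two integrable functions of one
    variable; outside it 1/|z| <= 1. *)
Lemma L1_rad_jb (q : R) : 2 < q ->
  L1 mu (fun z : P => rad z `^ (-1) * jb z `^ (- q)).
Proof.
move=> q2.
pose f (z : P) := `|z.1| `^ (- 2^-1) * \1_`[(-1)%R, 1%R] z.1 *
                  (`|z.2| `^ (- 2^-1) * \1_`[(-1)%R, 1%R] z.2) + jb z `^ (- q).
have Lf : L1 mu f := L1D (L1_prod L1_sing1 L1_sing1) (L1_jb_pow q2).
have mg : measurable_fun setT (fun z : P => rad z `^ (-1) * jb z `^ (- q)).
  by apply: measurable_funM; [exact: measurable_radpow|exact: measurable_jbpow].
have mf : measurable_fun setT f by exact: (L1_meas Lf).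
apply/L1P => //.
apply: (@le_lt_trans _ _ (\int[mu]_z `|f z|%:E)%E); last by apply/L1P.
apply: ae_ge0_le_integral => //.
- by apply/measurable_EFinP; exact: measurableT_comp.
- by apply/measurable_EFinP; exact: measurableT_comp.
apply: filterS ae_off_axes => z [z1 z2] _; rewrite lee_fin.
rewrite ger0_norm ?mulr_ge0 ?powR_ge0// ger0_norm; last first.
  by rewrite addr_ge0 ?mulr_ge0 ?powR_ge0.
have jq1 : jb z `^ (- q) <= 1.
  rewrite powRN invf_le1 ?powR_gt0 ?jb_gt0// powR_ge1 ?jb_ge1//; lra.
have rz : 0 < rad z.
  rewrite /rad sqrtr_gt0 /dot -!expr2 ltr_wpDr ?sqr_ge0// exprn_even_gt0//=.
have [r1|r1] := leP 1 (rad z).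
  rewrite /f ler_wpDl ?mulr_ge0 ?powR_ge0//.
  rewrite ler_piMl ?powR_ge0// powR_inv1 ?rad_ge0// invf_le1//.
rewrite /f ler_wpDr ?powR_ge0//.
have hr2 : rad z ^+ 2 < 1 by rewrite expr_lt1 ?rad_ge0.
have n1 : `|z.1| <= 1.
  rewrite -(@expr_le1 _ 2)// real_normK ?num_real//; move: hr2; rewrite rad_sqr /dot.
  by have := sqr_ge0 z.2; rewrite !expr2; lra.
have n2 : `|z.2| <= 1.
  rewrite -(@expr_le1 _ 2)// real_normK ?num_real//; move: hr2; rewrite rad_sqr /dot.
  by have := sqr_ge0 z.1; rewrite !expr2; lra.
rewrite !indicE !mem_set/= ?in_itv/= -?ler_norml// !mulr1.
rewrite -powRM// (le_trans (ler_piMr _ jq1)) ?powR_ge0//.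
have -> : rad z `^ (-1) = (rad z ^+ 2) `^ (- 2^-1).
  by rewrite -powR_mulrn ?rad_ge0// -powRrM mulrN mulfV.
rewrite !powRN lef_pV2 ?posrE ?powR_gt0 ?mulr_gt0 ?normr_gt0 ?exprn_gt0//.
apply: ge0_ler_powR; rewrite ?nnegrE ?sqr_ge0 ?mulr_ge0//.
rewrite rad_sqr /dot -!expr2 -(real_normK (num_real z.1)) -(real_normK (num_real z.2)).
by move: `|z.1| `|z.2| => x y; nra.
Qed.

(** Since the square of [lam] is at most 2 (<z>^2 + 1/|z|), it suffices to integrate <z>^(2 - 2 s)
    and <z>^(- 2 s) / |z|; the first is where [2 < s] is sharp. *)
Lemma L2_lam (s : R) : 2 < s -> L2 mu (fun z : P => lam z * jb z `^ (- s)).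
Proof.
move=> s2.
have m : measurable_fun setT (fun z : P => lam z * jb z `^ (- s)).
  by apply: measurable_funM; [exact: measurable_lam|exact: measurable_jbpow].
apply: L2P => //.
have h1 : 2 < 2 * s - 2 by lra.
have h2 : 2 < 2 * s by lra.
have := L1D (L1Z 2 (L1_jb_pow h1)) (L1Z 2 (L1_rad_jb h2)).
apply: L1_dom => [|z]; first exact: measurable_funX.
rewrite ger0_norm ?sqr_ge0// ger0_norm; last first.
  by rewrite addr_ge0// mulr_ge0// ?mulr_ge0 ?powR_ge0.
have j0 := jb_gt0 z.
have sq (a r : R) : (a `^ r) ^+ 2 = a `^ (2 * r).
  by rewrite -powR_mulrn ?powR_ge0// -powRrM mulrC.
have -> : jb z `^ (- (2 * s - 2)) = jb z ^+ 2 * (jb z `^ (- s)) ^+ 2.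
  rewrite sq -(@powR_mulrn _ _ 2) ?(ltW j0)// -powRD; last by rewrite (gt_eqF j0) implybT.
  by congr (_ `^ _); ring.
have -> : rad z `^ (-1) * jb z `^ (- (2 * s)) =
    (rad z `^ (- 2^-1)) ^+ 2 * (jb z `^ (- s)) ^+ 2.
  by rewrite !sq; congr (_ `^ _ * _ `^ _); field.
have c0 : 0 <= (jb z `^ (- s)) ^+ 2 by exact: sqr_ge0.
rewrite /lam exprMn; move: c0.
move: (jb z `^ (- s) ^+ 2) (jb z) (rad z `^ (- 2^-1)) => c a b c0.
by have := mulr_ge0 c0 (sqr_ge0 (a - b)); rewrite !expr2; nra.
Qed.

(* Sobolev embedding on the transform side. *)
Lemma lam_L1 (s : R) (f : P -> R) : 2 < s -> L2 mu (fun z => jb z `^ s * f z) ->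
  L1 mu (fun z => lam z * f z) /\
  \int[mu]_z `|lam z * f z| <=
    nrm mu (fun z => lam z * jb z `^ (- s)) * nrm mu (fun z => jb z `^ s * f z).
Proof.
move=> s2 Lf; have Ll := L2_lam s2.
have e z : lam z * jb z `^ (- s) * (jb z `^ s * f z) = lam z * f z.
  by rewrite powRN mulrA -(mulrA (lam z)) mulVf ?mulr1// gt_eqF ?powR_gt0 ?jb_gt0.
split.
  by have := L2_mul Ll Lf; apply: eq_integrable => // z _ /=; rewrite e.
have := cauchy_schwarz (L2_abs Ll) (L2_abs Lf); rewrite !nrm_abs.
apply: le_trans; rewrite /ip le_eqVlt; apply/orP; left; apply/eqP.
by apply: eq_Rintegral => z _; rewrite -normrM e.
Qed.

End Plane.

(** * Measures and densities determined by rectangles *)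

Section RectangleUniqueness.
Context {R : realType}.
Local Notation P := (plane R).
Local Notation mu1 := (@lebesgue_measure R).
Local Notation mu := (@lebesgue_measure R \x @lebesgue_measure R)%E.

Definition rect (a b c d : R) : set P := `]a, b]%classic `*` `]c, d]%classic.

Lemma measurable_rect a b c d : measurable (rect a b c d).
Proof. by apply: measurableX; exact: measurable_itv. Qed.

Lemma line_measure_eq (m1 m2 : {measure set (measurableTypeR R) -> \bar R}) :
  (m1 setT < +oo)%E -> (forall a b, m1 `]a, b]%classic = m2 `]a, b]%classic) ->
  forall A, measurable A -> m1 A = m2 A.
Proof.
move=> m1f m12 A mA.
apply: (@measure_unique _ R (measurableTypeR R) (@ocitv R) (fun n => `](- n%:R), n%:R]%classic)) => //.
- exact: ocitvI.
- by move=> n; exact: is_ocitv.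
- apply/seteqP; split => // x _; exists (Num.truncn `|x|).+1 => //=.
  rewrite in_itv/= -ltrNl; apply/andP; split.
    by apply: (le_lt_trans _ (truncnS_gt _)); rewrite -normrN ler_norm.
  by apply/ltW/(le_lt_trans _ (truncnS_gt _)); rewrite ler_norm.
- by move=> _ [[a b] _ <-]; exact: m12.
- move=> k; apply: le_lt_trans m1f; apply: le_measure; rewrite ?inE//.
Qed.

(** Uniqueness on the line is applied one coordinate at a time, first with a fixed interval as left
    factor, then with a fixed measurable set as right factor. *)
Lemma plane_measure_eq (m1 m2 : {measure set P -> \bar R}) :
  (m1 setT < +oo)%E -> (forall a b c d, m1 (rect a b c d) = m2 (rect a b c d)) ->
  forall A, measurable A -> m1 A = m2 A.
Proof.
move=> m1f m12.
have fin (B : set P) : measurable B -> (m1 B < +oo)%E.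
  by move=> mB; apply: le_lt_trans m1f; apply: le_measure; rewrite ?inE.
have H1 a b (B : set (measurableTypeR R)) : measurable B ->
    m1 (`]a, b]%classic `*` B) = m2 (`]a, b]%classic `*` B).
  move=> mB; have mI : measurable (`]a, b]%classic `*` setT : set P) by exact: measurableX.
  pose n1 := pushforward (mrestr m1 mI) (snd : P -> measurableTypeR R).
  pose n2 := pushforward (mrestr m2 mI) (snd : P -> measurableTypeR R).
  have E (m : {measure set P -> \bar R}) (C : set (measurableTypeR R)) :
      pushforward (mrestr m mI) (snd : P -> measurableTypeR R) C =
      m (`]a, b]%classic `*` C).
    rewrite /pushforward/mrestr; congr (m _).
    by apply/seteqP; split => -[x y] /=; tauto.
  rewrite -!E; apply: (@line_measure_eq n1 n2) => //.
    by have := fin _ (measurableX (measurable_itv `]a, b]) measurableT); rewrite -(E m1).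
  by move=> c d; exact: (etrans (E m1 _) (etrans (m12 a b c d) (esym (E m2 _)))).
have H2 (A B : set (measurableTypeR R)) : measurable A -> measurable B ->
    m1 (A `*` B) = m2 (A `*` B).
  move=> mA mB; have mI : measurable (setT `*` B : set P) by exact: measurableX.
  pose n1 := pushforward (mrestr m1 mI) (fst : P -> measurableTypeR R).
  pose n2 := pushforward (mrestr m2 mI) (fst : P -> measurableTypeR R).
  have E (m : {measure set P -> \bar R}) (C : set (measurableTypeR R)) :
      pushforward (mrestr m mI) (fst : P -> measurableTypeR R) C =
      m (C `*` B).
    rewrite /pushforward/mrestr; congr (m _).
    by apply/seteqP; split => -[x y] /=; tauto.
  rewrite -!E; apply: (@line_measure_eq n1 n2) => //.
    by have := fin _ (measurableX measurableT mB); rewrite -(E m1).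
  by move=> c d; exact: (etrans (E m1 _) (etrans (H1 c d _ mB) (esym (E m2 _)))).
move=> A mA.
apply: (@measure_unique _ R P [set A `*` B | A in measurable & B in measurable] (fun=> setT)) => //.
- exact: measurable_prod_measurableType.
- move=> _ _ [X mX [Y mY <-]] [X' mX' [Y' mY' <-]].
  exists (X `&` X'); first exact: measurableI.
  exists (Y `&` Y'); first exact: measurableI.
  by rewrite setXI.
- by move=> _; exists setT => //; exists setT => //; rewrite setXTT.
- by apply/seteqP; split => // x _; exists 0%N.
- by move=> _ [X mX [Y mY <-]]; exact: H2.
Qed.

End RectangleUniqueness.

Section Density.
Context d (T : measurableType d) (R : realType) (mu : {measure set T -> \bar R}).
Context (f : T -> \bar R) (mf : measurable_fun setT f) (f0 : forall x, (0 <= f x)%E).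

Definition dens (A : set T) : \bar R := (\int[mu]_(x in A) f x)%E.
Let dens0 : dens set0 = 0%E. Proof. by rewrite /dens integral_set0. Qed.
Let dens_ge0 A : (0 <= dens A)%E. Proof. exact: integral_ge0. Qed.
Let dens_sigma : semi_sigma_additive dens.
Proof. exact: semi_sigma_additive_nng_induced. Qed.
HB.instance Definition _ := isMeasure.Build _ _ _ dens dens0 dens_ge0 dens_sigma.
Definition dens_measure : {measure set T -> \bar R} := dens.
End Density.

Section RectangleTest.
Context {R : realType}.
Local Notation P := (plane R).
Local Notation mu := (@lebesgue_measure R \x @lebesgue_measure R)%E.

(** The positive and negative parts of [h] are densities of two finite measures that agree on
    rectangles, hence on all measurable sets; the set where [h >= 0] and its complement then force
    both parts to vanish. *)
Lemma rect_test (h : P -> R) : L1 mu h ->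
  (forall a b c d, a < b -> c < d -> \int[mu]_z (h z * \1_(rect a b c d) z) = 0) ->
  {ae mu, forall z, h z = 0}.
Proof.
move=> Lh h0; have mh := L1_meas Lh.
pose p := (EFin \o h)^\+%E; pose q := (EFin \o h)^\-%E.
have mE : measurable_fun setT (EFin \o h) by exact/measurable_EFinP.
have mp : measurable_fun setT p by exact: measurable_funepos.
have mq : measurable_fun setT q by exact: measurable_funeneg.
have p0 x : (0 <= p x)%E by exact: funepos_ge0.
have q0 x : (0 <= q x)%E by exact: funeneg_ge0.
have ip : (\int[mu]_x p x < +oo)%E := integral_funepos_lt_pinfty measurableT Lh.
have iq : (\int[mu]_x q x < +oo)%E := integral_funeneg_lt_pinfty measurableT Lh.
pose m1 := dens_measure mu mp p0; pose m2 := dens_measure mu mq q0.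
have m12 (A : set P) : measurable A -> m1 A = m2 A.
  apply: plane_measure_eq => // a b c d.
  have mr := measurable_rect a b c d.
  have [ab|ab] := ltP a b; last first.
    have -> : rect a b c d = set0; last by rewrite !measure0.
    apply/seteqP; split => // z [/=]; rewrite in_itv/= => /andP[h1 h2].
    by move: (lt_le_trans h1 (le_trans h2 ab)); rewrite ltxx.
  have [cd|cd] := ltP c d; last first.
    have -> : rect a b c d = set0; last by rewrite !measure0.
    apply/seteqP; split => // z [/= _]; rewrite in_itv/= => /andP[h1 h2].
    by move: (lt_le_trans h1 (le_trans h2 cd)); rewrite ltxx.
  have := h0 a b c d ab cd; rewrite /Rintegral.
  have -> : (\int[mu]_z (h z * \1_(rect a b c d) z)%:E =
             \int[mu]_(z in rect a b c d) (h z)%:E)%E.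
    rewrite [RHS]integral_mkcond; apply: eq_integral => z _.
    by rewrite patchE indicE; case: ifPn => _; rewrite ?mulr1 ?mulr0.
  have fr (g : P -> \bar R) : measurable_fun setT g -> (forall x, 0 <= g x)%E ->
      (\int[mu]_x g x < +oo)%E -> (\int[mu]_(x in rect a b c d) g x)%E \is a fin_num.
    move=> mg g0 ig; rewrite ge0_fin_numE ?integral_ge0//.
    by apply: le_lt_trans ig; apply: ge0_subset_integral.
  rewrite integralE fineB ?fr// => /eqP; rewrite subr_eq0 => /eqP e.
  by rewrite /m1 /m2 /= /dens -(fineK (fr _ mp p0 ip)) -(fineK (fr _ mq q0 iq)) e.
have key (g : P -> \bar R) (A : set P) : measurable A -> measurable_fun setT g ->
    (forall x, 0 <= g x)%E -> (\int[mu]_(x in A) g x = 0)%E ->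
    {ae mu, forall x, A x -> g x = 0%E}.
  move=> mA mg g0 i0.
  have [H _] := ae_eq_integral_abs mu mA (measurable_funTS mg).
  have : ae_eq mu A g (cst 0%E).
    by apply: H; under eq_integral do rewrite gee0_abs//.
  by apply: filterS => x; apply.
pose A := [set x | 0 <= h x].
have mA : measurable A.
  by rewrite -[A]setTI; apply: measurable_fun_le.
have pA x : A x -> q x = 0%E.
  move=> Ax; rewrite /q funenegE/= max_r// lee_fin oppr_le0; exact: Ax.
have pnA x : (~` A) x -> p x = 0%E.
  by move=> /negP; rewrite -ltNge => Ax; rewrite /p funeposE/= max_r// lee_fin ltW.
have i1 : (\int[mu]_(x in A) p x = 0)%E.
  have := m12 _ mA; rewrite /m1/m2/= /dens => ->.
  by apply: integral0_eq => x; exact: pA.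
have i2 : (\int[mu]_(x in ~` A) q x = 0)%E.
  have := m12 _ (measurableC mA); rewrite /m1/m2/= /dens => <-.
  by apply: integral0_eq => x; exact: pnA.
have k1 := key _ _ mA mp p0 i1; have k2 := key _ _ (measurableC mA) mq q0 i2.
apply: filterS2 k1 k2 => x k1 k2.
have e : (h x)%:E = (p x - q x)%E by rewrite /p /q -[LHS]/((EFin \o h) x) [in LHS](funeposneg (EFin \o h)).
have [Ax|Ax] := pselect (A x).
  by move: e; rewrite k1// pA// sube0 => -[].
by move: e; rewrite pnA// k2// sube0 => -[].
Qed.

End RectangleTest.

(** * The Hartley transform and Plancherel *)

Section Hartley.
Context {R : realType}.
Local Notation P := (plane R).
Local Notation mu1 := (@lebesgue_measure R).
Local Notation mu := (@lebesgue_measure R \x @lebesgue_measure R)%E.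

(* The Hartley kernel: [hartley] is real, symmetric, unitary and its own inverse. *)
Definition cas (t : R) : R := cos t + sin t.
Definition c2pi : R := (2 * pi)^-1.
Definition hartley (f : R * R -> R) (xi : R * R) : R :=
  c2pi * \int[mu]_x (f x * cas (dot x xi)).

Lemma c2pi_gt0 : 0 < c2pi.
Proof. by rewrite invr_gt0 mulr_gt0// pi_gt0. Qed.

Lemma dotC (x y : R * R) : dot x y = dot y x.
Proof. by rewrite /dot; ring. Qed.

Lemma dotNl (x z : R * R) : dot (- x) z = - dot x z.
Proof. by rewrite /dot/=; ring. Qed.

Lemma dotNr (x z : R * R) : dot x (- z) = - dot x z.
Proof. by rewrite /dot/=; ring. Qed.

Lemma cas_le2 t : `|cas t| <= 2.
Proof.
rewrite /cas (le_trans (ler_normD _ _))// (_ : 2 = 1 + 1); last by ring.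
by rewrite lerD// ler_norml ?cos_geN1 ?cos_le1 ?sin_geN1 ?sin_le1.
Qed.

Lemma continuous_cas : continuous cas.
Proof.
move=> t; apply: cvgD; first exact: continuous_cos.
exact: continuous_sin.
Qed.

Lemma measurable_cas : measurable_fun setT cas.
Proof. exact: (continuous_measurable_fun continuous_cas). Qed.

Lemma measurable_cas_dot (d : measure_display) (T : measurableType d)
  (f g : T -> P) : measurable_fun setT f -> measurable_fun setT g ->
  measurable_fun setT (fun t => cas (dot (f t) (g t))).
Proof.
move=> mf mg; apply: (measurableT_comp measurable_cas).
have := measurableT_comp measurable_dot (measurable_fun_pair mf mg); exact.
Qed.

(* Also valid, with junk values, when the sections are not integrable. *)
Lemma measurable_Rint (k : P * P -> R) : measurable_fun setT k ->
  measurable_fun setT (fun x => \int[mu]_y k (x, y)).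
Proof.
move=> mk; have mkE : measurable_fun setT (EFin \o k) by exact/measurable_EFinP.
apply: (measurableT_comp (@fine_measurable R setT measurableT)).
under eq_fun do rewrite integralE.
apply: emeasurable_funB.
- have := @measurable_tonelliP R ((EFin \o k)^\+%E) (measurable_funepos mkE) (fun=> funepos_ge0 _ _).
  by under eq_fun do under eq_integral do rewrite funeposE/=;
     under [in X in _ -> X]eq_fun do under eq_integral do rewrite funeposE/=.
- have := @measurable_tonelliP R ((EFin \o k)^\-%E) (measurable_funeneg mkE) (fun=> funeneg_ge0 _ _).
  by under eq_fun do under eq_integral do rewrite funenegE/=;
     under [in X in _ -> X]eq_fun do under eq_integral do rewrite funenegE/=.
Qed.

Lemma measurable_hartley (f : P -> R) : measurable_fun setT f ->
  measurable_fun setT (hartley f : P -> R).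
Proof.
move=> mf; apply: measurable_funM => //.
apply: (@measurable_Rint (fun p => f p.2 * cas (dot p.2 p.1))).
apply: measurable_funM; first exact: measurableT_comp mf measurable_snd.
exact: measurable_cas_dot measurable_snd measurable_fst.
Qed.

Lemma L1_cas (f : P -> R) xi : L1 mu f -> L1 mu (fun x => f x * cas (dot x xi)).
Proof.
move=> Lf; have := L1Z 2 Lf; apply: L1_dom => [|x].
  apply: measurable_funM; first exact: L1_meas Lf.
  exact: measurable_cas_dot.
by rewrite !normrM mulrC ler_wpM2r// (ger0_norm (ler0n _ _)) cas_le2.
Qed.

Lemma hartley_bound (f : P -> R) xi : L1 mu f ->
  `|hartley f xi| <= c2pi * (2 * \int[mu]_x `|f x|).
Proof.
move=> Lf; rewrite /hartley normrM gtr0_norm ?c2pi_gt0// ler_wpM2l ?(ltW c2pi_gt0)//.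
apply: le_trans (le_normr_Rintegral measurableT (L1_cas xi Lf)) _.
rewrite -RintegralZl//; last exact: L1_abs.
apply: le_Rintegral => //.
- exact: L1_abs (L1_cas xi Lf).
- exact: L1Z (L1_abs Lf).
by move=> x _; rewrite normrM mulrC ler_wpM2r// cas_le2.
Qed.

Lemma hartleyD (f g : P -> R) xi : L1 mu f -> L1 mu g ->
  hartley (fun x => f x + g x) xi = hartley f xi + hartley g xi.
Proof.
move=> Lf Lg; rewrite /hartley -mulrDr -RintegralD//; try exact: L1_cas.
by under eq_Rintegral do rewrite mulrDl.
Qed.

Lemma hartleyB (f g : P -> R) xi : L1 mu f -> L1 mu g ->
  hartley (fun x => f x - g x) xi = hartley f xi - hartley g xi.
Proof.
move=> Lf Lg; rewrite /hartley -mulrBr -RintegralB//; try exact: L1_cas.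
by under eq_Rintegral do rewrite mulrBl.
Qed.

Lemma L1P2_tensor (f g : P -> R) : L1 mu f -> L1 mu g ->
  L1P2 (fun p => f p.1 * g p.2).
Proof.
move=> Lf Lg; have mf := L1_meas Lf; have mg := L1_meas Lg; split.
  by apply: measurable_funM; apply: measurableT_comp.
under eq_integral => x _.
  under eq_integral => y _ do rewrite /= normrM EFinM.
  rewrite ge0_integralZl//; last first.
    by apply/measurable_EFinP; apply: measurableT_comp.
  over.
rewrite ge0_integralZr//; last 2 first.
- by apply/measurable_EFinP; apply: measurableT_comp.
- by apply: integral_ge0.
by apply: lte_mul_pinfty; [exact: integral_ge0|
  rewrite ge0_fin_numE; [exact/L1P|exact: integral_ge0]|exact/L1P].
Qed.

Lemma L1P2_tensor_cas (f g : P -> R) : L1 mu f -> L1 mu g ->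
  L1P2 (fun p => f p.1 * g p.2 * cas (dot p.1 p.2)).
Proof.
move=> Lf Lg; have L2 := L1P2_tensor (L1Z 2 Lf) Lg; apply: L1P2_dom L2 => [|p].
  apply: measurable_funM; last exact: measurable_cas_dot.
  by case: (L1P2_tensor Lf Lg).
rewrite !normrM (ger0_norm (ler0n _ 2)) mulrC mulrA.
by rewrite !ler_wpM2r// cas_le2.
Qed.

Lemma hartley_mult (f g : P -> R) : L1 mu f -> L1 mu g ->
  \int[mu]_x (hartley f x * g x) = \int[mu]_x (f x * hartley g x).
Proof.
move=> Lf Lg; have H := L1P2_tensor_cas Lf Lg.
have := fubini_swap H => /=.
have -> : (fun x => \int[mu]_y (f x * g y * cas (dot x y))) =
          (fun x => f x * \int[mu]_y (g y * cas (dot y x))).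
  apply/funext => x; rewrite -RintegralZl//; last exact: L1_cas.
  by apply: eq_Rintegral => y _; rewrite mulrA (dotC x).
have -> : (fun y => \int[mu]_x (f x * g y * cas (dot x y))) =
          (fun y => (\int[mu]_x (f x * cas (dot x y))) * g y).
  apply/funext => y; rewrite -RintegralZr//; last exact: L1_cas.
  by apply: eq_Rintegral => x _; rewrite mulrAC.
move=> e.
have [/= L1x _] := fubini_L1 H; have [/= L1y _] := fubini_L1 (L1P2_swap H).
have e1 x : f x * \int[mu]_y (g y * cas (dot y x)) =
    \int[mu]_y (f x * g y * cas (dot x y)).
  rewrite -RintegralZl//; last exact: L1_cas.
  by apply: eq_Rintegral => y _; rewrite mulrA (dotC x).
have e2 y : (\int[mu]_x (f x * cas (dot x y))) * g y =
    \int[mu]_x (f x * g y * cas (dot x y)).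
  rewrite -RintegralZr//; last exact: L1_cas.
  by apply: eq_Rintegral => x _; rewrite mulrAC.
transitivity (c2pi * \int[mu]_y ((\int[mu]_x (f x * cas (dot x y))) * g y)).
  rewrite -RintegralZl//; last by move: L1y; rewrite -(funext e2).
  by apply: eq_Rintegral => x _; rewrite /hartley mulrA.
transitivity (c2pi * \int[mu]_x (f x * \int[mu]_y (g y * cas (dot y x)))).
  by rewrite -e.
rewrite -RintegralZl//; last by move: L1x; rewrite -(funext e1).
by apply: eq_Rintegral => x _; rewrite /hartley mulrCA.
Qed.

End Hartley.

Section RealDominatedConvergence.
Context d (T : measurableType d) (R : realType) (mu : {measure set T -> \bar R}).

Lemma real_dct (f_ : nat -> T -> R) (f g : T -> R) :
  (forall n, measurable_fun setT (f_ n)) -> measurable_fun setT f ->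
  {ae mu, forall x, f_ n x @[n --> \oo] --> f x} ->
  L1 mu g -> (forall n x, `|f_ n x| <= g x) ->
  L1 mu f /\ \int[mu]_x f_ n x @[n --> \oo] --> \int[mu]_x f x.
Proof.
move=> mf_ mf ff Lg fg.
have [|||//||If _ cf] := @dominated_convergence _ _ _ mu setT measurableT
  (fun n x => (f_ n x)%:E) (EFin \o f) (EFin \o g).
- by move=> n; exact/measurable_EFinP.
- exact/measurable_EFinP.
- apply: filterS ff => x fx _; apply/cvg_EFin; [exact: nearW|exact: fx].
- by apply: aeW => x n _; rewrite /= lee_fin.
split => //; apply: fine_cvg; rewrite /Rintegral fineK//.
exact: (integrable_fin_num measurableT If).
Qed.

End RealDominatedConvergence.

Section Derivatives.
Context {R : realType}.
Implicit Types (f g : R -> R) (x df dg c : R).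

Lemma dvM f g x df dg : is_derive x 1 f df -> is_derive x 1 g dg ->
  is_derive x 1 (fun t => f t * g t) (df * g x + f x * dg).
Proof.
by move=> hf hg; apply: is_derive_eq (is_deriveM hf hg) _; rewrite /GRing.scale/=; ring.
Qed.

Lemma dvD f g x df dg : is_derive x 1 f df -> is_derive x 1 g dg ->
  is_derive x 1 (fun t => f t + g t) (df + dg).
Proof. by move=> hf hg; apply: is_derive_eq (is_deriveD hf hg) _. Qed.

Lemma dvZ c f x df : is_derive x 1 f df -> is_derive x 1 (fun t => c * f t) (c * df).
Proof. by move=> hf; apply: is_derive_eq (is_deriveZ c hf) _. Qed.

Lemma dv_comp f g x df dg : is_derive (g x) 1 f df -> is_derive x 1 g dg ->
  is_derive x 1 (fun t => f (g t)) (df * dg).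
Proof. by move=> hf hg; exact: is_derive1_comp. Qed.

Lemma dv_lin c x : is_derive x 1 (fun t : R => c * t) c.
Proof. by apply: is_derive_eq (is_deriveZ c (is_derive_id x 1)) _; rewrite /GRing.scale/= mulr1. Qed.

Lemma dv_cont f x df : is_derive x 1 f df -> {for x, continuous f}.
Proof.
by move=> h; apply/differentiable_continuous/derivable1_diffP; exact: ex_derive.
Qed.

Lemma ftc (f F : R -> R) (a b : R) : a < b -> (forall t : R, is_derive t 1 F (f t)) -> continuous f ->
  (\int[lebesgue_measure]_(t in `[a, b]) (f t)%:E = (F b - F a)%:E)%E.
Proof.
move=> ab dF cf; have cF t := dv_cont (dF t).
rewrite (@continuous_FTC2 _ f F)//.
- exact: continuous_subspaceT.
- split.
  + by move=> x _; exact: (@ex_derive _ _ _ _ _ _ _ (dF x)).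
  + exact: cvg_at_right_filter (cF a).
  + exact: cvg_at_left_filter (cF b).
- by move=> x _; have := dF x => dFx; rewrite derive1E derive_val.
Qed.

End Derivatives.

(** * Abel summation and the Poisson kernel *)

Section AbelPoisson.
Context {R : realType}.
Local Notation P := (plane R).
Local Notation mu1 := (@lebesgue_measure R).
Local Notation mu := (@lebesgue_measure R \x @lebesgue_measure R)%E.

Lemma Rint_prod (p q : R -> R) : L1 mu1 p -> L1 mu1 q ->
  \int[mu]_z (p z.1 * q z.2) = \int[mu1]_x p x * \int[mu1]_y q y.
Proof.
move=> Lp Lq; have L := L1_prod Lp Lq.
rewrite {1}/Rintegral -(integral12_prod_meas1 L) /fubini_F/=.
under eq_integral => x _.
  under eq_integral => y _ do rewrite EFinM.
  rewrite integralZl//.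
  have -> : (\int[mu1]_y (q y)%:E = (\int[mu1]_y q y)%:E)%E.
    by rewrite /Rintegral fineK//; exact: (integrable_fin_num measurableT Lq).
  over.
rewrite integralZr//.
have -> : (\int[mu1]_y (p y)%:E = (\int[mu1]_y p y)%:E)%E.
  by rewrite /Rintegral fineK//; exact: (integrable_fin_num measurableT Lp).
by [].
Qed.

Context (e : R) (e0 : 0 < e).

Let den_gt0 (z : R) : 0 < e ^+ 2 + z ^+ 2.
Proof. by rewrite ltr_wpDr ?sqr_ge0// exprn_gt0. Qed.

(** An exponential summability factor keeps every integral elementary: its transform is rational and
    the primitive of that is an arctangent. *)
Definition abel1 (t : R) : R := expR (- e * `|t|).
Definition poisson1 (z : R) : R := 2 * e / (e ^+ 2 + z ^+ 2).

Lemma measurable_abel1 : measurable_fun setT abel1.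
Proof.
apply: (measurableT_comp (@measurable_expR R)).
by apply: measurable_funM.
Qed.

Lemma abel1_ge0 t : 0 <= abel1 t.
Proof. exact: expR_ge0. Qed.

Lemma abel1_le1 t : abel1 t <= 1.
Proof. by rewrite /abel1 -expR0 ler_expR mulNr oppr_le0 mulr_ge0// ltW. Qed.

Lemma L1_abel1 : L1 mu1 abel1.
Proof.
have h : L1 mu1 (fun t => e^-1 * exponential_pdf e t).
  by apply: L1Z; apply: integrable_exponential_pdf => //; exact: ltW.
apply: (L1_even measurable_abel1 h).
- by move=> x; rewrite mulr_ge0 ?invr_ge0 ?(ltW e0)// exponential_pdf_ge0// ltW.
- move=> x x0; rewrite ger0_norm ?abel1_ge0// /abel1 ger0_norm//.
  by rewrite exponential_pdfE// mulrA mulVf ?gt_eqF// mul1r.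
- by move=> x; rewrite /abel1 normrN.
Qed.

(** The real part of exp((i z - e) t) / (i z - e). *)
Let Fp (z t : R) : R := (e ^+ 2 + z ^+ 2)^-1 * (expR (- e * t) * (z * sin (z * t) + (- e) * cos (z * t))).

Let dF (z t : R) : is_derive t 1 (Fp z) (cos (z * t) * expR (- e * t)).
Proof.
have dl c : is_derive t 1 (fun t : R => c * t) c by exact: dv_lin.
have d1 := dv_comp (is_derive_expR (- e * t)) (dl (- e)).
have d2 := dv_comp (is_derive_sin (z * t)) (dl z).
have d3 := dv_comp (is_derive_cos (z * t)) (dl z).
apply: is_derive_eq (dvZ _ (dvM d1 (dvD (dvZ z d2) (dvZ (- e) d3)))) _.
have := den_gt0 z; set D := _ + _ => D0.
apply: (mulfI (lt0r_neq0 D0)); rewrite [LHS]mulrA mulfV ?gt_eqF// mul1r /D; ring.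
Qed.

Let L1_trig_abel (h : R -> R) : measurable_fun setT h -> (forall t, `|h t| <= 1) ->
  L1 mu1 (fun t => h t * abel1 t).
Proof.
move=> mh h1; apply: L1_dom L1_abel1 => [|t].
  by apply: measurable_funM => //; exact: measurable_abel1.
by rewrite normrM ler_piMl.
Qed.

Let mcos z : measurable_fun setT (fun t : R => cos (z * t)).
Proof.
apply: continuous_measurable_fun => t.
by have := dv_cont (dv_comp (is_derive_cos (z * t)) (dv_lin z t)).
Qed.

Let msin z : measurable_fun setT (fun t : R => sin (z * t)).
Proof.
apply: continuous_measurable_fun => t.
by have := dv_cont (dv_comp (is_derive_sin (z * t)) (dv_lin z t)).
Qed.

Let cos1 z t : `|cos (z * t)| <= 1 :> R.
Proof. by rewrite ler_norml cos_geN1 cos_le1. Qed.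
Let sin1 z t : `|sin (z * t)| <= 1 :> R.
Proof. by rewrite ler_norml sin_geN1 sin_le1. Qed.

Lemma L1_cos_abel z : L1 mu1 (fun t => cos (z * t) * abel1 t).
Proof. exact: L1_trig_abel. Qed.

Lemma L1_sin_abel z : L1 mu1 (fun t => sin (z * t) * abel1 t).
Proof. exact: L1_trig_abel. Qed.

Lemma int_sin_abel z : \int[mu1]_t (sin (z * t) * abel1 t) = 0.
Proof.
have := mp_Rintegral mp_opp1 (L1_meas (L1_sin_abel z)).
have -> : (fun x => sin (z * - x) * abel1 (- x)) = (fun x => -1 * (sin (z * x) * abel1 x)).
  by apply/funext => x; rewrite /abel1 normrN mulrN sinN; ring.
rewrite RintegralZl//; last exact: L1_sin_abel.
lra.
Qed.

Let half z : \int[mu1]_t (cos (z * t) * abel1 t * \1_`[0%R, +oo[ t) = e / (e ^+ 2 + z ^+ 2).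
Proof.
pose f n (t : R) := cos (z * t) * abel1 t * \1_`[0%R, n.+1%:R] t.
have mf n : measurable_fun setT (f n).
  by apply: measurable_funM => //; exact: (L1_meas (L1_cos_abel z)).
have mg : measurable_fun setT (fun t => cos (z * t) * abel1 t * \1_`[0%R, +oo[ t).
  by apply: measurable_funM => //; exact: (L1_meas (L1_cos_abel z)).
have [| |_ cv] := @real_dct _ (measurableTypeR R) R mu1 f _ abel1 mf mg _ L1_abel1.
- apply: aeW => t; apply: cvg_near_cst.
  near=> n; rewrite /f !indicE; congr (_ * _%:R); congr nat_of_bool.
  apply/idP/idP; rewrite !inE/= !in_itv/=; first by move=> /andP[->].
  rewrite andbT => ->/=; rewrite (le_trans (ler_norm _))// (le_trans (ltW (truncnS_gt _)))//.
  by rewrite ler_nat ltnS; near: n; exact: nbhs_infty_ge.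
- move=> n t; have i1 : `|\1_`[0%R, n.+1%:R] t : R| <= 1.
    by rewrite indicE; case: (_ \in _); rewrite ?normr1 ?normr0.
  rewrite /f normrM; apply: le_trans (ler_piMr (normr_ge0 _) i1) _.
  by rewrite normrM (ger0_norm (abel1_ge0 t)) ler_piMl ?abel1_ge0.
have E n : \int[mu1]_t f n t = Fp z n.+1%:R - Fp z 0.
  rewrite /Rintegral.
  have -> : (\int[mu1]_t (f n t)%:E =
      \int[mu1]_(t in `[0%R, n.+1%:R]) (cos (z * t) * expR (- e * t))%:E)%E.
    rewrite [RHS]integral_mkcond; apply: eq_integral => t _.
    rewrite patchE /f indicE; case: ifPn; rewrite ?mulr0// inE/= in_itv/= => /andP[t0 _].
    by rewrite mulr1 /abel1 ger0_norm.
  rewrite (ftc _ (dF z))// => t.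
  have dl c : is_derive t 1 (fun t : R => c * t) c by exact: dv_lin.
  have d1 := dv_comp (is_derive_expR (- e * t)) (dl (- e)).
  have d3 := dv_comp (is_derive_cos (z * t)) (dl z).
  exact: dv_cont (dvM d3 d1).
have {}cv : Fp z n.+1%:R - Fp z 0 @[n --> \oo] -->
    \int[mu1]_t (cos (z * t) * abel1 t * \1_`[0%R, +oo[ t).
  by move: cv; rewrite (funext E).
have cv2 : Fp z n.+1%:R - Fp z 0 @[n --> \oo] --> 0 - Fp z 0.
  apply: cvgB; last exact: cvg_cst.
  rewrite -(mulr0 ((e ^+ 2 + z ^+ 2)^-1)); apply: cvgM; first exact: cvg_cst.
  have g0 : (`|z| + e) * expR (- e * n.+1%:R) @[n --> \oo] --> 0.
    rewrite -(mulr0 (`|z| + e)); apply: cvgM; first exact: cvg_cst.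
    have -> : (fun n => expR (- e * n.+1%:R)) = (fun n => expR (- e) ^+ n.+1).
      by apply/funext => n; rewrite expRM_natr.
    rewrite (cvg_shiftS (fun n => expR (- e) ^+ n)); apply: cvg_expr.
    by rewrite ger0_norm ?expR_ge0// expR_lt1 oppr_lt0.
  apply/norm_cvg0P; apply: squeeze_cvgr (cvg_cst 0) g0.
  apply: nearW => n; rewrite normr_ge0/= normrM ger0_norm ?expR_ge0// mulrC.
  rewrite ler_wpM2r ?expR_ge0// (le_trans (ler_normD _ _))// lerD//.
    by rewrite normrM ler_piMr.
  by rewrite normrM normrN (ger0_norm (ltW e0)) ler_piMr// ltW.
have -> : e / (e ^+ 2 + z ^+ 2) = 0 - Fp z 0.
  by rewrite /Fp !mulr0 expR0 sin0 cos0; ring.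
by rewrite -(cvg_lim _ cv)//; apply: cvg_lim.
Unshelve. all: by end_near. Qed.


Lemma poisson1_ge0 z : 0 <= poisson1 z.
Proof. by rewrite divr_ge0// ?mulr_ge0// ltW. Qed.

Lemma measurable_poisson1 : measurable_fun setT poisson1.
Proof.
apply: continuous_measurable_fun => z; apply: cvgM; first exact: cvg_cst.
apply: cvgV; first by rewrite gt_eqF.
by apply: cvgD; [exact: cvg_cst|exact: exprn_continuous].
Qed.

Let dP (x y : R) : is_derive y 1 (fun y => 2 * atan (e^-1 * (y + x))) (poisson1 (y + x)).
Proof.
have d2 : is_derive y 1 (fun y : R => e^-1 * (y + x)) (e^-1 * (1 + 0)).
  exact: (dvZ _ (dvD (is_derive_id y 1) (is_derive_cst x y 1))).
apply: is_derive_eq (dvZ 2 (dv_comp (is_derive1_atan _) d2)) _.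
rewrite /poisson1; have := den_gt0 (y + x); set z := y + x => h.
have h' : 1 + (e^-1 * z) ^+ 2 != 0 by rewrite gt_eqF// ltr_wpDr ?sqr_ge0.
by field; rewrite ?gt_eqF//= (_ : e * e + z * z = e ^+ 2 + z ^+ 2) ?gt_eqF//; ring.
Qed.

Let cP (x : R) : continuous (fun y => poisson1 (y + x)).
Proof.
move=> y; apply: cvgM; first exact: cvg_cst.
apply: cvgV; first by rewrite gt_eqF.
apply: cvgD; first exact: cvg_cst.
apply: (@continuous_comp _ _ _ (fun y => y + x) (fun y => y ^+ 2)); last exact: exprn_continuous.
by apply: cvgD => //; exact: cvg_cst.
Qed.

Let int_poisson_half : (\int[mu1]_(z in `[0%R, +oo[) (poisson1 z)%:E = pi%:E)%E.
Proof.
have E : poisson1 = (fun y => poisson1 (y + 0)) by apply/funext => y; rewrite addr0.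
rewrite (@ge0_continuous_FTC2y _ poisson1 (fun y => 2 * atan (e^-1 * (y + 0))) 0 pi).
- by rewrite addr0 mulr0 atan0 mulr0 sube0.
- by move=> x _; exact: poisson1_ge0.
- by rewrite E; apply: continuous_subspaceT; exact: cP.
- have e2 : pi = 2 * (pi / 2) :> R by field.
  rewrite e2.
  apply: cvgM; first exact: cvg_cst.
  have h : (e^-1 * (y + 0)) @[y --> +oo%R] --> +oo%R.
    apply/cvgryPge => A; near=> y; rewrite addr0 ler_pdivlMl//.
  have Z := @cvg_comp _ _ _ (fun y : R => e^-1 * (y + 0)) (@atan R) _ _ _ h (@cvgy_atan R).
  move: Z; rewrite /comp => Z.
  exact: Z.
- by move=> x _; exact: (@ex_derive _ _ _ _ _ _ _ (dP 0 x)).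
- exact: cvg_at_right_filter (dv_cont (dP 0 0)).
- by move=> x _; have := dP 0 x => h; rewrite derive1E derive_val addr0.
Unshelve. all: by end_near. Qed.

Lemma L1_poisson1 : L1 mu1 poisson1.
Proof.
have h : L1 mu1 (fun x => poisson1 x * \1_`[0%R, +oo[ x).
  apply: L1_indic => //; first exact: measurable_poisson1.
    exact: poisson1_ge0.
  by rewrite int_poisson_half ltry.
apply: (L1_even measurable_poisson1 h) => [x|x x0|x].
- by rewrite mulr_ge0// poisson1_ge0.
- by rewrite indicE mem_set/= ?in_itv/= ?x0// mulr1 ger0_norm// poisson1_ge0.
- by rewrite /poisson1 sqrrN.
Qed.

Lemma int_poisson1 : \int[mu1]_z poisson1 z = 2 * pi.
Proof.
rewrite /Rintegral ge0_symfun_integralT.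
- by rewrite -set_itvcy int_poisson_half.
- exact: poisson1_ge0.
- have E : poisson1 = (fun y => poisson1 (y + 0)) by apply/funext => y; rewrite addr0.
  by rewrite E; exact: cP.
- by move=> x; rewrite /poisson1/= sqrrN.
Qed.

Lemma L1_box (f : R -> R) a b : L1 mu1 f -> L1 mu1 (fun y => \1_`]a, b] y * f y).
Proof.
move=> Lf; have mf := L1_meas Lf; apply: L1_dom Lf => [|y].
  exact: measurable_funM.
by rewrite normrM indicE; case: (_ \in _); rewrite ?normr1 ?mul1r// normr0 mul0r.
Qed.

Lemma L1_poisson_shift x : L1 mu1 (fun y => poisson1 (x - y)).
Proof.
have := mp_L1 (mp_shift1 (- x)) L1_poisson1.
apply: eq_integrable => // y _ /=; congr EFin.
by rewrite /poisson1 -opprB sqrrN.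
Qed.

Lemma int_poisson_box x a b : a < b ->
  \int[mu1]_y (\1_`]a, b] y * poisson1 (x - y)) =
  2 * atan (e^-1 * (b - x)) - 2 * atan (e^-1 * (a - x)).
Proof.
move=> ab; rewrite /Rintegral.
have -> : (\int[mu1]_y (\1_`]a, b] y * poisson1 (x - y))%:E =
    \int[mu1]_(y in `]a, b]) (poisson1 (y - x))%:E)%E.
  rewrite [RHS]integral_mkcond; apply: eq_integral => y _.
  rewrite patchE indicE; case: ifPn => _; rewrite ?mul0r// mul1r.
  by rewrite /poisson1 -opprB sqrrN.
rewrite integral_itv_obnd_cbnd//; last first.
  apply/measurable_EFinP/measurable_funTS.
  by apply: (measurableT_comp measurable_poisson1); exact: measurable_funB.
by rewrite (ftc ab (dP (- x)))//; exact: cP.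
Qed.

Definition abel2 (xi : R * R) : R := abel1 xi.1 * abel1 xi.2.
Definition poisson2 (z : R * R) : R := poisson1 z.1 * poisson1 z.2.

Lemma L1_abel2 : L1 mu abel2.
Proof. exact: L1_prod L1_abel1 L1_abel1. Qed.

Lemma L1_poisson2 : L1 mu poisson2.
Proof. exact: L1_prod L1_poisson1 L1_poisson1. Qed.

Lemma int_poisson2 : \int[mu]_z `|poisson2 z| = (2 * pi) ^+ 2.
Proof.
have -> : (fun z => `|poisson2 z|) = poisson2.
  by apply/funext => z; rewrite ger0_norm// mulr_ge0// poisson1_ge0.
by rewrite (Rint_prod L1_poisson1 L1_poisson1) int_poisson1 expr2.
Qed.

Lemma abel2_ge0 xi : 0 <= abel2 xi.
Proof. by rewrite mulr_ge0// abel1_ge0. Qed.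

Lemma abel2_le1 xi : abel2 xi <= 1.
Proof. by rewrite mulr_ile1// ?abel1_ge0// abel1_le1. Qed.

(** From [cas a * cas b = cos (a - b) + sin (a + b)]: the second term, specific to the Hartley
    kernel, integrates to 0 against the even factor [abel2], and so does the product of sines
    contained in [cos (a - b)]. *)
Lemma abel_kernel (x y : R * R) :
  \int[mu]_xi (cas (dot xi x) * cas (dot xi y) * abel2 xi) = poisson2 (x - y).
Proof.
have C z := L1_cos_abel z; have S z := L1_sin_abel z.
have E (xi : R * R) : cas (dot xi x) * cas (dot xi y) * abel2 xi =
  (cos ((x.1 - y.1) * xi.1) * abel1 xi.1) * (cos ((x.2 - y.2) * xi.2) * abel1 xi.2)
  - (sin ((x.1 - y.1) * xi.1) * abel1 xi.1) * (sin ((x.2 - y.2) * xi.2) * abel1 xi.2)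
  + ((sin ((x.1 + y.1) * xi.1) * abel1 xi.1) * (cos ((x.2 + y.2) * xi.2) * abel1 xi.2)
  + (cos ((x.1 + y.1) * xi.1) * abel1 xi.1) * (sin ((x.2 + y.2) * xi.2) * abel1 xi.2)).
  have cc (a b : R) : cas a * cas b = cos (a - b) + sin (a + b).
    by rewrite /cas cosB sinD; ring.
  rewrite cc.
  have -> : dot xi x - dot xi y = (x.1 - y.1) * xi.1 + (x.2 - y.2) * xi.2.
    by rewrite /dot; ring.
  have -> : dot xi x + dot xi y = (x.1 + y.1) * xi.1 + (x.2 + y.2) * xi.2.
    by rewrite /dot; ring.
  by rewrite cosD sinD /abel2; ring.
under eq_Rintegral do rewrite E.
rewrite RintegralD//; last 2 first.
- exact: (L1B (L1_prod (C _) (C _)) (L1_prod (S _) (S _))).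
- exact: (L1D (L1_prod (S _) (C _)) (L1_prod (C _) (S _))).
rewrite RintegralB//; [|exact: (L1_prod (C _) (C _))|exact: (L1_prod (S _) (S _))].
rewrite RintegralD//; [|exact: (L1_prod (S _) (C _))|exact: (L1_prod (C _) (S _))].
rewrite (Rint_prod (C _) (C _)) (Rint_prod (S _) (S _)) (Rint_prod (S _) (C _)) (Rint_prod (C _) (S _)).
rewrite !int_sin_abel.
have ic z : \int[mu1]_t (cos (z * t) * abel1 t) = poisson1 z.
  have h1 : L1 mu1 (fun t => cos (z * t) * abel1 t * \1_`[0%R, +oo[ t).
    apply: L1_dom (C z) => [|t].
      by apply: measurable_funM => //; exact: (L1_meas (C z)).
    by rewrite normrM ler_piMr// indicE; case: (_ \in _); rewrite ?normr1 ?normr0.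
  have h2 := mp_L1 mp_opp1 h1.
  have := half z => hz.
  have hz' := mp_Rintegral mp_opp1 (L1_meas h1).
  (* Both half-lines contain 0, where the two indicators add up to 2; hence equality only almost
     everywhere. *)
  transitivity (\int[mu1]_t ((cos (z * t) * abel1 t * \1_`[0%R, +oo[ t) +
     (cos (z * - t) * abel1 (- t) * \1_`[0%R, +oo[ (- t)))).
    rewrite /Rintegral; congr fine; apply: ae_eq_integral => //.
    - by apply/measurable_EFinP; exact: (L1_meas (C z)).
    - by apply/measurable_EFinP; exact: (L1_meas (L1D h1 h2)).
    exists [set 0%R]; split; first exact: measurable_set1.
      exact: lebesgue_measure_set1.
    move=> t /= /not_implyP[_ ht]; apply: contrapT => t0; apply: ht; congr EFin.
    rewrite /abel1 normrN mulrN cosN -mulrDr !indicE.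
    have [tp|tn] := leP 0 t.
      rewrite mem_set/= ?in_itv/= ?tp// memNset/= ?addr0 ?mulr1//.
      rewrite in_itv/= andbT oppr_ge0 => tn; apply: t0; apply/eqP.
      by rewrite eq_le tp tn.
    rewrite memNset/= ?in_itv/= ?andbT ?leNgt ?tn//.
    by rewrite mem_set/= ?in_itv/= ?andbT ?oppr_ge0 ?(ltW tn)// add0r mulr1.
  rewrite RintegralD//; rewrite hz' hz /poisson1; field.
  by rewrite (_ : e * e + z * z = e ^+ 2 + z ^+ 2) ?gt_eqF//; ring.
by rewrite !ic /poisson2/=; ring.
Qed.


Definition smooth (g : R * R -> R) (x : R * R) : R :=
  c2pi ^+ 2 * \int[mu]_y (poisson2 (x - y) * g y).

Lemma L1_poisson2_mul x (g : P -> R) : L1 mu g ->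
  L1 mu (fun y => poisson2 (x - y) * g y).
Proof.
move=> Lg.
have := L1Z ((2 / e) ^+ 2) Lg; apply: L1_dom => [|y].
  apply: measurable_funM; last exact: (L1_meas Lg).
  have := L1_meas (mp_L1 mp_opp (mp_L1 (mp_shift x) L1_poisson2)).
  by congr (measurable_fun _ _); apply/funext => y /=; rewrite addrC.
rewrite normrM [leRHS]normrM; apply: ler_wpM2r => //; rewrite normrX.
have bd t : `|poisson1 t| <= `|2 / e|.
  rewrite ger0_norm ?poisson1_ge0// ger0_norm ?divr_ge0// ?(ltW e0)//.
  rewrite /poisson1 -!mulrA ler_wpM2l//.
  rewrite ler_pdivrMr// ler_pdivlMl// -expr2.
  by rewrite lerDl sqr_ge0.
by rewrite expr2 /poisson2 normrM ler_pM.
Qed.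

(** The factor [abel2] makes the double transform absolutely convergent, so the transform can be
    moved twice by Fubini; what remains is convolution with the normalised Poisson kernel. *)
Lemma hartley_abel (f g : P -> R) : L1 mu f -> L1 mu g ->
  \int[mu]_xi (hartley f xi * (hartley g xi * abel2 xi)) =
  \int[mu]_x (f x * smooth g x).
Proof.
move=> Lf Lg.
have mA := L1_meas L1_abel2.
have LgA : L1 mu (fun xi => hartley g xi * abel2 xi).
  pose C := c2pi * (2 * \int[mu]_x `|g x|).
  have := L1Z C L1_abel2; apply: L1_dom => [|xi].
    by apply: measurable_funM => //; exact: (measurable_hartley (L1_meas Lg)).
  rewrite normrM [leRHS]normrM; apply: ler_wpM2r => //.
  by apply: le_trans (hartley_bound xi Lg) _; rewrite -/C ler_norm.
rewrite (hartley_mult Lf LgA); apply: eq_Rintegral => x _; congr (_ * _).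
have LAx := L1_cas x L1_abel2.
have e1 : hartley (fun xi => hartley g xi * abel2 xi) x =
    c2pi * \int[mu]_xi (hartley g xi * (abel2 xi * cas (dot xi x))).
  by rewrite /hartley; congr (_ * _); apply: eq_Rintegral => xi _; rewrite mulrA.
rewrite e1 (hartley_mult Lg LAx) /smooth expr2 -mulrA; congr (_ * _).
have LyP := L1_poisson2_mul x Lg.
rewrite -RintegralZl//; apply: eq_Rintegral => y _.
rewrite /hartley (mulrC (poisson2 _)) mulrCA; congr (_ * (_ * _)).
rewrite -abel_kernel; apply: eq_Rintegral => xi _; ring.
Qed.

(** Young's inequality; the mass of [poisson2] is [(2 * pi) ^+ 2], exactly what the factor
    [c2pi ^+ 2] of [smooth] cancels. *)
Lemma smooth_form_le (f : P -> R) : L1 mu f -> L2 mu f ->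
  `|\int[mu]_x (f x * smooth f x)| <= nrm mu f ^+ 2.
Proof.
move=> Lf L2f; have mf := L1_meas Lf.
pose k (p : P * P) := poisson2 (p.1 - p.2) * f p.2 * f p.1.
have mk : measurable_fun setT k.
  apply: measurable_funM; first apply: measurable_funM.
  - exact: measurable_diff2 (L1_meas L1_poisson2).
  - exact: (measurableT_comp mf measurable_snd).
  - exact: (measurableT_comp mf measurable_fst).
have [//|Lk Y] := young_bound mk L1_poisson2 L2f L2f.
have [L1F _] := fubini_L1 Lk; rewrite int_poisson2 -expr2 in Y.
have c0 : 0 < (2 * pi : R) by rewrite mulr_gt0// pi_gt0.
have -> : \int[mu]_x (f x * smooth f x) = c2pi ^+ 2 * \int[mu]_x \int[mu]_y k (x, y).
  rewrite -RintegralZl//; apply: eq_Rintegral => x _; rewrite /smooth mulrCA; congr (_ * _).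
  rewrite -RintegralZl//; last exact: L1_poisson2_mul.
  by apply: eq_Rintegral => y _; rewrite /k/= mulrC.
rewrite normrM (ger0_norm (sqr_ge0 _)) -ler_pdivlMl ?exprn_gt0 ?c2pi_gt0//.
by rewrite /c2pi exprVn invrK.
Qed.

Lemma hartley_abel_le (f : P -> R) : L1 mu f -> L2 mu f ->
  L2 mu (fun xi => hartley f xi * Num.sqrt (abel2 xi)) /\
  nrm mu (fun xi => hartley f xi * Num.sqrt (abel2 xi)) <= nrm mu f.
Proof.
move=> Lf L2f.
have mA := L1_meas L1_abel2; have mh := measurable_hartley (L1_meas Lf).
have e1 xi : (hartley f xi * Num.sqrt (abel2 xi)) ^+ 2 = hartley f xi * (hartley f xi * abel2 xi).
  by rewrite exprMn sqr_sqrtr ?abel2_ge0// expr2 mulrA.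
have L : L2 mu (fun xi => hartley f xi * Num.sqrt (abel2 xi)).
  apply: L2P.
    apply: measurable_funM => //.
    by apply: (measurableT_comp (@continuous_measurable_fun R _ (@sqrt_continuous R))).
  rewrite (funext e1).
  pose C := c2pi * (2 * \int[mu]_x `|f x|).
  have := L1Z (C ^+ 2) L1_abel2; apply: L1_dom => [|xi].
    by do 2 apply: measurable_funM => //.
  rewrite mulrA normrM [leRHS]normrM; apply: ler_wpM2r => //.
  rewrite -expr2 !normrX.
  have h : `|hartley f xi| <= `|C| by apply: le_trans (hartley_bound xi Lf) _; rewrite -/C ler_norm.
  by rewrite lerXn2r ?nnegrE.
split => //.
rewrite -(@ler_pXn2r _ 2) ?nnegrE ?nrm_ge0// nrm_sqr /ip.
under eq_Rintegral do rewrite -expr2 e1.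
rewrite hartley_abel// (le_trans (ler_norm _))// smooth_form_le//.
Qed.

(** An explicit form, so that on rectangles the limit [e -> 0] needs only the limits of the
    arctangent. *)
Lemma smooth_rect (a b c d : R) x : a < b -> c < d ->
  smooth \1_(rect a b c d) x =
  (atan (e^-1 * (b - x.1)) - atan (e^-1 * (a - x.1))) / pi *
  ((atan (e^-1 * (d - x.2)) - atan (e^-1 * (c - x.2))) / pi).
Proof.
move=> ab cd; rewrite /smooth.
have E (y : R * R) : poisson2 (x - y) * \1_(rect a b c d) y =
   (\1_`]a, b] y.1 * poisson1 (x.1 - y.1)) * (\1_`]c, d] y.2 * poisson1 (x.2 - y.2)).
  rewrite /poisson2/= !indicE /rect in_setX; case: (_ \in _); case: (_ \in _);
    by rewrite /= ?mul1r ?mulr1 ?mul0r ?mulr0 ?mul0r.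
under eq_Rintegral do rewrite E.
rewrite (Rint_prod (L1_box a b (L1_poisson_shift x.1)) (L1_box c d (L1_poisson_shift x.2))).
rewrite !int_poisson_box// /c2pi.
have p0 := lt0r_neq0 (pi_gt0 R).
move: p0; move: (pi : R) (atan _) (atan _) (atan _) (atan _) => p u v w z p0; field.
exact: p0.
Qed.

End AbelPoisson.

Lemma Rintegral_eq0 d (T : measurableType d) (R : realType) (mu : {measure set T -> \bar R})
  (f : T -> R) : (forall x, f x = 0) -> \int[mu]_x f x = 0.
Proof.
move=> f0; rewrite (_ : f = fun=> 0); last exact/funext.
by rewrite Rintegral_cst// mul0r.
Qed.

(** * Convergence in L^2 *)

Section L2Convergence.
Context d (T : measurableType d) (R : realType) (mu : {measure set T -> \bar R}).
Implicit Types (f g h : T -> R).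

Definition cvL2 (f_ : nat -> T -> R) f : Prop := nrm mu (fun x => f_ n x - f x) @[n --> \oo] --> 0.

Lemma cvL2P (f_ : nat -> T -> R) f : cvL2 f_ f <-> forall e, 0 < e -> exists N, forall n, (N <= n)%N ->
     nrm mu (fun x => f_ n x - f x) <= e.
Proof.
split=> [/cvgrPdist_le h e e0|h].
  have [N _ H] := h e e0; exists N => n Nn; have := H n Nn.
  by rewrite sub0r normrN ger0_norm// nrm_ge0.
apply/cvgrPdist_le => e e0; have [N H] := h e e0; exists N => // n /= Nn.
by rewrite sub0r normrN ger0_norm ?nrm_ge0// H.
Qed.

Lemma cvL2_cst f : cvL2 (fun=> f) f.
Proof.
rewrite /cvL2; have -> : (fun x => f x - f x) = (fun=> 0) by apply/funext => x; rewrite subrr.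
by rewrite nrm0; exact: cvg_cst.
Qed.

Lemma cvL2_le (f_ : nat -> T -> R) f (u : nat -> R) : u @ \oo --> 0 ->
  (forall n, nrm mu (fun x => f_ n x - f x) <= u n) -> cvL2 f_ f.
Proof.
move=> u0 fu; apply: squeeze_cvgr (cvg_cst 0) u0.
by apply: nearW => n; rewrite nrm_ge0 fu.
Qed.

Lemma cvL2B (f_ : nat -> T -> R) f (g_ : nat -> T -> R) g : (forall n, L2 mu (f_ n)) -> L2 mu f ->
  (forall n, L2 mu (g_ n)) -> L2 mu g -> cvL2 f_ f -> cvL2 g_ g ->
  cvL2 (fun n x => f_ n x - g_ n x) (fun x => f x - g x).
Proof.
move=> Lf_ Lf Lg_ Lg cf cg.
apply: (@cvL2_le _ _ (fun n => nrm mu (fun x => f_ n x - f x) + nrm mu (fun x => g_ n x - g x))).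
  by rewrite -(addr0 0); exact: cvgD.
move=> n; have := nrmB (L2B (Lf_ n) Lf) (L2B (Lg_ n) Lg).
by apply: le_trans; rewrite le_eqVlt; apply/orP; left; apply/eqP; congr nrm; apply/funext => x; ring.
Qed.

Lemma cvL2_nrm (f_ : nat -> T -> R) f : (forall n, L2 mu (f_ n)) -> L2 mu f -> cvL2 f_ f ->
  nrm mu (f_ n) @[n --> \oo] --> nrm mu f.
Proof.
move=> Lf_ Lf /cvL2P cf; apply/cvgrPdist_le => e e0; have [N H] := cf e e0.
exists N => // n /= Nn; apply: le_trans (H n Nn).
have h1 : nrm mu f <= nrm mu (f_ n) + nrm mu (fun x => f_ n x - f x).
  rewrite (nrm_distC _ (f_ n)); have := nrmD (Lf_ n) (L2B Lf (Lf_ n)).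
  by apply: le_trans; rewrite le_eqVlt; apply/orP; left; apply/eqP; congr nrm; apply/funext => x; ring.
have h2 : nrm mu (f_ n) <= nrm mu f + nrm mu (fun x => f_ n x - f x).
  have := nrmD Lf (L2B (Lf_ n) Lf).
  by apply: le_trans; rewrite le_eqVlt; apply/orP; left; apply/eqP; congr nrm; apply/funext => x; ring.
by rewrite ler_norml; apply/andP; split; lra.
Qed.

Lemma cvL2_unique (f_ : nat -> T -> R) f g : (forall n, L2 mu (f_ n)) -> L2 mu f -> L2 mu g ->
  cvL2 f_ f -> cvL2 f_ g -> {ae mu, forall x, f x = g x}.
Proof.
move=> Lf_ Lf Lg cf cg.
have : nrm mu (fun x => f x - g x) = 0.
  have := cvL2B Lf_ Lf Lf_ Lg cf cg => /cvL2_nrm h.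
  have := h (fun n => L2B (Lf_ n) (Lf_ n)) (L2B Lf Lg).
  have -> : (fun n => nrm mu (fun x => f_ n x - f_ n x)) = (fun=> 0).
    apply/funext => n; rewrite -[RHS](nrm0 mu); congr nrm.
    by apply/funext => x; rewrite subrr.
  move=> h0; apply: etrans (esym (cvg_lim (@Rhausdorff R) h0)) _.
  exact: lim_cst.
move=> /(nrm0_ae (L2B Lf Lg)); apply: filterS => x /eqP.
by rewrite subr_eq0 => /eqP.
Qed.

Lemma cvL2_ip (f_ : nat -> T -> R) f (g_ : nat -> T -> R) g : (forall n, L2 mu (f_ n)) -> L2 mu f ->
  (forall n, L2 mu (g_ n)) -> L2 mu g -> cvL2 f_ f -> cvL2 g_ g ->
  ip mu (f_ n) (g_ n) @[n --> \oo] --> ip mu f g.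
Proof.
move=> Lf_ Lf Lg_ Lg cf cg.
pose b n := nrm mu (fun x => f_ n x - f x) * nrm mu (g_ n) +
            nrm mu f * nrm mu (fun x => g_ n x - g x).
have b0 : b @ \oo --> 0.
  have -> : 0 = 0 * nrm mu g + nrm mu f * 0 :> R by rewrite mul0r mulr0 addr0.
  apply: cvgD; first by apply: cvgM => //; exact: cvL2_nrm.
  by apply: cvgM => //; exact: cvg_cst.
apply/cvgrPdist_le => e e0; move/cvgrPdist_le : b0 => /(_ e e0)[N _ H].
exists N => // n /= Nn; apply: le_trans (H n Nn); rewrite sub0r normrN.
apply: le_trans (ler_norm _); rewrite distrC.
have -> : ip mu (f_ n) (g_ n) - ip mu f g =
  ip mu (fun x => f_ n x - f x) (g_ n) + ip mu f (fun x => g_ n x - g x).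
  by rewrite ipBl// ipBr//; ring.
by apply: le_trans (ler_normD _ _) _; apply: lerD; apply: cauchy_schwarz_abs => //; exact: L2B.
Qed.

Lemma cvL2_complete (f_ : nat -> T -> R) : (forall n, L2 mu (f_ n)) ->
  (forall e, 0 < e -> exists N, forall m n, (N <= m)%N -> (N <= n)%N ->
     nrm mu (fun x => f_ m x - f_ n x) <= e) -> exists f, L2 mu f /\ cvL2 f_ f.
Proof. by move=> Lf c; have [f [Lf' /cvL2P h]] := L2_complete Lf c; exists f. Qed.

Lemma cvL2_cauchy (f_ : nat -> T -> R) f : (forall n, L2 mu (f_ n)) -> L2 mu f -> cvL2 f_ f ->
  forall e, 0 < e -> exists N, forall m n, (N <= m)%N -> (N <= n)%N ->
     nrm mu (fun x => f_ m x - f_ n x) <= e.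
Proof.
move=> Lf_ Lf /cvL2P cf e e0; have [|N H] := cf (e / 2); first by rewrite divr_gt0.
exists N => m n Nm Nn; apply: le_trans (nrm_triangle (Lf_ m) Lf (Lf_ n)) _.
by rewrite (splitr e) lerD ?H// nrm_distC H.
Qed.

End L2Convergence.

Lemma cvg_seq_comp (R : realType) (h : R -> R) (u : nat -> R) l : {for l, continuous h} ->
  u n @[n --> \oo] --> l -> h (u n) @[n --> \oo] --> h l.
Proof. by move=> ch cu; exact: (@cvg_comp _ _ _ u h _ _ _ cu ch). Qed.

(** * Bessel's inequality and Parseval on rectangles *)

Section Plancherel.
Context {R : realType}.
Local Notation P := (plane R).
Local Notation mu1 := (@lebesgue_measure R).
Local Notation mu := (@lebesgue_measure R \x @lebesgue_measure R)%E.

Let eps n : R := n.+1%:R^-1.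
Let eps0 n : 0 < eps n. Proof. by rewrite invr_gt0. Qed.
Let eps_cvg : eps @ \oo --> 0. Proof. exact: cvg_harmonic. Qed.

Let abel_cvg (xi : R * R) : abel2 (eps n) xi @[n --> \oo] --> (1 : R).
Proof.
have h (t : R) : abel1 (eps n) t @[n --> \oo] --> (1 : R).
  rewrite -expR0; apply: cvg_seq_comp; first exact: continuous_expR.
  rewrite -(mul0r `|t|) -oppr0; apply: cvgM; last exact: cvg_cst.
  exact: cvgN.
by rewrite -(mulr1 1); exact: cvgM.
Qed.

(** Fatou as the Abel parameter tends to 0. This gives an inequality; equality of the norms is
    deduced from inversion, in [hart_isom]. *)
Lemma bessel (f : P -> R) : L1 mu f -> L2 mu f ->
  L2 mu (hartley f) /\ nrm mu (hartley f) <= nrm mu f.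
Proof.
move=> Lf L2f.
apply: (@nrm_fatou _ P R mu (fun n xi => hartley f xi * Num.sqrt (abel2 (eps n) xi)) (hartley f)).
- by move=> n; case: (hartley_abel_le (eps0 n) Lf L2f).
- by move=> n; case: (hartley_abel_le (eps0 n) Lf L2f).
- exact: (measurable_hartley (L1_meas Lf)).
- apply: aeW => xi; rewrite -[X in _ --> X]mulr1; apply: cvgM; first exact: cvg_cst.
  rewrite -[X in _ --> X]sqrtr1; apply: cvg_seq_comp; first exact: sqrt_continuous.
  exact: abel_cvg.
Qed.

Lemma rectE a b c d (z : R * R) : \1_(rect a b c d) z = \1_`]a, b] z.1 * \1_`]c, d] z.2 :> R.
Proof. by rewrite !indicE /rect in_setX; case: (_ \in _); case: (_ \in _); rewrite /= ?mulr1 ?mulr0. Qed.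

Lemma L1_rect a b c d : L1 mu (\1_(rect a b c d) : P -> R).
Proof.
have h (x y : R) : L1 mu1 (\1_`]x, y] : R -> R) by exact: integrable_indic_itv.
have := L1_prod (h a b) (h c d).
by apply: eq_integrable => // z _; rewrite /= rectE.
Qed.

Lemma L2_rect a b c d : L2 mu (\1_(rect a b c d) : P -> R).
Proof.
apply: L2P; first exact: measurable_indic (measurable_rect _ _ _ _).
have := L1_rect a b c d; apply: eq_integrable => // z _; rewrite /= indicE.
by case: (_ \in _); rewrite ?expr1n ?expr0n.
Qed.

Let atan_step a b x : x != a -> x != b -> a < b ->
  (atan ((eps n)^-1 * (b - x)) - atan ((eps n)^-1 * (a - x))) / pi @[n --> \oo] -->
  (\1_`]a, b] x : R).
Proof.
move=> xa xb ab.
have hp (t : R) : 0 < t -> atan ((eps n)^-1 * t) @[n --> \oo] --> pi / 2.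
  move=> t0; have h : (eps n)^-1 * t @[n --> \oo] --> +oo%R.
    apply/cvgryPge => A; near=> n; rewrite /eps invrK -ler_pdivrMr//.
    rewrite (le_trans (ler_norm _))// (le_trans (ltW (truncnS_gt _)))// ler_nat ltnS.
    by near: n; exact: nbhs_infty_ge.
  have Z := @cvg_comp _ _ _ (fun n => (eps n)^-1 * t) (@atan R) _ _ _ h (@cvgy_atan R).
  by move: Z; rewrite /comp => Z; exact: Z.
have hn (t : R) : t < 0 -> atan ((eps n)^-1 * t) @[n --> \oo] --> - (pi / 2).
  move=> t0; have : 0 < - t by rewrite oppr_gt0.
  move=> /hp h; rewrite (_ : (fun n => _) = (fun n => - atan ((eps n)^-1 * - t))).
    exact: cvgN.
  by apply/funext => n; rewrite mulrN atanN opprK.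
have p0 := pi_gt0 R.
have E (u : R) : 0 < u -> pi / 2 - - (pi / 2) = pi :> R by move=> _; field.
rewrite indicE.
have [lt1|ge1] := ltP x a.
  have -> : (x \in `]a, b]%classic) = false.
    by apply: memNset; rewrite /= in_itv/= ltNge (ltW lt1).
  rewrite (_ : false%:R = (pi / 2 - pi / 2) / pi :> R); last by rewrite subrr mul0r.
  apply: cvgM; last exact: cvg_cst.
  by apply: cvgB; apply: hp; rewrite subr_gt0// (lt_trans lt1).
have ax : a < x by rewrite lt_neqAle eq_sym xa.
have [lt2|ge2] := ltP x b.
  have -> : (x \in `]a, b]%classic) = true.
    by apply: mem_set; rewrite /= in_itv/= ax ltW.
  rewrite (_ : true%:R = (pi / 2 - - (pi / 2)) / pi :> R); last by rewrite (E 1)// mulfV ?gt_eqF.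
  apply: cvgM; last exact: cvg_cst.
  by apply: cvgB; [apply: hp; rewrite subr_gt0|apply: hn; rewrite subr_lt0].
have bx : b < x by rewrite lt_neqAle eq_sym xb.
have -> : (x \in `]a, b]%classic) = false.
  by apply: memNset; rewrite /= in_itv/= ax leNgt bx.
rewrite (_ : false%:R = (- (pi / 2) - - (pi / 2)) / pi :> R); last by rewrite subrr mul0r.
apply: cvgM; last exact: cvg_cst.
by apply: cvgB; apply: hn; rewrite subr_lt0.
Unshelve. all: by end_near. Qed.

Let atan_bound (u v : R) : `|(atan u - atan v) / pi| <= 1.
Proof.
have p0 := pi_gt0 R.
have pV : 0 <= (pi : R)^-1 by rewrite invr_ge0 ltW.
rewrite normrM (ger0_norm pV) ler_pdivrMr// mul1r.
have := atan_gtNpi2 u; have := atan_ltpi2 u; have := atan_gtNpi2 v; have := atan_ltpi2 v.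
by move=> ? ? ? ?; rewrite ler_norml; apply/andP; split; lra.
Qed.

Lemma ae_off_lines (a b : R * R) :
  {ae mu, forall z : P, [/\ z.1 != a.1, z.2 != a.2, z.1 != b.1 & z.2 != b.2]}.
Proof.
have h (c : R * R) : {ae mu, forall z : P, z.1 != c.1 /\ z.2 != c.2}.
  have := mp_ae (mp_shift (- c)) ae_off_axes; apply: filterS => z /=.
  by rewrite !subr_eq0.
by apply: filterS2 (h a) (h b) => z [? ?] [? ?]; split.
Qed.

(** The Abel parameter tends to 0 in [hartley_abel]: the frequency side is dominated thanks to
    [bessel], and the space side is explicit by [smooth_rect] and bounded by the modulus of [f]. *)
Lemma hartley_rect (f : P -> R) a b c d : L1 mu f -> L2 mu f -> a < b -> c < d ->
  ip mu (hartley f) (hartley \1_(rect a b c d)) = ip mu f \1_(rect a b c d).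
Proof.
move=> Lf L2f ab cd.
pose Q : P -> R := \1_(rect a b c d); rewrite -/Q.
have LQ : L1 mu Q := L1_rect a b c d; have L2Q : L2 mu Q := L2_rect a b c d.
have [Lh _] := bessel Lf L2f; have [LhQ _] := bessel LQ L2Q.
have Lhh := L2_mul Lh LhQ.
have [|||||_ c1] := @real_dct _ _ _ mu (fun n xi => hartley f xi * (hartley Q xi * abel2 (eps n) xi))
   (fun xi => hartley f xi * hartley Q xi) (fun xi => `|hartley f xi * hartley Q xi|).
- move=> n; apply: measurable_funM; first exact: (L2_meas Lh).
  by apply: measurable_funM; [exact: (L2_meas LhQ)|exact: (L1_meas (L1_abel2 (eps0 n)))].
- exact: (L1_meas Lhh).
- apply: aeW => xi; apply: cvgM; first exact: cvg_cst.
  by rewrite -[X in _ --> X]mulr1; apply: cvgM; [exact: cvg_cst|exact: abel_cvg].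
- exact: L1_abs Lhh.
- move=> n xi; rewrite mulrA normrM ler_piMr// ger0_norm ?abel2_le1 ?abel2_ge0//.
have sm n x : smooth (eps n) Q x =
   (atan ((eps n)^-1 * (b - x.1)) - atan ((eps n)^-1 * (a - x.1))) / pi *
   ((atan ((eps n)^-1 * (d - x.2)) - atan ((eps n)^-1 * (c - x.2))) / pi).
  exact: smooth_rect.
have mat (u : R) n : measurable_fun setT (fun x : R => atan ((eps n)^-1 * (u - x))).
  apply: (measurableT_comp (@continuous_measurable_fun R _ (@continuous_atan R))).
  by apply: measurable_funM => //; exact: measurable_funB.
have ms n : measurable_fun setT (fun x : P => smooth (eps n) Q x).
  rewrite (funext (sm n)); apply: measurable_funM; apply: measurable_funM => //.
    by apply: measurable_funB; apply: (measurableT_comp (mat _ n) measurable_fst).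
  by apply: measurable_funB; apply: (measurableT_comp (mat _ n) measurable_snd).
have [|||||_ c2] := @real_dct _ _ _ mu (fun n x => f x * smooth (eps n) Q x)
   (fun x => f x * Q x) (fun x => `|f x|).
- by move=> n; apply: measurable_funM => //; exact: (L1_meas Lf).
- by apply: measurable_funM; [exact: (L1_meas Lf)|exact: (L1_meas LQ)].
- apply: filterS (ae_off_lines (a, c) (b, d)) => x [/= xa xc xb xd].
  apply: cvgM; first exact: cvg_cst.
  rewrite (funext (fun n => sm n x)) /Q rectE.
  by apply: cvgM; exact: atan_step.
- exact: L1_abs.
- move=> n x; rewrite normrM ler_piMr// sm normrM mulr_ile1//.
have E n : \int[mu]_xi (hartley f xi * (hartley Q xi * abel2 (eps n) xi)) =
    \int[mu]_x (f x * smooth (eps n) Q x) by exact: hartley_abel.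
by rewrite (funext E) in c1; exact: (cvg_unique _ c1 c2).
Qed.

End Plancherel.

(** * The Hartley transform on L^2 *)

Section HartleyL2.
Context {R : realType}.
Local Notation P := (plane R).
Local Notation mu := (@lebesgue_measure R \x @lebesgue_measure R)%E.

Lemma rectI a b c d a' b' c' d' (z : R * R) :
  \1_(rect a b c d) z * \1_(rect a' b' c' d') z =
  \1_(rect (Num.max a a') (Num.min b b') (Num.max c c') (Num.min d d')) z :> R.
Proof.
have h (u v u' v' x : R) : \1_`]u, v] x * \1_`]u', v'] x = \1_`](Num.max u u'), (Num.min v v')] x :> R.
  rewrite !indicE -natrM mulnb; congr (_%:R); congr nat_of_bool.
  apply/idP/idP; rewrite ?inE/= !in_itv/= gt_max le_min.
    move=> /andP[]; rewrite !inE/= !in_itv/= => /andP[-> ->] /andP[-> ->].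
    by [].
  move=> /andP[/andP[h1 h2] /andP[h3 h4]].
  by rewrite !mem_set//= in_itv/= ?h1 ?h2 ?h3 ?h4.
by rewrite !rectE mulrACA !h.
Qed.

(** [h] need not be integrable, so it is first multiplied by the indicators of growing boxes; a
    rectangle intersected with a box is again a rectangle. *)
Lemma rect_test_L2 (h : P -> R) : L2 mu h ->
  (forall a b c d, a < b -> c < d -> ip mu h \1_(rect a b c d) = 0) ->
  {ae mu, forall z, h z = 0}.
Proof.
move=> Lh h0.
pose B n : P -> R := \1_(rect (- n%:R) n%:R (- n%:R) n%:R).
have Hn n : {ae mu, forall z, h z * B n z = 0}.
  have LhB : L1 mu (fun z => h z * B n z) := L2_mul Lh (L2_rect _ _ _ _).
  apply: (rect_test LhB) => a b c d ab cd.
  under eq_Rintegral do rewrite -mulrA rectI.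
  set a' := Num.max _ _; set b' := Num.min _ _; set c' := Num.max _ _; set d' := Num.min _ _.
  have [ab'|ab'] := ltP a' b'; last first.
    apply: Rintegral_eq0 => z; rewrite rectE indicE memNset ?mul0r ?mulr0//.
    rewrite /= in_itv/= => /andP[h1 h2].
    by move: (lt_le_trans h1 (le_trans h2 ab')); rewrite ltxx.
  have [cd'|cd'] := ltP c' d'; last first.
    apply: Rintegral_eq0 => z; rewrite rectE [X in _ * (_ * X)]indicE memNset ?mulr0//.
    rewrite /= in_itv/= => /andP[h1 h2].
    by move: (lt_le_trans h1 (le_trans h2 cd')); rewrite ltxx.
  exact: h0.
have : {ae mu, forall z, forall n, h z * B n z = 0} by exact: ae_foralln.
apply: filterS => z Hz.
pose n := (Num.truncn (`|z.1| + `|z.2|)).+1.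
have := Hz n; rewrite /B rectE !indicE.
have hn : `|z.1| + `|z.2| < n%:R by exact: truncnS_gt.
have b1 : z.1 \in `](- n%:R), n%:R]%classic.
  rewrite mem_set//= in_itv/=; have := ler_norm z.1; have := ler_norm (- z.1).
  by rewrite normrN; have := normr_ge0 z.2; move: hn => ? ? ? ?; apply/andP; split; lra.
have b2 : z.2 \in `](- n%:R), n%:R]%classic.
  rewrite mem_set//= in_itv/=; have := ler_norm z.2; have := ler_norm (- z.2).
  by rewrite normrN; have := normr_ge0 z.1; move: hn => ? ? ? ?; apply/andP; split; lra.
by rewrite b1 b2 !mulr1.
Qed.

Definition disc n : set P := [set x | dot x x <= n%:R ^+ 2].
Definition trunc (f : R * R -> R) n (x : R * R) : R := f x * \1_(disc n) x.

Lemma measurable_disc n : measurable (disc n).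
Proof.
by rewrite -[disc n]setTI; apply: measurable_fun_le => //; exact: measurable_dotd.
Qed.

Lemma L2_disc n : L2 mu (\1_(disc n) : P -> R).
Proof.
apply: L2_dom (L2_rect (- n.+1%:R) n.+1%:R (- n.+1%:R) n.+1%:R).
  exact: measurable_indic (measurable_disc n).
move=> z; rewrite rectE !indicE.
case: (boolP (z \in disc n)) => [|_]; last by rewrite normr0.
rewrite inE /disc/= => zn.
have nS : (n%:R : R) < n.+1%:R by rewrite ltr_nat.
have aux (x : R) : x ^+ 2 <= n%:R ^+ 2 -> x \in `](- n.+1%:R), n.+1%:R]%classic.
  move=> xn; have : `|x| <= n%:R by rewrite -(@ler_pXn2r _ 2) ?nnegrE// real_normK ?num_real.
  rewrite ler_norml => /andP[a1 a2].
  by rewrite mem_set//= in_itv/=; apply/andP; split; lra.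
have b1 := aux z.1; have b2 := aux z.2.
rewrite b1 ?b2 ?mulr1//; apply: le_trans zn; rewrite /dot -!expr2 ?lerDl ?lerDr sqr_ge0//.
Qed.

Lemma trunc_le f n x : `|trunc f n x| <= `|f x|.
Proof.
rewrite /trunc normrM indicE; case: (_ \in _); first by rewrite normr1 mulr1.
by rewrite normr0 mulr0.
Qed.

Lemma measurable_trunc f n : measurable_fun setT (f : P -> R) ->
  measurable_fun setT (trunc f n : P -> R).
Proof.
by move=> mf; apply: measurable_funM => //; exact: measurable_indic (measurable_disc n).
Qed.

Lemma L2_trunc (f : P -> R) n : L2 mu f -> L2 mu (trunc f n).
Proof.
move=> Lf; apply: (L2_dom _ _ Lf); first exact: measurable_trunc (L2_meas Lf).
exact: trunc_le.
Qed.

Lemma L1_trunc (f : P -> R) n : L2 mu f -> L1 mu (trunc f n).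
Proof. by move=> Lf; exact: L2_mul Lf (L2_disc n). Qed.

Lemma trunc_near (f : R * R -> R) x : trunc f n x @[n --> \oo] --> f x.
Proof.
apply: cvg_near_cst; near=> n; rewrite /trunc indicE mem_set ?mulr1// /disc/=.
have := dot_ge0 x; set t := dot x x => t0.
have tn : t + 1 <= n%:R.
  apply: le_trans (ltW (truncnS_gt (t + 1))) _; rewrite ler_nat.
  by near: n; exact: nbhs_infty_ge.
by rewrite (le_trans _ (lerXn2r 2 _ _ tn)) ?nnegrE ?expr2//; nra.
Unshelve. all: by end_near. Qed.

Lemma cvL2_trunc (f : P -> R) : L2 mu f -> cvL2 mu (trunc f) f.
Proof.
move=> Lf; have mf := L2_meas Lf.
have mt n : measurable_fun setT (fun x : P => trunc f n x - f x).
  by apply: measurable_funB => //; exact: measurable_trunc.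
have [|||||_ c] := @real_dct _ _ _ mu (fun n x => (trunc f n x - f x) ^+ 2) (fun=> 0)
   (fun x => f x ^+ 2).
- by move=> n; exact: measurable_funX.
- exact: measurable_cst.
- apply: aeW => x; rewrite (_ : 0 = (f x - f x) ^+ 2); last by rewrite subrr expr0n.
  have h : trunc f n x - f x @[n --> \oo] --> f x - f x.
    by apply: cvgB; [exact: trunc_near|exact: cvg_cst].
  by rewrite expr2; under eq_fun do rewrite expr2; exact: cvgM.
- exact: L2_sqr.
- move=> n x; rewrite ger0_norm ?sqr_ge0// /trunc indicE; case: (_ \in _).
    by rewrite mulr1 subrr expr0n sqr_ge0.
  by rewrite mulr0 sub0r sqrrN.
move: c; rewrite Rintegral_cst// mul0r => c.
rewrite /cvL2 -[X in _ --> X](@sqrtr0 R).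
have := cvg_seq_comp (@sqrt_continuous R 0) c; apply: cvg_trans; apply: near_eq_cvg.
apply: nearW => n; rewrite /nrm /ip; congr Num.sqrt; apply: eq_Rintegral => x _.
Qed.

(** The truncations to balls are those of [is_fourier], so that the two transforms can be compared
    term by term. *)
Definition is_hart (f F : R * R -> R) : Prop :=
  L2 mu (F : P -> R) /\ cvL2 mu (fun n => hartley (trunc f n)) F.

Lemma L2_hartley_trunc (f : P -> R) n : L2 mu f -> L2 mu (hartley (trunc f n)).
Proof. by move=> Lf; case: (bessel (L1_trunc n Lf) (L2_trunc n Lf)). Qed.

Lemma nrm_hartleyB (f g : P -> R) : L1 mu f -> L2 mu f -> L1 mu g -> L2 mu g ->
  nrm mu (fun x => hartley f x - hartley g x) <= nrm mu (fun x => f x - g x).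
Proof.
move=> L1f L2f L1g L2g; case: (bessel (L1B L1f L1g) (L2B L2f L2g)) => _.
by apply: le_trans; rewrite le_eqVlt; apply/orP; left; apply/eqP; congr nrm;
  apply/funext => x; rewrite hartleyB.
Qed.

(** Bessel applied to differences of truncations makes their transforms a Cauchy sequence. *)
Lemma hart_ex (f : P -> R) : L2 mu f -> exists F, is_hart f F.
Proof.
move=> Lf.
have [n|e e0|F [LF cF]] := @cvL2_complete _ _ _ mu (fun n => hartley (trunc f n)).
- exact: L2_hartley_trunc.
- have [N H] := cvL2_cauchy (fun n => L2_trunc n Lf) Lf (cvL2_trunc Lf) e0.
  exists N => m n Nm Nn; apply: le_trans (H m n Nm Nn).
  by apply: nrm_hartleyB; try exact: L1_trunc; exact: L2_trunc.
by exists F.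
Qed.

Lemma hart_nrm_le (f F : P -> R) : L2 mu f -> is_hart f F -> nrm mu F <= nrm mu f.
Proof.
move=> Lf [LF cF].
have c1 := cvL2_nrm (fun n => L2_hartley_trunc n Lf) LF cF.
have c2 := cvL2_nrm (fun n => L2_trunc n Lf) Lf (cvL2_trunc Lf).
apply: (ler_cvg_to c1 c2); apply: nearW => n.
by case: (bessel (L1_trunc n Lf) (L2_trunc n Lf)).
Qed.

Lemma hart_L1 (f : P -> R) : L1 mu f -> L2 mu f -> is_hart f (hartley f).
Proof.
move=> L1f L2f; split; first by case: (bessel L1f L2f).
apply: (cvL2_le (u := fun n => nrm mu (fun x => trunc f n x - f x))).
  exact: cvL2_trunc.
by move=> n; apply: nrm_hartleyB => //; [exact: L1_trunc|exact: L2_trunc].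
Qed.

Lemma hart_unique (f F F' : P -> R) : L2 mu f -> is_hart f F -> is_hart f F' ->
  {ae mu, forall x, F x = F' x}.
Proof.
move=> Lf [LF cF] [LF' cF'].
exact: (cvL2_unique (fun n => L2_hartley_trunc n Lf) LF LF' cF cF').
Qed.

Lemma hart_ae (f F F' : P -> R) : L2 mu f -> is_hart f F -> L2 mu F' ->
  {ae mu, forall x, F x = F' x} -> is_hart f F'.
Proof.
move=> Lf [LF cF] LF' FF; split => //; rewrite /cvL2.
rewrite (_ : (fun n => _) = (fun n => nrm mu (fun x => hartley (trunc f n) x - F x)))//.
apply/funext => n; apply/esym/ae_eq_nrm.
- by apply: filterS FF => x ->.
- exact: L2_meas (L2B (L2_hartley_trunc n Lf) LF).
- exact: L2_meas (L2B (L2_hartley_trunc n Lf) LF').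
Qed.

Lemma hart_sym (f F g G : P -> R) : L2 mu f -> L2 mu g -> is_hart f F -> is_hart g G ->
  ip mu F g = ip mu f G.
Proof.
move=> Lf Lg [LF cF] [LG cG].
have c1 := cvL2_ip (fun n => L2_hartley_trunc n Lf) LF (fun n => L2_trunc n Lg) Lg cF (cvL2_trunc Lg).
have c2 := cvL2_ip (fun n => L2_trunc n Lf) Lf (fun n => L2_hartley_trunc n Lg) LG (cvL2_trunc Lf) cG.
have E n : ip mu (hartley (trunc f n)) (trunc g n) = ip mu (trunc f n) (hartley (trunc g n)).
  by apply: hartley_mult; exact: L1_trunc.
by rewrite (funext E) in c1; exact: (cvg_unique _ c1 c2).
Qed.

Lemma hart_ip_rect (f F : P -> R) a b c d : L2 mu f -> is_hart f F -> a < b -> c < d ->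
  ip mu F (hartley \1_(rect a b c d)) = ip mu f \1_(rect a b c d).
Proof.
move=> Lf [LF cF] ab cd.
have LQ := L2_rect a b c d; have [LhQ _] := bessel (L1_rect a b c d) LQ.
have c1 := cvL2_ip (fun n => L2_hartley_trunc n Lf) LF (fun=> LhQ) LhQ cF (cvL2_cst _ _).
have c2 := cvL2_ip (fun n => L2_trunc n Lf) Lf (fun=> LQ) LQ (cvL2_trunc Lf) (cvL2_cst _ _).
have E n := hartley_rect (L1_trunc n Lf) (L2_trunc n Lf) ab cd.
by rewrite (funext E) in c1; exact: (cvg_unique _ c1 c2).
Qed.

(** Tested on a rectangle [Q], the transform of [F] pairs as [F] does with the transform of [Q], by
    symmetry, and this equals the pairing of [f] with [Q], by Parseval on rectangles. *)
Lemma hart_inv (f F : P -> R) : L2 mu f -> is_hart f F -> is_hart F f.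
Proof.
move=> Lf hF; have LF : L2 mu F by case: hF.
have [FF0 hFF0] := hart_ex LF; pose FF : P -> R := FF0.
have hFF : is_hart F FF := hFF0; have LFF : L2 mu FF by case: hFF.
apply: (hart_ae LF hFF Lf).
suff : {ae mu, forall x, FF x - f x = 0}.
  by move=> h; apply: filterS h => x /eqP; rewrite subr_eq0 => /eqP.
apply: rect_test_L2; first exact: L2B.
move=> a b c d ab cd; have LQ := L2_rect a b c d.
rewrite ipBl// -(hart_ip_rect Lf hF ab cd).
have hQ := hart_L1 (L1_rect a b c d) LQ.
by rewrite (hart_sym LF LQ hFF hQ) subrr.
Qed.

(** Bessel in both directions, thanks to inversion. *)
Lemma hart_isom (f F : P -> R) : L2 mu f -> is_hart f F -> nrm mu F = nrm mu f.
Proof.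
move=> Lf hF; apply/eqP; rewrite eq_le (hart_nrm_le Lf hF)/=.
by apply: hart_nrm_le; [case: hF|exact: hart_inv].
Qed.

Lemma hartB (f F g G : P -> R) : L2 mu f -> L2 mu g -> is_hart f F -> is_hart g G ->
  is_hart (fun x => f x - g x) (fun x => F x - G x).
Proof.
move=> Lf Lg [LF cF] [LG cG]; split; first exact: L2B.
have := cvL2B (fun n => L2_hartley_trunc n Lf) LF (fun n => L2_hartley_trunc n Lg) LG cF cG.
rewrite (_ : (fun n => hartley (trunc (fun x => f x - g x) n)) =
  (fun n x => hartley (trunc f n) x - hartley (trunc g n) x))//.
apply/funext => n; apply/funext => x.
rewrite -(hartleyB x (L1_trunc n Lf) (L1_trunc n Lg)).
by congr (hartley _ _); apply/funext => y; rewrite /trunc mulrBl.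
Qed.

Lemma hart_hartley (G : P -> R) : L1 mu G -> L2 mu G ->
  L2 mu (hartley G) /\ is_hart (hartley G) G.
Proof.
move=> L1G L2G; split; first by case: (bessel L1G L2G).
exact: hart_inv L2G (hart_L1 L1G L2G).
Qed.

Lemma hart_pointwise (f F : P -> R) : L2 mu f -> is_hart f F -> L1 mu F ->
  {ae mu, forall x, f x = hartley F x}.
Proof.
move=> Lf hF L1F; have LF : L2 mu F by case: hF.
exact: hart_unique LF (hart_inv Lf hF) (hart_L1 L1F LF).
Qed.

End HartleyL2.

(** * Weights and the transported bilinear form *)

Section Weights.
Context {R : realType}.
Implicit Types (W : R -> R) (a b : R) (p : nat).

(* Weights growing at least linearly and at most like the p-th power. *)
Definition weight p W : Prop :=
  [/\ measurable_fun setT W, forall a, 1 <= a -> 0 < W a,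
      forall a b, 1 <= a -> a <= b -> W a * b <= W b * a &
      forall a b, 1 <= a -> a <= b -> W b * a ^+ p <= W a * b ^+ p].

Lemma weight_nd p W a b : weight p W -> 1 <= a -> a <= b -> W a <= W b.
Proof.
move=> [_ W0 W1 _] a1 ab; have := W1 _ _ a1 ab; have := W0 _ a1 => h1 h2.
have a0 : 0 < a by apply: lt_le_trans a1.
rewrite -(ler_pM2r a0); apply: le_trans h2.
by rewrite ler_pM2l.
Qed.

Lemma weight_double p W a b : weight p W -> 1 <= a -> 1 <= b -> b <= 2 * a ->
  W b <= 2 ^+ p * W a.
Proof.
move=> Ww a1 b1 ba; have [_ W0 _ W2] := Ww.
have a0 : 0 < a by apply: lt_le_trans a1.
apply: le_trans (weight_nd Ww b1 ba) _.
have h : a <= 2 * a by lra.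
have := W2 _ _ a1 h; rewrite exprMn mulrA ler_pM2r ?exprn_gt0//.
by rewrite (mulrC (W a)).
Qed.

Lemma bernoulli p (x : R) : 0 <= x <= 1 -> 1 - p%:R * x <= (1 - x) ^+ p.
Proof.
move=> /andP[x0 x1]; elim: p => [|p IH]; first by rewrite mul0r subr0 expr0.
rewrite exprS; have x1' : 0 <= 1 - x by lra.
apply: le_trans (ler_wpM2l x1' IH); rewrite -natr1.
by have : 0 <= p%:R :> R by []; move: p%:R => q q0; nra.
Qed.

(** Replaces the mean value theorem, as the weights in use include minima and need not be
    differentiable: growth at most like the [p]-th power gives W(a) / W(b) >= (a / b)^p, and
    [bernoulli] linearises this. *)
Lemma weight_diff p W a b : weight p W -> 1 <= a -> a <= b ->
  W b - W a <= p%:R * (b - a) * (W b / b).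
Proof.
move=> [_ W0 _ W2] a1 ab.
have a0 : 0 < a by apply: lt_le_trans a1.
have b0 : 0 < b by apply: lt_le_trans ab.
have Wb0 : 0 < W b by apply: W0; apply: le_trans ab.
have h := W2 _ _ a1 ab.
have B : 1 - p%:R * ((b - a) / b) <= (a / b) ^+ p.
  have e : a / b = 1 - (b - a) / b by field; rewrite gt_eqF.
  rewrite e; apply: bernoulli; rewrite divr_ge0 ?subr_ge0 ?(ltW b0)//= ler_pdivrMr// mul1r; lra.
have h2 : W b * (a / b) ^+ p <= W a.
  by rewrite expr_div_n mulrA ler_pdivrMr ?exprn_gt0.
have := ler_wpM2l (ltW Wb0) B => h3.
have -> : p%:R * (b - a) * (W b / b) = W b * (p%:R * ((b - a) / b)).
  by field; rewrite gt_eqF.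
by have := le_trans h3 h2; rewrite mulrBr mulr1; lra.
Qed.

Lemma weight_pow p (r : R) : 1 <= r -> r <= p%:R -> weight p (fun a => a `^ r).
Proof.
move=> r1 rp; split.
- exact: measurable_powR.
- by move=> a a1; rewrite powR_gt0// (lt_le_trans _ a1).
- move=> a b a1 ab; have a0 : 0 < a by apply: lt_le_trans a1.
  have b0 : 0 < b by apply: lt_le_trans ab.
  have e x : 0 < x -> x `^ r = x `^ (r - 1) * x.
    by move=> x0; rewrite mulrC mulr_powRB1 ?(ltW x0)//; lra.
  rewrite (e a)// (e b)// -!mulrA (mulrC b) ler_pM2r ?mulr_gt0//.
  by apply: ge0_ler_powR; rewrite ?nnegrE ?subr_ge0// ltW.
- move=> a b a1 ab; have a0 : 0 < a by apply: lt_le_trans a1.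
  have b0 : 0 < b by apply: lt_le_trans ab.
  have e x : 0 < x -> x ^+ p = x `^ r * x `^ (p%:R - r).
    by move=> x0; rewrite -powRD ?(gt_eqF x0) ?implybT// subrKC powR_mulrn// ltW.
  rewrite (e a)// (e b)// mulrCA ler_pM2l ?powR_gt0// ler_pM2l ?powR_gt0//.
  by apply: ge0_ler_powR; rewrite ?nnegrE ?subr_ge0// ltW.
Qed.

(** Stability under minima provides the capped weights used for compactness and for the a priori
    bound. *)
Lemma weight_min p W V : weight p W -> weight p V -> weight p (fun a => Num.min (W a) (V a)).
Proof.
move=> [mW W0 W1 W2] [mV V0 V1 V2]; split.
- exact: measurable_minr.
- by move=> a a1; rewrite lt_min W0// V0.
- move=> a b a1 ab; have a0 : 0 < a by apply: lt_le_trans a1.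
  have b0 : 0 < b by apply: lt_le_trans ab.
  have := W1 _ _ a1 ab; have := V1 _ _ a1 ab.
  rewrite !minr_pMl ?(ltW a0) ?(ltW b0)// le_min !ge_min => -> ->.
  by rewrite orbT.
- move=> a b a1 ab; have a0 : 0 < a ^+ p by rewrite exprn_gt0// (lt_le_trans _ a1).
  have b0 : 0 < b ^+ p by rewrite exprn_gt0// (lt_le_trans _ (le_trans a1 ab)).
  have := W2 _ _ a1 ab; have := V2 _ _ a1 ab.
  rewrite !minr_pMl ?(ltW a0) ?(ltW b0)// le_min !ge_min => -> ->.
  by rewrite orbT.
Qed.

Lemma weightZ p W c : 0 < c -> weight p W -> weight p (fun a => c * W a).
Proof.
move=> c0 [mW W0 W1 W2]; split.
- exact: measurable_funM.
- by move=> a a1; rewrite mulr_gt0// W0.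
- by move=> a b a1 ab; rewrite -!mulrA ler_pM2l// W1.
- by move=> a b a1 ab; rewrite -!mulrA ler_pM2l// W2.
Qed.

End Weights.

(** * Commutators and sums of weights *)

Section Brackets.
Context {R : realType}.
Local Notation P := (plane R).
Implicit Types (z x y : R * R) (W : R -> R).

Lemma jbN z : jb ((- z) : R * R) = jb z.
Proof. by rewrite /jb dotNl dotNr opprK. Qed.

Lemma radN z : rad ((- z) : R * R) = rad z.
Proof. by rewrite /rad dotNl dotNr opprK. Qed.

Lemma rad_le_jb z : rad z <= jb z.
Proof. by rewrite /rad /jb ler_wsqrtr// lerDr. Qed.

Lemma dot_le_rad x y : dot x y <= rad x * rad y.
Proof.
rewrite /rad -sqrtrM ?dot_ge0// (le_trans (ler_norm _))// -sqrtr_sqr ler_wsqrtr//.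
rewrite /dot; move: x.1 x.2 y.1 y.2 => a b c d.
by have := sqr_ge0 (a * d - b * c); rewrite !expr2; nra.
Qed.

Lemma jb_triangle x y : jb (x + y) <= rad x + jb y.
Proof.
have j0 := ltW (jb_gt0 y).
rewrite -(@ler_pXn2r _ 2) ?nnegrE ?addr_ge0 ?rad_ge0 ?(ltW (jb_gt0 _))// sqrrD !jb_sqr rad_sqr.
have -> : dot (x + y) (x + y) = dot x x + dot x y *+ 2 + dot y y.
  by rewrite /dot/= mulr2n; ring.
have h : dot x y <= rad x * jb y.
  by apply: le_trans (dot_le_rad x y) _; rewrite ler_wpM2l ?rad_ge0// rad_le_jb.
by rewrite !mulr2n; lra.
Qed.

Lemma jb_sum x y : jb (x + y) <= jb x + jb y.
Proof. by apply: le_trans (jb_triangle x y) _; rewrite lerD2r rad_le_jb. Qed.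

Lemma jb_dist x y : `|jb x - jb y| <= rad (x - y).
Proof.
rewrite ler_norml; apply/andP; split.
  have := jb_triangle (y - x) x; rewrite subrK -(radN (y - x)) opprB; lra.
have := jb_triangle (x - y) y; rewrite subrK; lra.
Qed.

(** W(a) / a is nondecreasing and doubling, and the larger of <x> and <y> is at most twice the
    larger of <y> and <x - y>; the difference of the brackets is at most |x - y|. *)
Lemma weight_comm p W x y : weight p W ->
  `|W (jb x) - W (jb y)| <= p%:R * 2 ^+ p * rad (x - y) *
     (W (jb y) / jb y + W (jb (x - y)) / jb (x - y)).
Proof.
move=> Ww; have [_ W0 W1 _] := Ww.
set z := x - y; have xE : x = z + y by rewrite /z subrK.
have j1 := @jb_ge1 R; have j0 := @jb_gt0 R.
pose q a := W a / a.
have q0 a : 1 <= a -> 0 <= q a.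
  by move=> a1; rewrite divr_ge0 ?(ltW (W0 _ a1))// (le_trans ler01).
have qnd a b : 1 <= a -> a <= b -> q a <= q b.
  move=> a1 ab; have a0 : 0 < a by apply: lt_le_trans a1.
  have b0 : 0 < b by apply: lt_le_trans ab.
  by rewrite /q ler_pdivrMr// mulrAC ler_pdivlMr// W1.
have qd m : 1 <= m -> q (2 * m) <= 2 ^+ p * q m.
  move=> m1; have m0 : 0 < m by apply: lt_le_trans m1.
  have m2 : 1 <= 2 * m by lra.
  have := weight_double Ww m1 m2 (lexx _) => h.
  rewrite /q mulrA ler_pdivrMr ?mulr_gt0//.
  have -> : 2 ^+ p * W m / m * (2 * m) = 2 * (2 ^+ p * W m) by field; rewrite gt_eqF.
  by have := W0 _ m2; have := W0 _ m1; lra.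
have key a b M : 1 <= a -> 1 <= b -> M = Num.max a b ->
    `|W a - W b| <= p%:R * `|a - b| * q M.
  move=> a1 b1 ->; wlog ab : a b a1 b1 / a <= b.
    move=> H; case/orP: (le_total a b) => [|ba]; first exact: H.
    by rewrite distrC (distrC a) maxC; apply: H.
  rewrite max_r// (distrC (W a)) (distrC a) !ger0_norm ?subr_ge0 ?(weight_nd Ww)//.
  exact: weight_diff.
have := key (jb x) (jb y) _ (j1 _) (j1 _) erefl.
set M := Num.max _ _ => h; apply: le_trans h _.
pose m := Num.max (jb z) (jb y).
have m1 : 1 <= m by rewrite le_max j1.
have M1 : 1 <= M by rewrite le_max j1.
have Mm : M <= 2 * m.
  have zm : jb z <= m by rewrite le_max lexx.
  have ym : jb y <= m by rewrite le_max lexx orbT.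
  by rewrite ge_max xE (le_trans (jb_sum z y)) ?(le_trans ym)//=; lra.
have qM : q M <= 2 ^+ p * (q (jb y) + q (jb z)).
  apply: le_trans (qnd _ _ M1 Mm) _; apply: le_trans (qd _ m1) _.
  rewrite ler_pM2l ?exprn_gt0//.
  rewrite /m; case: (leP (jb z) (jb y)) => _; [rewrite lerDl|rewrite lerDr]; exact: q0.
rewrite -/(q (jb y)) -/(q (jb z)) -!mulrA ler_wpM2l//.
rewrite (mulrCA (2 ^+ p)) ler_pM ?q0//.
exact: jb_dist.
Qed.

(** For |x - y| < 1 the brackets of [x] and [y] are comparable and one term suffices. The indicator
    matters because [kern] bounds the symbol by a power of <z>, without the singular part of [lam],
    only for |z| >= 1. *)
Lemma weight_sum p W x y : weight p W ->
  W (jb x) <= 2 ^+ p * (W (jb y) + ((1 <= rad (x - y))%R)%:R * W (jb (x - y))).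
Proof.
move=> Ww; have [_ W0 _ _] := Ww; have j1 := @jb_ge1 R.
set z := x - y; have xE : x = z + y by rewrite /z subrK.
have [r1|r1] := leP 1 (rad z).
  rewrite mul1r mulrDr.
  have [zy|/ltW yz] := leP (jb z) (jb y).
    apply: (@le_trans _ _ (2 ^+ p * W (jb y))).
      by apply: weight_double Ww _ _ _ => //; rewrite {1}xE (le_trans (jb_sum z y))//; lra.
    by rewrite lerDl mulr_ge0 ?exprn_ge0// ltW// W0.
  apply: (@le_trans _ _ (2 ^+ p * W (jb z))).
    by apply: weight_double Ww _ _ _ => //; rewrite {1}xE (le_trans (jb_sum z y))//; lra.
  by rewrite lerDr mulr_ge0 ?exprn_ge0// ltW// W0.
rewrite mul0r addr0; apply: weight_double Ww _ _ _ => //.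
by rewrite {1}xE (le_trans (jb_triangle z y))//; have := j1 y; lra.
Qed.

End Brackets.

(** * Convolution estimates *)

Section Convolution.
Context {R : realType}.
Local Notation P := (plane R).
Local Notation mu := (@lebesgue_measure R \x @lebesgue_measure R)%E.

Lemma Rint_E (f : P -> R) : L1 mu f -> (\int[mu]_x f x)%:E = (\int[mu]_x (f x)%:E)%E.
Proof. by move=> Lf; rewrite /Rintegral fineK//; exact: (integrable_fin_num measurableT Lf). Qed.

Lemma L2_sqr_le (f g : P -> R) : measurable_fun setT f -> L1 mu g ->
  (forall x, 0 <= g x) -> {ae mu, forall x, f x ^+ 2 <= g x} ->
  L2 mu f /\ nrm mu f ^+ 2 <= \int[mu]_x g x.
Proof.
move=> mf Lg g0 fg.
have H : (\int[mu]_x (f x ^+ 2)%:E <= (\int[mu]_x g x)%:E)%E.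
  rewrite Rint_E//; apply: ae_ge0_le_integral => //.
  - by move=> x _; rewrite lee_fin sqr_ge0.
  - by apply/measurable_EFinP; exact: measurable_funX.
  - by move=> x _; rewrite lee_fin.
  - by apply/measurable_EFinP; exact: (L1_meas Lg).
  - by apply: filterS fg => x fg _; rewrite lee_fin.
have Lf : L2 mu f by split => //; apply: le_lt_trans H _; rewrite ltry.
by split => //; rewrite -lee_fin nrm_sqrE.
Qed.

Lemma ae_section (k : P * P -> R) : L1P2 k ->
  {ae mu, forall x : P, L1 mu (fun y => k (x, y))}.
Proof.
move=> [mk ik].
have mA : measurable_fun setT (fun p => `|k p|%:E).
  by apply/measurable_EFinP; exact: measurableT_comp.
have mF := measurable_tonelliP mA (fun p => (normr_ge0 _ : (0 <= `|k p|%:E)%E)).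
have iF : mu.-integrable setT (fun x => \int[mu]_y `|k (x, y)|%:E)%E.
  apply/integrableP; split => //; apply: le_lt_trans ik.
  apply: ge0_le_integral => //; first exact: measurableT_comp.
  by move=> x _; rewrite gee0_abs// integral_ge0.
have := integrable_ae measurableT iF; apply: filterS => x /(_ I) xfin.
apply/L1P; first exact: measurable_slice1.
by rewrite ltey_eq xfin.
Qed.

Lemma mp_refl_shift (a : R * R) : measure_preserving mu ((fun x => a - x) : P -> P).
Proof.
have [m1 h1] := mp_opp (R := R); have [m2 h2] := mp_shift a.
have e : (fun x : P => a - x) = (fun x : P => x + a) \o (fun x : P => - x).
  by apply/funext => x /=; rewrite addrC.
split; first by rewrite e; exact: measurableT_comp.
move=> A mA; rewrite e comp_preimage h1 ?h2//.
by rewrite -[X in measurable X]setTI; exact: m2.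
Qed.

Lemma young_L1 (a g : P -> R) : L1 mu a -> L1 mu g ->
  L1P2 (fun p => a (p.1 - p.2) * g p.2) /\
  \int[mu]_x \int[mu]_y (a (x - y) * g y) = (\int[mu]_z a z) * \int[mu]_z g z.
Proof.
move=> La Lg; have ma := L1_meas La; have mg := L1_meas Lg.
pose k (p : P * P) := a (p.1 - p.2) * g p.2.
have mk : measurable_fun setT k.
  apply: measurable_funM; first exact: measurable_diff2.
  exact: (measurableT_comp mg measurable_snd).
have sh y : L1 mu (fun x => a (x - y)) := mp_L1 (mp_shift (- y)) La.
have Lk : L1P2 k.
  split => //; rewrite (@tonelliP _ (fun p => `|k p|%:E))//; last first.
    by apply/measurable_EFinP; exact: measurableT_comp.
  rewrite (_ : (fun y => _) = (fun y => (\int[mu]_z `|a z|)%:E * `|g y|%:E)%E).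
    rewrite ge0_integralZl ?lee_fin ?Rintegral_ge0//.
      by rewrite -Rint_E ?ltry//; exact: L1_abs.
    by apply/measurable_EFinP; exact: measurableT_comp.
  apply/funext => y; under eq_integral => x _ do rewrite /k/= normrM EFinM.
  rewrite ge0_integralZr//; last first.
    by apply/measurable_EFinP; apply: measurableT_comp => //; exact: (L1_meas (sh y)).
  rewrite Rint_E; last exact: L1_abs.
  rewrite -(mp_ge0_integral (mp_shift (- y)) (f := fun z => `|a z|%:E))//.
  by apply/measurable_EFinP; exact: measurableT_comp.
split => //; rewrite (fubini_swap Lk).
rewrite (_ : (fun y => _) = (fun y => (\int[mu]_z a z) * g y)).
  by rewrite RintegralZl.
apply/funext => y; transitivity ((\int[mu]_x a (x - y)) * g y).
  by rewrite /k/= (RintegralZr (g y) measurableT (sh y)).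
by rewrite (mp_Rintegral (mp_shift (- y)) ma).
Qed.

(** Writing the modulus of [a] as the product of two square roots, Cauchy-Schwarz bounds the square
    of the integral by the mass of [a] times the convolution of that modulus with [b ^+ 2], which
    [young_L1] integrates. *)
Lemma conv_L2 (a b : P -> R) : L1 mu a -> L2 mu b ->
  [/\ {ae mu, forall x : P, L1 mu (fun y => a (x - y) * b y)},
      L2 mu (fun x => \int[mu]_y `|a (x - y) * b y|) &
      nrm mu (fun x => \int[mu]_y `|a (x - y) * b y|) <= (\int[mu]_z `|a z|) * nrm mu b].
Proof.
move=> La Lb; have mb := L2_meas Lb; have ma := L1_meas La.
have [Lk ik] := young_L1 (L1_abs La) (L2_sqr Lb).
have [LI _] := fubini_L1 Lk.
pose A := \int[mu]_z `|a z|.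
have A0 : 0 <= A by apply: Rintegral_ge0.
have mf : measurable_fun setT (fun x : P => \int[mu]_y `|a (x - y) * b y|).
  apply: (@measurable_Rint _ (fun p => `|a (p.1 - p.2) * b p.2|)).
  apply: measurableT_comp => //; apply: measurable_funM; first exact: measurable_diff2.
  exact: (measurableT_comp mb measurable_snd).
have key : {ae mu, forall x : P, L1 mu (fun y => a (x - y) * b y) /\
    (\int[mu]_y `|a (x - y) * b y|) ^+ 2 <= A * \int[mu]_y (`|a (x - y)| * b y ^+ 2)}.
  have := ae_section Lk; apply: filterS => x /= Lx.
  have Lax := mp_L1 (mp_refl_shift x) La; have max := L1_meas Lax.
  have mS : measurable_fun setT (fun y : P => Num.sqrt `|a (x - y)|).
    apply: measurableT_comp; first exact: (@continuous_measurable_fun R _ (@sqrt_continuous R)).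
    exact: measurableT_comp.
  have LS : L2 mu (fun y : P => Num.sqrt `|a (x - y)|).
    apply: L2P => //; rewrite (_ : (fun y => _) = (fun y => `|a (x - y)|)).
      exact: L1_abs.
    by apply/funext => y; rewrite sqr_sqrtr.
  have LSb : L2 mu (fun y : P => Num.sqrt `|a (x - y)| * `|b y|).
    apply: L2P; first by apply: measurable_funM => //; exact: measurableT_comp.
    rewrite (_ : (fun y => _) = (fun y => `|a (x - y)| * b y ^+ 2))//.
    by apply/funext => y; rewrite exprMn sqr_sqrtr// real_normK// num_real.
  have e y : Num.sqrt `|a (x - y)| * (Num.sqrt `|a (x - y)| * `|b y|) = `|a (x - y) * b y|.
    by rewrite mulrA -expr2 sqr_sqrtr// normrM.
  have Lp := L2_mul LS LSb.
  rewrite (_ : (fun y => _) = (fun y => `|a (x - y) * b y|)) in Lp; last by apply/funext => y; rewrite e.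
  split.
    apply: (L1_dom _ _ Lp); last by move=> y; rewrite normr_id.
    exact: measurable_funM.
  have := cauchy_schwarz LS LSb; rewrite /ip.
  rewrite (_ : (fun y => _) = (fun y => `|a (x - y) * b y|)); last by apply/funext => y; rewrite e.
  move=> cs; have i0 : 0 <= \int[mu]_y `|a (x - y) * b y| by apply: Rintegral_ge0.
  have := lerXn2r 2 i0 (mulr_ge0 (nrm_ge0 _ _) (nrm_ge0 _ _)) cs.
  have nS : nrm mu (fun y : P => Num.sqrt `|a (x - y)|) ^+ 2 = A.
    rewrite nrm_sqr /ip /A; transitivity (\int[mu]_y `|a (x - y)|).
      by apply: eq_Rintegral => y _; rewrite -expr2 sqr_sqrtr.
    rewrite (mp_Rintegral (mp_refl_shift x) (f := fun z => `|a z|))//.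
    exact: measurableT_comp.
  have nSb : nrm mu (fun y : P => Num.sqrt `|a (x - y)| * `|b y|) ^+ 2 =
      \int[mu]_y (`|a (x - y)| * b y ^+ 2).
    rewrite nrm_sqr /ip; apply: eq_Rintegral => y _.
    by rewrite -expr2 exprMn sqr_sqrtr// real_normK// num_real.
  by rewrite exprMn nS nSb.
have [Lf nf] := L2_sqr_le mf (L1Z A LI) (fun x => mulr_ge0 A0
   (Rintegral_ge0 _ (fun y _ => mulr_ge0 (normr_ge0 _) (sqr_ge0 _)))) (filterS (fun x => @proj2 _ _) key).
split => //; first exact: filterS (fun x => @proj1 _ _) key.
rewrite -(@ler_pXn2r _ 2) ?nnegrE ?mulr_ge0 ?nrm_ge0// (le_trans nf)//.
by rewrite RintegralZl// ik mulrA -expr2 exprMn nrm_sqr /ip.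
Qed.

Lemma L2_dom_ae (f g : P -> R) : measurable_fun setT f -> L2 mu g ->
  {ae mu, forall x, `|f x| <= `|g x|} -> L2 mu f /\ nrm mu f <= nrm mu g.
Proof.
move=> mf Lg fg.
have fg2 : {ae mu, forall x, f x ^+ 2 <= g x ^+ 2}.
  apply: filterS fg => x h; rewrite -(real_normK (num_real (f x))) -(real_normK (num_real (g x))).
  by rewrite lerXn2r ?nnegrE.
have [Lf nf] := L2_sqr_le mf (L2_sqr Lg) (fun x => sqr_ge0 _) fg2.
split => //; rewrite -(@ler_pXn2r _ 2) ?nnegrE ?nrm_ge0// (le_trans nf)//.
by rewrite nrm_sqr /ip.
Qed.

(** The kernel is dominated by two convolutions, with the integrable factor at [x - y] in one and at
    [y] in the other: this is the shape obtained when a weight is distributed over a product. *)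
Lemma op_L2 (k : P * P -> R) (a b a2 b2 : P -> R) : measurable_fun setT k ->
  L1 mu a -> L2 mu b -> L2 mu a2 -> L1 mu b2 ->
  (forall x y : P, `|k (x, y)| <= `|a (x - y) * b y| + `|a2 (x - y) * b2 y|) ->
  [/\ {ae mu, forall x : P, L1 mu (fun y => k (x, y))},
      L2 mu (fun x => \int[mu]_y k (x, y)) &
      nrm mu (fun x => \int[mu]_y k (x, y)) <=
        (\int[mu]_z `|a z|) * nrm mu b + nrm mu a2 * \int[mu]_z `|b2 z|].
Proof.
move=> mk La Lb La2 Lb2 kab.
have [s1 l1 n1] := conv_L2 La Lb; have [s2 l2 n2] := conv_L2 Lb2 La2.
have e x : (fun y : P => a2 (x - y) * b2 y) = (fun z => b2 (x - z) * a2 z) \o (fun y : P => x - y).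
  by apply/funext => y /=; rewrite subKr mulrC.
have s2' : {ae mu, forall x : P, L1 mu (fun y => a2 (x - y) * b2 y)}.
  by apply: filterS s2 => x h; rewrite e; exact: (mp_L1 (mp_refl_shift x) h).
have i2 x : \int[mu]_y `|a2 (x - y) * b2 y| = \int[mu]_y `|b2 (x - y) * a2 y|.
  rewrite -(mp_Rintegral (mp_refl_shift x) (f := fun z => `|b2 (x - z) * a2 z|)).
    by apply: eq_Rintegral => y _; rewrite subKr mulrC.
  apply: measurableT_comp => //; apply: measurable_funM; last exact: (L2_meas La2).
  exact: (L1_meas (mp_L1 (mp_refl_shift x) Lb2)).
have sk : {ae mu, forall x : P, L1 mu (fun y => k (x, y)) /\
    `|\int[mu]_y k (x, y)| <= `|\int[mu]_y `|a (x - y) * b y| + \int[mu]_y `|b2 (x - y) * a2 y| |}.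
  apply: filterS2 s1 s2' => x h1 h2.
  have h := L1D (L1_abs h1) (L1_abs h2).
  have hk : L1 mu (fun y => k (x, y)).
    apply: (L1_dom _ _ h); first exact: measurable_slice1.
    by move=> y; apply: le_trans (kab x y) _; rewrite ler_norm.
  split => //; rewrite [leRHS]ger0_norm ?addr_ge0 ?Rintegral_ge0//.
  have <- := i2 x; rewrite -RintegralD//; try exact: L1_abs.
  apply: le_trans (le_normr_Rintegral measurableT hk) _.
  by apply: le_Rintegral => //; exact: L1_abs.
have [Lk nk] := L2_dom_ae (measurable_Rint mk) (L2D l1 l2) (filterS (fun x => @proj2 _ _) sk).
split => //; first exact: filterS (fun x => @proj1 _ _) sk.
apply: le_trans nk _; apply: le_trans (nrmD l1 l2) _.
by rewrite lerD// mulrC.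
Qed.

End Convolution.

(** * The bilinear form and its energy estimate *)

Section Bilinear.
Context {R : realType}.
Local Notation P := (plane R).
Local Notation mu := (@lebesgue_measure R \x @lebesgue_measure R)%E.
Implicit Types (F G : R * R -> R) (z x y : R * R) (m : R * R -> R) (n p : nat) (W : R -> R) (A : R).

Definition wedge x y : R := x.1 * y.2 - x.2 * y.1.
Definition evp F z : R := (F z + F (- z)) / 2.
Definition odp F z : R := (F z - F (- z)) / 2.
(** An even function that dominates both parity parts and both values [F z], [F (- z)]; for even
    weights its norms are at most twice those of [F]. *)
Definition sym F z : R := `|F z| + `|F (- z)|.

(* For [F] and [G] the Hartley transforms of [f] and [g], and [m] the symbol
   of (- Delta)^(-1 + alpha), [Bop m F G] is that of - u . grad g, where
   u = grad^perp (- Delta)^(-1 + alpha) f. *)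
Definition kB m F G (q : R * R * (R * R)) : R :=
  wedge (q.1 - q.2) q.2 * m (q.1 - q.2) *
  (evp F (q.1 - q.2) * G q.2 + odp F (q.1 - q.2) * G (- q.2)).
Definition Bop m F G x : R := c2pi * \int[mu]_y kB m F G (x, y).

(* [A] controls the symbol and [n] the power of <z> it loses, as for a difference of two symbols. *)
Definition kern A n m : Prop :=
  [/\ 0 <= A, measurable_fun setT (m : P -> R), forall z, m (- z) = m z,
      forall z, rad z * `|m z| <= A * lam z &
      forall z, 1 <= rad z -> rad z * `|m z| <= A * jb z ^+ n].

Definition wL2 W F : Prop := L2 mu (fun z => W (jb z) * F z).
Definition wn W F : R := nrm mu (fun z => W (jb z) * F z).
Definition lL1 F : Prop := L1 mu (fun z => lam z * F z).
Definition ln1 F : R := \int[mu]_z `|lam z * F z|.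

Lemma wedge_le x y : `|wedge x y| <= rad x * rad y.
Proof.
rewrite /rad -sqrtrM ?dot_ge0// -sqrtr_sqr ler_wsqrtr//.
rewrite /dot /wedge; move: x.1 x.2 y.1 y.2 => a b c d.
by have := sqr_ge0 (a * c + b * d); rewrite !expr2; nra.
Qed.

Lemma sym_ge0 F z : 0 <= sym F z.
Proof. by rewrite addr_ge0. Qed.

Lemma meas_refl F : measurable_fun setT (F : P -> R) -> measurable_fun setT ((fun z => F (- z)) : P -> R).
Proof. by move=> mF; have [m _] := mp_opp (R := R); exact: (measurableT_comp mF m). Qed.

Lemma lam_ge0 z : 0 <= lam z.
Proof. by rewrite addr_ge0 ?powR_ge0// ltW// jb_gt0. Qed.

Lemma jb_le_lam z : jb z <= lam z.
Proof. by rewrite lerDl powR_ge0. Qed.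

Lemma rad_le_lam z : rad z <= lam z.
Proof. exact: le_trans (rad_le_jb z) (jb_le_lam z). Qed.

Lemma lam_ge1 z : 1 <= lam z.
Proof. exact: le_trans (jb_ge1 z) (jb_le_lam z). Qed.

Lemma lamN z : lam ((- z) : R * R) = lam z.
Proof. by rewrite /lam jbN radN. Qed.

Lemma sym_mul (w F : R * R -> R) z : (forall z, 0 <= w z) -> (forall z, w (- z) = w z) ->
  w z * sym F z = `|w z * F z| + `|w (- z) * F (- z)|.
Proof. by move=> w0 wN; rewrite mulrDr !normrM wN (ger0_norm (w0 z)). Qed.

Lemma L1_sym (w F : P -> R) : (forall z, 0 <= w z) -> (forall z, w (- z) = w z) ->
  L1 mu (fun z => w z * F z) ->
  L1 mu (fun z => w z * sym F z) /\
  \int[mu]_z `|w z * sym F z| = 2 * \int[mu]_z `|w z * F z|.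
Proof.
move=> w0 wN L; have L' := mp_L1 (mp_opp (R := R)) L.
have La := L1D (L1_abs L) (L1_abs L').
have e : (fun z : P => w z * sym F z) = (fun z => `|w z * F z| + `|w (- z) * F (- z)|).
  by apply/funext => z; rewrite sym_mul.
split; first by rewrite e.
transitivity (\int[mu]_z (`|w z * F z| + `|w (- z) * F (- z)|)).
  by apply: eq_Rintegral => z _; rewrite sym_mul// ger0_norm// addr_ge0.
rewrite RintegralD//; try exact: L1_abs.
rewrite (mp_Rintegral (mp_opp (R := R)) (f := fun z => `|w z * F z|)); first by rewrite mulrC mulr_natr mulr2n.
by apply: measurableT_comp => //; exact: (L1_meas L).
Qed.

Lemma L2_sym (w F : P -> R) : (forall z, 0 <= w z) -> (forall z, w (- z) = w z) ->
  L2 mu (fun z => w z * F z) ->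
  L2 mu (fun z => w z * sym F z) /\
  nrm mu (fun z => w z * sym F z) <= 2 * nrm mu (fun z => w z * F z).
Proof.
move=> w0 wN L; have L' := mp_L2 (mp_opp (R := R)) L.
have e : (fun z : P => w z * sym F z) = (fun z => `|w z * F z| + `|w (- z) * F (- z)|).
  by apply/funext => z; rewrite sym_mul.
rewrite e; split; first exact: L2D (L2_abs L) (L2_abs L').
apply: le_trans (nrmD (L2_abs L) (L2_abs L')) _.
by rewrite !nrm_abs (mp_nrm (mp_opp (R := R)) (L2_meas L)); lra.
Qed.

Lemma measurable_kB m F G : measurable_fun setT (m : P -> R) -> measurable_fun setT (F : P -> R) ->
  measurable_fun setT (G : P -> R) -> measurable_fun setT (kB m F G : P * P -> R).
Proof.
move=> mm mF mG; have mFN := meas_refl mF; have mGN := meas_refl mG.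
have c1 (f : P -> R) : measurable_fun setT f -> measurable_fun setT (fun q : P * P => f (q.1 - q.2)).
  exact: measurable_diff2.
have c2 (f : P -> R) : measurable_fun setT f -> measurable_fun setT (fun q : P * P => f q.2).
  by move=> mf; exact: (measurableT_comp mf measurable_snd).
have p1 : measurable_fun setT ((fun z => z.1) : P -> R) by exact: measurable_fst.
have p2 : measurable_fun setT ((fun z => z.2) : P -> R) by exact: measurable_snd.
apply: measurable_funM; first (apply: measurable_funM; last exact: c1).
  apply: measurable_funB; apply: measurable_funM; try exact: (c1 _ p1); try exact: (c1 _ p2).
    exact: (c2 _ p2).
  exact: (c2 _ p1).
apply: measurable_funD; apply: measurable_funM.
- by apply: (c1 (evp F)); apply: measurable_funM => //; exact: measurable_funD.
- exact: c2.
- by apply: (c1 (odp F)); apply: measurable_funM => //; exact: measurable_funB.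
- exact: (c2 (fun z => G (- z))).
Qed.

Lemma ev_le F z : `|evp F z| <= sym F z / 2.
Proof. by rewrite normrM (ger0_norm (_ : 0 <= 2^-1)) ?invr_ge0// ler_pM2r ?invr_gt0// ler_normD. Qed.

Lemma od_le F z : `|odp F z| <= sym F z / 2.
Proof. by rewrite normrM (ger0_norm (_ : 0 <= 2^-1)) ?invr_ge0// ler_pM2r ?invr_gt0// ler_normB. Qed.

Lemma evN F z : evp F (- z) = evp F z.
Proof. by rewrite /evp opprK addrC. Qed.

Lemma odN F z : odp F (- z) = - odp F z.
Proof. by rewrite /odp opprK -mulNr opprB. Qed.

Lemma kB_le m F G x y :
  `|kB m F G (x, y)| <= rad (x - y) * `|m (x - y)| * sym F (x - y) * (rad y * sym G y).
Proof.
rewrite /kB/= !normrM; set z := x - y.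
have h : `|evp F z * G y + odp F z * G (- y)| <= sym F z * sym G y.
  apply: le_trans (ler_normD _ _) _; rewrite (normrM (evp F z)) (normrM (odp F z)) /(sym G y) mulrDr.
  have := sym_ge0 F z => s0.
  by apply: lerD; apply: ler_wpM2r => //; [apply: le_trans (ev_le _ _) _|apply: le_trans (od_le _ _) _]; lra.
rewrite (_ : _ * _ * (rad y * _) = rad z * rad y * `|m z| * (sym F z * sym G y)); last by ring.
by rewrite ler_pM ?mulr_ge0 ?rad_ge0// ler_wpM2r// wedge_le.
Qed.

Lemma Wjb_ge0 p W z : weight p W -> 0 <= W (jb z).
Proof. by move=> [_ W0 _ _]; rewrite ltW// W0// jb_ge1. Qed.

Lemma meas_Wjb p W : weight p W -> measurable_fun setT ((fun z => W (jb z)) : P -> R).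
Proof. by move=> [mW _ _ _]; apply: measurableT_comp => //; exact: measurable_jb. Qed.

(** The second factor |z|, supplied by the commutator with the weight, removes the singularity of
    the symbol at the origin, since |z| |z|^(-1/2) <= 1 in the unit disc. *)
Lemma kern_rad2 A m z : kern A 0 m -> rad z * (rad z * `|m z|) <= 2 * A * jb z.
Proof.
move=> [A0 _ _ k1 k2]; have r0 := rad_ge0 z; have j1 := jb_ge1 z.
have [rz|rz] := leP 1 (rad z).
  have := k2 z rz; rewrite expr0 mulr1 => h; apply: (@le_trans _ _ (rad z * A)).
    by rewrite ler_wpM2l.
  by have := rad_le_jb z; nra.
apply: (@le_trans _ _ (rad z * (A * lam z))); first by rewrite ler_wpM2l// k1.
rewrite /lam; have h : rad z * rad z `^ (- 2^-1) <= 1.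
  have [->|rn] := eqVneq (rad z) 0; first by rewrite mul0r.
  have rp : 0 < rad z by rewrite lt_def rn.
  rewrite -{1}(powRr1 r0) -powRD ?rn ?implybT//.
  rewrite [leRHS](_ : 1 = 1 `^ (1 - 2^-1)); last by rewrite powR1.
  by apply: ge0_ler_powR; rewrite ?nnegrE ?powR1//; lra.
rewrite mulrCA mulrDr; have : rad z * jb z <= jb z by nra.
by nra.
Qed.

Definition Cb p : R := c2pi * 2 ^+ p * 4.

Lemma sym_wL2 p W (v : R -> R) F : weight p W -> (forall z, 0 <= v (jb z)) ->
  wL2 W (fun z => v (jb z) * F z) ->
  L2 mu (fun z => W (jb z) * v (jb z) * sym F z) /\
  nrm mu (fun z => W (jb z) * v (jb z) * sym F z) <= 2 * wn W (fun z => v (jb z) * F z).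
Proof.
move=> Ww v0; rewrite /wn /wL2.
rewrite (_ : (fun z => _) = (fun z => W (jb z) * v (jb z) * F z)); last by apply/funext => z; rewrite mulrA.
apply: (@L2_sym (fun z => W (jb z) * v (jb z))) => [z|z]; first by rewrite mulr_ge0// (Wjb_ge0 _ Ww).
by rewrite jbN.
Qed.

(** [weight_sum] puts the weight either on [G], with [F] integrable against [lam], or on [F], with
    the roles exchanged; in the second case [F] also carries the [n] powers of <z> lost by the
    symbol. The derivative falls on [G] in both. *)
Lemma Bop_bound A n m p W F G : kern A n m -> weight p W ->
  measurable_fun setT (F : P -> R) -> measurable_fun setT (G : P -> R) ->
  lL1 F -> lL1 G -> wL2 W (fun z => jb z ^+ n * F z) -> wL2 W (fun z => jb z * G z) ->
  [/\ {ae mu, forall x : P, L1 mu (fun y => kB m F G (x, y))},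
      wL2 W (Bop m F G) &
      wn W (Bop m F G) <= Cb p * A *
        (ln1 F * wn W (fun z => jb z * G z) + wn W (fun z => jb z ^+ n * F z) * ln1 G)].
Proof.
move=> Km Ww mF mG LF LG LWF LWG.
have [A0 mm mN k1 k2] := Km; have [mW W0 _ _] := Ww.
have W0' z := Wjb_ge0 z Ww.
have j0 z : 0 <= jb z := ltW (jb_gt0 z).
have [LsF isF] := L1_sym lam_ge0 lamN LF.
have [LsG isG] := L1_sym lam_ge0 lamN LG.
have [LWsF nsF] := @sym_wL2 p W (fun a => a ^+ n) F Ww (fun z => exprn_ge0 n (j0 z)) LWF.
have [LWsG nsG] := @sym_wL2 p W id G Ww j0 LWG.
pose B := 2 ^+ p * A.
have B0 : 0 <= B by rewrite mulr_ge0// exprn_ge0.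
have mk := measurable_kB mm mF mG.
have mWk : measurable_fun setT (fun q : P * P => W (jb q.1) * kB m F G q).
  by apply: measurable_funM mk; exact: (measurableT_comp (meas_Wjb Ww) measurable_fst).
have [] := @op_L2 _ _ _ _ _ _ mWk (L1Z B LsF) LWsG (L2Z B LWsF) LsG.
  move=> x y /=; rewrite normrM (ger0_norm (W0' x)).
  set z := x - y; have := kB_le m F G x y; rewrite -/z => kb.
  have r0 := rad_ge0 y; have rz0 := rad_ge0 z; have sF := sym_ge0 F z; have sG := sym_ge0 G y.
  have n0 := normr_ge0 (m z).
  apply: le_trans (ler_wpM2l (W0' x) kb) _.
  move: kb; set Q := _ * (rad y * sym G y) => kb.
  have q0 : 0 <= Q by rewrite !mulr_ge0.
  apply: le_trans (ler_wpM2r q0 (weight_sum x y Ww)) _; rewrite -/z -(mulrA _ _ Q) mulrDl mulrDr /Q.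
  have p0 : 0 <= 2 ^+ p :> R by rewrite exprn_ge0.
  have n1 : 0 <= B * (lam z * sym F z) * (W (jb y) * jb y * sym G y) by rewrite !mulr_ge0 ?lam_ge0.
  have n2 : 0 <= B * (W (jb z) * jb z ^+ n * sym F z) * (lam y * sym G y).
    by rewrite !mulr_ge0 ?lam_ge0 ?exprn_ge0.
  rewrite (ger0_norm n1) (ger0_norm n2) /B.
  apply: lerD.
    rewrite [leRHS](_ : _ = 2 ^+ p * (W (jb y) * (A * lam z * sym F z * (jb y * sym G y)))); last by ring.
    rewrite ler_wpM2l// ler_wpM2l// ler_pM ?mulr_ge0//.
      by rewrite ler_wpM2r// k1.
    by rewrite ler_wpM2r// rad_le_jb.
  rewrite [leRHS](_ : _ = 2 ^+ p * (W (jb z) * (A * jb z ^+ n * sym F z * (lam y * sym G y)))); last by ring.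
  rewrite ler_wpM2l//; have [rz|rz] := leP 1 (rad z); last first.
    by rewrite !mul0r !mulr_ge0// ?lam_ge0// exprn_ge0.
  rewrite mul1r ler_wpM2l// ler_pM ?mulr_ge0//.
    by rewrite ler_wpM2r// k2.
  by rewrite ler_wpM2r// rad_le_lam.
move=> sec LB nB.
have sec' : {ae mu, forall x : P, L1 mu (fun y => kB m F G (x, y))}.
  apply: filterS sec => x h; have Wx : W (jb x) != 0 by rewrite gt_eqF// W0// jb_ge1.
  have := L1Z (W (jb x))^-1 h; rewrite (_ : (fun y => _) = (fun y => kB m F G (x, y)))//.
  by apply/funext => y /=; rewrite mulrA mulVf// mul1r.
have mB : measurable_fun setT (Bop m F G : P -> R).
  by apply: measurable_funM => //; exact: measurable_Rint.
have e : {ae mu, forall x : P, c2pi * \int[mu]_y (W (jb x) * kB m F G (x, y)) = W (jb x) * Bop m F G x}.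
  by apply: filterS sec' => x h; rewrite (RintegralZl _ measurableT h) mulrCA.
have mWB : measurable_fun setT (fun x : P => W (jb x) * Bop m F G x).
  by apply: measurable_funM mB; exact: meas_Wjb Ww.
have LcB := L2Z c2pi LB.
split => //; first exact: ae_eq_L2 e LcB mWB.
rewrite /wn -(ae_eq_nrm e (L2_meas LcB) mWB) nrmZ// (ger0_norm (ltW c2pi_gt0)).
apply: le_trans (ler_wpM2l (ltW c2pi_gt0) nB) _; rewrite -/(ln1 F) in isF *.
have -> : \int[mu]_z `|B * (lam z * sym F z)| = B * (2 * ln1 F).
  rewrite -isF -RintegralZl//; last exact: L1_abs.
  by apply: eq_Rintegral => z _; rewrite normrM (ger0_norm B0).
rewrite nrmZ// (ger0_norm B0) isG -/(ln1 G) /Cb -/B.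
rewrite [leRHS](_ : _ = c2pi * (B * (2 * ln1 F) * (2 * wn W (fun z => jb z * G z))
  + B * (2 * wn W (fun z => jb z ^+ n * F z)) * (2 * ln1 G))); last by rewrite /B /wn; ring.
rewrite ler_wpM2l ?(ltW c2pi_gt0)// lerD//.
  by rewrite ler_wpM2l// !mulr_ge0// Rintegral_ge0.
rewrite ler_wpM2r ?mulr_ge0 ?Rintegral_ge0//.
by rewrite ler_wpM2l.
Qed.

Lemma ae_Rint (f g : P -> R) : {ae mu, forall x, f x = g x} -> measurable_fun setT f ->
  measurable_fun setT g -> \int[mu]_x f x = \int[mu]_x g x.
Proof.
move=> fg mf mg; have m1 : measurable_fun setT (fun _ : P => (1 : R)) by exact: measurable_cst.
have e1 : {ae mu, forall x : P, (1 : R) = 1} by apply: aeW.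
have := ae_eq_ip fg e1 mf mg m1 m1; rewrite /ip.
by under eq_Rintegral do rewrite mulr1; under [in RHS]eq_Rintegral do rewrite mulr1.
Qed.

Lemma Rint2_opp (k : P * P -> R) : L1P2 k ->
  \int[mu]_x \int[mu]_y (- k (x, y)) = - \int[mu]_x \int[mu]_y k (x, y).
Proof.
move=> Lk; rewrite -mulN1r -RintegralZl//; last by case: (fubini_L1 Lk).
have mk : measurable_fun setT k by case: Lk.
apply: ae_Rint.
- by apply: filterS (ae_section Lk) => x h; rewrite -RintegralZl//; under [RHS]eq_Rintegral do rewrite mulN1r.
- apply: (@measurable_Rint _ (fun q => - k q)); exact: (measurableT_comp (@oppr_measurable R setT)).
- by apply: measurable_funM => //; exact: measurable_Rint.
Qed.

Lemma Rint2_swap0 (k : P * P -> R) : L1P2 k -> (forall x y, k (y, x) = - k (x, y)) ->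
  \int[mu]_x \int[mu]_y k (x, y) = 0.
Proof.
move=> Lk kN; have := Rint2_opp Lk.
rewrite (_ : \int[mu]_x \int[mu]_y (- k (x, y)) = \int[mu]_x \int[mu]_y k (y, x)).
  by rewrite -(fubini_swap Lk); lra.
by apply: eq_Rintegral => x _; apply: eq_Rintegral => y _; rewrite (kN x y).
Qed.

(** The symmetry for the part of the kernel that pairs [G (- y)] with [G x]: the map sending
    [(x, y)] to [(- y, - x)] keeps [x - y]. *)
Lemma Rint2_refl0 (k : P * P -> R) : L1P2 k -> (forall x y, k (- y, - x) = - k (x, y)) ->
  \int[mu]_x \int[mu]_y k (x, y) = 0.
Proof.
move=> Lk kN; have mk : measurable_fun setT k by case: Lk.
have mks := L1P2_swap Lk.
have := Rint2_opp Lk.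
rewrite (_ : \int[mu]_x \int[mu]_y (- k (x, y)) = \int[mu]_x \int[mu]_y k (y, x)).
  by rewrite -(fubini_swap Lk); lra.
have m1 : measurable_fun setT (fun x => \int[mu]_y k (y, x)).
  by apply: (@measurable_Rint _ (fun q => k (q.2, q.1))); case: mks.
rewrite -(mp_Rintegral (mp_opp (R := R)) m1).
apply: eq_Rintegral => x _.
rewrite -(mp_Rintegral (mp_opp (R := R)) (f := fun y => k (y, - x))); last exact: measurable_slice2.
by apply: eq_Rintegral => y _; rewrite kN.
Qed.

Definition wip W F G : R := ip mu (fun z => W (jb z) * F z) (fun z => W (jb z) * G z).
Definition Ce p : R := c2pi * (p%:R * 2 ^+ p * 8).

(** No derivative falls on the factor measured in the weighted norm: the |y| coming from [wedge] is
    divided by the <y> gained in [weight_comm], or else is absorbed in [lam y], on the factor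
    measured in L^1. *)
Lemma jump_bound A p W F G x y m : kern A 0 m -> weight p W ->
  `|(W (jb x) - W (jb y)) * kB m F G (x, y)| <=
  `|p%:R * 2 ^+ p * 2 * A * (lam (x - y) * sym F (x - y)) * (W (jb y) * sym G y)| +
  `|p%:R * 2 ^+ p * 2 * A * (W (jb (x - y)) * sym F (x - y)) * (lam y * sym G y)|.
Proof.
move=> Km Ww; have [A0 _ _ _ _] := Km; have W0 z := Wjb_ge0 z Ww.
rewrite normrM; set z := x - y; set B := p%:R * 2 ^+ p * 2 * A.
have B0 : 0 <= B by rewrite !mulr_ge0// exprn_ge0.
have r0 := rad_ge0 y; have rz0 := rad_ge0 z; have sF := sym_ge0 F z; have sG := sym_ge0 G y.
have l0 := lam_ge0; have jy := jb_gt0 y; have jz := jb_gt0 z.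
have n1 : 0 <= B * (lam z * sym F z) * (W (jb y) * sym G y) by rewrite !mulr_ge0.
have n2 : 0 <= B * (W (jb z) * sym F z) * (lam y * sym G y) by rewrite !mulr_ge0.
rewrite (ger0_norm n1) (ger0_norm n2).
have h1 := weight_comm x y Ww; have h2 := kB_le m F G x y; rewrite -/z in h1 h2.
have h3 := kern_rad2 z Km.
apply: le_trans (ler_pM (normr_ge0 _) (normr_ge0 _) h1 h2) _.
set c := p%:R * 2 ^+ p; have c0 : 0 <= c by rewrite mulr_ge0// exprn_ge0.
have -> : B = c * (2 * A) by rewrite /B /c; ring.
rewrite [leLHS](_ : _ = c * ((rad z * (rad z * `|m z|)) * sym F z * (W (jb y) * (rad y / jb y) * sym G y)) +
  c * ((rad z * (rad z * `|m z|) / jb z) * sym F z * W (jb z) * (rad y * sym G y))); last by rewrite /c; ring.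
have ry : rad y / jb y <= 1 by rewrite ler_pdivrMr// mul1r rad_le_jb.
have q0 : 0 <= rad z * (rad z * `|m z|) by rewrite !mulr_ge0.
have h4 : rad z * (rad z * `|m z|) <= 2 * A * lam z.
  by apply: le_trans h3 _; rewrite ler_wpM2l ?mulr_ge0// jb_le_lam.
have h5 : rad z * (rad z * `|m z|) / jb z <= 2 * A by rewrite ler_pdivrMr.
apply: lerD.
  rewrite [leRHS](_ : _ = c * ((2 * A * lam z) * sym F z * (W (jb y) * 1 * sym G y))); last by ring.
  rewrite ler_wpM2l// ler_pM ?mulr_ge0 ?invr_ge0 ?(ltW jy)//; first by rewrite ler_wpM2r.
  by rewrite ler_wpM2r// ler_wpM2l.
rewrite [leRHS](_ : _ = c * ((2 * A) * sym F z * W (jb z) * (lam y * sym G y))); last by ring.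
rewrite ler_wpM2l// ler_pM ?mulr_ge0 ?invr_ge0 ?(ltW jz)//.
  by rewrite ler_wpM2r// ler_wpM2r.
by rewrite ler_wpM2r// rad_le_lam.
Qed.

(* Antisymmetry: [wedge (x - y) y] changes sign when x and y are exchanged, so that only the
   commutator with the weight is left. *)
Lemma Bop_energy A m p W F G : kern A 0 m -> weight p W ->
  measurable_fun setT (F : P -> R) -> measurable_fun setT (G : P -> R) ->
  lL1 F -> lL1 G -> wL2 W F -> wL2 W G -> wL2 W (fun z => jb z * G z) ->
  `|wip W (Bop m F G) G| <= Ce p * A * (ln1 F * wn W G + wn W F * ln1 G) * wn W G.
Proof.
move=> Km Ww mF mG LF LG WF WG WjG.
have [A0 mm mN k1 _] := Km; have W0 z := Wjb_ge0 z Ww.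
have mW := meas_Wjb Ww.
have j0 z : 0 <= jb z := ltW (jb_gt0 z).
have WF' : wL2 W (fun z => jb z ^+ 0 * F z).
  by move: WF; rewrite /wL2; under [X in L2 _ X]eq_fun do rewrite -(mul1r (F _)).
have [sec LB _] := Bop_bound Km Ww mF mG LF LG WF' WjG.
have [LsF isF] := L1_sym lam_ge0 lamN LF.
have [LsG isG] := L1_sym lam_ge0 lamN LG.
have WN z : W (jb ((- z) : R * R)) = W (jb z) by rewrite jbN.
have [WsF nsF] := L2_sym W0 WN WF.
have [WsG nsG] := L2_sym W0 WN WG.
have [WjsG _] := @sym_wL2 p W id G Ww j0 WjG.
pose B := p%:R * 2 ^+ p * 2 * A.
have B0 : 0 <= B by rewrite !mulr_ge0// exprn_ge0.
have mk := measurable_kB mm mF mG.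
pose c z := W (jb z) * G z.
pose kD (q : P * P) := (W (jb q.1) - W (jb q.2)) * kB m F G q.
have mkD : measurable_fun setT kD.
  apply: measurable_funM mk; apply: measurable_funB.
    exact: (measurableT_comp mW measurable_fst).
  exact: (measurableT_comp mW measurable_snd).
have [secD LD nD] := op_L2 mkD (L1Z B LsF) WsG (L2Z B WsF) LsG (fun x y => jump_bound F G x y Km Ww).
pose a1 (q : P * P) := wedge (q.1 - q.2) q.2 * m (q.1 - q.2).
(* The integrand with weight [W (jb x)] is [c x * kD] plus these two, in which the weight sits at
   [y]. [K1] is antisymmetric under the exchange of [x] and [y], [K2] under the map sending [(x, y)]
   to [(- y, - x)], so both integrate to 0. *)
pose K1 (q : P * P) := a1 q * (evp F (q.1 - q.2) * G q.2) * W (jb q.2) * c q.1.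
pose K2 (q : P * P) := a1 q * (odp F (q.1 - q.2) * G (- q.2)) * W (jb q.2) * c q.1.
have c1 (f : P -> R) : measurable_fun setT f -> measurable_fun setT (fun q : P * P => f (q.1 - q.2)).
  exact: measurable_diff2.
have c2 (f : P -> R) : measurable_fun setT f -> measurable_fun setT (fun q : P * P => f q.2).
  by move=> mf; exact: (measurableT_comp mf measurable_snd).
have c3 (f : P -> R) : measurable_fun setT f -> measurable_fun setT (fun q : P * P => f q.1).
  by move=> mf; exact: (measurableT_comp mf measurable_fst).
have p1 : measurable_fun setT ((fun z => z.1) : P -> R) by exact: measurable_fst.
have p2 : measurable_fun setT ((fun z => z.2) : P -> R) by exact: measurable_snd.
have ma1 : measurable_fun setT a1.
  apply: measurable_funM; last exact: c1.
  apply: measurable_funB; apply: measurable_funM; try exact: (c1 _ p1); try exact: (c1 _ p2).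
    exact: (c2 _ p2).
  exact: (c2 _ p1).
have mc : measurable_fun setT (c : P -> R) := L2_meas WG.
have mK1 : measurable_fun setT K1.
  apply: measurable_funM; last exact: c3.
  apply: measurable_funM; last exact: (c2 _ mW).
  apply: measurable_funM => //; apply: measurable_funM; last exact: c2.
  by apply: (c1 (evp F)); apply: measurable_funM => //; apply: measurable_funD => //; exact: meas_refl.
have mK2 : measurable_fun setT K2.
  apply: measurable_funM; last exact: c3.
  apply: measurable_funM; last exact: (c2 _ mW).
  apply: measurable_funM => //; apply: measurable_funM; last exact: (c2 _ (meas_refl mG)).
  by apply: (c1 (odp F)); apply: measurable_funM => //; apply: measurable_funB => //; exact: meas_refl.
have K_le (f : R * R -> R) (e : R) x y : `|f (x - y)| <= sym F (x - y) / 2 -> `|e| <= sym G y ->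
    `|a1 (x, y) * (f (x - y) * e) * W (jb y) * c x| <=
    `|A * (lam (x - y) * sym F (x - y)) * (W (jb y) * jb y * sym G y) * c x|.
  move=> hf he; set z := x - y in hf *; have sF := sym_ge0 F z; have sG := sym_ge0 G y.
  have n1 : 0 <= A * (lam z * sym F z) * (W (jb y) * jb y * sym G y) by rewrite !mulr_ge0 ?lam_ge0.
  rewrite (normrM _ (c x)) [leRHS]normrM (ger0_norm n1) ler_wpM2r//.
  rewrite (normrM _ (W (jb y))) (ger0_norm (W0 y)).
  rewrite [leRHS](_ : _ = (A * lam z * sym F z) * (jb y * sym G y) * W (jb y)); last by ring.
  rewrite ler_wpM2r// (normrM (a1 _)) (normrM (wedge _ _)) (normrM (f z)) -/z.
  have hw := wedge_le z y; have n2 := normr_ge0 (m z); have hk := k1 z.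
  apply: (@le_trans _ _ ((rad z * rad y * `|m z|) * (sym F z * sym G y))).
    rewrite ler_pM ?mulr_ge0//; first by rewrite ler_wpM2r.
    rewrite ler_pM//; apply: le_trans hf _.
    by rewrite ler_pdivrMr// ler_peMr// ler1n.
  rewrite [leLHS](_ : _ = (rad z * `|m z| * sym F z) * (rad y * sym G y)); last by ring.
  rewrite ler_pM ?mulr_ge0 ?rad_ge0//; first by rewrite ler_wpM2r.
  by rewrite ler_wpM2r// rad_le_jb.
(* The weighted bound on [jb z * G z] is spent here, on the absolute convergence of [K1] and [K2];
   the final estimate does not contain it. *)
have LsFA := L1Z A LsF.
have [LK1 _] := young_bound mK1 LsFA WjsG WG (fun x y => K_le (evp F) (G y) x y (ev_le F _)
   (ler_wpDr (normr_ge0 _) (lexx _))).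
have [LK2 _] := young_bound mK2 LsFA WjsG WG (fun x y => K_le (odp F) (G (- y)) x y (od_le F _)
   (ler_wpDl (normr_ge0 _) (lexx _))).
have a1s x y : a1 (y, x) = - a1 (x, y).
  by rewrite /a1 /wedge/= -(opprB x y) mN; ring.
have a1r x y : a1 (- y, - x) = - a1 (x, y).
  have e : - y - - x = x - y :> R * R by rewrite opprK addrC.
  by rewrite /a1 /wedge/= e; ring.
have Z1 : \int[mu]_x \int[mu]_y K1 (x, y) = 0.
  apply: Rint2_swap0 => // x y; rewrite /K1 a1s /c/= -(opprB x y) evN; ring.
have Z2 : \int[mu]_x \int[mu]_y K2 (x, y) = 0.
  by apply: Rint2_refl0 => // x y; rewrite /K2 a1r /c/= !opprK !jbN (addrC (- y)); ring.
have [L1 _] := fubini_L1 LK1; have [L2' _] := fubini_L1 LK2.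
have LDc := L2_mul LD WG.
have E : wip W (Bop m F G) G = c2pi * ip mu (fun x => \int[mu]_y kD (x, y)) c.
  transitivity (\int[mu]_x (c2pi * (((\int[mu]_y kD (x, y)) * c x + \int[mu]_y K1 (x, y)) + \int[mu]_y K2 (x, y)))).
    apply: ae_Rint.
    - apply: filterS2 (filterI sec secD) (filterI (ae_section LK1) (ae_section LK2)) => x [h1 h2] [h3 h4].
      have h5 := L1Z (c x) h2.
      have -> : W (jb x) * Bop m F G x * (W (jb x) * G x) = c2pi * \int[mu]_y (W (jb x) * c x * kB m F G (x, y)).
        by rewrite (RintegralZl _ measurableT h1) /c; rewrite -/(c x) mulrAC mulrCA !mulrA.
      congr (_ * _); transitivity (\int[mu]_y (c x * kD (x, y) + K1 (x, y) + K2 (x, y))).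
        by apply: eq_Rintegral => y _; rewrite /kD /K1 /K2 /a1 /kB/=; ring.
      rewrite RintegralD//; last exact: L1D.
      by rewrite RintegralD// (RintegralZl _ measurableT h2) (mulrC (c x)).
    - by apply: measurable_funM => //; exact: (L2_meas LB).
    - apply: measurable_funM => //; apply: measurable_funD; last exact: measurable_Rint.
      apply: measurable_funD; last exact: measurable_Rint.
      exact: (L1_meas LDc).
  rewrite RintegralZl//; last by apply: L1D => //; exact: L1D.
  rewrite RintegralD//; last exact: L1D.
  by rewrite RintegralD// Z1 Z2 !addr0.
rewrite E normrM (ger0_norm (ltW c2pi_gt0)).
apply: le_trans (ler_wpM2l (ltW c2pi_gt0) (cauchy_schwarz_abs LD WG)) _.
rewrite -/(wn W G) /Ce -!mulrA ler_wpM2l ?(ltW c2pi_gt0)// !mulrA ler_wpM2r ?nrm_ge0//.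
apply: le_trans nD _.
have -> : \int[mu]_z `|B * (lam z * sym F z)| = B * (2 * ln1 F).
  rewrite -isF -RintegralZl//; last exact: L1_abs.
  by apply: eq_Rintegral => z _; rewrite normrM (ger0_norm B0).
rewrite nrmZ// (ger0_norm B0) isG -/(ln1 G).
rewrite [leRHS](_ : _ = B * (2 * ln1 F) * (2 * wn W G) + B * (2 * wn W F) * (2 * ln1 G)); last by rewrite /B; ring.
rewrite lerD//; first by rewrite ler_wpM2l// !mulr_ge0// Rintegral_ge0.
rewrite ler_wpM2r ?mulr_ge0 ?Rintegral_ge0//.
by rewrite ler_wpM2l.
Qed.

End Bilinear.

(** * Sobolev estimates *)

Section Symbols.
Context {R : realType}.
Local Notation P := (plane R).
Implicit Types (z : R * R) (a alpha x : R).

Lemma fraclapN alpha z : fraclap_symbol alpha ((- z) : R * R) = fraclap_symbol alpha z.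
Proof. by rewrite /fraclap_symbol dotNl dotNr opprK. Qed.

Lemma measurable_fraclap alpha : measurable_fun setT (fraclap_symbol alpha : P -> R).
Proof. exact: measurable_radpow. Qed.

Lemma rad_fraclap alpha z : 0 < rad z -> rad z * fraclap_symbol alpha z = rad z `^ (2 * alpha - 1).
Proof.
move=> r0; rewrite /fraclap_symbol -/(rad z) -{1}(powRr1 (ltW r0)) -powRD.
  by congr (_ `^ _); lra.
by rewrite (gt_eqF r0) implybT.
Qed.

Lemma fraclap_ge0 alpha z : 0 <= fraclap_symbol alpha z.
Proof. exact: powR_ge0. Qed.

Lemma powR_anti x a b : 0 < x -> x <= 1 -> a <= b -> x `^ b <= x `^ a.
Proof.
move=> x0 x1 ab; rewrite -(subrK a b) powRD ?(gt_eqF x0) ?implybT// ger_pMl ?powR_gt0//.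
rewrite [leRHS](_ : 1 = 1 `^ (b - a)); last by rewrite powR1.
by apply: ge0_ler_powR; rewrite ?nnegrE ?subr_ge0// ltW.
Qed.

(** |z| times the symbol is |z|^(2 alpha - 1) with an exponent in [-1/4, 0], hence at most 1 for |z|
    >= 1 and at most |z|^(-1/2) in the disc. *)
Lemma kern_sy alpha : 3 / 8 <= alpha -> alpha <= 1 / 2 -> kern 1 0 (fraclap_symbol alpha).
Proof.
move=> a1 a2; split => //.
- exact: measurable_fraclap.
- exact: fraclapN.
- move=> z; rewrite ger0_norm ?fraclap_ge0// mul1r.
  have [r0|r0] := eqVneq (rad z) 0; first by rewrite r0 mul0r lam_ge0.
  have rp : 0 < rad z by rewrite lt_def r0 rad_ge0.
  rewrite rad_fraclap//; have [r1|r1] := leP 1 (rad z).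
    apply: le_trans (lam_ge1 z); rewrite -[leRHS](powRr0 (rad z)); apply: ler_powR => //; lra.
  apply: (@le_trans _ _ (rad z `^ (- 2^-1))); last by rewrite lerDr ltW// jb_gt0.
  by apply: powR_anti => //; [exact: ltW|lra].
- move=> z r1; rewrite ger0_norm ?fraclap_ge0// mul1r expr0.
  rewrite rad_fraclap ?(lt_le_trans _ r1)// -[leRHS](powRr0 (rad z)); apply: ler_powR => //; lra.
Qed.

Lemma expR_sub1 x : 0 <= x -> expR x - 1 <= x * expR x.
Proof.
move=> x0; have := expR_ge1Dx (- x); rewrite expRN => h.
have e0 := expR_gt0 x; have := ler_wpM2l (ltW e0) h.
by rewrite mulfV ?gt_eqF// mulrDr mulrN mulr1; lra.
Qed.

(** |z| times the difference has modulus | |z|^(-2 d) - 1 |. For |z| >= 1 this is at most 2 d ln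
    |z|, and the logarithm is paid by one power of <z>: this is why no logarithm of [d] appears. In
    the disc it is at most |z|^(-2 d) times 2 d times the modulus of ln |z|; as d <= 1/8, both
    |z|^(-2 d) and a quarter of that modulus are at most v = |z|^(-1/4), which gives 8 d v^2. *)
Lemma kern_diff alpha : 3 / 8 <= alpha -> alpha <= 1 / 2 ->
  kern (8 * (1 / 2 - alpha)) 1 (fun z => fraclap_symbol alpha z - fraclap_symbol (1 / 2) z).
Proof.
move=> a1 a2; pose d := 1 / 2 - alpha; rewrite -/d.
have d0 : 0 <= d by rewrite /d; lra.
have d8 : d <= 1 / 8 by rewrite /d; lra.
have key z : 0 < rad z ->
    rad z * `|fraclap_symbol alpha z - fraclap_symbol (1 / 2) z| = `|rad z `^ (- (2 * d)) - 1|.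
  move=> r0; rewrite -{1}(gtr0_norm r0) -normrM mulrBr !rad_fraclap//.
  by rewrite mulrCA mulfV// mulr1 subrr powRr0; congr `|_ `^ _ - _|; rewrite /d; lra.
have big z : 1 <= rad z -> `|rad z `^ (- (2 * d)) - 1| <= 8 * d * jb z.
  move=> r1; have r0 : 0 < rad z by exact: lt_le_trans r1.
  have le1 : rad z `^ (- (2 * d)) <= 1.
    by rewrite -[leRHS](powRr0 (rad z)); apply: ler_powR => //; lra.
  rewrite distrC ger0_norm ?subr_ge0//.
  rewrite /powR (gt_eqF r0); have := expR_ge1Dx (- (2 * d) * ln (rad z)).
  have := ln_sublinear r0; have := rad_le_jb z; nra.
split.
- by rewrite mulr_ge0.
- by apply: measurable_funB; exact: measurable_fraclap.
- by move=> z; rewrite !fraclapN.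
- move=> z; have [r0|r0] := eqVneq (rad z) 0.
    by rewrite r0 mul0r mulr_ge0 ?mulr_ge0 ?lam_ge0.
  have rp : 0 < rad z by rewrite lt_def r0 rad_ge0.
  rewrite key//; have [r1|r1] := leP 1 (rad z).
    by apply: le_trans (big z r1) _; rewrite ler_wpM2l ?mulr_ge0// jb_le_lam.
  have q0 : 1 <= rad z `^ (- (2 * d)).
    by rewrite -[leLHS](powRr0 (rad z)); apply: powR_anti => //; [exact: ltW|lra].
  rewrite ger0_norm ?subr_ge0//.
  pose v := rad z `^ (- 4^-1).
  have v0 : 0 < v by rewrite powR_gt0.
  have vv : v * v = rad z `^ (- 2^-1).
    by rewrite -powRD ?r0 ?implybT//; congr (_ `^ _); lra.
  have hv : rad z `^ (- (2 * d)) <= v by apply: powR_anti => //; [exact: ltW|lra].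
  have lv : - ln (rad z) <= 4 * v.
    have : - ln (rad z) = 4 * ln v by rewrite /v ln_powR; lra.
    by move=> ->; rewrite ler_pM2l// ltW// ln_sublinear.
  have l0 : 0 <= - ln (rad z) by rewrite oppr_ge0 ln_le0// ltW.
  have x0 : 0 <= - (2 * d) * ln (rad z) by rewrite mulNr -mulrN mulr_ge0// mulr_ge0.
  have := expR_sub1 x0.
  have -> : expR (- (2 * d) * ln (rad z)) = rad z `^ (- (2 * d)) by rewrite /powR (gt_eqF rp).
  move=> h; apply: le_trans h _.
  apply: (@le_trans _ _ (8 * d * (v * v))).
    rewrite (_ : 8 * d * (v * v) = (2 * d * (4 * v)) * v); last by ring.
    rewrite ler_pM ?powR_ge0// mulNr -mulrN ler_wpM2l// mulr_ge0//.
  by rewrite vv ler_wpM2l ?mulr_ge0// lerDr ltW// jb_gt0.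
- by move=> z r1; rewrite key ?(lt_le_trans _ r1)// expr1; exact: big.
Qed.

End Symbols.

(** * Weighted norms and frequency cuts *)

Section Norms.
Context {R : realType}.
Local Notation P := (plane R).
Local Notation mu := (@lebesgue_measure R \x @lebesgue_measure R)%E.
Implicit Types (F G : R * R -> R) (z : R * R) (m : R * R -> R) (n : nat) (W V : R -> R) (r N A : R).

Definition Hs r F : Prop := wL2 (fun a => a `^ r) F.
Definition ns r F : R := wn (fun a => a `^ r) F.

Lemma wn_ge0 W F : 0 <= wn W F. Proof. exact: nrm_ge0. Qed.

Lemma wL2_meas p W F : weight p W -> wL2 W F -> measurable_fun setT (F : P -> R).
Proof.
move=> Ww LF; have [mW W0 _ _] := Ww; have mWj := meas_Wjb Ww.
rewrite (_ : (F : P -> R) = fun z => (W (jb z))^-1 * (W (jb z) * F z)).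
  apply: measurable_funM; last exact: (L2_meas LF).
  rewrite (_ : (fun z => _) = (fun z : P => W (jb z) `^ (-1))).
    exact: (measurableT_comp (@measurable_powR R (-1)) mWj).
  by apply/funext => z; rewrite powR_inv1// (Wjb_ge0 _ Ww).
by apply/funext => z; rewrite mulrA mulVf ?mul1r// gt_eqF// W0// jb_ge1.
Qed.

Lemma wL2D W F G : wL2 W F -> wL2 W G -> wL2 W (fun z => F z + G z).
Proof. by move=> LF LG; have := L2D LF LG; rewrite /wL2; under [X in L2 _ X]eq_fun do rewrite -mulrDr. Qed.

Lemma wL2B W F G : wL2 W F -> wL2 W G -> wL2 W (fun z => F z - G z).
Proof. by move=> LF LG; have := L2B LF LG; rewrite /wL2; under [X in L2 _ X]eq_fun do rewrite -mulrBr. Qed.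

Lemma wL2Z W c F : wL2 W F -> wL2 W (fun z => c * F z).
Proof. by move=> LF; have := L2Z c LF; rewrite /wL2; under [X in L2 _ X]eq_fun do rewrite mulrCA. Qed.

Lemma wnD W F G : wL2 W F -> wL2 W G -> wn W (fun z => F z + G z) <= wn W F + wn W G.
Proof.
move=> LF LG; apply: le_trans (nrmD LF LG); rewrite /wn.
by under eq_fun do rewrite mulrDr.
Qed.

Lemma wnB W F G : wL2 W F -> wL2 W G -> wn W (fun z => F z - G z) <= wn W F + wn W G.
Proof.
move=> LF LG; apply: le_trans (nrmB LF LG); rewrite /wn.
by under eq_fun do rewrite mulrBr.
Qed.

Lemma wnBE W F G : wn W (fun z => F z - G z) =
  nrm mu (fun z => W (jb z) * F z - W (jb z) * G z).
Proof. by rewrite /wn; under eq_fun do rewrite mulrBr. Qed.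

Lemma wn_triangle W F G (H : R * R -> R) : wL2 W F -> wL2 W G -> wL2 W H ->
  wn W (fun z => F z - H z) <= wn W (fun z => F z - G z) + wn W (fun z => G z - H z).
Proof.
by move=> LF LG LH; have := nrm_triangle LF LG LH; rewrite !wnBE.
Qed.

Lemma wn_distC W F G : wn W (fun z => F z - G z) = wn W (fun z => G z - F z).
Proof. by apply: nrm_eqE => z; rewrite -(opprB (G z)) mulrN sqrrN. Qed.

Lemma wnZ W c F : wL2 W F -> wn W (fun z => c * F z) = `|c| * wn W F.
Proof. by move=> LF; rewrite -(nrmZ c LF) /wn; under eq_fun do rewrite mulrCA. Qed.

Lemma wn_ae W F G : wL2 W F -> wL2 W G -> {ae mu, forall z : P, F z = G z} -> wn W F = wn W G.
Proof.
move=> LF LG e; apply: ae_eq_nrm; [|exact: (L2_meas LF)|exact: (L2_meas LG)].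
by apply: filterS e => z ->.
Qed.

Lemma wL2_ae p W F G : weight p W -> wL2 W F -> measurable_fun setT (G : P -> R) ->
  {ae mu, forall z : P, F z = G z} -> wL2 W G.
Proof.
move=> Ww LF mG e; apply: (ae_eq_L2 _ LF); first by apply: filterS e => z ->.
by apply: measurable_funM => //; exact: meas_Wjb Ww.
Qed.

Lemma wL2_le p W V F G : weight p W -> weight p V -> measurable_fun setT (G : P -> R) -> wL2 V F ->
  (forall z, W (jb z) * `|G z| <= V (jb z) * `|F z|) -> wL2 W G /\ wn W G <= wn V F.
Proof.
move=> Ww Vw mG LF h.
have mWG : measurable_fun setT (fun z : P => W (jb z) * G z).
  by apply: measurable_funM => //; exact: meas_Wjb Ww.
have b z : `|W (jb z) * G z| <= `|V (jb z) * F z|.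
  by rewrite !normrM (ger0_norm (Wjb_ge0 z Ww)) (ger0_norm (Wjb_ge0 z Vw)).
by split; [exact: (L2_dom mWG b LF)|exact: (nrm_le mWG b LF)].
Qed.

(** Used with [h] the time step: the cross term is the one to which the energy estimate applies. *)
Lemma wn_add_sqr W F G (h : R) : wL2 W F -> wL2 W G ->
  wn W (fun z => F z + h * G z) ^+ 2 = wn W F ^+ 2 + 2 * h * wip W G F + h ^+ 2 * wn W G ^+ 2.
Proof.
move=> LF LG; rewrite !nrm_sqr /wip.
under eq_fun do rewrite mulrDr mulrCA.
have LhG := L2Z h LG.
rewrite (ipDl LF LhG (L2D LF LhG)) (ipDr LF LhG LF) (ipDr LF LhG LhG).
rewrite (ipZr h LG LF) (ipZl h LG LF) (ipZl h LG LhG) (ipZr h LG LG).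
have e : ip mu (fun z => W (jb z) * F z) (fun z => W (jb z) * G z) =
  ip mu (fun z => W (jb z) * G z) (fun z => W (jb z) * F z) := ipC _ _ _.
by rewrite e; ring.
Qed.

Lemma wip_le W F G : wL2 W F -> wL2 W G -> `|wip W F G| <= wn W F * wn W G.
Proof. exact: cauchy_schwarz_abs. Qed.

Lemma wipDl W F G (H : R * R -> R) : wL2 W F -> wL2 W G -> wL2 W H ->
  wip W (fun z => F z + G z) H = wip W F H + wip W G H.
Proof.
move=> LF LG LH; rewrite -(ipDl LF LG LH) /wip; congr ip.
by apply/funext => z; rewrite mulrDr.
Qed.

Definition cut N F z : R := F z * ((rad z <= N)%R)%:R.

Lemma measurable_cut N F : measurable_fun setT (F : P -> R) -> measurable_fun setT (cut N F : P -> R).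
Proof.
move=> mF; apply: measurable_funM => //.
have mB : measurable ([set z | rad z <= N] : set P).
  by rewrite -[X in measurable X]setTI; apply: measurable_fun_le => //; exact: measurable_rad.
rewrite (_ : (fun z => _) = (\1_([set z | rad z <= N] : set P) : P -> R)).
  exact: measurable_indic mB.
by apply/funext => z; rewrite indicE; congr ((_ : bool)%:R); apply/idP/idP; rewrite inE.
Qed.

Lemma cut_le N F z : `|cut N F z| <= `|F z|.
Proof. by rewrite /cut; case: (rad z <= N); rewrite /= ?mulr1// mulr0 normr0. Qed.

Lemma cut_idem N F : cut N (cut N F) = cut N F.
Proof. by apply/funext => z; rewrite /cut; case: (rad z <= N); rewrite /= ?mulr1// !mulr0. Qed.

Lemma wL2_cut p W N F : weight p W -> wL2 W F -> wL2 W (cut N F) /\ wn W (cut N F) <= wn W F.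
Proof.
move=> Ww LF; apply: (wL2_le Ww Ww) => //; first exact: measurable_cut (wL2_meas Ww LF).
by move=> z; rewrite ler_wpM2l ?(Wjb_ge0 z Ww)// cut_le.
Qed.

(** The cut is symmetric in every weighted product, so when [G] is already cut the energy of a
    Galerkin step involves the uncut [Bop]. *)
Lemma wip_cut W N F G : wip W (cut N F) G = wip W F (cut N G).
Proof. by apply: eq_Rintegral => z _; rewrite /cut; ring. Qed.

Lemma wL2_tail p W N F : weight p W -> wL2 W F -> wL2 W (fun z => F z - cut N F z) /\
  wn W (fun z => F z - cut N F z) <= wn W F.
Proof.
move=> Ww LF; have mF := wL2_meas Ww LF; apply: (wL2_le Ww Ww) => //.
  by apply: measurable_funB => //; exact: measurable_cut.
move=> z; rewrite ler_wpM2l ?(Wjb_ge0 z Ww)// /cut.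
by case: (rad z <= N); rewrite /= ?mulr1 ?subrr ?normr0// mulr0 subr0.
Qed.

Lemma jb_le1rad z : jb z <= 1 + rad z.
Proof.
rewrite -(@ler_pXn2r _ 2) ?nnegrE ?(ltW (jb_gt0 _)) ?addr_ge0 ?rad_ge0//.
by rewrite jb_sqr -rad_sqr sqrrD expr1n; have := rad_ge0 z; rewrite mulr2n mul1r; lra.
Qed.

(** Bernstein's inequality: below the cutoff one derivative costs [1 + N]. *)
Lemma wL2_jbcut p W N F : 0 <= N -> weight p W -> wL2 W F ->
  wL2 W (fun z => jb z * cut N F z) /\ wn W (fun z => jb z * cut N F z) <= (1 + N) * wn W F.
Proof.
move=> N0 Ww LF; have mF := wL2_meas Ww LF.
have N1 : 0 <= 1 + N by lra.
have b z : `|jb z * cut N F z| <= `|(1 + N) * F z|.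
  rewrite /cut !normrM (ger0_norm N1) (ger0_norm (ltW (jb_gt0 z))).
  have [zN|_] := leP (rad z) N; last by rewrite /= normr0 !mulr0 mulr_ge0.
  by rewrite /= normr1 mulr1 ler_wpM2r// (le_trans (jb_le1rad z)); lra.
rewrite -{1}(ger0_norm N1) -(wnZ _ LF); apply: (wL2_le Ww Ww).
- by apply: measurable_funM; [exact: measurable_jb|exact: measurable_cut].
- exact: wL2Z.
- by move=> z; rewrite ler_wpM2l ?(Wjb_ge0 z Ww).
Qed.

End Norms.

(** * Estimates of the bilinear form in H^s *)

Section Sobolev.
Context {R : realType} (s : R) (p : nat) (hs : 2 < s) (hp : s + 2 <= p%:R).
Local Notation P := (plane R).
Local Notation mu := (@lebesgue_measure R \x @lebesgue_measure R)%E.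
Implicit Types (F G : R * R -> R) (z : R * R) (m : R * R -> R) (n : nat) (W V : R -> R) (r N A : R).

Lemma weight_s : weight p (fun a : R => a `^ s).
Proof. by have h := hs; have h' := hp; apply: weight_pow; lra. Qed.

Lemma weight_s1 : weight p (fun a : R => a `^ (s + 1)).
Proof. by have h := hs; have h' := hp; apply: weight_pow; lra. Qed.

Lemma jb_s1 z : jb z `^ (s + 1) = jb z `^ s * jb z.
Proof. by rewrite powRD ?(gt_eqF (jb_gt0 z)) ?implybT// powRr1// ltW// jb_gt0. Qed.

Lemma Hs_jb F : wL2 (fun a => a `^ s) (fun z => jb z * F z) <-> Hs (s + 1) F.
Proof. by rewrite /Hs /wL2; under [X in _ <-> L2 _ X]eq_fun do rewrite jb_s1 -mulrA. Qed.

Lemma ns_jb F : wn (fun a => a `^ s) (fun z => jb z * F z) = ns (s + 1) F.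
Proof. by rewrite /ns /wn; under [in RHS]eq_fun do rewrite jb_s1 -mulrA. Qed.

Lemma Hs_le F : Hs (s + 1) F -> Hs s F /\ ns s F <= ns (s + 1) F.
Proof.
move=> LF; have mF := wL2_meas weight_s1 LF.
apply: (wL2_le weight_s weight_s1) => // z; rewrite ler_wpM2r// ler_powR ?jb_ge1//; lra.
Qed.

(** The constant of the embedding of H^s into the functions integrable against [lam]; combined with
    [Cb] and [Ce] into [Kc] it serves all the estimates below. *)
Definition Ks : R := nrm mu (fun z : P => lam z * jb z `^ (- s)).
Definition Kc : R := (Cb p + Ce p) * Ks.

Lemma Ks_ge0 : 0 <= Ks. Proof. exact: nrm_ge0. Qed.

Lemma Cb_ge0 : 0 <= Cb p :> R.
Proof. by rewrite !mulr_ge0 ?(ltW c2pi_gt0)// exprn_ge0. Qed.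

Lemma Ce_ge0 : 0 <= Ce p :> R.
Proof. by rewrite !mulr_ge0 ?(ltW c2pi_gt0)// exprn_ge0. Qed.

Lemma Kc_ge0 : 0 <= Kc.
Proof. by rewrite mulr_ge0 ?Ks_ge0// addr_ge0 ?Cb_ge0 ?Ce_ge0. Qed.

Lemma Hs_lam F : Hs s F -> lL1 F /\ ln1 F <= Ks * ns s F.
Proof. exact: lam_L1. Qed.

(** Absolute convergence of the integral defining [Bop] at almost every point. It is carried along
    because values of [Bop] can be added or compared at a point only when the real integrals are
    linear there. *)
Definition okB m F G : Prop := {ae mu, forall x : P, L1 mu (fun y => kB m F G (x, y))}.

Let arith (a b k A f F g G u v : R) : 0 <= a -> a <= b -> 0 <= A -> 0 <= u -> 0 <= v -> 0 <= f ->
  f <= k * F -> 0 <= g -> g <= k * G ->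
  a * A * (f * u + v * g) <= A * (b * k) * (F * u + v * G).
Proof.
move=> a0 ab A0 u0 v0 f0 fF g0 gG.
rewrite [leLHS](_ : _ = A * (a * (f * u + v * g))); last by ring.
rewrite [leRHS](_ : _ = A * (b * ((k * F) * u + v * (k * G)))); last by ring.
rewrite ler_wpM2l// ler_pM ?addr_ge0 ?mulr_ge0// lerD//; first by rewrite ler_wpM2r.
by rewrite ler_wpM2l.
Qed.

Let ln_ge0 F : 0 <= ln1 F. Proof. exact: Rintegral_ge0. Qed.

Let Cb_le : Cb p <= Cb p + Ce p :> R. Proof. by rewrite lerDl Ce_ge0. Qed.
Let Ce_le : Ce p <= Cb p + Ce p :> R. Proof. by rewrite lerDr Cb_ge0. Qed.

Lemma est_W A m W F G : kern A 0 m -> weight p W -> Hs s F -> Hs s G -> wL2 W F ->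
  wL2 W (fun z => jb z * G z) ->
  [/\ okB m F G, wL2 W (Bop m F G) &
      wn W (Bop m F G) <= A * Kc * (ns s F * wn W (fun z => jb z * G z) + wn W F * ns s G)].
Proof.
move=> Km Ww HF HG WF WG.
have [lF nF] := Hs_lam HF; have [lG nG] := Hs_lam HG.
have A0 : 0 <= A by case: Km.
have e : (fun z => jb z ^+ 0 * F z) = F by apply/funext => z; rewrite expr0 mul1r.
have WF' : wL2 W (fun z => jb z ^+ 0 * F z) by rewrite e.
have [h1 h2 h3] := Bop_bound Km Ww (wL2_meas weight_s HF) (wL2_meas weight_s HG) lF lG WF' WG.
split; [exact: h1|exact: h2|apply: le_trans h3 _; rewrite e].
by apply: (arith Cb_ge0 Cb_le A0 (wn_ge0 _ _) (wn_ge0 _ _) (ln_ge0 _) nF (ln_ge0 _) nG).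
Qed.

(** The general estimate with the weight <z>^s: one derivative is lost, on the transported argument
    [G] only. *)
Lemma est_s A m F G : kern A 0 m -> Hs s F -> Hs (s + 1) G ->
  [/\ okB m F G, Hs s (Bop m F G) & ns s (Bop m F G) <= A * (2 * Kc) * ns s F * ns (s + 1) G].
Proof.
move=> Km HF HG; have [HG' nG] := Hs_le HG.
have A0 : 0 <= A by case: Km.
have [h1 h2 h3] := est_W Km weight_s HF HG' HF (proj2 (Hs_jb G) HG).
split; [exact: h1|exact: h2|apply: le_trans h3 _; rewrite ns_jb -/(ns s F)].
have := Kc_ge0; have := wn_ge0 (fun a => a `^ s) F; rewrite -/(ns s F).
move: (ns s F) (ns s G) (ns (s + 1) G) Kc nG => a b c K bc a0 K0.
rewrite [leRHS](_ : _ = A * K * (a * c + a * c)); last by ring.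
by rewrite ler_wpM2l ?mulr_ge0// lerD2l ler_wpM2l.
Qed.

(** For a difference of symbols, controlled up to one power of <z>, so that [F] pays a derivative as
    well; through this estimate the gap of the symbols enters the error. *)
Lemma est_d A m F G : kern A 1 m -> Hs (s + 1) F -> Hs (s + 1) G ->
  [/\ okB m F G, Hs s (Bop m F G) & ns s (Bop m F G) <= A * (2 * Kc) * ns (s + 1) F * ns (s + 1) G].
Proof.
move=> Km HF HG; have [HF' nF] := Hs_le HF; have [HG' nG] := Hs_le HG.
have [lF lnF] := Hs_lam HF'; have [lG lnG] := Hs_lam HG'.
have A0 : 0 <= A by case: Km.
have e : (fun z => jb z ^+ 1 * F z) = (fun z => jb z * F z) by apply/funext => z; rewrite expr1.
have WF' : wL2 (fun a => a `^ s) (fun z => jb z ^+ 1 * F z) by rewrite e; exact/Hs_jb.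
have [h1 h2 h3] := Bop_bound Km weight_s (wL2_meas weight_s HF') (wL2_meas weight_s HG') lF lG WF' (proj2 (Hs_jb G) HG).
split; [exact: h1|exact: h2|apply: le_trans h3 _; rewrite e !ns_jb].
have lnF' := le_trans lnF (ler_wpM2l Ks_ge0 nF); have lnG' := le_trans lnG (ler_wpM2l Ks_ge0 nG).
apply: le_trans (arith Cb_ge0 Cb_le A0 (wn_ge0 _ _) (wn_ge0 _ _) (ln_ge0 _) lnF' (ln_ge0 _) lnG') _.
rewrite -/(ns (s + 1) F) -/(ns (s + 1) G) -/Kc.
by move: (ns (s + 1) F) (ns (s + 1) G) Kc => a b K; rewrite le_eqVlt; apply/orP; left; apply/eqP; ring.
Qed.

(** For [F = G] the bound is quadratic in the [W]-norm with a factor that depends on the H^s norm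
    alone, which is what propagates arbitrary weights. *)
Lemma est_e A m W F G : kern A 0 m -> weight p W -> Hs s F -> Hs s G -> wL2 W F -> wL2 W G ->
  wL2 W (fun z => jb z * G z) ->
  `|wip W (Bop m F G) G| <= A * Kc * (ns s F * wn W G + wn W F * ns s G) * wn W G.
Proof.
move=> Km Ww HF HG WF WG WjG; have A0 : 0 <= A by case: Km.
have [lF nF] := Hs_lam HF; have [lG nG] := Hs_lam HG.
apply: le_trans (Bop_energy Km Ww (wL2_meas weight_s HF) (wL2_meas weight_s HG) lF lG WF WG WjG) _.
apply: ler_wpM2r; first exact: wn_ge0.
by apply: (arith Ce_ge0 Ce_le A0 (wn_ge0 _ _) (wn_ge0 _ _) (ln_ge0 _) nF (ln_ge0 _) nG).
Qed.

End Sobolev.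

(* Comparing numerical expressions would otherwise unfold the constant. *)
Opaque Kc.

(** * Stability of the Euler-Galerkin scheme *)

Section Stability.
Context {R : realType} (s : R) (p : nat) (hs : 2 < s) (hp : s + 2 <= p%:R).
Local Notation P := (plane R).
Local Notation mu := (@lebesgue_measure R \x @lebesgue_measure R)%E.
Implicit Types (F G g e : R * R -> R) (x z : R * R) (m : R * R -> R) (n k : nat) (W V : R -> R).
Implicit Types (r N A h Y d T : R).
Local Notation K := (Kc s p).
Let ws := weight_s hs hp.
Let ws1 := weight_s1 hs hp.
Let K0 : 0 <= K := Kc_ge0 s p.

(** Expansion around the error [e] and the discarded frequencies [t]. Only [Bop m g e] puts the
    derivative on [e], and there the energy cancellation applies; in every other term it falls on
    [q], [t] or [gam], which are controlled in H^(s+1). *)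
Lemma Bop_expand m m' g gam q :
  let e := fun z => g z - q z in let t := fun z => gam z - q z in
  okB m g g -> okB m' gam gam -> okB m g e -> okB m e q -> okB m q t -> okB m t gam ->
  okB (fun z => m z - m' z) gam gam ->
  {ae mu, forall x : P, Bop m g g x - Bop m' gam gam x =
     Bop m g e x + (Bop m e q x - Bop m q t x - Bop m t gam x +
       Bop (fun z => m z - m' z) gam gam x)}.
Proof.
move=> e t h1 h2 h3 h4 h5 h6 h7.
apply: filterS2 (filterI (filterI h1 h2) (filterI h3 h4)) (filterI (filterI h5 h6) h7).
move=> x [[i1 i2] [i3 i4]] [[i5 i6] i7].
suff H : \int[mu]_y kB m g g (x, y) + (\int[mu]_y kB m q t (x, y) + \int[mu]_y kB m t gam (x, y)) =
  \int[mu]_y kB m' gam gam (x, y) + (\int[mu]_y kB m g e (x, y) + (\int[mu]_y kB m e q (x, y) +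
  \int[mu]_y kB (fun z => m z - m' z) gam gam (x, y))).
  have E mm F G : Bop mm F G x = c2pi * \int[mu]_y kB mm F G (x, y) by [].
  rewrite !E; move: H.
  move: (\int[mu]_y kB m g g (x, y)) (\int[mu]_y kB m q t (x, y)) (\int[mu]_y kB m t gam (x, y))
    (\int[mu]_y kB m' gam gam (x, y)) (\int[mu]_y kB m g e (x, y)) (\int[mu]_y kB m e q (x, y))
    (\int[mu]_y kB (fun z => m z - m' z) gam gam (x, y)) => a1 a2 a3 a4 a5 a6 a7 H.
  have -> : a1 = a4 + (a5 + (a6 + a7)) - (a2 + a3) by lra.
  by ring.
rewrite -(RintegralD _ i5 i6)// -(RintegralD _ i1 (L1D i5 i6))//.
rewrite -(RintegralD _ i4 i7)// -(RintegralD _ i3 (L1D i4 i7))// -(RintegralD _ i2 (L1D i3 (L1D i4 i7)))//.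
by apply: eq_Rintegral => y _; rewrite /kB /evp /odp /e /t/=; field.
Qed.

(** [E] is the norm of the error, [Zz] that of its rate of change, [w] their pairing and [Rr] the
    norm of the remainder. The square of [Zz] contains [(1 + N) ^+ 2], which one factor [h]
    absorbs. *)
Let step_arith h N Kk Y E Gg Rr Zz w a b y' : 0 <= h -> h <= 1 -> 0 <= N -> h * (1 + N) ^+ 2 <= 1 ->
  0 <= Kk -> 0 <= E -> 0 <= Gg -> Gg <= 1 + Y -> 0 <= Rr -> 0 <= Zz -> 0 <= a -> 0 <= b ->
  Rr <= a * E + b -> Zz <= 2 * Kk * Gg * (1 + N) * E + Rr ->
  w <= 2 * Kk * Gg * E ^+ 2 + Rr * E ->
  y' = E ^+ 2 + 2 * h * w + h ^+ 2 * Zz ^+ 2 ->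
  y' <= (1 + h * (4 * Kk * (1 + Y) + 2 * a + 1 + 8 * Kk ^+ 2 * (1 + Y) ^+ 2 + 4 * a ^+ 2)) * E ^+ 2
     + h * (5 * b ^+ 2).
Proof.
move=> h0 h1 N0 hN k0 E0 G0 GY R0 Z0 a0 b0 Rab Zle wle ->.
have Y0 : 0 <= 1 + Y by exact: le_trans GY.
have N1 : 0 <= 1 + N by lra.
have E2 : 0 <= E ^+ 2 by rewrite sqr_ge0.
pose u := 2 * Kk * Gg * (1 + N) * E; pose c := 2 * Kk * Gg.
have c0 : 0 <= c by rewrite !mulr_ge0.
have cY : c <= 2 * Kk * (1 + Y) by rewrite ler_wpM2l// mulr_ge0.
have c2 : c ^+ 2 <= 4 * Kk ^+ 2 * (1 + Y) ^+ 2.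
  by apply: le_trans (lerXn2r 2 c0 (mulr_ge0 (mulr_ge0 _ k0) Y0) cY) _; rewrite // !exprMn; lra.
have u0 : 0 <= u by rewrite !mulr_ge0.
have Z2 : Zz ^+ 2 <= 2 * u ^+ 2 + 2 * Rr ^+ 2.
  apply: le_trans (lerXn2r 2 Z0 (addr_ge0 u0 R0) Zle) _.
  by rewrite -/u; have := sqr_ge0 (u - Rr); rewrite !expr2; nra.
have hu : h ^+ 2 * u ^+ 2 <= h * (c ^+ 2 * E ^+ 2).
  have -> : h ^+ 2 * u ^+ 2 = (h * (1 + N) ^+ 2) * (h * (c ^+ 2 * E ^+ 2)) by rewrite /u /c; ring.
  by rewrite ler_piMl// !mulr_ge0// sqr_ge0.
have h2h : h ^+ 2 <= h by rewrite expr2 ler_piMr.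
have R2 : Rr ^+ 2 <= 2 * a ^+ 2 * E ^+ 2 + 2 * b ^+ 2.
  apply: le_trans (lerXn2r 2 R0 (addr_ge0 (mulr_ge0 a0 E0) b0) Rab) _.
  by have := sqr_ge0 (a * E - b); rewrite !expr2; nra.
have RE : 2 * (Rr * E) <= (2 * a + 1) * E ^+ 2 + b ^+ 2.
  have := ler_wpM2r E0 Rab; have := sqr_ge0 (E - b); rewrite !expr2; nra.
have hZ : h ^+ 2 * Zz ^+ 2 <= 2 * (h * (c ^+ 2 * E ^+ 2)) + 2 * (h * Rr ^+ 2).
  apply: le_trans (ler_wpM2l (sqr_ge0 h) Z2) _.
  have := ler_wpM2r (sqr_ge0 Rr) h2h; nra.
have cE : 2 * c * E ^+ 2 <= 2 * (2 * Kk * (1 + Y)) * E ^+ 2 by rewrite ler_wpM2r// ler_wpM2l.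
have c2E : c ^+ 2 * E ^+ 2 <= 4 * Kk ^+ 2 * (1 + Y) ^+ 2 * E ^+ 2 by rewrite ler_wpM2r.
rewrite -/c in wle.
have s1 : 2 * h * w <= h * (2 * c * E ^+ 2 + ((2 * a + 1) * E ^+ 2 + b ^+ 2)).
  rewrite [leLHS](_ : _ = h * (2 * w)); last by ring.
  by rewrite ler_wpM2l//; lra.
have s2 : h ^+ 2 * Zz ^+ 2 <= h * (2 * (4 * Kk ^+ 2 * (1 + Y) ^+ 2 * E ^+ 2) + 2 * (2 * a ^+ 2 * E ^+ 2 + 2 * b ^+ 2)).
  apply: le_trans hZ _; rewrite -mulrCA [X in _ + X]mulrCA -mulrDr ler_wpM2l//.
  by apply: lerD; rewrite ler_wpM2l.
have s1' := le_trans s1 (ler_wpM2l h0 (lerD cE (lexx _))).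
apply: le_trans (lerD (lerD (lexx (E ^+ 2)) s1') s2) _.
rewrite le_eqVlt; apply/orP; left; apply/eqP; ring.
Qed.

Definition galerkin_step h N m g z : R := g z + h * cut N (Bop m g g) z.

(** The growth rate found in [step_arith] for [a = 2 * K * Y], the coefficient of the error in the
    remainder. *)
Definition Astep Y : R := 4 * K * (1 + Y) + 2 * (2 * K * Y) + 1 + 8 * K ^+ 2 * (1 + Y) ^+ 2 + 4 * (2 * K * Y) ^+ 2.

Lemma cutD N F G z : cut N (fun z => F z + G z) z = cut N F z + cut N G z.
Proof. by rewrite /cut mulrDl. Qed.

Lemma cutB N F G z : cut N (fun z => F z - G z) z = cut N F z - cut N G z.
Proof. by rewrite /cut mulrBl. Qed.

Lemma cutZ N c F z : cut N (fun z => c * F z) z = c * cut N F z.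
Proof. by rewrite /cut mulrA. Qed.

Lemma Hs1_cut N F : 0 <= N -> Hs s F -> cut N F = F ->
  Hs (s + 1) F /\ ns (s + 1) F <= (1 + N) * ns s F.
Proof.
move=> N0 HF cF; have [h1 h2] := wL2_jbcut N0 ws HF; rewrite cF in h1 h2.
by split; [exact/Hs_jb|rewrite -ns_jb].
Qed.

Let rem_arith (Kk d E Y t rho q1 q0 w1 w0 g1 : R) : 0 <= Kk -> 0 <= d -> 0 <= E -> 0 <= Y -> 0 <= t ->
  0 <= q1 -> 0 <= q0 -> 0 <= w1 -> 0 <= w0 -> 0 <= g1 ->
  q1 <= Y -> q0 <= Y -> w1 <= t -> w0 <= t -> g1 <= Y ->
  2 * Kk * E * q1 + 2 * Kk * q0 * w1 + 2 * Kk * w0 * g1 + d * (2 * Kk) * g1 * g1 + rho <=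
  2 * Kk * Y * E + (2 * Kk * (2 * Y * t + d * Y ^+ 2) + rho).
Proof.
move=> k0 d0 E0 Y0 t0 q10 q00 w10 w00 g10 qY q0Y wt w0t gY.
have a4 : Kk * E * q1 <= Kk * E * Y by rewrite ler_wpM2l// mulr_ge0.
have a5 : Kk * q0 * w1 <= Kk * Y * t by rewrite ler_pM ?mulr_ge0// ler_wpM2l.
have a6 : Kk * w0 * g1 <= Kk * t * Y by rewrite ler_pM ?mulr_ge0// ler_wpM2l.
have a7 : d * Kk * g1 * g1 <= d * Kk * Y * Y by rewrite ler_pM ?mulr_ge0// ler_wpM2l ?mulr_ge0.
by rewrite expr2; lra.
Qed.

(** The bound 1 on the error controls the norm of [g] by [1 + Y], so that the growth rate depends on
    the reference curve alone; this is what the bootstrap maintains. *)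
Lemma step_bound m m' d Y h N g (gam gam' r : R * R -> R) (t rho : R) :
  kern 1 0 m -> kern 1 0 m' -> kern d 1 (fun z => m z - m' z) ->
  0 <= h -> h <= 1 -> 0 <= N -> h * (1 + N) ^+ 2 <= 1 ->
  Hs s g -> cut N g = g -> Hs (s + 1) gam -> ns (s + 1) gam <= Y ->
  ns (s + 1) (fun z => gam z - cut N gam z) <= t -> Hs s r -> ns s r <= rho ->
  {ae mu, forall z : P, gam' z = gam z + h * (Bop m' gam gam z + r z)} ->
  measurable_fun setT (gam' : P -> R) ->
  let e := fun z => g z - cut N gam z in
  let e' := fun z => galerkin_step h N m g z - cut N gam' z in
  let b := 2 * K * (2 * Y * t + d * Y ^+ 2) + rho in
  ns s e <= 1 ->
  Hs s (galerkin_step h N m g) /\ ns s e' ^+ 2 <= (1 + h * Astep Y) * ns s e ^+ 2 + h * (5 * b ^+ 2).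
Proof.
move=> Km Km' Kd h0 h1 N0 hN Hg cg Hgam gY tt Hr rr gam'E mgam' e e' b e1.
have N1 : 1 <= 1 + N by rewrite lerDl.
have [Hgam0 ngam0] := Hs_le hs hp Hgam.
pose q := cut N gam; pose w := fun z => gam z - q z.
have [Hq nq] := wL2_cut N ws1 Hgam; have [Hw nw] := wL2_tail N ws1 Hgam.
have [Hq0 nq0] := Hs_le hs hp Hq; have [Hw0 nw0] := Hs_le hs hp Hw.
rewrite -/q -/w in Hq nq Hw nw Hq0 nq0 Hw0 nw0 tt.
have He : Hs s e by exact: wL2B Hg Hq0.
have ce : cut N e = e by apply/funext => z; rewrite /e cutB cg cut_idem.
have [Hg1 ng1] := Hs1_cut N0 Hg cg; have [He1 ne1] := Hs1_cut N0 He ce.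
have [k1 B1 n1] := est_s hs hp Km Hg Hg1.
have [k2 B2 n2] := est_s hs hp Km' Hgam0 Hgam.
have [k3 B3 n3] := est_s hs hp Km Hg He1.
have [k4 B4 n4] := est_s hs hp Km He Hq.
have [k5 B5 n5] := est_s hs hp Km Hq0 Hw.
have [k6 B6 n6] := est_s hs hp Km Hw0 Hgam.
have [k7 B7 n7] := est_d hs hp Kd Hgam Hgam.
have X := Bop_expand k1 k2 k3 k4 k5 k6 k7; rewrite -/e -/w in X.
pose Rm := fun z => Bop m e q z - Bop m q w z - Bop m w gam z + Bop (fun z => m z - m' z) gam gam z - r z.
have HR1 := wL2D (wL2B (wL2B B4 B5) B6) B7.
have HR : Hs s Rm := wL2B HR1 Hr.
have Y0 : 0 <= Y by exact: le_trans (wn_ge0 _ _) gY.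
have t0 : 0 <= t by exact: le_trans (wn_ge0 _ _) tt.
have d0 : 0 <= d by case: Kd.
have K2 : 0 <= 2 * K by rewrite mulr_ge0.
have nR : ns s Rm <= 2 * K * Y * ns s e + b.
  apply: le_trans (wnB HR1 Hr) _.
  apply: le_trans (lerD (wnD (wL2B (wL2B B4 B5) B6) B7) rr) _.
  apply: le_trans (lerD (lerD (wnB (wL2B B4 B5) B6) n7) (lexx _)) _.
  apply: le_trans (lerD (lerD (lerD (wnB B4 B5) n6) (lexx _)) (lexx _)) _.
  apply: le_trans (lerD (lerD (lerD (lerD n4 n5) (lexx _)) (lexx _)) (lexx _)) _.
  rewrite !mul1r /b.
  have n0 r' F : 0 <= ns r' F := wn_ge0 _ _.
  have nqY : ns (s + 1) q <= Y := le_trans nq gY.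
  have nqY0 : ns s q <= Y := le_trans nq0 nqY.
  have nwt : ns s w <= t := le_trans nw0 tt.
  apply: rem_arith; [exact: K0|exact: d0|exact: n0|exact: Y0|exact: t0|exact: n0|exact: n0|exact: n0|exact: n0|exact: n0|exact: nqY|exact: nqY0|exact: tt|exact: nwt|exact: gY].
pose Z := fun z => Bop m g e z + Rm z.
have HZ : Hs s Z := wL2D B3 HR.
have [HcZ ncZ] := wL2_cut N ws HZ.
have [HcB _] := wL2_cut N ws B1.
have Hst : Hs s (galerkin_step h N m g) by exact: wL2D Hg (wL2Z h HcB).
split=> //.
have e'E : {ae mu, forall z : P, e' z = e z + h * cut N Z z}.
  apply: filterS2 X gam'E => z X1 G1.
  have key (g0 b1 b2 b3 u r0 c ga : R) : b1 - b2 = b3 + u ->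
      (g0 + h * (b1 * c)) - (ga + h * (b2 + r0)) * c = g0 - ga * c + h * ((b3 + (u - r0)) * c).
    by move=> b12; have -> : b1 = b2 + (b3 + u) by [rewrite -b12; ring|]; ring.
  have := key (g z) _ _ _ _ (r z) ((rad z <= N)%R%:R) (gam z) X1.
  by rewrite -G1; exact.
have me' : measurable_fun setT (e' : P -> R).
  by apply: measurable_funB; [exact: (wL2_meas ws Hst)|exact: measurable_cut].
have Hsum : Hs s (fun z => e z + h * cut N Z z) := wL2D He (wL2Z h HcZ).
have He' : Hs s e'.
  by apply: (wL2_ae ws Hsum me'); apply: filterS e'E => z ->.
have E' : ns s e' = ns s (fun z => e z + h * cut N Z z) := wn_ae He' Hsum e'E.
rewrite E' /Astep.
have G1 : ns s g <= 1 + Y.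
  have gE : g = fun z => e z + q z by apply/funext => z; rewrite /e subrK.
  rewrite {1}gE; apply: le_trans (wnD He Hq0) _; apply: lerD => //.
  by apply: le_trans nq0 _; exact: le_trans nq _.
apply: (@step_arith h N K Y (ns s e) (ns s g) (ns s Rm) (ns s (cut N Z)) (wip (fun a => a `^ s) (cut N Z) e)
   (2 * K * Y) b).
- exact: h0.
- exact: h1.
- exact: N0.
- exact: hN.
- exact: K0.
- exact: wn_ge0.
- exact: wn_ge0.
- exact: G1.
- exact: wn_ge0.
- exact: wn_ge0.
- exact: (mulr_ge0 K2 Y0).
- have r0 : 0 <= rho by exact: le_trans (wn_ge0 _ _) rr.
  rewrite /b; apply: addr_ge0 => //; apply: mulr_ge0 => //; apply: addr_ge0.
    by rewrite !mulr_ge0.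
  by rewrite mulr_ge0// sqr_ge0.
- exact: nR.
- apply: le_trans ncZ _; apply: le_trans (wnD B3 HR) _; apply: lerD; last exact: lexx.
  apply: le_trans n3 _; rewrite mul1r.
  rewrite -(mulrA (2 * K * ns s g) (1 + N)).
  exact: (ler_wpM2l (mulr_ge0 K2 (wn_ge0 (fun a => a `^ s) g)) ne1).
- rewrite wip_cut ce; rewrite (wipDl B3 HR He); apply: lerD.
    apply: le_trans (ler_norm _) _.
    apply: le_trans (est_e hs hp Km ws Hg He Hg He (proj2 (Hs_jb s e) He1)) _.
    by rewrite le_eqVlt; apply/orP; left; apply/eqP; rewrite /ns; ring.
  exact: le_trans (ler_norm _) (wip_le HR He).
- exact: wn_add_sqr He HcZ.
Qed.

Fixpoint galerkin h N m (g0 : R * R -> R) n : R * R -> R :=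
  if n is n'.+1 then galerkin_step h N m (galerkin h N m g0 n') else cut N g0.

Lemma Astep_ge0 Y : 0 <= Y -> 0 <= Astep Y.
Proof.
move=> Y0; have Y1 : 0 <= 1 + Y by rewrite addr_ge0.
by rewrite /Astep; move: K K0 => k k0; rewrite !addr_ge0 ?mulr_ge0 ?exprn_ge0 ?mulr_ge0.
Qed.

Lemma cut_st h N m g : cut N g = g -> cut N (galerkin_step h N m g) = galerkin_step h N m g.
Proof. by move=> cg; apply/funext => z; rewrite /galerkin_step cutD cutZ cut_idem cg. Qed.

Lemma gal_cut h N m g0 n : cut N (galerkin h N m g0 n) = galerkin h N m g0 n.
Proof. by elim: n => [|n IH] /=; [rewrite cut_idem|rewrite cut_st]. Qed.

Lemma gal_Hs h N m g0 n : kern 1 0 m -> 0 <= N -> Hs s g0 -> Hs s (galerkin h N m g0 n).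
Proof.
move=> Km N0 H0; elim: n => [|n IH] /=; first by have [] := wL2_cut N ws H0.
have [H1 _] := Hs1_cut N0 IH (gal_cut _ _ _ _ _).
have [_ HB _] := est_s hs hp Km IH H1.
have [HcB _] := wL2_cut N ws HB.
exact: wL2D IH (wL2Z h HcB).
Qed.

Lemma gronwall_pow h T A n : 0 <= h -> 0 <= A -> n%:R * h <= T -> (1 + h * A) ^+ n <= expR (A * T).
Proof.
move=> h0 A0 nT; have hA : 0 <= h * A by rewrite mulr_ge0.
apply: (@le_trans _ _ (expR (h * A) ^+ n)).
  by apply: lerXn2r; rewrite ?nnegrE ?addr_ge0 ?expR_ge0// expR_ge1Dx.
rewrite -expRM_natl ler_expR [leLHS](_ : _ = A * (n%:R * h)); last by rewrite -mulr_natl; ring.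
by rewrite ler_wpM2l.
Qed.

(** The step inequality is available only while [y k <= 1]; since the final bound is itself at most
    1, the induction never leaves that range. *)
Lemma gronwall (y : nat -> R) h T A b n : 0 <= h -> 0 <= A -> 0 <= b -> n%:R * h <= T ->
  y 0%N <= 0 -> expR (A * T) * (T * b) <= 1 ->
  (forall k, (k < n)%N -> y k <= 1 -> y k.+1 <= (1 + h * A) * y k + h * b) ->
  forall k, (k <= n)%N -> y k <= expR (A * T) * (T * b).
Proof.
move=> h0 A0 b0 nT y0 small H.
have hA : 0 <= 1 + h * A by rewrite addr_ge0// mulr_ge0.
have hA1 : 1 <= 1 + h * A by rewrite lerDl mulr_ge0.
have fin k : (k <= n)%N -> (1 + h * A) ^+ k * (k%:R * h * b) <= expR (A * T) * (T * b).
  move=> kn; have kT : k%:R * h <= T by apply: le_trans nT; rewrite ler_wpM2r// ler_nat.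
  apply: ler_pM; rewrite ?exprn_ge0 ?mulr_ge0//; first exact: gronwall_pow.
  by rewrite ler_wpM2r.
have main k : (k <= n)%N -> y k <= (1 + h * A) ^+ k * (k%:R * h * b).
  elim: k => [|k IH] kn; first by rewrite !mul0r mulr0.
  have kn' : (k <= n)%N by exact: ltnW.
  have yk := IH kn'; have yk1 : y k <= 1.
    by apply: le_trans yk _; apply: le_trans (fin k kn') _.
  apply: le_trans (H k kn yk1) _; rewrite exprS -mulrA -natr1.
  have q1 : 1 <= (1 + h * A) ^+ k.+1 by apply: exprn_ege1.
  rewrite (_ : (1 + h * A) * (_ * _) = (1 + h * A) * ((1 + h * A) ^+ k * (k%:R * h * b)) + (1 + h * A) ^+ k.+1 * (h * b)); last by rewrite exprS; ring.
  apply: lerD; first by rewrite ler_wpM2l.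
  by rewrite ler_peMl// mulr_ge0.
by move=> k kn; apply: le_trans (main k kn) (fin k kn).
Qed.

(** [b] collects three sources of error: the truncated frequencies of the reference ([t]), the gap
    between the symbols ([d]) and the defect of the reference in the discrete equation ([rho]). *)
Lemma stability m m' d Y T h N n g0 (gam r : nat -> R * R -> R) (t rho : R) :
  kern 1 0 m -> kern 1 0 m' -> kern d 1 (fun z => m z - m' z) ->
  0 <= h -> h <= 1 -> 0 <= N -> h * (1 + N) ^+ 2 <= 1 -> n%:R * h <= T -> Hs s g0 ->
  (forall k, (k <= n)%N -> [/\ Hs (s + 1) (gam k), ns (s + 1) (gam k) <= Y &
     ns (s + 1) (fun z => gam k z - cut N (gam k) z) <= t]) ->
  (forall k, (k < n)%N -> [/\ Hs s (r k), ns s (r k) <= rho &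
     {ae mu, forall z : P, gam k.+1 z = gam k z + h * (Bop m' (gam k) (gam k) z + r k z)}]) ->
  {ae mu, forall z : P, g0 z = gam 0%N z} ->
  let b := 2 * K * (2 * Y * t + d * Y ^+ 2) + rho in
  expR (Astep Y * T) * (T * (5 * b ^+ 2)) <= 1 ->
  forall k, (k <= n)%N ->
  ns s (fun z => galerkin h N m g0 k z - cut N (gam k) z) ^+ 2 <= expR (Astep Y * T) * (T * (5 * b ^+ 2)).
Proof.
move=> Km Km' Kd h0 h1 N0 hN nT H0 Hg Hr g00 b small.
have [Hg0 gY0 _] := Hg 0%N (leq0n _).
have Y0 : 0 <= Y := le_trans (wn_ge0 _ _) gY0.
apply: (gronwall h0 (Astep_ge0 Y0) _ nT _ small).
- by rewrite mulr_ge0// sqr_ge0.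
- have Hg0s := proj1 (Hs_le hs hp Hg0).
  have Hc := wL2B (proj1 (wL2_cut N ws H0)) (proj1 (wL2_cut N ws Hg0s)).
  rewrite /= (_ : ns s _ = 0) ?expr0n//.
  have Hz : Hs s (fun=> 0).
    by rewrite /Hs /wL2; under [X in L2 _ X]eq_fun do rewrite mulr0; exact: L2_0.
  transitivity (ns s (fun=> 0)); last first.
    by rewrite /ns /wn; under eq_fun do rewrite mulr0; exact: nrm0.
  by apply: wn_ae Hc Hz _; apply: filterS g00 => z; rewrite /cut => ->; rewrite subrr.
- move=> k kn yk; have [Hk nk tk] := Hg k (ltnW kn); have [Hk1 _ _] := Hg k.+1 kn.
  have [Hrk nr e] := Hr k kn.
  have e1 : ns s (fun z => galerkin h N m g0 k z - cut N (gam k) z) <= 1.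
    by rewrite -(@ler_pXn2r _ 2) ?nnegrE ?wn_ge0// expr1n.
  exact: (proj2 (step_bound Km Km' Kd h0 h1 N0 hN (gal_Hs h k Km N0 H0) (gal_cut _ _ _ _ _)
    Hk nk tk Hrk nr e (wL2_meas ws1 Hk1) e1)).
Qed.

Definition Agal Gg : R := 4 * K * Gg + 4 * K ^+ 2 * Gg ^+ 2.

(** Once the iterates are bounded in H^s, [est_e] and [est_W] are linear in the remaining [W]-norm,
    so every weight satisfied by the datum is propagated, with a factor independent of the
    weight. *)
Lemma gal_bound m W T h N n g0 Gg : kern 1 0 m -> weight p W ->
  0 <= h -> h <= 1 -> 0 <= N -> h * (1 + N) ^+ 2 <= 1 -> n%:R * h <= T -> Hs s g0 -> wL2 W g0 ->
  (forall k, (k <= n)%N -> ns s (galerkin h N m g0 k) <= Gg) ->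
  forall k, (k <= n)%N -> wL2 W (galerkin h N m g0 k) /\
    wn W (galerkin h N m g0 k) ^+ 2 <= expR (Agal Gg * T) * wn W g0 ^+ 2.
Proof.
move=> Km Ww h0 h1 N0 hN nT H0 W0 Hgg.
have G0 : 0 <= Gg := le_trans (wn_ge0 _ _) (Hgg 0%N (leq0n _)).
have A0 : 0 <= Agal Gg by rewrite /Agal; move: K K0 => k0 k1; rewrite addr_ge0 ?mulr_ge0 ?exprn_ge0.
suff main k : (k <= n)%N -> wL2 W (galerkin h N m g0 k) /\
    wn W (galerkin h N m g0 k) ^+ 2 <= (1 + h * Agal Gg) ^+ k * wn W g0 ^+ 2.
  move=> k kn; have [h2 h3] := main k kn; split => //; apply: le_trans h3 _.
  rewrite ler_wpM2r ?sqr_ge0//; apply: gronwall_pow => //.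
  by apply: le_trans nT; rewrite ler_wpM2r// ler_nat.
elim: k => [|k IH] kn.
  have [h2 h3] := wL2_cut N Ww W0; split => //=; rewrite mul1r.
  by rewrite ler_pXn2r ?nnegrE ?wn_ge0.
have [Wk nk] := IH (ltnW kn); have Hk := gal_Hs h k Km N0 H0.
have ck := gal_cut h N m g0 k; have gk := Hgg k (ltnW kn).
rewrite /= (exprS (1 + h * Agal Gg)) -(mulrA (1 + h * Agal Gg)); move: (galerkin h N m g0 k) Wk nk Hk ck gk => g Wg ng Hg cg gG.
have [Wj nj] := wL2_jbcut N0 Ww Wg; rewrite cg in Wj nj.
have [_ WB nB] := est_W hs hp Km Ww Hg Hg Wg Wj.
have [Wc nc] := wL2_cut N Ww WB.
have En := est_e hs hp Km Ww Hg Hg Wg Wg Wj.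
split; first exact: wL2D Wg (wL2Z h Wc).
have -> : wn W (galerkin_step h N m g) ^+ 2 = _ := wn_add_sqr h Wg Wc.
rewrite wip_cut cg.
have hA : 0 <= 1 + h * Agal Gg by rewrite addr_ge0// mulr_ge0.
apply: le_trans _ (ler_wpM2l hA ng).
have wp : wip W (Bop m g g) g <= 2 * K * Gg * wn W g ^+ 2.
  apply: le_trans (ler_norm _) _; apply: le_trans En _; rewrite mul1r.
  have : K * ns s g * wn W g ^+ 2 <= K * Gg * wn W g ^+ 2 by rewrite ler_wpM2r ?sqr_ge0// ler_wpM2l.
  by move: K (ns s g) (wn W g) => k1 a b H; rewrite [leLHS](_ : _ = 2 * (k1 * a * b ^+ 2)); [lra|ring].
have w0 := wn_ge0 W g; have s0 : 0 <= ns s g := wn_ge0 _ _.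
have Zle : wn W (cut N (Bop m g g)) <= 2 * K * Gg * (1 + N) * wn W g.
  apply: le_trans nc _; apply: le_trans nB _; rewrite mul1r.
  have q1 : ns s g * wn W (fun z => jb z * g z) <= Gg * ((1 + N) * wn W g).
    by apply: ler_pM => //; exact: wn_ge0.
  have q2 : wn W g * ns s g <= Gg * ((1 + N) * wn W g).
    by rewrite (mulrC (wn W g)); apply: ler_pM => //; rewrite ler_peMl// lerDl.
  apply: le_trans (ler_wpM2l K0 (lerD q1 q2)) _.
  by rewrite le_eqVlt; apply/orP; left; apply/eqP; ring.
have Z0 := wn_ge0 W (cut N (Bop m g g)).
move: (wn W (cut N (Bop m g g))) (wip W (Bop m g g) g) (wn W g) Zle wp Z0 w0 => Z w y Zle wp Z0 y0.
rewrite /Agal; move: K K0 Zle wp => k0 k1 Zle wp.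
have Z2 := lerXn2r 2 Z0 (le_trans Z0 Zle) Zle.
have h2 : h ^+ 2 * Z ^+ 2 <= h * (4 * k0 ^+ 2 * Gg ^+ 2 * y ^+ 2).
  apply: le_trans (ler_wpM2l (sqr_ge0 h) Z2) _.
  rewrite [leLHS](_ : _ = (h * (1 + N) ^+ 2) * (h * (4 * k0 ^+ 2 * Gg ^+ 2 * y ^+ 2))); last by ring.
  by rewrite ler_piMl// !mulr_ge0// ?exprn_ge0.
have h3 : 2 * h * w <= 2 * h * (2 * k0 * Gg * y ^+ 2) by rewrite ler_wpM2l// mulr_ge0.
apply: le_trans (lerD (lerD (lexx _) h3) h2) _.
by rewrite le_eqVlt; apply/orP; left; apply/eqP; ring.
Qed.

End Stability.

(** * Tightness *)

Section WeightMore.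
Context {R : realType}.
Local Notation P := (plane R).
Local Notation mu := (@lebesgue_measure R \x @lebesgue_measure R)%E.
Implicit Types (F G : R * R -> R) (z : R * R) (W V : R -> R) (r N a : R) (p : nat).

Lemma weightD p W V : weight p W -> weight p V -> weight p (fun a => W a + V a).
Proof.
move=> [mW W0 W1 W2] [mV V0 V1 V2]; split.
- exact: measurable_funD.
- by move=> a a1; rewrite addr_gt0 ?W0 ?V0.
- by move=> a b a1 ab; rewrite !mulrDl lerD ?W1 ?V1.
- by move=> a b a1 ab; rewrite !mulrDl lerD ?W2 ?V2.
Qed.

Lemma cut_trunc n F : cut n%:R F = trunc F n.
Proof.
apply/funext => z; rewrite /cut /trunc indicE; congr (_ * (_ : bool)%:R).
apply/idP/idP; rewrite inE /disc/= -rad_sqr => h.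
  by rewrite ler_pXn2r ?nnegrE ?rad_ge0.
by move: h; rewrite ler_pXn2r ?nnegrE ?rad_ge0.
Qed.

Lemma cutM N F G z : cut N (fun z => F z * G z) z = F z * cut N G z.
Proof. by rewrite /cut mulrA. Qed.

Lemma cut_cut N N' F : N <= N' -> cut N (cut N' F) = cut N F.
Proof.
move=> NN; apply/funext => z; rewrite /cut.
have [h|h] := leP (rad z) N; last by rewrite !mulr0.
by rewrite (le_trans h NN) !mulr1.
Qed.

Lemma tail_mono p W N N' F : weight p W -> wL2 W F -> N <= N' ->
  wn W (fun z => F z - cut N' F z) <= wn W (fun z => F z - cut N F z).
Proof.
move=> Ww LF NN; have mF := wL2_meas Ww LF.
have [LN _] := wL2_tail N Ww LF.
apply: (proj2 (wL2_le Ww Ww _ LN _)).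
  by apply: measurable_funB => //; exact: measurable_cut.
move=> z; rewrite ler_wpM2l ?(Wjb_ge0 z Ww)// /cut.
have [h|h] := leP (rad z) N; first by rewrite (le_trans h NN)/= mulr1 subrr normr0.
case: (rad z <= N'); rewrite /= ?mulr1 ?mulr0 ?subrr ?subr0 ?normr0//.
Qed.

Lemma tail_small p W F : weight p W -> wL2 W F -> forall e, 0 < e ->
  exists N0 : R, forall N, N0 <= N -> wn W (fun z => F z - cut N F z) <= e.
Proof.
move=> Ww LF e e0; have [N hN] := proj1 (cvL2P _ _ _) (cvL2_trunc LF) e e0.
exists N%:R => N' freq_cut; apply: le_trans (tail_mono Ww LF freq_cut) _.
apply: le_trans (hN N (leqnn N)); rewrite wn_distC wnBE.
rewrite le_eqVlt; apply/orP; left; apply/eqP; congr (nrm mu).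
by apply/funext => z; rewrite -cut_trunc cutM.
Qed.

Lemma wn_cut_le p W N F (s : R) : weight p W -> weight p (fun a : R => a `^ s) -> 0 <= s -> 0 <= N -> Hs s F ->
  wL2 W (cut N F) /\ wn W (cut N F) <= W (1 + N) * ns s F.
Proof.
move=> Ww ws s0 N0 HF; have mF := wL2_meas ws HF.
have N1 : 1 <= 1 + N by rewrite lerDl.
have WN : 0 <= W (1 + N) by case: Ww => _ W0 _ _; rewrite ltW// W0.
rewrite -(ger0_norm WN) -(wnZ _ HF); apply: (wL2_le Ww ws); [exact: measurable_cut|exact: wL2Z|].
move=> z; rewrite /cut normrM; have [h|h] := leP (rad z) N; last by rewrite /= normr0 !mulr0 mulr_ge0 ?powR_ge0.
rewrite /= normr1 mulr1 normrM (ger0_norm WN) mulrA ler_wpM2r//.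
apply: (@le_trans _ _ (W (1 + N))).
  apply: (weight_nd Ww); first exact: jb_ge1.
  by apply: le_trans (jb_le1rad z) _; rewrite lerD2l.
by rewrite ler_peMl// powR_ge1// jb_ge1.
Qed.

(** Below any frequency the [W]-norm is controlled by the H^s norm, so approximation in H^s passes
    the bound to [cut N F]; as [N] grows, Fatou gives it for [F]. *)
Lemma wn_lsc p W F (s M : R) : weight p W -> weight p (fun a : R => a `^ s) -> 0 <= s -> Hs s F ->
  (forall e, 0 < e -> exists G, [/\ wL2 W G, wn W G <= M, Hs s G & ns s (fun z => G z - F z) <= e]) ->
  wL2 W F /\ wn W F <= M.
Proof.
move=> Ww ws s0 HF H; have mF := wL2_meas ws HF.
have c N : 0 <= N -> wL2 W (cut N F) /\ wn W (cut N F) <= M.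
  move=> N0; have [LN _] := wn_cut_le Ww ws s0 N0 HF; split => //.
  have WN : 0 < W (1 + N) by case: Ww => _ W0 _ _; rewrite W0// lerDl.
  apply/ler_addgt0Pr => e e0; have [G [LG nG HG GF]] := H (e / W (1 + N)) (divr_gt0 e0 WN).
  have [LcG ncG] := wL2_cut N Ww LG.
  have HD := wL2B HG HF; have [LcD ncD] := wn_cut_le Ww ws s0 N0 HD.
  have eF : cut N F = fun z => cut N G z - cut N (fun z => G z - F z) z.
    by apply/funext => z; rewrite cutB subKr.
  rewrite {1}eF; apply: le_trans (wnB LcG LcD) _; apply: lerD; first exact: le_trans nG.
  apply: le_trans ncD _; rewrite mulrC -ler_pdivlMr//.
apply: (@nrm_fatou _ _ _ mu (fun n z => W (jb z) * cut n%:R F z) (fun z => W (jb z) * F z) M).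
- by move=> n; exact: (c n%:R _).1.
- by move=> n; exact: (c n%:R _).2.
- by apply: measurable_funM => //; exact: meas_Wjb Ww.
- apply: aeW => z; apply: cvgZl_tmp; rewrite (_ : (fun n => _) = trunc F ^~ z).
    exact: trunc_near.
  by apply/funext => n; rewrite cut_trunc.
Qed.

End WeightMore.

Section Tightness.
Context {R : realType} (s : R) (p : nat) (hs : 2 < s) (hp : s + 2 <= p%:R).
Local Notation P := (plane R).
Implicit Types (F G g : R * R -> R) (z : R * R) (n : nat) (W V : R -> R) (N a : R).
Let ws := weight_s hs hp.
Let ws1 := weight_s1 hs hp.

Let ws2 : weight p (fun a : R => a `^ (s + 2)).
Proof. by have h := hs; have h' := hp; apply: weight_pow => //; lra. Qed.

(* Between <z>^r and a large multiple of it beyond [Rn]; with all [n] at once, a bound in these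
   weights is the de la Vallee-Poussin form of a uniform decay of the tails in H^r. *)
Definition tw (r : R) n (Rn : R) a : R := a `^ r + n.+1%:R * Num.min (a `^ r) (Rn^-1 * a `^ (r + 1)).

Lemma tw_weight r n (Rn : R) : 0 < Rn -> weight p (fun a : R => a `^ r) ->
  weight p (fun a : R => a `^ (r + 1)) -> weight p (tw r n Rn).
Proof.
move=> R0 w1 w2; apply: weightD => //; apply: weightZ => //.
by apply: weight_min => //; apply: weightZ; rewrite ?invr_gt0.
Qed.

(** [Wn] and [Vn] are the weights [tw] of orders [s + 1] and [s]; the latter measures [Bop], which
    has one derivative less. A single bound [M] serves all [n] because the radii [Rn n] are adapted
    to [g]. *)
Lemma tight_weights g : Hs (s + 1) g ->
  exists (Wn Vn : nat -> R -> R) (Rn : nat -> R) (M : R), 0 < M /\ forall n,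
  [/\ weight p (Wn n), weight p (Vn n), (forall a, 1 <= a -> Wn n a = a * Vn n a),
      (forall a, 1 <= a -> a `^ (s + 1) <= Wn n a) &
      (forall a, 1 <= a -> Rn n <= a -> n.+1%:R * a `^ (s + 1) <= Wn n a)] /\
  (wL2 (Wn n) g /\ wn (Wn n) g <= M).
Proof.
move=> Hg; have mg := wL2_meas ws1 Hg.
have main n : exists Rn : R, [/\ 0 < Rn, wL2 (tw (s + 1) n Rn) g & wn (tw (s + 1) n Rn) g <= ns (s + 1) g + 1].
  pose c : R := n.+1%:R; have c0 : 0 < c by rewrite ltr0n.
  have e0 : 0 < (2 * c)^-1 by rewrite invr_gt0 mulr_gt0.
  have [N0 hN] := tail_small ws1 Hg e0.
  pose N := Num.max 0 N0; have N00 : 0 <= N by rewrite le_max lexx.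
  have tN := hN N (_ : N0 <= N); rewrite le_max lexx orbT in tN; have {}tN := tN isT.
  (* With this radius the frequencies below [N] contribute at most [1 / (2 c)] to the capped part,
     the same as the tail beyond [N]; multiplied by [c] the capped part has norm at most 1. *)
  pose Rn := 1 + 2 * c * (1 + N) * ns (s + 1) g.
  have n0 : 0 <= ns (s + 1) g := wn_ge0 _ _.
  have Rp : 0 < Rn by rewrite ltr_pwDl// !mulr_ge0// ?addr_ge0// ltW.
  exists Rn; pose U a := Num.min (a `^ (s + 1)) (Rn^-1 * a `^ (s + 1 + 1)).
  have ws2' : weight p (fun a : R => a `^ (s + 1 + 1)) by rewrite (_ : s + 1 + 1 = s + 2)//; ring.
  have wU : weight p U by apply: weight_min => //; apply: weightZ; rewrite ?invr_gt0.
  have wW := tw_weight n Rp ws1 ws2'.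
  have U1 (z : R * R) : U (jb z) <= jb z `^ (s + 1) by rewrite ge_min lexx.
  have [Lc nc] := wL2_cut N ws1 Hg; have [Lt nt] := wL2_tail N ws1 Hg.
  have UF F : measurable_fun setT (F : P -> R) -> Hs (s + 1) F -> wL2 U F /\ wn U F <= ns (s + 1) F.
    by move=> mF HF; apply: (wL2_le wU ws1) => // z; rewrite ler_wpM2r.
  have [LUg _] := UF g mg Hg.
  have [LUt nUt] := UF _ (wL2_meas ws1 Lt) Lt.
  have k0 : 0 <= (1 + N) / Rn by apply: divr_ge0; [exact: addr_ge0|exact: ltW].
  have [LUc nUc] : wL2 U (cut N g) /\ wn U (cut N g) <= (1 + N) / Rn * ns (s + 1) g.
    rewrite -(ger0_norm k0) -(wnZ _ Hg); apply: (wL2_le wU ws1); [exact: measurable_cut|exact: wL2Z|].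
    move=> z; rewrite /cut normrM; have [h|h] := leP (rad z) N; last by rewrite /= normr0 !mulr0 mulr_ge0 ?powR_ge0.
    rewrite /= normr1 mulr1 normrM (ger0_norm k0) mulrA ler_wpM2r//.
    have : U (jb z) <= Rn^-1 * jb z `^ (s + 1 + 1) by rewrite ge_min lexx orbT.
    move=> h1; apply: le_trans h1 _.
    rewrite powRD ?(gt_eqF (jb_gt0 z)) ?implybT// (powRr1 (ltW (jb_gt0 z))).
    rewrite mulrCA ler_wpM2l ?powR_ge0// mulrC ler_wpM2r ?invr_ge0 ?(ltW Rp)//.
    by apply: le_trans (jb_le1rad z) _; rewrite lerD2l.
  have nU : wn U g <= c^-1.
    have gE : g = fun z => cut N g z + (g z - cut N g z) by apply/funext => z; rewrite subrKC.
    rewrite {1}gE; apply: le_trans (wnD LUc LUt) _.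
    have -> : c^-1 = (2 * c)^-1 + (2 * c)^-1 by field; rewrite gt_eqF.
    apply: lerD; last exact: le_trans nUt tN.
    apply: le_trans nUc _; rewrite mulrAC ler_pdivrMr// [leRHS]mulrC ler_pdivlMr ?mulr_gt0//.
    by rewrite /Rn [leLHS](_ : _ = 2 * c * (1 + N) * ns (s + 1) g) ?lerDr//; ring.
  have WE z : tw (s + 1) n Rn (jb z) * g z = jb z `^ (s + 1) * g z + c * (U (jb z) * g z).
    by rewrite /tw mulrDl -mulrA.
  have LW : wL2 (tw (s + 1) n Rn) g.
    by rewrite /wL2; under [X in L2 _ X]eq_fun do rewrite WE; apply: L2D => //; exact: L2Z.
  split => //; rewrite /wn; under eq_fun do rewrite WE.
  apply: le_trans (nrmD Hg (L2Z c LUg)) _; rewrite lerD2l (nrmZ c LUg) (gtr0_norm c0).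
  by rewrite mulrC -ler_pdivlMr// mul1r.
have [Rn hR] := choice main.
exists (fun n => tw (s + 1) n (Rn n)), (fun n => tw s n (Rn n)), Rn, (ns (s + 1) g + 1).
split; first by rewrite ltr_wpDl// wn_ge0.
move=> n; have [R0 h1 h2] := hR n; split => //; split.
- by apply: tw_weight => //; rewrite (_ : s + 1 + 1 = s + 2)//; ring.
- exact: tw_weight.
- move=> a a1; have a0 : 0 < a by exact: lt_le_trans a1.
  have e r : a `^ (r + 1) = a * a `^ r by rewrite powRD ?(gt_eqF a0) ?implybT// (powRr1 (ltW a0)) mulrC.
  rewrite /tw mulrDr -(e s); congr (_ + _); rewrite mulrCA; congr (_ * _).
  by rewrite minr_pMr ?ltW// -(e s) mulrCA -(e (s + 1)).
- move=> a a1; rewrite /tw lerDl mulr_ge0// le_min powR_ge0 mulr_ge0 ?powR_ge0//.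
  by rewrite invr_ge0 ltW.
- move=> a a1 Ra; have a0 : 0 < a by exact: lt_le_trans a1.
  rewrite /tw min_l; first by rewrite lerDr powR_ge0.
  rewrite [a `^ (s + 1 + 1)]powRD ?(gt_eqF a0) ?implybT// (powRr1 (ltW a0)) mulrCA.
  by rewrite ler_peMr ?powR_ge0// mulrC ler_pdivlMr// mul1r.
Qed.

End Tightness.

(** * Uniform bounds on tight families *)

Section Compactness.
Context {R : realType} (s : R) (p : nat) (hs : 2 < s) (hp : s + 2 <= p%:R).
Local Notation P := (plane R).
Local Notation mu := (@lebesgue_measure R \x @lebesgue_measure R)%E.
Implicit Types (F G g : R * R -> R) (z : R * R) (n : nat) (W V : R -> R) (N a : R) (m : R * R -> R).
Local Notation K := (Kc s p).
Let ws := weight_s hs hp.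
Let ws1 := weight_s1 hs hp.
Let K0 : 0 <= K := Kc_ge0 s p.

Lemma Bop_sub m F G : kern 1 0 m -> Hs (s + 1) F -> Hs (s + 1) G ->
  Hs s (fun z => Bop m F F z - Bop m G G z) /\
  ns s (fun z => Bop m F F z - Bop m G G z) <=
    2 * K * (ns (s + 1) F + ns (s + 1) G) * ns (s + 1) (fun z => F z - G z).
Proof.
move=> Km HF HG; pose e z := F z - G z.
have He : Hs (s + 1) e := wL2B HF HG.
have [HF0 nF] := Hs_le hs hp HF; have [HG0 nG] := Hs_le hs hp HG; have [He0 ne] := Hs_le hs hp He.
have [k1 B1 _] := est_s hs hp Km HF0 HF; have [k2 B2 _] := est_s hs hp Km HG0 HG.
have [k3 B3 n3] := est_s hs hp Km HF0 He; have [k4 B4 n4] := est_s hs hp Km He0 HG.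
have Hd : Hs s (fun z => Bop m F F z - Bop m G G z) := wL2B B1 B2.
split => //.
have E : {ae mu, forall x : P, Bop m F F x - Bop m G G x = Bop m F e x + Bop m e G x}.
  apply: filterS2 (filterI k1 k2) (filterI k3 k4) => x [i1 i2] [i3 i4].
  have E mm A B : Bop mm A B x = c2pi * \int[mu]_y kB mm A B (x, y) by [].
  rewrite !E -mulrBr -mulrDr -(RintegralB _ i1 i2)// -(RintegralD _ i3 i4)//; congr (_ * _).
  by apply: eq_Rintegral => y _; rewrite /kB /evp /odp /e/=; field.
have Hsum := wL2D B3 B4.
have -> : ns s (fun z => Bop m F F z - Bop m G G z) = ns s (fun z => Bop m F e z + Bop m e G z) := wn_ae Hd Hsum E.
apply: le_trans (wnD B3 B4) _; apply: le_trans (lerD n3 n4) _; rewrite !mul1r -/e.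
have n0 (r : R) H : 0 <= ns r H := wn_ge0 _ _.
have a1 := n0 s F; have a2 := n0 s e; have a3 := n0 (s + 1) e; have a4 := n0 (s + 1) G.
move: (ns s F) (ns (s + 1) F) (ns s e) (ns (s + 1) e) (ns (s + 1) G) K K0 nF ne a1 a2 a3 a4.
move=> f f1 e0 e1 g1 k k0 nf nE a1 a2 a3 a4.
rewrite mulrDr mulrDl; apply: lerD; first by rewrite ler_wpM2r// ler_wpM2l// mulr_ge0.
by rewrite [leRHS]mulrAC ler_wpM2r// ler_wpM2l// mulr_ge0.
Qed.

Context (Wn Vn : nat -> R -> R) (Rn : nat -> R) (M : R) (M0 : 0 < M).
Context (HT : forall n,
  [/\ weight p (Wn n), weight p (Vn n), (forall a, 1 <= a -> Wn n a = a * Vn n a),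
      (forall a, 1 <= a -> a `^ (s + 1) <= Wn n a) &
      (forall a, 1 <= a -> Rn n <= a -> n.+1%:R * a `^ (s + 1) <= Wn n a)]).

Definition tight F : Prop := forall n, wL2 (Wn n) F /\ wn (Wn n) F <= M.

Lemma tight_Hs F : tight F -> Hs (s + 1) F /\ ns (s + 1) F <= M.
Proof.
move=> tF; have [LF nF] := tF 0%N; have [w0 _ _ h _] := HT 0%N.
have mF := wL2_meas w0 LF.
have [h1 h2] := wL2_le ws1 w0 mF LF (fun z => ler_wpM2r (normr_ge0 _) (h _ (jb_ge1 z))).
by split => //; exact: le_trans h2 nF.
Qed.

Lemma tail_gen W V (n : nat) (Rr N : R) F : weight p W -> weight p V -> wL2 W F ->
  (forall a, 1 <= a -> Rr <= a -> n.+1%:R * V a <= W a) -> Rr <= N -> 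
  wn V (fun z => F z - cut N F z) <= wn W F / n.+1%:R.
Proof.
move=> wW wV LF h RN; have mF := wL2_meas wW LF.
have c0 : 0 <= n.+1%:R^-1 :> R by rewrite invr_ge0.
rewrite mulrC -(ger0_norm c0) -(wnZ _ LF).
apply: (proj2 (wL2_le wV wW _ (wL2Z _ LF) _)).
  by apply: measurable_funB => //; exact: measurable_cut.
move=> z; rewrite /cut; have [zN|zN] := leP (rad z) N.
  by rewrite /= mulr1 subrr normr0 mulr0 mulr_ge0// (Wjb_ge0 _ wW).
rewrite mulr0 subr0 normrM (ger0_norm c0) mulrA ler_wpM2r// ler_pdivlMr// mulrC.
by apply: h; [exact: jb_ge1|apply: le_trans RN _; exact: le_trans (ltW zN) (rad_le_jb z)].
Qed.

Lemma tight_tail n N F : Rn n <= N -> tight F ->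
  ns (s + 1) (fun z => F z - cut N F z) <= M / n.+1%:R.
Proof.
move=> RN tF; have [LF nF] := tF n; have [w0 _ _ _ h] := HT n.
apply: le_trans (tail_gen w0 ws1 LF h RN) _.
by rewrite ler_wpM2r// invr_ge0.
Qed.

Lemma small_frac (c e : R) : 0 < e -> exists n : nat, c / n.+1%:R <= e.
Proof.
move=> e0; exists (Num.truncn (`|c| / e)).
rewrite ler_pdivrMr// mulrC -ler_pdivrMr//; apply: ltW.
apply: le_lt_trans _ (truncnS_gt (_ : R)).
by rewrite ler_pM2r ?invr_gt0// ler_norm.
Qed.

Lemma tight_tail_e e : 0 < e -> exists N0, 0 <= N0 /\ forall N F, N0 <= N -> tight F ->
  ns (s + 1) (fun z => F z - cut N F z) <= e.
Proof.
move=> e0; have [n ne] := small_frac M e0.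
exists (Num.max 0 (Rn n)); split; first by rewrite le_max lexx.
move=> N F; rewrite ge_max => /andP[_ RN] tF; apply: le_trans (tight_tail RN tF) ne.
Qed.

(** Bernstein at low frequencies and uniformly small tails at high ones: on a tight family,
    closeness in H^s implies closeness in H^(s+1). *)
Lemma tight_interp e : 0 < e -> exists d, 0 < d /\ forall F G, tight F -> tight G ->
  ns s (fun z => F z - G z) <= d -> ns (s + 1) (fun z => F z - G z) <= e.
Proof.
move=> e0; have e4 : 0 < e / 4 by rewrite divr_gt0.
have [N [N0 hN]] := tight_tail_e e4.
exists (e / 2 / (1 + N)); split; first by rewrite !divr_gt0// ltr_pwDl.
move=> F G tF tG; set D := fun z => F z - G z => nD.
have [HF _] := tight_Hs tF; have [HG _] := tight_Hs tG.
have HD : Hs (s + 1) D := wL2B HF HG; have [HD0 _] := Hs_le hs hp HD.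
have [Hc nc] := wL2_cut N ws HD0.
have [Hc1 nc1] := Hs1_cut hs hp N0 Hc (cut_idem N D).
have [HtF _] := wL2_tail N ws1 HF; have [HtG _] := wL2_tail N ws1 HG.
have DE : D = fun z => cut N D z + ((F z - cut N F z) - (G z - cut N G z)).
  by apply/funext => z; rewrite /D cutB; ring.
rewrite DE; apply: le_trans (wnD Hc1 (wL2B HtF HtG)) _.
apply: le_trans (lerD nc1 (wnB HtF HtG)) _.
apply: le_trans (lerD (lexx _) (lerD (hN _ _ (lexx N) tF) (hN _ _ (lexx N) tG))) _.
have N1 : 0 < 1 + N by rewrite ltr_pwDl.
have h1 : (1 + N) * ns s (cut N D) <= e / 2.
  by rewrite mulrC -ler_pdivlMr//; exact: le_trans nc nD.
apply: le_trans (lerD h1 (lexx _)) _.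
by rewrite [leLHS](_ : _ = e)//; field.
Qed.

Lemma tight_B m F : kern 1 0 m -> tight F ->
  Hs s (Bop m F F) /\ ns s (Bop m F F) <= 2 * K * M ^+ 2.
Proof.
move=> Km tF; have [HF nF] := tight_Hs tF; have [HF0 nF0] := Hs_le hs hp HF.
have [_ HB nB] := est_s hs hp Km HF0 HF; split => //.
apply: le_trans nB _; rewrite mul1r expr2.
have n0 (r : R) H : 0 <= ns r H := wn_ge0 _ _.
have a1 : ns s F <= M := le_trans nF0 nF.
have := ler_pM (n0 _ _) (n0 _ _) a1 nF; rewrite -(mulrA (2 * K)).
by move=> /(ler_wpM2l (mulr_ge0 (ler0n R 2) K0)).
Qed.

(** [Wn n] is <z> times [Vn n], so [est_W] bounds [Bop] in the weight [Vn n], which exceeds [n.+1]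
    times <z>^s at large frequencies. *)
Lemma tight_B_tail m e : kern 1 0 m -> 0 < e -> exists N0, forall N F, N0 <= N -> tight F ->
  ns s (fun z => Bop m F F z - cut N (Bop m F F) z) <= e.
Proof.
move=> Km e0; have [n ne] := small_frac (2 * K * M ^+ 2) e0.
exists (Rn n) => N F RN tF; have [HF nF] := tight_Hs tF; have [HF0 nF0] := Hs_le hs hp HF.
have [LW nW] := tF n; have [wW wV WV _ h] := HT n.
have mF := wL2_meas ws HF0.
have VW (z : R * R) : Vn n (jb z) <= Wn n (jb z).
  by rewrite (WV _ (jb_ge1 z)) ler_peMl ?jb_ge1// (Wjb_ge0 _ wV).
have [LV nV] := wL2_le wV wW mF LW (fun z => ler_wpM2r (normr_ge0 _) (VW z)).
have e1 z : Vn n (jb z) * (jb z * F z) = Wn n (jb z) * F z.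
  by rewrite (WV _ (jb_ge1 z)) mulrA (mulrC (jb z)).
have LVj : wL2 (Vn n) (fun z => jb z * F z).
  by move: LW; rewrite /wL2; under [X in L2 _ X]eq_fun do rewrite -e1.
have nVj : wn (Vn n) (fun z => jb z * F z) = wn (Wn n) F.
  by rewrite /wn; under eq_fun do rewrite e1.
have [_ LB nB] := est_W hs hp Km wV HF0 HF0 LV LVj.
have hV a : 1 <= a -> Rn n <= a -> n.+1%:R * a `^ s <= Vn n a.
  move=> a1 Ra; have a0 : 0 < a by exact: lt_le_trans a1.
  have := h a a1 Ra; rewrite (WV _ a1) powRD ?(gt_eqF a0) ?implybT// (powRr1 (ltW a0)) mulrA.
  by rewrite [a * _]mulrC ler_pM2r.
apply: le_trans (tail_gen wV ws LB hV RN) _; apply: le_trans ne.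
rewrite ler_wpM2r ?invr_ge0//; apply: le_trans nB _; rewrite mul1r nVj.
have n0 (r : R) H : 0 <= ns r H := wn_ge0 _ _.
have a0 := n0 s F; have a1 : ns s F <= M := le_trans nF0 nF; have a2 := wn_ge0 (Wn n) F.
have a3 := wn_ge0 (Vn n) F; have a4 := le_trans nV nW.
rewrite [leRHS](_ : _ = K * (M * M + M * M)); last by ring.
by rewrite ler_wpM2l// lerD// ler_pM.
Qed.

End Compactness.

(** * Flows: comparison, existence and uniqueness *)

Section Steps.
Context {R : realType} (T : R) (T0 : 0 < T).
Implicit Types (t : R) (j k : nat).

(* Dyadic steps h and frequency cutoffs N tied by h (1 + N)^2 = 1, the stability condition of
   the explicit scheme. *)
Definition time_step j : R := T / 2 ^+ j.
Definition freq_cut j : R := Num.sqrt (time_step j)^-1 - 1.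
Definition time_index j t : nat := Num.truncn (t / time_step j).

Lemma hh_gt0 j : 0 < time_step j.
Proof. by rewrite divr_gt0 ?exprn_gt0. Qed.

Lemma hh_N j : time_step j <= 1 -> 0 <= freq_cut j /\ time_step j * (1 + freq_cut j) ^+ 2 <= 1.
Proof.
move=> h1; have h0 := hh_gt0 j.
have i1 : 1 <= (time_step j)^-1 by rewrite invf_ge1.
rewrite /freq_cut subr_ge0 subrKC sqr_sqrtr ?invr_ge0 ?(ltW h0)// mulfV ?gt_eqF//; split => //.
by rewrite -[leLHS]sqrtr1 ler_wsqrtr.
Qed.

Lemma hh_small d : 0 < d -> exists j0, forall j, (j0 <= j)%N -> time_step j <= d.
Proof.
move=> d0; exists (Num.truncn (T / d)).+1 => j jj.
have h2 : (j%:R : R) <= 2 ^+ j by rewrite -natrX ler_nat ltnW// ltn_expl.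
have h3 : T / d <= j%:R.
  by apply: ltW; apply: lt_le_trans (truncnS_gt (_ : R)) _; rewrite ler_nat.
rewrite /time_step ler_pdivrMr ?exprn_gt0// mulrC -ler_pdivrMr//; exact: le_trans h3 h2.
Qed.

Lemma NN_big N0 : exists j0, forall j, (j0 <= j)%N -> N0 <= freq_cut j.
Proof.
pose c := Num.max 1 (N0 + 1); have c1 : 1 <= c by rewrite le_max lexx.
have c0 : 0 < c by exact: lt_le_trans c1.
have c2 : 0 < (c ^+ 2)^-1 by rewrite invr_gt0 exprn_gt0.
have [j0 h] := hh_small c2.
exists j0 => j /h hj; rewrite /freq_cut lerBrDr; apply: (@le_trans _ _ c); first by rewrite le_max lexx orbT.
rewrite -[leLHS](ger0_norm (ltW c0)) -sqrtr_sqr ler_wsqrtr//.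
by rewrite -[leLHS]invrK lef_pV2 ?posrE ?invr_gt0 ?exprn_gt0 ?hh_gt0.
Qed.

Lemma hh_T j : (2 ^ j)%:R * time_step j = T.
Proof. by rewrite /time_step natrX mulrCA mulfV ?mulr1// expf_neq0. Qed.

Lemma hh_add j i : (2 ^ i)%:R * time_step (j + i) = time_step j.
Proof. by rewrite /time_step natrX exprD invfM mulrCA (mulrCA (2 ^+ i)) mulfV ?mulr1// expf_neq0. Qed.

Lemma kk_le j t : 0 <= t -> (time_index j t)%:R * time_step j <= t.
Proof.
by move=> t0; rewrite -ler_pdivlMr ?hh_gt0// truncn_le// divr_ge0// ltW// hh_gt0.
Qed.

Lemma kk_gt j t : t < (time_index j t)%:R * time_step j + time_step j.
Proof. by rewrite -[X in _ + X]mul1r -mulrDl natr1 -ltr_pdivrMr ?hh_gt0// truncnS_gt. Qed.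

Lemma kk_max j t : 0 <= t -> t <= T -> (time_index j t <= 2 ^ j)%N.
Proof.
move=> t0 tT; rewrite -(ler_nat R) -(ler_pM2r (hh_gt0 j)) hh_T.
exact: le_trans (kk_le j t0) tT.
Qed.

Lemma kkT j k : (k <= 2 ^ j)%N -> 0 <= k%:R * time_step j /\ k%:R * time_step j <= T.
Proof.
move=> kj; split; first by rewrite mulr_ge0// ltW// hh_gt0.
by rewrite -(hh_T j) ler_wpM2r ?ler_nat// ltW// hh_gt0.
Qed.

Lemma kk0 j : time_index j 0 = 0%N.
Proof. by rewrite /time_index mul0r truncn0. Qed.

Lemma kk_refine j i t : 0 <= t -> (time_index j t * 2 ^ i <= time_index (j + i) t)%N /\
  (time_index (j + i) t)%:R * time_step (j + i) <= (time_index j t * 2 ^ i)%:R * time_step (j + i) + time_step j.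
Proof.
move=> t0; have e : (time_index j t * 2 ^ i)%:R * time_step (j + i) = (time_index j t)%:R * time_step j.
  by rewrite natrM -mulrA hh_add.
split; last by rewrite e; apply: le_trans (kk_le _ t0) (ltW (kk_gt _ _)).
rewrite -ltnS -(ltr_nat R) -(ltr_pM2r (hh_gt0 (j + i))) e.
by apply: le_lt_trans (kk_le j t0) _; rewrite -natr1 mulrDl mul1r kk_gt.
Qed.

End Steps.

(** * Comparing the scheme with a flow *)

Section Compare.
Context {R : realType} (s : R) (p : nat) (hs : 2 < s) (hp : s + 2 <= p%:R) (T : R) (T0 : 0 < T).
Local Notation P := (plane R).
Local Notation mu := (@lebesgue_measure R \x @lebesgue_measure R)%E.
Implicit Types (F G g : R * R -> R) (z : R * R) (j k n : nat) (N t Y d : R) (m : R * R -> R)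
  (gam : R -> R * R -> R).
Local Notation K := (Kc s p).
Let ws := weight_s hs hp.
Let ws1 := weight_s1 hs hp.
Let K0 : 0 <= K := Kc_ge0 s p.

(* A curve in H^(s+1) whose time derivative in H^s is [Bop m gam gam], with
   all the quantifiers uniform in time. *)
Definition flow m Y gam : Prop :=
  [/\ forall t, 0 <= t -> t <= T -> Hs (s + 1) (gam t) /\ ns (s + 1) (gam t) <= Y,
      forall e, 0 < e -> exists N0, forall N t, N0 <= N -> 0 <= t -> t <= T ->
        ns (s + 1) (fun z => gam t z - cut N (gam t) z) <= e &
      forall e, 0 < e -> exists2 del, 0 < del & forall t t', 0 <= t -> t <= T -> 0 <= t' -> t' <= T ->
        `|t' - t| <= del ->
        ns s (fun z => gam t' z - (gam t z + (t' - t) * Bop m (gam t) (gam t) z)) <= e * `|t' - t|].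

(** The square root of the Gronwall factor, so that the bound on the squared error becomes linear in
    the sources of error. *)
Definition Cst Y : R := Num.sqrt (expR (Astep s p Y * T) * (T * 5)).

Lemma flow_B m Y gam t : kern 1 0 m -> flow m Y gam -> 0 <= t -> t <= T ->
  Hs s (Bop m (gam t) (gam t)) /\ ns s (Bop m (gam t) (gam t)) <= 2 * K * Y ^+ 2.
Proof.
move=> Km [h1 _ _] t0 tT; have [HF nF] := h1 t t0 tT; have [HF0 nF0] := Hs_le hs hp HF.
have [_ HB nB] := est_s hs hp Km HF0 HF; split => //.
apply: le_trans nB _; rewrite mul1r expr2.
have n0 (r : R) H : 0 <= ns r H := wn_ge0 _ _.
have := ler_pM (n0 _ _) (n0 _ _) (le_trans nF0 nF) nF; rewrite -(mulrA (2 * K)).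
by move=> /(ler_wpM2l (mulr_ge0 (ler0n R 2) K0)).
Qed.

Lemma flow_lip m Y gam : kern 1 0 m -> flow m Y gam -> forall e, 0 < e ->
  exists2 del, 0 < del & forall t t', 0 <= t -> t <= T -> 0 <= t' -> t' <= T ->
  `|t' - t| <= del -> ns s (fun z => gam t' z - gam t z) <= e.
Proof.
move=> Km fl e e0; have [h1 _ h3] := fl; have [del del0 hd] := h3 1 ltr01.
pose c := 1 + 2 * K * Y ^+ 2.
have c0 : 0 < c by rewrite ltr_pwDl// mulr_ge0 ?sqr_ge0// mulr_ge0.
exists (Num.min del (e / c)); first by rewrite lt_min del0 divr_gt0.
move=> t t' t0 tT t0' tT'; rewrite le_min => /andP[d1 d2].
have [Ht _] := h1 t t0 tT; have [Ht' _] := h1 t' t0' tT'.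
have [Ht0 _] := Hs_le hs hp Ht; have [Ht0' _] := Hs_le hs hp Ht'.
have [HB nB] := flow_B Km fl t0 tT.
have Hx := wL2D Ht0 (wL2Z (t' - t) HB).
apply: le_trans (wn_triangle Ht0' Hx Ht0) _.
have e2 : (fun z => gam t z + (t' - t) * Bop m (gam t) (gam t) z - gam t z) =
          (fun z => (t' - t) * Bop m (gam t) (gam t) z) by apply/funext => z; rewrite addrAC subrr add0r.
rewrite e2 (wnZ _ HB).
apply: le_trans (lerD (hd t t' t0 tT t0' tT' d1) (ler_wpM2l (normr_ge0 _) nB)) _.
by move: d2; rewrite ler_pdivlMr// /c; lra.
Qed.

Lemma Cst_ge0 Y : 0 <= Cst Y. Proof. exact: sqrtr_ge0. Qed.

Lemma Cst_sqr Y b : expR (Astep s p Y * T) * (T * (5 * b ^+ 2)) = (Cst Y * b) ^+ 2.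
Proof.
rewrite exprMn /Cst sqr_sqrtr; first by ring.
by rewrite mulr_ge0 ?expR_ge0// mulr_ge0// ltW.
Qed.

(** Sampled on the grid, the flow satisfies the Euler step up to a residual that uniform
    differentiability makes small, so it can be the reference of [stability]; tails and residual
    cost [e] in all. *)
Lemma flow_cmp m m' d Y gam g0 e : kern 1 0 m -> kern 1 0 m' -> kern d 1 (fun z => m z - m' z) ->
  flow m' Y gam -> Hs s g0 -> {ae mu, forall z : P, g0 z = gam 0 z} ->
  0 < e -> Cst Y * (2 * K * d * Y ^+ 2 + e) <= 1 ->
  exists j0, forall j k, (j0 <= j)%N -> (k <= 2 ^ j)%N -> time_step T j <= 1 /\
   ns s (fun z => galerkin (time_step T j) (freq_cut T j) m g0 k z - cut (freq_cut T j) (gam (k%:R * time_step T j)) z) <=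
   Cst Y * (2 * K * d * Y ^+ 2 + e).
Proof.
move=> Km Km' Kd fl H0 g00 e0 small; have [h1 h2 h3] := fl.
have Y0 : 0 <= Y by apply: le_trans (h1 0 (lexx 0) (ltW T0)).2; exact: wn_ge0.
have e2 : 0 < e / 2 by rewrite divr_gt0.
have [del del0 hd] := h3 _ e2.
(* Tails below [e / 2 / c] contribute at most [e / 2] after multiplication by [4 * K * Y]; the
   residual takes the other half. *)
pose c := 4 * K * Y + 1; have c0 : 0 < c by rewrite ltr_wpDl// mulr_ge0// mulr_ge0.
have ec : 0 < e / 2 / c by rewrite divr_gt0.
have [N0 hN] := h2 _ ec.
have [j1 hj1] := NN_big T0 N0; have [j2 hj2] := hh_small T ltr01; have [j3 hj3] := hh_small T del0.
exists (maxn j1 (maxn j2 j3)) => j k; rewrite !geq_max => /andP[jj1 /andP[jj2 jj3]] kj.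
have hle := hj2 j jj2; have hdel := hj3 j jj3; have NN0 := hj1 j jj1.
split => //; have hp0 := hh_gt0 T0 j; have [Np hN2] := hh_N T0 hle.
pose h := time_step T j; pose N := freq_cut T j.
pose ga (k : nat) := gam (k%:R * h).
pose r (k : nat) z := h^-1 * (ga k.+1 z - (ga k z + h * Bop m' (ga k) (ga k) z)).
have d0 : 0 <= d by case: Kd.
have Hga i : (i <= 2 ^ j)%N -> Hs (s + 1) (ga i) /\ ns (s + 1) (ga i) <= Y.
  by move=> ij; have [a1 a2] := kkT T0 ij; exact: h1.
have incr (k' : nat) : k'.+1%:R * h - k'%:R * h = h by rewrite -natr1 mulrDl mul1r addrAC subrr add0r.
have HX i : (i < 2 ^ j)%N -> Hs s (fun z => ga i.+1 z - (ga i z + h * Bop m' (ga i) (ga i) z)).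
  move=> ij; have [Ha _] := Hga i.+1 ij; have [Hb _] := Hga i (ltnW ij).
  have [a1 a2] := kkT T0 (ltnW ij).
  have [HB _] := flow_B Km' fl a1 a2.
  exact: (wL2B (Hs_le hs hp Ha).1 (wL2D (Hs_le hs hp Hb).1 (wL2Z h HB))).
have := @stability _ s p hs hp m m' d Y T h N (2 ^ j) g0 ga r (e / 2 / c) (e / 2) Km Km' Kd (ltW hp0) hle Np hN2.
rewrite hh_T// => /(_ (lexx T) H0).
have p1 k' : (k' <= 2 ^ j)%N -> [/\ Hs (s + 1) (ga k'), ns (s + 1) (ga k') <= Y &
     ns (s + 1) (fun z => ga k' z - cut N (ga k') z) <= e / 2 / c].
  move=> kj'; have [a1 a2] := kkT T0 kj'; have [a3 a4] := Hga k' kj'; split => //.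
  exact: hN.
have p2 k' : (k' < 2 ^ j)%N -> [/\ Hs s (r k'), ns s (r k') <= e / 2 &
     {ae mu, forall z : P, ga k'.+1 z = ga k' z + h * (Bop m' (ga k') (ga k') z + r k' z)}].
  move=> kj'; have HXk := HX k' kj'; split.
  - exact: wL2Z.
  - have [a1 a2] := kkT T0 (ltnW kj'); have [a3 a4] := kkT T0 kj'.
    have := hd (k'%:R * h) (k'.+1%:R * h) a1 a2 a3 a4.
    rewrite incr (gtr0_norm hp0) => /(_ hdel) hX.
    have -> : ns s (r k') = `|h^-1| * ns s (fun z => ga k'.+1 z - (ga k' z + h * Bop m' (ga k') (ga k') z)) := wnZ _ HXk.
    by rewrite (@gtr0_norm _ h^-1) ?invr_gt0// mulrC ler_pdivrMr.
  - apply: aeW => z; rewrite /r mulrDr (mulrA h h^-1) mulfV ?gt_eqF// mul1r.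
    by rewrite addrA subrKC.
have g00' : {ae mu, forall z : P, g0 z = ga 0%N z} by rewrite /ga mul0r.
move=> /(_ p1 p2 g00'); cbv zeta; rewrite !Cst_sqr.
set b := 2 * K * _ + _.
have b0 : 0 <= b.
  rewrite /b; apply: addr_ge0; last exact: ltW.
  apply: mulr_ge0; first exact: mulr_ge0.
  apply: addr_ge0; apply: mulr_ge0; [exact: mulr_ge0|exact: ltW|exact: d0|exact: sqr_ge0].
have ble : b <= 2 * K * d * Y ^+ 2 + e.
  have q : 4 * K * Y * (e / 2 / c) <= e / 2.
    by rewrite mulrCA ler_piMr ?(ltW e2)// ler_pdivrMr// mul1r /c lerDl.
  by rewrite /b; move: q; move: (e / 2 / c) K => x k1 q; lra.
have Cb : Cst Y * b <= Cst Y * (2 * K * d * Y ^+ 2 + e) by rewrite ler_wpM2l// Cst_ge0.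
have Cb0 : 0 <= Cst Y * b by rewrite mulr_ge0// Cst_ge0.
move=> H; have {}H := H (_ : _ <= 1) k kj.
have : ns s (fun z => galerkin h N m g0 k z - cut N (ga k) z) <= Cst Y * b.
  rewrite -(@ler_pXn2r _ 2) ?nnegrE ?wn_ge0//; apply: H.
  by rewrite exprn_ile1//; exact: le_trans Cb small.
by move=> H'; exact: le_trans H' Cb.
Qed.

(** Off the grid, [time_index] rounds [t] down, the flow moves little within one step, and its
    frequencies beyond the cutoff are negligible. *)
Lemma flow_cmp_t m m' d Y gam g0 e : kern 1 0 m -> kern 1 0 m' -> kern d 1 (fun z => m z - m' z) ->
  flow m' Y gam -> Hs s g0 -> {ae mu, forall z : P, g0 z = gam 0 z} ->
  0 < e -> Cst Y * (2 * K * d * Y ^+ 2 + e) <= 1 ->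
  exists j0, forall j t, (j0 <= j)%N -> 0 <= t -> t <= T ->
   ns s (fun z => galerkin (time_step T j) (freq_cut T j) m g0 (time_index T j t) z - gam t z) <=
   Cst Y * (2 * K * d * Y ^+ 2 + e) + e.
Proof.
move=> Km Km' Kd fl H0 g00 e0 small; have [h1 h2 h3] := fl.
have e2 : 0 < e / 2 by rewrite divr_gt0.
have [N0 hN] := h2 _ e2; have [del del0 hd] := flow_lip Km' fl e2.
have [j1 hj1] := NN_big T0 N0; have [j3 hj3] := hh_small T del0.
have [j0 hj0] := flow_cmp Km Km' Kd fl H0 g00 e0 small.
exists (maxn j0 (maxn j1 j3)) => j t; rewrite !geq_max => /andP[jj0 /andP[jj1 jj3]] t0 tT.
have kj := @kk_max _ _ T0 j t t0 tT; have [a1 a2] := kkT T0 kj.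
have [hle hg] := hj0 j _ jj0 kj; have [Np _] := hh_N T0 hle.
set t' := (time_index T j t)%:R * time_step T j in hg a1 a2 *.
have Hg := gal_Hs hs hp (time_step T j) (time_index T j t) Km Np H0.
have [Ht1 _] := h1 t t0 tT; have [Ht1' _] := h1 t' a1 a2.
have [Ht _] := Hs_le hs hp Ht1; have [Ht' _] := Hs_le hs hp Ht1'.
have [Hc _] := wL2_cut (freq_cut T j) ws Ht'; have [Htl1 _] := wL2_tail (freq_cut T j) ws1 Ht1'.
have [_ Htl] := Hs_le hs hp Htl1.
apply: le_trans (wn_triangle Hg Hc Ht) _.
have -> : forall x, x + e = x + (e / 2 + e / 2) by move=> x; congr (_ + _); field.
apply: lerD; first exact: hg.
apply: le_trans (wn_triangle Hc Ht' Ht) _; apply: lerD.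
  rewrite wn_distC; apply: le_trans Htl _; apply: hN => //; exact: hj1.
apply: hd => //; rewrite distrC ger0_norm ?subr_ge0; last exact: kk_le.
by apply: le_trans (hj3 j jj3); rewrite lerBlDl ltW// kk_gt.
Qed.

End Compare.

Section SmallParameter.
Context {R : realType}.

(** Dividing by [c + 1] rather than by [c] covers [c = 0]. *)
Lemma small_gt0 (c e : R) : 0 <= c -> 0 < e -> 0 < e / (c + 1).
Proof. by move=> c0 e0; rewrite divr_gt0// ltr_wpDl. Qed.

Lemma small_le (c e x : R) : 0 <= c -> 0 < e -> x <= e / (c + 1) -> c * x <= e.
Proof.
move=> c0 e0; have c1 : 0 < c + 1 by rewrite ltr_wpDl.
rewrite ler_pdivlMr// => h; have [x0|x0] := leP 0 x; first by apply: le_trans h; rewrite mulrDr mulr1 mulrC lerDl.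
by apply: le_trans (ltW e0); rewrite mulr_ge0_le0// ltW.
Qed.

Lemma floor_gap (a b h t t' : R) : a <= t -> t < a + h -> b <= t' -> t' < b + h ->
  b - a <= t' - t + h /\ `|b - a - (t' - t)| <= h.
Proof. by move=> *; split; [lra|rewrite ler_norml; apply/andP; split; lra]. Qed.

Lemma half_sum (u h del : R) : u <= del / 2 -> h <= del / 2 -> u + h <= del.
Proof. by move=> *; lra. Qed.

Lemma gap_le (t t' h T : R) : 0 <= t -> t' <= T -> h <= 1 -> t' - t + h <= T + 1.
Proof. by move=> *; lra. Qed.

Lemma half_le (e : R) : 0 < e -> e / 2 <= e.
Proof. by move=> *; lra. Qed.

End SmallParameter.

(** * Existence as a limit of the scheme *)

Section Existence.
Context {R : realType} (s : R) (p : nat) (hs : 2 < s) (hp : s + 2 <= p%:R) (T : R) (T0 : 0 < T).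
Local Notation P := (plane R).
Local Notation mu := (@lebesgue_measure R \x @lebesgue_measure R)%E.
Implicit Types (F G g : R * R -> R) (z : R * R) (i j k l n : nat) (N t Y d e : R).
Local Notation K := (Kc s p).
Let ws := weight_s hs hp.
Let ws1 := weight_s1 hs hp.
Let K0 : 0 <= K := Kc_ge0 s p.

Lemma Hs_complete (F_ : nat -> R * R -> R) : (forall n, Hs s (F_ n)) ->
  (forall e, 0 < e -> exists N : nat, forall m n : nat, (N <= m)%N -> (N <= n)%N ->
    ns s (fun z => F_ m z - F_ n z) <= e) ->
  exists F, Hs s F /\ forall e, 0 < e -> exists N : nat, forall n, (N <= n)%N -> ns s (fun z => F_ n z - F z) <= e.
Proof.
move=> HF C; have C' e : 0 < e -> exists N : nat, forall m n : nat, (N <= m)%N -> (N <= n)%N ->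
    nrm mu (fun z => jb z `^ s * F_ m z - jb z `^ s * F_ n z) <= e.
  by move=> /C [N hN]; exists N => m n Nm Nn; have := hN m n Nm Nn; rewrite /ns wnBE.
have [f [Lf hf]] := L2_complete HF C'.
have e z : jb z `^ s * (jb z `^ (- s) * f z) = f z.
  by rewrite mulrA powRN mulfV ?mul1r// gt_eqF// powR_gt0// jb_gt0.
exists (fun z => jb z `^ (- s) * f z); split.
  by rewrite /Hs /wL2; under [X in L2 _ X]eq_fun do rewrite e.
move=> e1 /hf [N hN]; exists N => n /hN; rewrite /ns wnBE.
by under [X in nrm _ X <= _ -> _]eq_fun do rewrite -e.
Qed.

(** With equal symbols the gap is 0, so [stability] also compares two approximations of the same
    equation. *)
Lemma kern0 m : kern 1 0 m -> kern 0 1 (fun z : R * R => m z - m z).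
Proof.
move=> [_ mm mN _ _]; split => //.
- exact: measurable_funB.
- by move=> z; rewrite !subrr.
- by move=> z; rewrite subrr normr0 mulr0 mul0r.
- by move=> z _; rewrite subrr normr0 mulr0 mul0r.
Qed.

Lemma gal_ext h N (m g g' : R * R -> R) n : cut N g = cut N g' -> galerkin h N m g n = galerkin h N m g' n.
Proof. by move=> e; elim: n => [|n IH] //=; rewrite IH. Qed.

Lemma NN_le j i : freq_cut T j <= freq_cut T (j + i).
Proof.
rewrite lerB// ler_wsqrtr// lef_pV2 ?posrE ?hh_gt0// -(hh_add T j i).
by rewrite ler_peMl ?(ltW (hh_gt0 T0 _))// ler1n expn_gt0.
Qed.

Context (m : R * R -> R) (Km : kern 1 0 m) (g0 : R * R -> R) (Hg0 : Hs (s + 1) g0).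
Context (Wn Vn : nat -> R -> R) (Rn : nat -> R) (M : R) (M0 : 0 < M).
Context (HT : forall n,
  [/\ weight p (Wn n), weight p (Vn n), (forall a, 1 <= a -> Wn n a = a * Vn n a),
      (forall a, 1 <= a -> a `^ (s + 1) <= Wn n a) &
      (forall a, 1 <= a -> Rn n <= a -> n.+1%:R * a `^ (s + 1) <= Wn n a)]).
Local Notation gj j k := (galerkin (time_step T j) (freq_cut T j) m g0 k).
Local Notation tight := (tight Wn M).
Context (j0 : nat) (hle : forall j, (j0 <= j)%N -> time_step T j <= 1).
Context (tg : forall j k, (j0 <= j)%N -> (k <= 2 ^ j)%N -> tight (gj j k)).
Let L : R := 2 * K * M ^+ 2.
Let L0 : 0 <= L. Proof. by rewrite mulr_ge0 ?sqr_ge0// mulr_ge0. Qed.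
Let tH F : tight F -> Hs (s + 1) F /\ ns (s + 1) F <= M.
Proof. exact: (tight_Hs hs hp HT). Qed.
Let tH0 F : tight F -> Hs s F.
Proof. by move=> /tH [h _]; have [] := Hs_le hs hp h. Qed.
Let tB F : tight F -> Hs s (Bop m F F) /\ ns s (Bop m F F) <= L.
Proof. exact: (tight_B hs hp HT Km). Qed.

Let gj_lip j k i : (j0 <= j)%N -> (k + i <= 2 ^ j)%N ->
  ns s (fun z => gj j (k + i) z - gj j k z) <= i%:R * time_step T j * L.
Proof.
move=> jj; elim: i => [|i IH] ki.
  rewrite addn0 !mul0r (_ : (fun z => _) = (fun=> 0)).
    by rewrite /ns /wn; under eq_fun do rewrite mulr0; rewrite nrm0.
  by apply/funext => z; rewrite subrr.
have ki' : (k + i <= 2 ^ j)%N by apply: leq_trans ki; rewrite addnS.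
have kj : (k <= 2 ^ j)%N by apply: leq_trans ki'; exact: leq_addr.
have t1 := tg jj ki'; have [HB nB] := tB t1.
have [Hc nc] := wL2_cut (freq_cut T j) ws HB.
have HD := wL2B (tH0 t1) (tH0 (tg jj kj)).
have e : (fun z => gj j (k + i.+1) z - gj j k z) =
  (fun z => (gj j (k + i) z - gj j k z) + time_step T j * cut (freq_cut T j) (Bop m (gj j (k + i)) (gj j (k + i))) z).
  by apply/funext => z; rewrite addnS /= /galerkin_step addrAC.
rewrite e; apply: le_trans (wnD HD (wL2Z _ Hc)) _.
rewrite (wnZ _ Hc) (gtr0_norm (hh_gt0 T0 j)) -natr1 !mulrDl mul1r.
apply: lerD; first exact: IH.
by rewrite ler_wpM2l ?(ltW (hh_gt0 T0 j))//; exact: le_trans nc nB.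
Qed.

(** Over a time at most [del] the iterates stay close in H^s, hence in H^(s+1) by tightness, so each
    increment is nearly the time step times [Bop] at the starting iterate. *)
Let gj_diff e : 0 < e -> exists del j2, [/\ 0 < del, (j0 <= j2)%N &
  forall j k i, (j2 <= j)%N -> (k + i <= 2 ^ j)%N -> i%:R * time_step T j <= del ->
  ns s (fun z => gj j (k + i) z - (gj j k z + i%:R * time_step T j * Bop m (gj j k) (gj j k) z)) <=
  e * (i%:R * time_step T j)].
Proof.
move=> e0; have e2 : 0 < e / 2 by rewrite divr_gt0.
pose c := 2 * K * (M + M); have c0 : 0 <= c by apply: mulr_ge0; [exact: mulr_ge0|apply: addr_ge0; exact: ltW].
have [d [d0 hd]] := tight_interp hs hp M HT (small_gt0 c0 e2).
have [N0 hN] := tight_B_tail hs hp M HT Km e2.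
have [j1 hj1] := NN_big T0 N0.
exists (d / (L + 1)), (maxn j0 j1); split; [exact: small_gt0|exact: leq_maxl|].
move=> j k i; rewrite geq_max => /andP[jj jj1].
have kj0 (k' : nat) : (k + k' <= 2 ^ j)%N -> (k <= 2 ^ j)%N by move=> h; apply: leq_trans h; exact: leq_addr.
elim: i => [|i IH] ki hi.
  rewrite !mul0r mulr0 addn0 (_ : (fun z => _) = (fun=> 0)).
    by rewrite /ns /wn; under eq_fun do rewrite mulr0; rewrite nrm0.
  by apply/funext => z; rewrite mul0r addr0 subrr.
have ki' : (k + i <= 2 ^ j)%N by apply: leq_trans ki; rewrite addnS.
have hp0 := hh_gt0 T0 j.
have hi' : i%:R * time_step T j <= d / (L + 1).
  by apply: le_trans hi; rewrite ler_wpM2r ?(ltW hp0)// ler_nat.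
have t1 := tg jj ki'; have t0 := tg jj (kj0 _ ki').
have [HB1 _] := tB t1; have [HB0 _] := tB t0.
have lip := gj_lip jj ki'.
have near : ns (s + 1) (fun z => gj j (k + i) z - gj j k z) <= e / 2 / (c + 1).
  by apply: hd => //; apply: le_trans lip _; rewrite mulrC; exact: small_le.
have [HBd nBd] := Bop_sub hs hp Km (tH t1).1 (tH t0).1.
have nBd' : ns s (fun z => Bop m (gj j (k + i)) (gj j (k + i)) z - Bop m (gj j k) (gj j k) z) <= e / 2.
  apply: le_trans nBd _; apply: le_trans (ler_wpM2r (wn_ge0 _ _) _) (small_le c0 e2 near).
  apply: ler_wpM2l; first exact: mulr_ge0.
  by apply: lerD; [exact: (tH t1).2|exact: (tH t0).2].
have [Hc nc] := wL2_cut (freq_cut T j) ws HBd.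
have [Ht _] := wL2_tail (freq_cut T j) ws HB0.
have tl := hN _ _ (hj1 j jj1) t0.
have HD := wL2B (tH0 t1) (wL2D (tH0 t0) (wL2Z (i%:R * time_step T j) HB0)).
have HE := wL2B Hc Ht.
have E : (fun z => gj j (k + i.+1) z - (gj j k z + i.+1%:R * time_step T j * Bop m (gj j k) (gj j k) z)) =
  (fun z => (gj j (k + i) z - (gj j k z + i%:R * time_step T j * Bop m (gj j k) (gj j k) z)) +
     time_step T j * (cut (freq_cut T j) (fun z => Bop m (gj j (k + i)) (gj j (k + i)) z - Bop m (gj j k) (gj j k) z) z
       - (Bop m (gj j k) (gj j k) z - cut (freq_cut T j) (Bop m (gj j k) (gj j k)) z))).
  apply/funext => z; rewrite addnS /= /galerkin_step cutB -natr1.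
  move: (gj j (k + i) z) (gj j k z) (cut _ _ z) (cut _ _ z) (Bop _ _ _ z) => *; ring.
rewrite E; apply: le_trans (wnD HD (wL2Z _ HE)) _.
rewrite (wnZ _ HE) (gtr0_norm hp0) -natr1 mulrDl mul1r mulrDr; apply: lerD; first exact: IH.
rewrite [leRHS]mulrC ler_wpM2l ?(ltW hp0)//; apply: le_trans (wnB Hc Ht) _.
have -> : e = e / 2 + e / 2 by field.
by apply: lerD => //; exact: le_trans nc nBd'.
Qed.

Let CstM : 0 <= Cst s p T M := Cst_ge0 _ _ _ _.

(** The finer run, sampled at the coarse grid points, is the reference curve of [stability] with
    equal symbols; [gj_diff] bounds its residual. *)
Let gj_coarse e : 0 < e -> exists2 j3, (j0 <= j3)%N & forall j i k, (j3 <= j)%N -> (k <= 2 ^ j)%N ->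
  ns s (fun z => gj j k z - gj (j + i) (k * 2 ^ i) z) <= e.
Proof.
move=> e0; have e2 : 0 < e / 2 by rewrite divr_gt0.
pose e3 := Num.min 1 (e / 2); have e30 : 0 < e3 by rewrite lt_min ltr01.
pose rho := e3 / (Cst s p T M + 1) / 2.
have rho0 : 0 < rho by rewrite divr_gt0// small_gt0.
pose c := 4 * K * M; have c0 : 0 <= c by rewrite mulr_ge0 ?(ltW M0)// mulr_ge0.
pose t := Num.min (e / 2) (rho / (c + 1)); have t0 : 0 < t by rewrite lt_min e2 small_gt0.
have [N0 [N00 hN]] := tight_tail_e hs hp M HT t0.
have [del [j2 [del0 j02 hdel]]] := gj_diff rho0.
have [j1 hj1] := NN_big T0 N0; have [j4 hj4] := hh_small T del0.
exists (maxn (maxn j2 j0) (maxn j1 j4)); first by rewrite !leq_max leqnn orbT.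
move=> j i k; rewrite !geq_max => /andP[/andP[jj2 jj0] /andP[jj1 jj4]] kj.
pose q := (2 ^ i)%N; pose ga k := gj (j + i) (k * q).
have jji : (j2 <= j + i)%N by exact: leq_trans jj2 (leq_addr _ _).
have jj0i : (j0 <= j + i)%N by exact: leq_trans jj0 (leq_addr _ _).
have ix k' : (k' <= 2 ^ j)%N -> (k' * q <= 2 ^ (j + i))%N by move=> h; rewrite expnD leq_mul2r h orbT.
have tga k' : (k' <= 2 ^ j)%N -> tight (ga k') by move=> h; apply: tg => //; exact: ix.
have hp0 := hh_gt0 T0 j; have [Np hN2] := hh_N T0 (hle jj0).
have hq : q%:R * time_step T (j + i) = time_step T j by exact: hh_add.
pose h := time_step T j; pose N := freq_cut T j.
pose r k' z := h^-1 * (ga k'.+1 z - (ga k' z + h * Bop m (ga k') (ga k') z)).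
have HX k' : (k' < 2 ^ j)%N -> Hs s (fun z => ga k'.+1 z - (ga k' z + h * Bop m (ga k') (ga k') z)).
  move=> h'; exact: (wL2B (tH0 (tga _ h')) (wL2D (tH0 (tga _ (ltnW h'))) (wL2Z h (tB (tga _ (ltnW h'))).1))).
have Hga0 : Hs s (ga 0%N) := tH0 (tga _ (leq0n _)).
have := @stability _ s p hs hp m m 0 M T h N (2 ^ j) (ga 0%N) ga r t rho Km Km (kern0 Km) (ltW hp0) (hle jj0) Np hN2.
rewrite hh_T// => /(_ (lexx T) Hga0).
have p1 k' : (k' <= 2 ^ j)%N -> [/\ Hs (s + 1) (ga k'), ns (s + 1) (ga k') <= M &
     ns (s + 1) (fun z => ga k' z - cut N (ga k') z) <= t].
  move=> h'; have [a1 a2] := tH (tga _ h'); split => //.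
  by apply: hN; [exact: hj1|exact: tga].
have p2 k' : (k' < 2 ^ j)%N -> [/\ Hs s (r k'), ns s (r k') <= rho &
     {ae mu, forall z : P, ga k'.+1 z = ga k' z + h * (Bop m (ga k') (ga k') z + r k' z)}].
  move=> h'; have HXk := HX k' h'; split.
  - exact: wL2Z.
  - have ii : (k' * q + q <= 2 ^ (j + i))%N by rewrite -mulSnr; exact: ix.
    have := hdel (j + i)%N (k' * q)%N q jji ii; rewrite hq => /(_ (hj4 j jj4)).
    rewrite -mulSnr => hX.
    have -> : ns s (r k') = `|h^-1| * ns s (fun z => ga k'.+1 z - (ga k' z + h * Bop m (ga k') (ga k') z)) := wnZ _ HXk.
    by rewrite (@gtr0_norm _ h^-1) ?invr_gt0// mulrC ler_pdivrMr.
  - by apply: aeW => z; rewrite /r mulrDr (mulrA h h^-1) mulfV ?gt_eqF// mul1r addrA subrKC.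
have g00 : {ae mu, forall z : P, ga 0%N z = ga 0%N z} by apply: aeW.
move=> /(_ p1 p2 g00); cbv zeta; rewrite !Cst_sqr//; set b := 2 * K * _ + _.
have tc : c * t <= rho by apply: small_le => //; rewrite ge_min lexx orbT.
have bE : b = c * t + rho by rewrite /b /c; move: K => k1; ring.
have b0 : 0 <= b by rewrite bE; apply: addr_ge0; [apply: mulr_ge0 => //|]; exact: ltW.
have Cb : Cst s p T M * b <= e3.
  apply: (small_le CstM e30); rewrite bE; apply: le_trans (lerD tc (lexx _)) _.
  by rewrite /rho [leLHS](_ : _ = e3 / (Cst s p T M + 1))//; field; rewrite gt_eqF// ltr_wpDl.
have Cb0 : 0 <= Cst s p T M * b by rewrite mulr_ge0.
have Cb1 : (Cst s p T M * b) ^+ 2 <= 1.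
  by rewrite exprn_ile1//; apply: le_trans Cb _; rewrite ge_min lexx.
move=> /(_ Cb1 k kj).
(* The coarse scheme sees its datum only below its own, smaller cutoff, so starting from [g0] or
   from the finer cut of [g0] is the same. *)
rewrite (_ : galerkin h N m (ga 0%N) k = gj j k); last first.
  by apply: gal_ext; rewrite /ga mul0n /= cut_cut// NN_le.
rewrite ler_pXn2r ?nnegrE ?wn_ge0// => H.
have Hc := (wL2_cut N ws (tH0 (tga k kj))).1.
have Htl := (wL2_tail N ws1 (tH (tga k kj)).1).1.
apply: le_trans (wn_triangle (tH0 (tg jj0 kj)) Hc (tH0 (tga k kj))) _.
have -> : e = e / 2 + e / 2 by field.
apply: lerD.
  by apply: le_trans H _; apply: le_trans Cb _; rewrite ge_min lexx orbT.
rewrite wn_distC; apply: le_trans (Hs_le hs hp Htl).2 _.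
have [_ _ h3] := p1 k kj; apply: le_trans h3 _.
by rewrite ge_min lexx.
Qed.

Let gt j t : R * R -> R := gj j (time_index T j t).

Let gt_tight j t : (j0 <= j)%N -> 0 <= t -> t <= T -> tight (gt j t).
Proof. by move=> jj t0 tT; apply: tg => //; exact: kk_max. Qed.

(** The coarse and fine roundings of [t] differ by at most one coarse step, which [gj_lip] controls;
    [gj_coarse] does the rest. *)
Let gt_cauchy e : 0 < e -> exists2 j4, (j0 <= j4)%N & forall j i t, (j4 <= j)%N -> 0 <= t -> t <= T ->
  ns s (fun z => gt j t z - gt (j + i) t z) <= e.
Proof.
move=> e0; have e2 : 0 < e / 2 by rewrite divr_gt0.
have [j3 j03 h3] := gj_coarse e2; have [j4 h4] := hh_small T (small_gt0 L0 e2).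
exists (maxn j3 j4); first by rewrite leq_max j03.
move=> j i t; rewrite geq_max => /andP[jj3 jj4] t0 tT.
have jj0 := leq_trans j03 jj3; have jj0i : (j0 <= j + i)%N by exact: leq_trans jj0 (leq_addr _ _).
have kj := kk_max T0 j t0 tT; have kji := kk_max T0 (j + i) t0 tT.
have [r1 r2] := kk_refine T0 j i t0.
have kq : (time_index T j t * 2 ^ i <= 2 ^ (j + i))%N by exact: leq_trans kji.
have tm := tg jj0i kq.
apply: le_trans (wn_triangle (tH0 (gt_tight jj0 t0 tT)) (tH0 tm) (tH0 (gt_tight jj0i t0 tT))) _.
have -> : e = e / 2 + e / 2 by field.
apply: lerD; first exact: h3.
rewrite wn_distC; pose d := (time_index T (j + i) t - time_index T j t * 2 ^ i)%N.
have dE : (time_index T j t * 2 ^ i + d)%N = time_index T (j + i) t by rewrite subnKC.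
have := @gj_lip (j + i)%N (time_index T j t * 2 ^ i)%N d jj0i; rewrite dE => /(_ kji) h.
apply: le_trans h _; rewrite mulrC; apply: (small_le L0 e2).
apply: le_trans (h4 j jj4); rewrite -(lerD2l ((time_index T j t * 2 ^ i)%:R * time_step T (j + i))).
by rewrite -mulrDl -natrD dE.
Qed.

(** The conditions on [t] are put under the existential so that [choice] yields a curve defined for
    every [t]. *)
Let lim_ex t : exists F, 0 <= t -> t <= T -> Hs s F /\
  forall e, 0 < e -> exists2 j4, (j0 <= j4)%N & forall j, (j4 <= j)%N -> ns s (fun z => gt j t z - F z) <= e.
Proof.
have [/andP[t0 tT]|nt] := boolP ((0 <= t) && (t <= T)); last first.
  by exists (fun=> 0) => t0 tT; rewrite t0 tT in nt.
have HF n : Hs s (gt (j0 + n) t) by apply: tH0; apply: gt_tight => //; exact: leq_addr.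
have [|F [HF' hF]] := @Hs_complete (fun n => gt (j0 + n) t) HF.
  move=> e e0; have e2 : 0 < e / 2 by rewrite divr_gt0.
  have [j4 j04 h4] := gt_cauchy e2; exists j4 => k n jk jn.
  have jm : (j4 <= j0 + k)%N by exact: leq_trans jk (leq_addl _ _).
  have jn' : (j4 <= j0 + n)%N by exact: leq_trans jn (leq_addl _ _).
  have c l : (j4 <= j0 + l)%N -> ns s (fun z => gt j4 t z - gt (j0 + l) t z) <= e / 2.
    by move=> h; have := h4 j4 (j0 + l - j4)%N t (leqnn _) t0 tT; rewrite subnKC.
  apply: le_trans (wn_triangle (HF k) (tH0 (gt_tight j04 t0 tT)) (HF n)) _.
  have -> : e = e / 2 + e / 2 by field.
  by apply: lerD; [rewrite wn_distC; exact: c|exact: c].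
exists F => _ _; split => // e /hF[N hN]; exists (j0 + N)%N; first exact: leq_addr.
move=> j jj; have := hN (j - j0)%N; rewrite subnKC; last by apply: leq_trans jj; exact: leq_addr.
by apply; rewrite leq_subRL// ?(leq_trans (leq_addr _ _) jj).
Qed.

(** The limit is taken in H^s; the weighted bounds pass to it by lower semicontinuity, and they
    provide the uniform tails in H^(s+1) required by [flow]. *)
Lemma exist_flow : exists gam, [/\ flow s T m M gam, {ae mu, forall z : P, gam 0 z = g0 z} &
  forall e, 0 < e -> exists j4, forall j t, (j4 <= j)%N -> 0 <= t -> t <= T ->
    ns s (fun z => galerkin (time_step T j) (freq_cut T j) m g0 (time_index T j t) z - gam t z) <= e].
Proof.
have [gam hgam] := choice lim_ex.
have gH t : 0 <= t -> t <= T -> Hs s (gam t) by move=> t0 tT; have [] := hgam t t0 tT.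
have unif e : 0 < e -> exists2 j4, (j0 <= j4)%N & forall j t, (j4 <= j)%N -> 0 <= t -> t <= T ->
    ns s (fun z => gt j t z - gam t z) <= e.
  move=> e0; have e2 : 0 < e / 2 by rewrite divr_gt0.
  have [j4 j04 h4] := gt_cauchy e2; exists j4 => // j t jj t0 tT.
  have [Hg /(_ _ e2) [j5 j05 h5]] := hgam t t0 tT.
  have jj0 := leq_trans j04 jj.
  have jj0' : (j0 <= j + j5)%N by exact: leq_trans jj0 (leq_addr _ _).
  apply: le_trans (wn_triangle (tH0 (gt_tight jj0 t0 tT)) (tH0 (gt_tight jj0' t0 tT)) Hg) _.
  have -> : e = e / 2 + e / 2 by field.
  by apply: lerD; [exact: h4|apply: h5; exact: leq_addl].
have gtight t : 0 <= t -> t <= T -> tight (gam t).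
  move=> t0 tT n; have [wW _ _ _ _] := HT n.
  have s0 : 0 <= s by apply: le_trans (ltW hs).
  apply: (wn_lsc wW ws s0 (gH t t0 tT)) => e /unif [j4 j04 h4].
  have tt := gt_tight j04 t0 tT; have [a1 a2] := tt n.
  by exists (gt j4 t); split => //; [exact: tH0|exact: h4].
have fwd e : 0 < e -> exists2 del, 0 < del & forall t t', 0 <= t -> t' <= T -> t <= t' -> t' - t <= del ->
    ns s (fun z => gam t' z - (gam t z + (t' - t) * Bop m (gam t) (gam t) z)) <= e * (t' - t).
  move=> e0; have [del [j2 [del0 j02 hdel]]] := gj_diff e0.
  have del2 : 0 < del / 2 by rewrite divr_gt0.
  exists (del / 2) => // t t' t0 tT' tt td.
  have tT : t <= T by exact: le_trans tT'.
  have t0' : 0 <= t' by exact: le_trans tt.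
  (* One fifth for each of the bounds [y1] to [y5]. *)
  apply/ler_addgt0Pr => eta eta0; pose x := eta / 5; have x0 : 0 < x by rewrite divr_gt0.
  pose c := 2 * K * (M + M); have c0 : 0 <= c by apply: mulr_ge0; [exact: mulr_ge0|apply: addr_ge0; exact: ltW].
  have T1 : 0 <= T + 1 by rewrite addr_ge0// ltW.
  have [d [d0 hd]] := tight_interp hs hp M HT (small_gt0 (mulr_ge0 T1 c0) x0).
  have dx0 : 0 < Num.min d x by rewrite lt_min d0.
  have [j4 j04 h4] := unif _ dx0.
  have hm : 0 < Num.min (del / 2) (Num.min (x / (e + 1)) (x / (L + 1))).
    by rewrite !lt_min del2 (small_gt0 (ltW e0) x0) (small_gt0 L0 x0).
  have [j5 h5] := hh_small T hm.
  pose j := maxn j2 (maxn j4 j5).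
  have jj2 : (j2 <= j)%N by rewrite leq_max leqnn.
  have jj4 : (j4 <= j)%N by rewrite !leq_max leqnn orbT.
  have jj5 : (j5 <= j)%N by rewrite !leq_max leqnn !orbT.
  have jj0 := leq_trans j02 jj2.
  have := h5 j jj5; rewrite !le_min => /andP[hj1 /andP[hj2 hj3]].
  pose h := time_step T j; have h0 : 0 < h := hh_gt0 T0 j.
  have kt' : (time_index T j t' <= 2 ^ j)%N := kk_max T0 j t0' tT'.
  have kk_mono : (time_index T j t <= time_index T j t')%N.
    rewrite -ltnS -(ltr_nat R) -(ltr_pM2r h0); apply: le_lt_trans (kk_le T0 j t0) _.
    by apply: le_lt_trans tt _; rewrite -natr1 mulrDl mul1r; exact: kk_gt.
  pose i := (time_index T j t' - time_index T j t)%N.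
  have iE : (time_index T j t + i)%N = time_index T j t' by rewrite subnKC.
  have ihE : i%:R * h = (time_index T j t')%:R * h - (time_index T j t)%:R * h by rewrite -mulrBl -natrB.
  have b1 := kk_le T0 j t0; have b2 := kk_gt T0 j t; have b3 := kk_le T0 j t0'; have b4 := kk_gt T0 j t'.
  rewrite -/h in b1 b2 b3 b4 hj1 hj2 hj3.
  have [ih1 ih2] := floor_gap b1 b2 b3 b4; rewrite -ihE in ih1 ih2.
  have ih0 : 0 <= i%:R * h by rewrite mulr_ge0// ltW.
  have ihd : i%:R * h <= del.
    by apply: le_trans ih1 _; exact: half_sum.
  have A := gt_tight jj0 t0 tT; have A' := gt_tight jj0 t0' tT'.
  have X := hdel j (time_index T j t) i jj2; rewrite iE in X; have {}X := X kt' ihd.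
  rewrite -/h -/(gt j t) -/(gt j t') in X.
  have Gt := gtight t t0 tT; have Gt' := gtight t' t0' tT'.
  have [HBA nBA] := tB A; have [HBG nBG] := tB Gt.
  have n1 := h4 j t jj4 t0 tT; have n2 := h4 j t' jj4 t0' tT'.
  have n3 : ns (s + 1) (fun z => gt j t z - gam t z) <= x / ((T + 1) * c + 1).
    by apply: hd => //; apply: le_trans n1 _; rewrite ge_min lexx.
  have [HBd nBd] := Bop_sub hs hp Km (tH A).1 (tH Gt).1.
  have HXj := wL2D (tH0 A) (wL2Z (i%:R * h) HBA).
  have HX := wL2D (tH0 Gt) (wL2Z (t' - t) HBG).
  have HD := wL2B (tH0 A) (tH0 Gt).
  have HZ1 := wL2Z (i%:R * h) HBd; have HZ2 := wL2Z (i%:R * h - (t' - t)) HBG.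
  apply: le_trans (wn_triangle (tH0 Gt') (tH0 A') HX) _.
  apply: le_trans (lerD (lexx _) (wn_triangle (tH0 A') HXj HX)) _.
  have E : (fun z => gt j t z + i%:R * h * Bop m (gt j t) (gt j t) z - (gam t z + (t' - t) * Bop m (gam t) (gam t) z)) =
     (fun z => (gt j t z - gam t z) + (i%:R * h * (Bop m (gt j t) (gt j t) z - Bop m (gam t) (gam t) z)
        + (i%:R * h - (t' - t)) * Bop m (gam t) (gam t) z)).
    apply/funext => z; move: (gt j t z) (gam t z) (Bop _ _ _ z) (Bop _ _ _ z) => *; ring.
  rewrite E; apply: le_trans (lerD (lexx _) (lerD (lexx _) (wnD HD (wL2D HZ1 HZ2)))) _.
  apply: le_trans (lerD (lexx _) (lerD (lexx _) (lerD (lexx _) (wnD HZ1 HZ2)))) _.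
  rewrite (wnZ _ HBd) (wnZ _ HBG) (ger0_norm ih0).
  have y1 : ns s (fun z => gam t' z - gt j t' z) <= x.
    by rewrite /ns wn_distC; apply: le_trans n2 _; rewrite ge_min lexx orbT.
  have y2 : ns s (fun z => gt j t' z - (gt j t z + i%:R * h * Bop m (gt j t) (gt j t) z)) <= e * (t' - t) + x.
    apply: le_trans X _; apply: le_trans (ler_wpM2l (ltW e0) ih1) _.
    by rewrite mulrDr lerD2l; apply: small_le (ltW e0) x0 hj2.
  have y3 : ns s (fun z => gt j t z - gam t z) <= x.
    by apply: le_trans n1 _; rewrite ge_min lexx orbT.
  have y4 : i%:R * h * ns s (fun z => Bop m (gt j t) (gt j t) z - Bop m (gam t) (gam t) z) <= x.
    have q1 : i%:R * h <= T + 1.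
      by apply: le_trans ih1 _; apply: gap_le => //; exact: hle.
    have q2 : ns s (fun z => Bop m (gt j t) (gt j t) z - Bop m (gam t) (gam t) z) <=
        c * ns (s + 1) (fun z => gt j t z - gam t z).
      apply: le_trans nBd _; apply: ler_wpM2r; first exact: wn_ge0.
      by apply: ler_wpM2l; [exact: mulr_ge0|apply: lerD; [exact: (tH A).2|exact: (tH Gt).2]].
    apply: le_trans (ler_pM ih0 (wn_ge0 _ _) q1 q2) _; rewrite mulrA.
    exact: small_le (mulr_ge0 T1 c0) x0 n3.
  have y5 : `|i%:R * h - (t' - t)| * ns s (Bop m (gam t) (gam t)) <= x.
    apply: le_trans (ler_pM (normr_ge0 _) (wn_ge0 _ _) ih2 nBG) _.
    by rewrite mulrC; exact: small_le L0 x0 hj3.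
  apply: le_trans (lerD y1 (lerD y2 (lerD y3 (lerD y4 y5)))) _.
  by rewrite /x; move: (e * (t' - t)) => u; rewrite le_eqVlt; apply/orP; left; apply/eqP; field.
exists gam; split.
- split.
  + by move=> t t0 tT; exact: tH (gtight t t0 tT).
  + move=> e e0; have [N0 [_ hN]] := tight_tail_e hs hp M HT e0; exists N0 => N t NN0 t0 tT.
    by apply: hN => //; exact: gtight.
  + move=> e e0; have e2 : 0 < e / 2 by rewrite divr_gt0.
    pose c := 2 * K * (M + M); have c0 : 0 <= c by apply: mulr_ge0; [exact: mulr_ge0|apply: addr_ge0; exact: ltW].
    have [d [d0 hd]] := tight_interp hs hp M HT (small_gt0 c0 e2).
    have [del del0 hdel] := fwd _ e2.
    have L1 : 0 < e / 2 + L by rewrite ltr_wpDr.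
    have dl : 0 < d / (e / 2 + L) by rewrite divr_gt0.
    exists (Num.min del (d / (e / 2 + L))); first by rewrite lt_min del0.
    move=> t t' t0 tT t0' tT'; rewrite le_min => /andP[g1 g2].
    have [tt|/ltW tt] := leP t t'.
      rewrite ger0_norm ?subr_ge0// in g1 g2 *; apply: le_trans (hdel t t' t0 tT' tt g1) _.
      by apply: ler_wpM2r; [rewrite subr_ge0|exact: half_le].
    (* For [t' <= t] the forward estimate based at [t'] is read backwards; replacing [Bop] at [t']
       by [Bop] at [t] costs the other half of [e]. *)
    rewrite distrC ger0_norm ?subr_ge0// in g1 g2 *.
    have Gt := gtight t t0 tT; have Gt' := gtight t' t0' tT'.
    have [HB' nB'] := tB Gt'; have [HB nB] := tB Gt.
    have X := hdel t' t t0' tT tt g1.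
    have HX := wL2B (tH0 Gt) (wL2D (tH0 Gt') (wL2Z (t - t') HB')).
    have near : ns s (fun z => gam t z - gam t' z) <= d.
      have eq : (fun z => gam t z - gam t' z) = (fun z => (gam t z - (gam t' z + (t - t') * Bop m (gam t') (gam t') z)) + (t - t') * Bop m (gam t') (gam t') z).
        by apply/funext => z; move: (Bop _ _ _ z) => b; ring.
      rewrite eq; apply: le_trans (wnD HX (wL2Z (t - t') HB')) _.
      rewrite (wnZ _ HB') (ger0_norm (_ : 0 <= t - t')) ?subr_ge0//.
      apply: le_trans (lerD X (ler_wpM2l (_ : 0 <= t - t') nB')) _; first by rewrite subr_ge0.
      by rewrite (mulrC (e / 2)) -mulrDr -ler_pdivlMr.
    have near1 := hd _ _ Gt Gt' near.
    have [HBd nBd] := Bop_sub hs hp Km (tH Gt).1 (tH Gt').1.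
    have nBd' : ns s (fun z => Bop m (gam t) (gam t) z - Bop m (gam t') (gam t') z) <= e / 2.
      apply: le_trans nBd _; apply: le_trans (ler_wpM2r (wn_ge0 _ _) _) (small_le c0 e2 near1).
      by apply: ler_wpM2l; [exact: mulr_ge0|apply: lerD; [exact: (tH Gt).2|exact: (tH Gt').2]].
    have eq : (fun z => gam t' z - (gam t z + (t' - t) * Bop m (gam t) (gam t) z)) =
       (fun z => (t - t') * (Bop m (gam t) (gam t) z - Bop m (gam t') (gam t') z) -
          (gam t z - (gam t' z + (t - t') * Bop m (gam t') (gam t') z))).
      by apply/funext => z; move: (Bop _ _ _ z) (Bop _ _ _ z) => b1 b2; ring.
    rewrite eq; apply: le_trans (wnB (wL2Z (t - t') HBd) HX) _.
    rewrite (wnZ _ HBd) (ger0_norm (_ : 0 <= t - t')) ?subr_ge0//.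
    have tt0 : 0 <= t - t' by rewrite subr_ge0.
    apply: le_trans (lerD (ler_wpM2l tt0 nBd') X) _.
    by move: (t - t') => u; rewrite le_eqVlt; apply/orP; left; apply/eqP; field.
- have TT := ltW T0; have HG := gH 0 (lexx 0) TT; have [Hg00 _] := Hs_le hs hp Hg0.
  have D := wL2B HG Hg00.
  have z0 : ns s (fun z => gam 0 z - g0 z) = 0.
    apply/eqP; rewrite eq_le; apply/andP; split; last exact: wn_ge0.
    apply/ler_addgt0Pr => e e0; rewrite add0r; have e2 : 0 < e / 2 by rewrite divr_gt0.
    have [j4 j04 h4] := unif _ e2; have [N0 hN] := tail_small ws Hg00 e2.
    have [j5 h5] := NN_big T0 N0; pose j := maxn j4 j5.
    have jj4 : (j4 <= j)%N by exact: leq_maxl.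
    have jj5 : (j5 <= j)%N by exact: leq_maxr.
    have A := tH0 (gt_tight (leq_trans j04 jj4) (lexx 0) TT).
    apply: le_trans (wn_triangle HG A Hg00) _.
    have -> : e = e / 2 + e / 2 by field.
    apply: lerD; first by rewrite wn_distC; exact: h4.
    by rewrite /gt kk0 /= wn_distC; apply: hN; exact: h5.
  have := nrm0_ae D z0; apply: filterS => z /eqP.
  by rewrite mulf_eq0 gt_eqF ?powR_gt0 ?jb_gt0//= subr_eq0 => /eqP.
- by move=> e /unif [j4 _ h4]; exists j4.
Qed.

End Existence.

(** * Uniqueness and perturbation of flows *)

Section FlowTheorem.
Context {R : realType} (s : R) (p : nat) (hs : 2 < s) (hp : s + 2 <= p%:R) (T : R) (T0 : 0 < T).
Local Notation P := (plane R).
Local Notation mu := (@lebesgue_measure R \x @lebesgue_measure R)%E.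
Implicit Types (F G g : R * R -> R) (z : R * R) (i j k l n : nat) (N t Y d e : R) (m : R * R -> R)
  (gam : R -> R * R -> R).
Local Notation K := (Kc s p).
Let ws := weight_s hs hp.
Let ws1 := weight_s1 hs hp.
Let K0 : 0 <= K := Kc_ge0 s p.

(** Both flows are limits of the same Galerkin iterates: with equal symbols the smallness condition
    of [flow_cmp_t] is met by taking its [e] small. *)
Lemma flow_unique m Y Y' gam gam' : kern 1 0 m -> flow s T m Y gam -> flow s T m Y' gam' ->
  {ae mu, forall z : P, gam 0 z = gam' 0 z} ->
  forall t, 0 <= t -> t <= T -> {ae mu, forall z : P, gam t z = gam' t z}.
Proof.
move=> Km fl fl' e0 t t0 tT.
have TT := ltW T0; have [h1 _ _] := fl; have [h1' _ _] := fl'.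
have H t1 : 0 <= t1 -> t1 <= T -> Hs s (gam t1) by move=> a b; exact: (Hs_le hs hp (h1 _ a b).1).1.
have H' t1 : 0 <= t1 -> t1 <= T -> Hs s (gam' t1) by move=> a b; exact: (Hs_le hs hp (h1' _ a b).1).1.
have H0 := H 0 (lexx 0) TT.
have D := wL2B (H t t0 tT) (H' t t0 tT).
have z0 : ns s (fun z => gam t z - gam' t z) = 0.
  apply/eqP; rewrite eq_le; apply/andP; split; last exact: wn_ge0.
  apply/ler_addgt0Pr => e e1; rewrite add0r.
  have C0 Z : 0 <= Cst s p T Z := Cst_ge0 _ _ _ _.
  pose e3 := Num.min 1 (e / 4).
  have e30 : 0 < e3 by rewrite lt_min ltr01 divr_gt0.
  have app Z (g : R -> R * R -> R) : flow s T m Z g -> {ae mu, forall z : P, gam 0 z = g 0 z} ->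
     exists j0, forall j, (j0 <= j)%N ->
       ns s (fun z => galerkin (time_step T j) (freq_cut T j) m (gam 0) (time_index T j t) z - g t z) <= e / 2.
    move=> flg ae0; pose x := Num.min e3 (e3 / (Cst s p T Z + 1)).
    have x0 : 0 < x by rewrite lt_min e30 small_gt0.
    have Cx : Cst s p T Z * (2 * K * 0 * Z ^+ 2 + x) <= e3.
      by rewrite mulr0 mul0r add0r; apply: small_le => //; rewrite ge_min lexx orbT.
    have Cx1 : Cst s p T Z * (2 * K * 0 * Z ^+ 2 + x) <= 1 by apply: le_trans Cx _; rewrite ge_min lexx.
    have [j0 hj] := flow_cmp_t hs hp T0 Km Km (kern0 Km) flg H0 ae0 x0 Cx1.
    exists j0 => j jj; apply: le_trans (hj j t jj t0 tT) _.
    have x3 : x <= e3 by rewrite ge_min lexx.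
    have e34 : e3 <= e / 4 by rewrite ge_min lexx orbT.
    apply: le_trans (lerD Cx x3) _; apply: le_trans (lerD e34 e34) _.
    by rewrite le_eqVlt; apply/orP; left; apply/eqP; field.
  have ae00 : {ae mu, forall z : P, gam 0 z = gam 0 z} by apply: aeW.
  have [j1 hj1] := app _ _ fl ae00; have [j2 hj2] := app _ _ fl' e0.
  have [j3 hj3] := hh_small T ltr01.
  pose j := maxn j3 (maxn j1 j2).
  have jj1 : (j1 <= j)%N by rewrite !leq_max leqnn orbT.
  have jj2 : (j2 <= j)%N by rewrite !leq_max leqnn !orbT.
  have jj3 : (j3 <= j)%N by rewrite !leq_max leqnn.
  have [Np _] := hh_N T0 (hj3 j jj3).
  have Hg := gal_Hs hs hp (time_step T j) (time_index T j t) Km Np H0.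
  apply: le_trans (wn_triangle (H t t0 tT) Hg (H' t t0 tT)) _.
  have -> : e = e / 2 + e / 2 by field.
  by apply: lerD; [rewrite wn_distC; exact: hj1|exact: hj2].
have := nrm0_ae D z0; apply: filterS => z /eqP.
by rewrite mulf_eq0 gt_eqF ?powR_gt0 ?jb_gt0//= subr_eq0 => /eqP.
Qed.

(** Comparison with the given flow keeps the iterates for [m] bounded in H^s; [gal_bound] then
    propagates the weights adapted to the datum, which is the tightness that [exist_flow] needs. The
    bound [1 / 2] leaves the other half of the bootstrap threshold 1 to the discretisation. *)
Lemma flow_perturb m m' d Y gam : kern 1 0 m -> kern 1 0 m' -> kern d 1 (fun z => m z - m' z) ->
  flow s T m' Y gam -> Cst s p T Y * (2 * K * d * Y ^+ 2) <= 1 / 2 ->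
  exists Y' gam', [/\ flow s T m Y' gam', {ae mu, forall z : P, gam' 0 z = gam 0 z} &
    forall t, 0 <= t -> t <= T ->
      ns s (fun z => gam' t z - gam t z) <= Cst s p T Y * (2 * K * d * Y ^+ 2)].
Proof.
move=> Km Km' Kd fl small; have TT := ltW T0; have [h1 _ _] := fl.
have Hg1 : Hs (s + 1) (gam 0) by exact: (h1 0 (lexx 0) TT).1.
have [Hg0 _] := Hs_le hs hp Hg1.
have C0 Z : 0 <= Cst s p T Z := Cst_ge0 _ _ _ _.
have half : 0 < (1 / 2 : R) by rewrite divr_gt0.
have cond e : 0 < e -> e <= 1 / 2 / (Cst s p T Y + 1) -> Cst s p T Y * (2 * K * d * Y ^+ 2 + e) <= 1.
  move=> e0 /(small_le (C0 Y) half) h; rewrite mulrDr; apply: le_trans (lerD small h) _.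
  by rewrite -splitr.
pose e1 : R := 1 / 2 / (Cst s p T Y + 1); have e10 : 0 < e1 by exact: small_gt0.
have ae00 : {ae mu, forall z : P, gam 0 z = gam 0 z} by apply: aeW.
have [j0 hj0] := flow_cmp hs hp T0 Km Km' Kd fl Hg0 ae00 e10 (cond _ e10 (lexx _)).
have hle j : (j0 <= j)%N -> time_step T j <= 1 by move=> jj; have [] := hj0 j 0%N jj (leq0n _).
have bnd j k : (j0 <= j)%N -> (k <= 2 ^ j)%N -> ns s (galerkin (time_step T j) (freq_cut T j) m (gam 0) k) <= 1 + Y.
  move=> jj kj; have [_ hb] := hj0 j k jj kj; have [Np _] := hh_N T0 (hle j jj).
  have [a1 a2] := kkT T0 kj; have [Hg nY] := h1 _ a1 a2; have [Hg' nY'] := Hs_le hs hp Hg.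
  have Hgal := gal_Hs hs hp (time_step T j) k Km Np Hg0.
  have [Hc nc] := wL2_cut (freq_cut T j) ws Hg'.
  have E : galerkin (time_step T j) (freq_cut T j) m (gam 0) k = fun z =>
     (galerkin (time_step T j) (freq_cut T j) m (gam 0) k z - cut (freq_cut T j) (gam (k%:R * time_step T j)) z) + cut (freq_cut T j) (gam (k%:R * time_step T j)) z.
    by apply/funext => z; rewrite subrK.
  rewrite E; apply: le_trans (wnD (wL2B Hgal Hc) Hc) _; apply: lerD.
    by apply: le_trans hb _; exact: cond.
  by apply: le_trans nc _; apply: le_trans nY' _.
have [Wn [Vn [Rn [M1 [M10 hW]]]]] := tight_weights hs hp Hg1.
have HT n := (hW n).1.
pose M := Num.sqrt (expR (Agal s p (1 + Y) * T)) * M1.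
have M0 : 0 < M by rewrite mulr_gt0// sqrtr_gt0 expR_gt0.
have tg j k : (j0 <= j)%N -> (k <= 2 ^ j)%N -> tight Wn M (galerkin (time_step T j) (freq_cut T j) m (gam 0) k).
  move=> jj kj n; have [[wW _ _ _ _] [LW nW]] := hW n.
  have [Np hN] := hh_N T0 (hle j jj).
  have hT := hh_T T j; have hTle : (2 ^ j)%:R * time_step T j <= T by rewrite hT.
  have [LWk nWk] := gal_bound hs hp Km wW (ltW (hh_gt0 T0 j)) (hle j jj) Np hN hTle Hg0 LW (fun k => @bnd j k jj) kj.
  split => //; rewrite -(@ler_pXn2r _ 2) ?nnegrE ?wn_ge0 ?(ltW M0)//.
  have ME : M ^+ 2 = expR (Agal s p (1 + Y) * T) * M1 ^+ 2 by rewrite /M exprMn sqr_sqrtr ?expR_ge0.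
  rewrite ME; apply: le_trans nWk _; apply: ler_wpM2l; first exact: expR_ge0.
  by rewrite ler_pXn2r ?nnegrE ?wn_ge0 ?(ltW M10).
have [gam' [fl' ae0 lim]] := exist_flow hs hp T0 Km Hg1 M0 HT hle tg.
exists M, gam'; split => // t t0 tT.
have [h1' _ _] := fl'.
have H := (Hs_le hs hp (h1 t t0 tT).1).1; have H' := (Hs_le hs hp (h1' t t0 tT).1).1.
apply/ler_addgt0Pr => e e0; pose x := Num.min (Num.min e1 (e / 3)) (e / 3 / (Cst s p T Y + 1)).
have e3 : 0 < e / 3 by rewrite divr_gt0.
have x0 : 0 < x by rewrite !lt_min e10 e3 small_gt0.
have x1 : x <= e1 by rewrite !ge_min lexx.
have x2 : x <= e / 3 by rewrite !ge_min lexx orbT.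
have x3 : Cst s p T Y * x <= e / 3 by apply: small_le => //; rewrite !ge_min lexx !orbT.
have [j1 hj1] := flow_cmp_t hs hp T0 Km Km' Kd fl Hg0 ae00 x0 (cond _ x0 x1).
have [j2 hj2] := lim _ e3.
pose j := maxn j0 (maxn j1 j2).
have jj0 : (j0 <= j)%N by rewrite !leq_max leqnn.
have jj1 : (j1 <= j)%N by rewrite !leq_max leqnn orbT.
have jj2 : (j2 <= j)%N by rewrite !leq_max leqnn !orbT.
have [Np _] := hh_N T0 (hle j jj0).
have Hg := gal_Hs hs hp (time_step T j) (time_index T j t) Km Np Hg0.
apply: le_trans (wn_triangle H' Hg H) _; rewrite {1}wn_distC.
apply: le_trans (lerD (hj2 j t jj2 t0 tT) (hj1 j t jj1 t0 tT)) _.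
rewrite mulrDr; apply: le_trans (lerD (lexx _) (lerD (lerD (lexx _) x3) x2)) _.
by rewrite le_eqVlt; apply/orP; left; apply/eqP; field.
Qed.

End FlowTheorem.

(** * From the Fourier to the Hartley transform *)

Section LnormBridge.
Context {R : realType}.
Local Notation P := (plane R).
Local Notation mu := (@lebesgue_measure R \x @lebesgue_measure R)%E.

Lemma Lnorm2_int (f : P -> R) :
  Lnorm mu 2%:E (fun x => (f x)%:E) = poweR (\int[mu]_x (f x ^+ 2)%:E) 2^-1.
Proof.
rewrite unlock /=; congr (poweR _ _); apply: eq_integral => x _.
by rewrite powR_mulrn// real_normK// num_real.
Qed.

Lemma Lnorm2E (f : P -> R) : L2 mu f -> Lnorm mu 2%:E (fun x => (f x)%:E) = (nrm mu f)%:E.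
Proof.
move=> Lf; rewrite Lnorm2_int -(nrm_sqrE Lf) poweR_EFin; congr (_%:E).
by rewrite powR12_sqrt ?sqr_ge0// sqrtr_sqr ger0_norm// nrm_ge0.
Qed.

Lemma Lnorm2_L2 (f : P -> R) : measurable_fun setT f ->
  (Lnorm mu 2%:E (fun x => (f x)%:E) < +oo)%E -> L2 mu f.
Proof.
move=> mf; rewrite Lnorm2_int => h; split => //.
rewrite ltey; apply/eqP => e; move: h; rewrite e poweRyr//.
Qed.

Lemma Lfun2P (f : P -> R) : f \in Lfun mu 2%:E <-> L2 mu f.
Proof.
split => [|Lf].
  move=> /andP[]; rewrite !inE /= => mf nf; exact: Lnorm2_L2.
rewrite inE; apply/andP; split; rewrite inE/=; first exact: (L2_meas Lf).
by rewrite /finite_norm (Lnorm2E Lf) ltry.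
Qed.

End LnormBridge.

Section FourierBridge.
Context {R : realType}.
Local Notation P := (plane R).
Local Notation mu := (@lebesgue_measure R \x @lebesgue_measure R)%E.
Implicit Types (f F : R * R -> R) (g : R * R -> R[i]) (x xi : R * R) (n : nat).

Lemma Rint_disc f n : measurable_fun setT (f : P -> R) ->
  \int[mu]_(x in (disc n : set P)) f x = \int[mu]_x trunc f n x.
Proof.
move=> mf; rewrite Rintegral_mkcond; apply: eq_Rintegral => x _.
by rewrite patchE /trunc indicE; case: ifPn => _; rewrite ?mulr1 ?mulr0.
Qed.

Lemma measurable_trig (h : R -> R) xi : continuous h ->
  measurable_fun setT ((fun x => h (dot x xi)) : P -> R).
Proof.
move=> ch; apply: (measurableT_comp (continuous_measurable_fun ch)).
by under eq_fun do rewrite dotC; exact: measurable_dotr.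
Qed.

Lemma dotNx x xi : dot x (- xi) = - dot x xi.
Proof. exact: dotNr. Qed.

Lemma tf_Re f n xi : L2 mu f -> complex.Re (truncated_fourier f n xi) = evp (hartley (trunc f n)) xi.
Proof.
move=> Lf; have Lt := L1_trunc n Lf; have mf := L2_meas Lf.
have Lc := L1_cas xi Lt; have Lc' := L1_cas (- xi) Lt.
rewrite /truncated_fourier /cintegral /= mul0r subr0 /evp /hartley -mulrDr -mulrA; congr (_ * _).
rewrite -(RintegralD _ Lc Lc')// -(RintegralZr 2^-1 measurableT (L1D Lc Lc')).
transitivity (\int[mu]_(x in (disc n : set P)) (cos (dot x xi) * f x)).
  by apply: eq_Rintegral => x _; rewrite cosN mulr0 subr0.
rewrite Rint_disc; last by apply: measurable_funM => //; exact: (measurable_trig xi (@continuous_cos R)).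
apply: eq_Rintegral => x _; rewrite /trunc /cas dotNx cosN sinN.
by move: (cos _) (sin _) (f x) (\1__ _) => a b c d; field.
Qed.

Lemma tf_Im f n xi : L2 mu f -> complex.Im (truncated_fourier f n xi) = - odp (hartley (trunc f n)) xi.
Proof.
move=> Lf; have Lt := L1_trunc n Lf; have mf := L2_meas Lf.
have Lc := L1_cas xi Lt; have Lc' := L1_cas (- xi) Lt.
rewrite /truncated_fourier /cintegral /= mul0r addr0 /odp /hartley -mulrBr -mulrA -mulrN; congr (_ * _).
rewrite -(RintegralB _ Lc Lc')// -mulrN -(RintegralZr (- 2^-1) measurableT (L1B Lc Lc')).
transitivity (\int[mu]_(x in (disc n : set P)) (- sin (dot x xi) * f x)).
  by apply: eq_Rintegral => x _; rewrite sinN mulr0 add0r.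
rewrite Rint_disc; last first.
  apply: measurable_funM => //; apply: (measurableT_comp (@oppr_measurable R setT)).
  exact: (measurable_trig xi (@continuous_sin R)).
apply: eq_Rintegral => x _; rewrite /trunc /cas dotNx cosN sinN.
by move: (cos _) (sin _) (f x) (\1__ _) => a b c d; field.
Qed.

(** The Fourier transform recovered from the Hartley transform: the even part of [cas] is [cos] and
    its odd part is [sin]. *)
Definition cplx F xi : R[i] := (evp F xi +i* - odp F xi)%C.

Lemma evpB (F G : R * R -> R) xi : evp (fun x => F x - G x) xi = evp F xi - evp G xi.
Proof. by rewrite /evp; field. Qed.

Lemma odpB (F G : R * R -> R) xi : odp (fun x => F x - G x) xi = odp F xi - odp G xi.
Proof. by rewrite /odp; field. Qed.

Lemma tfE f n xi : L2 mu f -> truncated_fourier f n xi = cplx (hartley (trunc f n)) xi.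
Proof.
move=> Lf; rewrite /cplx -(tf_Re n xi Lf) -(tf_Im n xi Lf).
by case: (truncated_fourier f n xi).
Qed.

Lemma L2_refl F : L2 mu F -> L2 mu (fun z => F (- z)).
Proof. exact: (mp_L2 (mp_opp (R := R))). Qed.

Lemma L2_evp F : L2 mu F -> L2 mu (evp F).
Proof.
move=> LF; have := L2Z 2^-1 (L2D LF (L2_refl LF)).
by under [X in L2 _ X]eq_fun do rewrite mulrC.
Qed.

Lemma L2_odp F : L2 mu F -> L2 mu (odp F).
Proof.
move=> LF; have := L2Z 2^-1 (L2B LF (L2_refl LF)).
by under [X in L2 _ X]eq_fun do rewrite mulrC.
Qed.

Lemma nrm_refl F : measurable_fun setT (F : P -> R) -> nrm mu (fun z => F (- z)) = nrm mu F.
Proof. exact: (mp_nrm (mp_opp (R := R))). Qed.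

Lemma nrm_evp F : L2 mu F -> nrm mu (evp F) <= nrm mu F.
Proof.
move=> LF; have L' := L2_refl LF.
have -> : nrm mu (evp F) = nrm mu (fun z => 2^-1 * (F z + F (- z))) by apply: nrm_eqE => z; rewrite mulrC.
rewrite (nrmZ _ (L2D LF L')) gtr0_norm ?invr_gt0//.
by have := nrmD LF L'; rewrite (nrm_refl (L2_meas LF)); lra.
Qed.

Lemma nrm_odp F : L2 mu F -> nrm mu (odp F) <= nrm mu F.
Proof.
move=> LF; have L' := L2_refl LF.
have -> : nrm mu (odp F) = nrm mu (fun z => 2^-1 * (F z - F (- z))) by apply: nrm_eqE => z; rewrite mulrC.
rewrite (nrmZ _ (L2B LF L')) gtr0_norm ?invr_gt0//.
by have := nrmB LF L'; rewrite (nrm_refl (L2_meas LF)); lra.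
Qed.

Lemma normc_cplx F xi : normc (cplx F xi) = Num.sqrt ((F xi ^+ 2 + F (- xi) ^+ 2) / 2).
Proof. by rewrite /= /evp /odp; congr Num.sqrt; field. Qed.

Lemma measurable_sqrtf (f : P -> R) : measurable_fun setT f -> measurable_fun setT (fun x => Num.sqrt (f x)).
Proof. by move=> mf; apply: measurableT_comp => //; exact: (@continuous_measurable_fun R _ (@sqrt_continuous R)). Qed.

(** The squared modulus is the mean of the squares of [F] at [z] and at [- z], so it has the same
    integral as [F ^+ 2] against an even weight. *)
Lemma L2_normc_cplx (v : P -> R) F : measurable_fun setT v -> (forall z, v (- z) = v z) -> L2 mu (fun z => v z * F z) ->
  measurable_fun setT (F : P -> R) ->
  L2 mu (fun xi => v xi * normc (cplx F xi)) /\
  nrm mu (fun xi => v xi * normc (cplx F xi)) = nrm mu (fun xi => v xi * F xi).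
Proof.
move=> mv vN LF mF; have L' := L2_refl LF; have mF' := meas_refl mF.
have sq z : (v z * normc (cplx F z)) ^+ 2 = ((v z * F z) ^+ 2 + (v (- z) * F (- z)) ^+ 2) / 2.
  have q0 : 0 <= (F z ^+ 2 + F (- z) ^+ 2) / 2 by rewrite divr_ge0// addr_ge0// sqr_ge0.
  by rewrite normc_cplx (exprMn 2 (v z)) sqr_sqrtr// vN !exprMn; field.
have m1 : measurable_fun setT (fun z : P => v z * normc (cplx F z)).
  apply: measurable_funM => //; under [X in measurable_fun _ X]eq_fun do rewrite normc_cplx.
  apply: measurable_sqrtf; apply: measurable_funM => //.
  by apply: measurable_funD; exact: measurable_funX.
have L1s := L1D (L2_sqr LF) (L2_sqr L').
have Lh : L1 mu (fun z => (v z * normc (cplx F z)) ^+ 2).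
  by under [X in L1 _ X]eq_fun do rewrite sq mulrC; exact: L1Z.
split; first exact: L2P.
rewrite /nrm; congr Num.sqrt; rewrite /ip.
transitivity (\int[mu]_z (((v z * F z) ^+ 2 + (v (- z) * F (- z)) ^+ 2) * 2^-1)).
  by apply: eq_Rintegral => z _; rewrite -expr2 sq.
rewrite (RintegralZr 2^-1 measurableT L1s) (RintegralD _ (L2_sqr LF) (L2_sqr L'))//.
rewrite (mp_Rintegral (mp_opp (R := R)) (f := fun z => (v z * F z) ^+ 2)).
  by under [in RHS]eq_Rintegral do rewrite -expr2; field.
by apply: measurable_funX; exact: (L2_meas LF).
Qed.

Lemma fourier_ex f F : L2 mu f -> is_hart f F -> is_fourier f (cplx F).
Proof.
move=> Lf [LF cF]; split.
- exact: (L2_meas (L2_evp LF)).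
- by apply: (measurableT_comp (@oppr_measurable R setT)); exact: (L2_meas (L2_odp LF)).
- pose D n xi := F xi - hartley (trunc f n) xi.
  have LD n : L2 mu (D n) by apply: L2B => //; exact: L2_hartley_trunc.
  have e n : Lnorm mu 2%:E (fun xi => (normc (cplx F xi - truncated_fourier f n xi))%:E) = (nrm mu (D n))%:E.
    have m1 : measurable_fun setT ((fun=> 1) : P -> R) by exact: measurable_cst.
    have LD1 : L2 mu (fun z => 1 * D n z) by under [X in L2 _ X]eq_fun do rewrite mul1r.
    have [L E] := @L2_normc_cplx (fun=> 1) (D n) m1 (fun _ => erefl) LD1 (L2_meas (LD n)).
    have e1 : (fun xi : P => (normc (cplx F xi - truncated_fourier f n xi))%:E) = (fun xi => (1 * normc (cplx (D n) xi))%:E).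
      by apply/funext => xi; rewrite mul1r (tfE _ _ Lf) /cplx /D evpB odpB /= -!opprD.
    by rewrite e1 (Lnorm2E L) E; congr (_%:E); apply: nrm_eqE => z; rewrite mul1r.
  under eq_fun do rewrite e.
  apply/fine_cvgP; split; first by apply: nearW.
  rewrite (_ : fine \o _ = fun n => nrm mu (fun xi => hartley (trunc f n) xi - F xi)); first exact: cF.
  by apply/funext => n /=; rewrite /D nrm_distC.
Qed.

(* Re - Im turns the kernel exp(-i x.xi) into cas(x.xi). *)
Definition hart f xi : R := complex.Re (fourier f xi) - complex.Im (fourier f xi).

Lemma fourier_spec f : L2 mu f -> is_fourier f (fourier f).
Proof.
move=> Lf; have [F hF] := hart_ex Lf; rewrite /fourier.
exact: (xgetPex _ (ex_intro (is_fourier f) _ (fourier_ex Lf hF))).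
Qed.

Lemma Re_le_normc (a b : R) : `|a| <= normc (a +i* b)%C.
Proof. by rewrite /= -sqrtr_sqr ler_wsqrtr// lerDl sqr_ge0. Qed.

Lemma Im_le_normc (a b : R) : `|b| <= normc (a +i* b)%C.
Proof. by rewrite /= -sqrtr_sqr ler_wsqrtr// lerDr sqr_ge0. Qed.

(** [fourier f] is known only through the property by which it was picked. Its real and imaginary
    parts are L^2 limits of the same truncated transforms as those of [cplx F], hence agree with
    them. *)
Lemma fourierE f F : L2 mu f -> is_hart f F ->
  {ae mu, forall xi : P, fourier f xi = cplx F xi}.
Proof.
move=> Lf [LF cF]; have [m1 m2 c] := fourier_spec Lf.
pose g := fourier f; rewrite -/g in m1 m2 c.
pose H n := hartley (trunc f n); have LH n : L2 mu (H n) by exact: L2_hartley_trunc.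
have mH n := L2_meas (LH n).
have mN n : measurable_fun setT ((fun xi => normc (g xi - truncated_fourier f n xi)) : P -> R).
  have -> : (fun xi : P => normc (g xi - truncated_fourier f n xi)) =
      (fun xi => Num.sqrt ((complex.Re (g xi) - evp (H n) xi) ^+ 2 + (complex.Im (g xi) - - odp (H n) xi) ^+ 2)).
    by apply/funext => xi; rewrite (tfE _ _ Lf) /cplx; case: (g xi).
  apply: measurable_sqrtf; apply: measurable_funD; apply: measurable_funX; apply: measurable_funB => //.
    exact: (L2_meas (L2_evp (LH n))).
  by apply: (measurableT_comp (@oppr_measurable R setT)); exact: (L2_meas (L2_odp (LH n))).
have conv (u : P -> R) (v_ : nat -> P -> R) (v : P -> R) : measurable_fun setT u -> (forall n, L2 mu (v_ n)) -> L2 mu v ->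
    (forall n xi, `|u xi - v_ n xi| <= normc (g xi - truncated_fourier f n xi)) ->
    (forall n, nrm mu (fun xi => v_ n xi - v xi) <= nrm mu (fun xi => H n xi - F xi)) ->
    {ae mu, forall xi, u xi = v xi}.
  move=> mu_ Lv_ Lv ub vb.
  have eN n : (Lnorm mu 2%:E (fun xi => (normc (g xi - truncated_fourier f n xi))%:E) < +oo)%E ->
      L2 mu (fun xi => normc (g xi - truncated_fourier f n xi)) := Lnorm2_L2 (mN n).
  (* Convergence of the extended norms to 0 gives their finiteness only from some rank on. *)
  have [N hN] : exists N, forall n, (N <= n)%N -> L2 mu (fun xi => normc (g xi - truncated_fourier f n xi)).
    have /fine_cvgP[[N _ hN] _] := c; exists N => n Nn; apply: eN.
    by have := hN n Nn; rewrite ge0_fin_numE// Lnorm_ge0.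
  have LuB n : (N <= n)%N -> L2 mu (fun xi => u xi - v_ n xi) /\
      nrm mu (fun xi => u xi - v_ n xi) <= nrm mu (fun xi => normc (g xi - truncated_fourier f n xi)).
    move=> Nn; have m := measurable_funB mu_ (L2_meas (Lv_ n)).
    have b xi : `|u xi - v_ n xi| <= `|normc (g xi - truncated_fourier f n xi)|.
      by rewrite [leRHS]ger0_norm ?sqrtr_ge0//; case: (g xi - _) (ub n xi) => a b /=; rewrite ?sqrtr_ge0.
    by split; [exact: L2_dom m b (hN n Nn)|exact: nrm_le m b (hN n Nn)].
  have Lu : L2 mu u.
    have := L2D (LuB N (leqnn N)).1 (Lv_ N); rewrite (_ : (fun x => _) = u)//.
    by apply/funext => x; rewrite subrK.
  have z0 : nrm mu (fun xi => u xi - v xi) = 0.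
    apply/eqP; rewrite eq_le; apply/andP; split; last exact: nrm_ge0.
    apply/ler_addgt0Pr => e e0; rewrite add0r; have e2 : 0 < e / 2 by rewrite divr_gt0.
    have [N1 hN1] := (proj1 (cvL2P _ _ _) cF) _ e2.
    have /fine_cvgP[_ c2] := c.
    move/cvgrPdist_le : c2 => /(_ _ e2) [N2 _ hN2].
    pose n := maxn N (maxn N1 N2).
    have n0 : (N <= n)%N by rewrite leq_max leqnn.
    have n1 : (N1 <= n)%N by rewrite !leq_max leqnn orbT.
    have n2 : (N2 <= n)%N by rewrite !leq_max leqnn !orbT.
    apply: le_trans (nrm_triangle Lu (Lv_ n) Lv) _.
    have -> : e = e / 2 + e / 2 by field.
    apply: lerD; last by apply: le_trans (vb n) _; exact: hN1.
    apply: le_trans (LuB n n0).2 _.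
    by have := hN2 n n2; rewrite /= (Lnorm2E (hN n n0)) /= sub0r normrN ger0_norm// nrm_ge0.
  by apply: filterS (nrm0_ae (L2B Lu Lv) z0) => x /eqP; rewrite subr_eq0 => /eqP.
have LB n : L2 mu (fun x => H n x - F x) by exact: L2B.
have e1 := conv (fun xi => complex.Re (g xi)) (fun n => evp (H n)) (evp F) m1 (fun n => L2_evp (LH n)) (L2_evp LF).
have e2 := conv (fun xi => complex.Im (g xi)) (fun n xi => - odp (H n) xi) (fun xi => - odp F xi) m2 (fun n => L2N (L2_odp (LH n))) (L2N (L2_odp LF)).
have {}e1 : {ae mu, forall xi : P, complex.Re (g xi) = evp F xi}.
  apply: e1 => [n xi|n].
    by rewrite (tfE _ _ Lf) /cplx; case: (g xi) => a b; exact: Re_le_normc.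
  apply: le_trans (nrm_evp (LB n)); rewrite le_eqVlt; apply/orP; left; apply/eqP.
  by apply: nrm_eqE => x; rewrite evpB.
have {}e2 : {ae mu, forall xi : P, complex.Im (g xi) = - odp F xi}.
  apply: e2 => [n xi|n].
    by rewrite (tfE _ _ Lf) /cplx; case: (g xi) => a b; exact: Im_le_normc.
  apply: le_trans (nrm_odp (LB n)); rewrite le_eqVlt; apply/orP; left; apply/eqP.
  by apply: nrm_eqE => x; rewrite odpB -opprB opprK; ring.
apply: filterS2 e1 e2 => xi; rewrite /cplx -/g; case: (g xi) => a b /= -> ->.
by [].
Qed.

Lemma measurable_hart f : L2 mu f -> measurable_fun setT (hart f : P -> R).
Proof. by move=> /fourier_spec [m1 m2 _]; exact: measurable_funB. Qed.

Lemma hart_spec f : L2 mu f -> is_hart f (hart f).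
Proof.
move=> Lf; have [F hF] := hart_ex Lf; have [LF _] := hF.
have e : {ae mu, forall xi : P, F xi = hart f xi}.
  by apply: filterS (fourierE Lf hF) => xi; rewrite /hart => -> /=; rewrite /evp /odp; field.
exact: hart_ae Lf hF (ae_eq_L2 e LF (measurable_hart Lf)) e.
Qed.

Lemma jb_powE (r : R) xi : (1 + dot xi xi) `^ (r / 2) = jb xi `^ r.
Proof.
have q : 0 <= 1 + dot xi xi by rewrite addr_ge0// dot_ge0.
by rewrite /jb -(powR12_sqrt q) -powRrM mulrC.
Qed.

(** The second part rests on [F ^+ 2] being at most twice the squared modulus of [cplx F], so that a
    finite [Hnorm] controls [F] itself and not only its parity parts. *)
Lemma HnormE f F (r : R) : L2 mu f -> is_hart f F -> 
  (Hs r F -> Hnorm r f = (ns r F)%:E) /\ ((Hnorm r f < +oo)%E -> Hs r F).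
Proof.
move=> Lf hF; have [LF _] := hF; have mF := L2_meas LF.
have [m1 m2 _] := fourier_spec Lf.
have mv := measurable_jbpow r (R := R).
have vN (z : R * R) : jb (- z) `^ r = jb z `^ r by rewrite jbN.
have eF := fourierE Lf hF.
have mN : measurable_fun setT ((fun xi => jb xi `^ r * normc (fourier f xi)) : P -> R).
  apply: measurable_funM => //.
  have -> : (fun xi : P => normc (fourier f xi)) = (fun xi => Num.sqrt (complex.Re (fourier f xi) ^+ 2 + complex.Im (fourier f xi) ^+ 2)).
    by apply/funext => xi; case: (fourier f xi).
  by apply: measurable_sqrtf; apply: measurable_funD; apply: measurable_funX.
have HE : Hnorm r f = Lnorm mu 2%:E (fun xi => (jb xi `^ r * normc (fourier f xi))%:E).
  by rewrite /Hnorm; under [in LHS]eq_fun do rewrite jb_powE.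
have sq z : (jb z `^ r * normc (cplx F z)) ^+ 2 = ((jb z `^ r * F z) ^+ 2 + (jb (- z) `^ r * F (- z)) ^+ 2) / 2.
  have q0 : 0 <= (F z ^+ 2 + F (- z) ^+ 2) / 2 by rewrite divr_ge0// addr_ge0// sqr_ge0.
  by rewrite normc_cplx (exprMn 2 (jb z `^ r)) sqr_sqrtr// vN !exprMn; field.
rewrite HE; split => [HF|fin].
  have [L E] := L2_normc_cplx mv vN HF mF.
  have e : {ae mu, forall xi : P, jb xi `^ r * normc (cplx F xi) = jb xi `^ r * normc (fourier f xi)}.
    by apply: filterS eF => xi ->.
  have L' := ae_eq_L2 e L mN.
  by rewrite (Lnorm2E L') -(ae_eq_nrm e (L2_meas L) mN) E.
have L := Lnorm2_L2 mN fin.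
have e : {ae mu, forall xi : P, jb xi `^ r * normc (fourier f xi) = jb xi `^ r * normc (cplx F xi)}.
  by apply: filterS eF => xi ->.
have mc : measurable_fun setT (fun xi : P => jb xi `^ r * normc (cplx F xi)).
  apply: measurable_funM => //; under [X in measurable_fun _ X]eq_fun do rewrite normc_cplx.
  apply: measurable_sqrtf; apply: measurable_funM => //.
  by apply: measurable_funD; apply: measurable_funX => //; exact: meas_refl.
have L' := ae_eq_L2 e L mc.
apply: (L2_dom _ _ (L2Z 2 L')); first exact: measurable_funM.
move=> z; rewrite -(@ler_pXn2r _ 2) ?nnegrE// !real_normK ?num_real//.
rewrite (exprMn 2 2) sq; have := sqr_ge0 (jb z `^ r * F z); have := sqr_ge0 (jb (- z) `^ r * F (- z)).
by move: (_ ^+ 2) (_ ^+ 2) => a b a0 b0; rewrite expr2; lra.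
Qed.

End FourierBridge.

(** * Regularity of Hartley integrals *)

Section HartleyCalculus.
Context {R : realType}.
Local Notation P := (plane R).
Local Notation mu := (@lebesgue_measure R \x @lebesgue_measure R)%E.
Implicit Types (F G : R * R -> R) (x z v : R * R) (t : R).

Definition dcas t : R := cos t - sin t.

Lemma is_derive_cas t : is_derive t 1 (@cas R) (dcas t).
Proof.
have h := is_deriveD (is_derive_cos t) (is_derive_sin t).
by apply: (is_derive_eq h); rewrite /dcas addrC.
Qed.

Lemma dcas_le2 t : `|dcas t| <= 2.
Proof.
apply: le_trans (ler_normB _ _) _.
have h1 : `|cos t| <= 1 by rewrite ler_norml cos_geN1 cos_le1.
have h2 : `|sin t| <= 1 by rewrite ler_norml sin_geN1 sin_le1.
by lra.
Qed.

Lemma lip_mvt (f df : R -> R) (C : R) : (forall t : R, is_derive t 1 f (df t)) ->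
  (forall t, `|df t| <= C) -> forall a b, `|f b - f a| <= C * `|b - a|.
Proof.
move=> fd fC a b; wlog ab : a b / a <= b.
  move=> H; case/orP: (le_total a b) => [|ba]; first exact: H.
  by rewrite distrC (distrC b); apply: H.
have cf : {within `[a, b], continuous f}.
  by apply: continuous_subspaceT => u; exact: dv_cont (fd u).
have [c _ ->] := MVT_segment ab (fun u _ => fd u) cf.
by rewrite normrM ler_wpM2r.
Qed.

Lemma cas_lip (a b : R) : `|cas b - cas a| <= 2 * `|b - a|.
Proof. exact: (lip_mvt is_derive_cas dcas_le2). Qed.

Lemma dot_norm_le x z : `|dot x z| <= rad x * rad z.
Proof.
rewrite ler_norml dot_le_rad andbT lerNl -dotNl.
by apply: le_trans (dot_le_rad (- x) z) _; rewrite radN.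
Qed.

Lemma hartley_lip F x x' : L1 mu F -> L1 mu (fun z => rad z * F z) ->
  `|hartley F x' - hartley F x| <= c2pi * (2 * \int[mu]_z `|rad z * F z|) * rad (x' - x).
Proof.
move=> LF LrF; rewrite /hartley -mulrBr normrM (gtr0_norm c2pi_gt0) -mulrA ler_wpM2l ?(ltW c2pi_gt0)//.
have c y := L1_cas y LF.
have e y : \int[mu]_z (F z * cas (dot z y)) = \int[mu]_z (F z * cas (dot z y)) by [].
rewrite -(RintegralB _ (c x') (c x))//.
have LB := L1B (c x') (c x).
apply: le_trans (le_normr_Rintegral measurableT LB) _.
have La := L1_abs LrF.
have -> : 2 * (\int[mu]_z `|rad z * F z|) * rad (x' - x) = \int[mu]_z (2 * rad (x' - x) * `|rad z * F z|).
  by rewrite (RintegralZl _ measurableT La) mulrAC.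
apply: le_Rintegral => //; first exact: L1_abs.
  exact: L1Z.
move=> z _; rewrite -mulrBr normrM normrM (ger0_norm (rad_ge0 z)).
rewrite [leRHS](_ : _ = `|F z| * (2 * (rad z * rad (x' - x)))); last by ring.
rewrite ler_wpM2l//; apply: le_trans (cas_lip _ _) _; rewrite ler_wpM2l//.
rewrite (_ : dot z x' - dot z x = dot z (x' - x)); first exact: dot_norm_le.
by rewrite /dot/=; ring.
Qed.

Lemma rad_small x (e : R) : 0 < e -> \forall y \near x, rad (y - x) <= e.
Proof.
move=> e0; have e2 : 0 < e / 2 by rewrite divr_gt0.
have : \forall y \near x, ball x (e / 2) y by exact: nbhsx_ballx.
apply: filterS => y [b1 b2]; rewrite /ball/= in b1 b2.
rewrite -(@ler_pXn2r _ 2) ?nnegrE ?rad_ge0 ?(ltW e0)// rad_sqr /dot/=.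
have h1 : (y.1 - x.1) * (y.1 - x.1) <= (e / 2) ^+ 2.
  rewrite -expr2 -(real_normK (num_real (y.1 - x.1))) ler_pXn2r ?nnegrE// ?(ltW e2)//.
  by rewrite distrC ltW.
have h2 : (y.2 - x.2) * (y.2 - x.2) <= (e / 2) ^+ 2.
  rewrite -expr2 -(real_normK (num_real (y.2 - x.2))) ler_pXn2r ?nnegrE// ?(ltW e2)//.
  by rewrite distrC ltW.
by apply: le_trans (lerD h1 h2) _; rewrite !expr2; nra.
Qed.

Lemma continuous_hartley F : L1 mu F -> L1 mu (fun z => rad z * F z) ->
  continuous (hartley F : R * R -> R).
Proof.
move=> LF LrF x; apply/cvgrPdist_le => e e0.
pose C := c2pi * (2 * \int[mu]_z `|rad z * F z|).
have C0 : 0 <= C by rewrite !mulr_ge0 ?(ltW c2pi_gt0)// Rintegral_ge0.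
have e1 : 0 < e / (C + 1) by rewrite divr_gt0// ltr_wpDl.
apply: filterS (rad_small x e1) => y yx.
rewrite distrC; apply: le_trans (hartley_lip x y LF LrF) _; rewrite -/C.
have c1 : 0 < C + 1 by rewrite ltr_wpDl.
move: yx; rewrite ler_pdivlMr// => yx; apply: le_trans yx.
by rewrite mulrDr mulr1 mulrC lerDl rad_ge0.
Qed.

(** Differentiation under the integral along the line through [x] directed by [v], dominated by
    twice the modulus of [dot v z * F z]. *)
Lemma D_hartley F x v : L1 mu F -> L1 mu (fun z => dot v z * F z) ->
  'D_v (hartley F) x = c2pi * \int[mu]_z (dot v z * F z * dcas (dot x z)).
Proof.
move=> LF LvF.
pose f t (z : P) := F z * cas (dot x z + t * dot v z).
have df t (z : P) : is_derive t 1 (f ^~ z) (dot v z * F z * dcas (dot x z + t * dot v z)).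
  have h1 : is_derive t 1 (fun t => dot x z + t * dot v z) (dot v z).
    have h := dvD (is_derive_cst (dot x z) t 1) (dvM (is_derive_id t 1) (is_derive_cst (dot v z) t 1)).
    by apply: (is_derive_eq h); rewrite /=; ring.
  have h2 := dvZ (F z) (dv_comp (g := fun t => dot x z + t * dot v z) (is_derive_cas (dot x z + t * dot v z)) h1).
  by apply: (is_derive_eq h2); ring.
have dotE t (z : R * R) : dot x z + t * dot v z = dot (t *: v + x) z.
  by rewrite /dot/=; change (t *: v.1) with (t * v.1); change (t *: v.2) with (t * v.2); ring.
have Lf t : L1 mu (f t).
  have := L1_cas (t *: v + x) LF; rewrite (_ : (fun z => _) = f t)//.
  by apply/funext => z; rewrite /f dotE dotC.
have I0 : `](-1 : R), 1[%classic 0 by rewrite /= in_itv/= oppr_lt0 ltr01.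
have LG := L1Z 2 (L1_abs LvF).
have := @cvg_differentiation_under_integral R _ P mu f setT measurableT 0 (-1) 1 I0 (fun t _ => Lf t)
  (fun t z _ _ => @ex_derive _ _ _ _ _ _ _ (df t z)) (fun z => 2 * `|dot v z * F z|)
  (fun z => mulr_ge0 (ler0n R 2) (normr_ge0 _)) LG.
have pE t (z : P) : partial1of2 f t z = dot v z * F z * dcas (dot x z + t * dot v z).
  by rewrite partial1of2E; exact: derive_val.
have dom (t : R) (z : P) : `](-1 : R), 1[%classic t -> setT z -> `|partial1of2 f t z| <= 2 * `|dot v z * F z|.
  by move=> _ _; rewrite pE normrM mulrC ler_wpM2r// dcas_le2.
move=> /(_ dom) H.
have {}H : h^-1 *: (hartley F (h *: v + x) - hartley F x) @[h --> 0^'] -->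
    c2pi * \int[mu]_z (dot v z * F z * dcas (dot x z)).
  have -> : \int[mu]_z (dot v z * F z * dcas (dot x z)) = \int[mu]_z partial1of2 f 0 z.
    by apply: eq_Rintegral => z _; rewrite pE mul0r addr0.
  have F0 : Filter (0^' : set_system R) by exact: dnbhs_filter.
  have H2 := cvgM (cvg_cst (c2pi : R)) H.
  apply: cvg_trans (H2 F0 F0); apply: near_eq_cvg; apply: nearW => h /=.
  have e t : hartley F (t *: v + x) = c2pi * \int[mu]_z f t z.
    by congr (_ * _); apply: eq_Rintegral => z _; rewrite /f dotE dotC.
  have e0 : hartley F x = c2pi * \int[mu]_z f 0 z by rewrite -e scale0r add0r.
  rewrite addr0 e e0 -mulrBr; change (c2pi * (h^-1 * (\int[mu]_z f h z - \int[mu]_z f 0 z)) = h^-1 * (c2pi * (\int[mu]_z f h z - \int[mu]_z f 0 z))).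
  by rewrite mulrCA.
exact: cvg_lim H.
Qed.

End HartleyCalculus.

(** * The transform of the bilinear form *)

Section Equation.
Context {R : realType}.
Local Notation P := (plane R).
Local Notation mu := (@lebesgue_measure R \x @lebesgue_measure R)%E.
Implicit Types (f F G : R * R -> R) (x z v : R * R) (m : R * R -> R) (c : R * R -> R).

Lemma Rint2D (k k' : P * P -> R) : L1P2 k -> L1P2 k' ->
  \int[mu]_x \int[mu]_y (k (x, y) + k' (x, y)) =
  \int[mu]_x \int[mu]_y k (x, y) + \int[mu]_x \int[mu]_y k' (x, y).
Proof.
move=> Lk Lk'; have [i1 _] := fubini_L1 Lk; have [i2 _] := fubini_L1 Lk'.
rewrite -(RintegralD _ i1 i2)//.
have mk : measurable_fun setT k by case: Lk.
have mk' : measurable_fun setT k' by case: Lk'.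
apply: ae_Rint.
- by apply: filterS2 (ae_section Lk) (ae_section Lk') => x h1 h2; rewrite RintegralD.
- by apply: (@measurable_Rint _ (fun q => k q + k' q)); exact: measurable_funD.
- by apply: measurable_funD; exact: measurable_Rint.
Qed.

Lemma Rint2_tensors (l : seq ((R * R -> R) * (R * R -> R))) :
  (forall q, List.In q l -> L1 mu (q.1 : P -> R) /\ L1 mu (q.2 : P -> R)) ->
  L1P2 (fun q : P * P => \sum_(a <- l) a.1 (q.1 - q.2) * a.2 q.2) /\
  \int[mu]_x \int[mu]_y (\sum_(a <- l) a.1 (x - y) * a.2 y) =
  \sum_(a <- l) (\int[mu]_z a.1 z) * \int[mu]_z a.2 z.
Proof.
elim: l => [|a l IH] H.
  have e : (fun q : P * P => \sum_(a <- [::]) (a : (R * R -> R) * (R * R -> R)).1 (q.1 - q.2) * a.2 q.2) = fun=> 0.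
    by apply/funext => q; rewrite big_nil.
  split; last by rewrite big_nil; apply: Rintegral_eq0 => x; apply: Rintegral_eq0 => y; rewrite big_nil.
  have [h _] := young_L1 (L1_0 mu) (L1_0 mu); rewrite e.
  by move: h; rewrite (_ : (fun p : P * P => 0 * 0) = fun=> 0)//; apply/funext => q; rewrite mulr0.
have [a1 a2] := H a (or_introl erefl).
have [Ll El] := IH (fun q hq => H q (or_intror hq)).
have [La Ea] := young_L1 a1 a2.
have e : (fun q : P * P => \sum_(b <- a :: l) b.1 (q.1 - q.2) * b.2 q.2) =
  (fun q => a.1 (q.1 - q.2) * a.2 q.2 + \sum_(b <- l) b.1 (q.1 - q.2) * b.2 q.2).
  by apply/funext => q; rewrite big_cons.
split; first by rewrite e; exact: L1P2D.
rewrite big_cons -El -Ea -(Rint2D La Ll).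
by apply: eq_Rintegral => x _; apply: eq_Rintegral => y _; rewrite big_cons.
Qed.

Lemma Rint_odd f : measurable_fun setT (f : P -> R) -> (forall z, f (- z) = - f z) -> L1 mu f ->
  \int[mu]_z f z = 0.
Proof.
move=> mf fN Lf; have := mp_Rintegral (mp_opp (R := R)) mf.
under eq_Rintegral do rewrite fN -mulN1r.
by rewrite (RintegralZl _ measurableT Lf); lra.
Qed.

Definition sin_d x z : R := sin (dot x z).
Definition cos_d x z : R := cos (dot x z).

(* The velocity integrals on the Hartley side, [c] being a coordinate. *)
Definition vel m F c x : R :=
  \int[mu]_z (c z * m z * (evp F z * sin_d x z - odp F z * cos_d x z)).
Definition grd G c x : R := \int[mu]_z (c z * G z * dcas (dot x z)).

Lemma measurable_sin_d x : measurable_fun setT (sin_d x : P -> R).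
Proof.
apply: (measurableT_comp (continuous_measurable_fun (@continuous_sin R))).
exact: measurable_dotr.
Qed.

Lemma measurable_cos_d x : measurable_fun setT (cos_d x : P -> R).
Proof.
apply: (measurableT_comp (continuous_measurable_fun (@continuous_cos R))).
exact: measurable_dotr.
Qed.

Lemma meas_fst : measurable_fun setT ((fun z => z.1) : P -> R). Proof. exact: measurable_fst. Qed.
Lemma meas_snd : measurable_fun setT ((fun z => z.2) : P -> R). Proof. exact: measurable_snd. Qed.

Lemma fst_le_rad z : `|z.1| <= rad z.
Proof. by rewrite /rad -sqrtr_sqr ler_wsqrtr// expr2 lerDl -expr2 sqr_ge0. Qed.

Lemma snd_le_rad z : `|z.2| <= rad z.
Proof. by rewrite /rad -sqrtr_sqr ler_wsqrtr// expr2 lerDr -expr2 sqr_ge0. Qed.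

Lemma meas_evp F : measurable_fun setT (F : P -> R) -> measurable_fun setT (evp F : P -> R).
Proof. by move=> mF; apply: measurable_funM => //; apply: measurable_funD => //; exact: meas_refl. Qed.

Lemma meas_odp F : measurable_fun setT (F : P -> R) -> measurable_fun setT (odp F : P -> R).
Proof. by move=> mF; apply: measurable_funM => //; apply: measurable_funB => //; exact: meas_refl. Qed.

(** [cas] at [a] is expanded by the addition formulas along [a = (a - b) + b], which makes the
    integrand a sum of eight tensors. By parity four of them have integral 0, and the others combine
    into velocity times gradient. *)
Lemma hartley_Bop m F G x : kern 1 0 m -> measurable_fun setT (F : P -> R) -> measurable_fun setT (G : P -> R) ->
  lL1 F -> lL1 G ->
  (forall c, measurable_fun setT (c : P -> R) -> (forall z, `|c z| <= rad z) -> L1 mu (fun z => c z * m z * (evp F z * sin_d x z - odp F z * cos_d x z)) /\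
     L1 mu (fun z => c z * G z * dcas (dot x z))) /\
  (okB m F G -> hartley (Bop m F G) x = c2pi ^+ 2 *
    (vel m F (fun z => z.1) x * grd G (fun z => z.2) x - vel m F (fun z => z.2) x * grd G (fun z => z.1) x)).
Proof.
move=> Km mF mG LF LG; have [_ mm mN k1 _] := Km.
have [LsF _] := L1_sym lam_ge0 lamN LF; have [LsG _] := L1_sym lam_ge0 lamN LG.
have ms := measurable_sin_d x; have mc := measurable_cos_d x.
have s1 z : `|sin_d x z| <= 1 by rewrite ler_norml sin_geN1 sin_le1.
have c1 z : `|cos_d x z| <= 1 by rewrite ler_norml cos_geN1 cos_le1.
have LA (c e : P -> R) (h : P -> R) : measurable_fun setT c -> (forall z, `|c z| <= rad z) ->
    measurable_fun setT e -> (forall z, `|e z| <= sym F z / 2) ->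
    measurable_fun setT h -> (forall z, `|h z| <= 1) -> L1 mu (fun z => c z * m z * e z * h z).
  move=> mc' cr me er mh h1; apply: (L1_dom _ _ LsF).
    by apply: measurable_funM => //; apply: measurable_funM => //; exact: measurable_funM.
  move=> z; have sF := sym_ge0 F z.
  rewrite (normrM _ (h z)) (normrM _ (e z)) (normrM (c z)) [leRHS]ger0_norm ?mulr_ge0 ?lam_ge0//.
  apply: le_trans (ler_pM _ (normr_ge0 _) (lexx _) (h1 z)) _; first by rewrite !mulr_ge0.
  rewrite mulr1; apply: ler_pM; [by rewrite mulr_ge0|by []| |].
    by apply: le_trans (ler_wpM2r _ (cr z)) _ => //; have := k1 z; rewrite mul1r.
  by apply: le_trans (er z) _; lra.
have LB (c g h : P -> R) : measurable_fun setT c -> (forall z, `|c z| <= rad z) ->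
    measurable_fun setT g -> (forall z, `|g z| <= sym G z) ->
    measurable_fun setT h -> (forall z, `|h z| <= 2) -> L1 mu (fun z => c z * g z * h z).
  move=> mc' cr mg gr mh h2; apply: (L1_dom _ _ (L1Z 2 LsG)).
    by apply: measurable_funM => //; exact: measurable_funM.
  move=> z; have sG := sym_ge0 G z.
  rewrite (normrM _ (h z)) (normrM (c z)) [leRHS]ger0_norm ?mulr_ge0 ?lam_ge0// [leRHS]mulrC.
  apply: ler_pM; [exact: mulr_ge0|by []| |exact: h2].
  by apply: ler_pM; [by []|by []|exact: le_trans (cr z) (rad_le_lam z)|exact: gr].
have mev := meas_evp mF; have mod_ := meas_odp mF.
have G1 z : `|G z| <= sym G z by rewrite lerDl.
have mGN := meas_refl mG.
have GN1 z : `|G (- z)| <= sym G z by rewrite lerDr.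
have md : measurable_fun setT ((fun z => dcas (dot x z)) : P -> R) by exact: measurable_funB.
have mca : measurable_fun setT ((fun z => cas (dot x z)) : P -> R) by exact: measurable_funD.
split.
  move=> c mc' cr; split; last by apply: LB => // z; exact: dcas_le2.
  have := L1B (LA c _ _ mc' cr mev (ev_le F) ms s1) (LA c _ _ mc' cr mod_ (od_le F) mc c1).
  rewrite (_ : (fun z => _) = (fun z => c z * m z * (evp F z * sin_d x z - odp F z * cos_d x z)))//.
  by apply/funext => z; rewrite mulrBr !mulrA.
move=> ok; pose C (e h : P -> R) (b : bool) (z : R * R) := (if b then z.1 else z.2) * m z * e z * h z.
pose D (g h : P -> R) (b : bool) (z : R * R) := (if b then z.1 else z.2) * g z * h z.
have mb (b : bool) : measurable_fun setT ((fun z => if b then z.1 else z.2) : P -> R) by case: b; [exact: meas_fst|exact: meas_snd].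
have br (b : bool) z : `|if b then z.1 else z.2| <= rad z by case: b; [exact: fst_le_rad|exact: snd_le_rad].
have LCes b : L1 mu (C (evp F) (sin_d x) b) := LA _ _ _ (mb b) (br b) mev (ev_le F) ms s1.
have LCec b : L1 mu (C (evp F) (cos_d x) b) := LA _ _ _ (mb b) (br b) mev (ev_le F) mc c1.
have LCos b : L1 mu (C (odp F) (sin_d x) b) := LA _ _ _ (mb b) (br b) mod_ (od_le F) ms s1.
have LCoc b : L1 mu (C (odp F) (cos_d x) b) := LA _ _ _ (mb b) (br b) mod_ (od_le F) mc c1.
have LDd b : L1 mu (D G (fun z => dcas (dot x z)) b) := LB _ _ _ (mb b) (br b) mG G1 md (fun z => dcas_le2 _).
have LDc b : L1 mu (D G (fun z => cas (dot x z)) b) := LB _ _ _ (mb b) (br b) mG G1 mca (fun z => cas_le2 _).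
have LNd b : L1 mu (D (fun z => G (- z)) (fun z => dcas (dot x z)) b) := LB _ _ _ (mb b) (br b) mGN GN1 md (fun z => dcas_le2 _).
have LNc b : L1 mu (D (fun z => G (- z)) (fun z => cas (dot x z)) b) := LB _ _ _ (mb b) (br b) mGN GN1 mca (fun z => cas_le2 _).
pose neg (f : P -> R) z := - f z.
have LN (f : P -> R) : L1 mu f -> L1 mu (neg f) by exact: L1N.
(* The signs of [wedge] are put on the first factors. Those with [evp] and [cos_d], or [odp] and
   [sin_d], are odd and vanish; in the surviving terms with [G (- z)] and [cas], reflecting [z]
   produces [dcas], by [ND]. *)
pose l := [:: (C (evp F) (cos_d x) true, D G (fun z => cas (dot x z)) false);
  (neg (C (evp F) (cos_d x) false), D G (fun z => cas (dot x z)) true);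
  (C (evp F) (sin_d x) true, D G (fun z => dcas (dot x z)) false);
  (neg (C (evp F) (sin_d x) false), D G (fun z => dcas (dot x z)) true);
  (C (odp F) (cos_d x) true, D (fun z => G (- z)) (fun z => cas (dot x z)) false);
  (neg (C (odp F) (cos_d x) false), D (fun z => G (- z)) (fun z => cas (dot x z)) true);
  (C (odp F) (sin_d x) true, D (fun z => G (- z)) (fun z => dcas (dot x z)) false);
  (neg (C (odp F) (sin_d x) false), D (fun z => G (- z)) (fun z => dcas (dot x z)) true)].
have Hl q : List.In q l -> L1 mu (q.1 : P -> R) /\ L1 mu (q.2 : P -> R).
  move=> /=; case=> [<-|[<-|[<-|[<-|[<-|[<-|[<-|[<-|[]]]]]]]]]; split => /=;
  first [exact: LCec|exact: LCes|exact: LCoc|exact: LCos|exact: LDd|exact: LDc|exact: LNd|exact: LNc|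
    exact: (LN _ (LCec _))|exact: (LN _ (LCes _))|exact: (LN _ (LCoc _))|exact: (LN _ (LCos _))].
have [Lk Ek] := Rint2_tensors Hl.
have kE (a b : R * R) : kB m F G (a, b) * cas (dot a x) = \sum_(q <- l) q.1 (a - b) * q.2 b.
  rewrite !big_cons big_nil /kB /C /D /neg /wedge /=.
  have -> : cas (dot a x) = cos_d x (a - b) * cas (dot x b) + sin_d x (a - b) * dcas (dot x b).
    have e1 : dot a x = dot x (a - b) + dot x b by rewrite /dot/=; ring.
    by rewrite /cas /dcas /cos_d /sin_d e1 cosD sinD; ring.
  move: (evp F _) (odp F _) (m _) (cos_d x _) (sin_d x _) (cas _) (dcas _) (G b) (G (- b)) => *; ring.
have EE : hartley (Bop m F G) x = c2pi ^+ 2 * \sum_(q <- l) (\int[mu]_z q.1 z) * \int[mu]_z q.2 z.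
  rewrite -Ek /hartley expr2 -mulrA; congr (_ * _).
  have [LI _] := fubini_L1 Lk.
  rewrite -(RintegralZl _ measurableT LI); apply: ae_Rint.
  - apply: filterS ok => a h; rewrite /Bop -mulrA; congr (_ * _).
    by rewrite -(RintegralZr _ measurableT h); apply: eq_Rintegral => b _; rewrite -kE.
  - apply: measurable_funM; first by apply: measurable_funM => //; apply: measurable_Rint; exact: measurable_kB.
    by apply: measurable_cas_dot => //; exact: measurable_cst.
  - exact: (L1_meas (L1Z c2pi LI)).
have oddC (e h : P -> R) b : (forall z, e (- z) * h (- z) = e z * h z) -> L1 mu (C e h b) -> \int[mu]_z C e h b z = 0.
  move=> eh L; apply: Rint_odd => //; first exact: (L1_meas L).
  by move=> z; rewrite /C mN -!mulrA eh; case: b {L}; rewrite /=; ring.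
have sN z : sin_d x (- z) = - sin_d x z by rewrite /sin_d dotNr sinN.
have cN z : cos_d x (- z) = cos_d x z by rewrite /cos_d dotNr cosN.
have Ec b : \int[mu]_z C (evp F) (cos_d x) b z = 0 by apply: oddC => // z; rewrite evN cN.
have Os b : \int[mu]_z C (odp F) (sin_d x) b z = 0 by apply: oddC => // z; rewrite odN sN mulrNN.
have ND b : \int[mu]_z D (fun z => G (- z)) (fun z => cas (dot x z)) b z = - \int[mu]_z D G (fun z => dcas (dot x z)) b z.
  rewrite -(mp_Rintegral (mp_opp (R := R)) (L1_meas (LNc b))) -mulN1r -(RintegralZl _ measurableT (LDd b)).
  apply: eq_Rintegral => z _; rewrite /D opprK dotNr /cas /dcas cosN sinN; case: b; rewrite /=; ring.
have negE (f : P -> R) : L1 mu f -> \int[mu]_z neg f z = - \int[mu]_z f z.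
  by move=> L; rewrite -mulN1r -(RintegralZl _ measurableT L); apply: eq_Rintegral => z _; rewrite mulN1r.
have velE (b : bool) : vel m F (fun z => if b then z.1 else z.2) x =
    \int[mu]_z C (evp F) (sin_d x) b z - \int[mu]_z C (odp F) (cos_d x) b z.
  rewrite -(RintegralB _ (LCes b) (LCoc b))//; apply: eq_Rintegral => z _.
  by rewrite /C; ring.
rewrite EE (velE true) (velE false) !big_cons big_nil /=.
rewrite !negE//; rewrite !Ec !Os !ND.
rewrite /grd -/(D G (fun z => dcas (dot x z)) true) -/(D G (fun z => dcas (dot x z)) false).
by congr (_ * _); ring.
Qed.

End Equation.

(** * Solutions seen on the transform side *)

Section Representation.
Context {R : realType} (s : R) (p : nat) (hs : 2 < s) (hp : s + 2 <= p%:R).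
Local Notation P := (plane R).
Local Notation mu1 := (@lebesgue_measure R).
Local Notation mu := (@lebesgue_measure R \x @lebesgue_measure R)%E.
Implicit Types (f g F G : R * R -> R) (x z : R * R) (alpha : R).
Let ws := weight_s hs hp.

Lemma rect_measure (a b c d : R) : a < b -> c < d ->
  (mu (rect a b c d) = ((b - a) * (d - c))%:E)%E.
Proof.
move=> ab cd; rewrite /rect.
apply: etrans (product_measure1E mu1 mu1 (measurable_itv _) (measurable_itv _)) _.
have e (u v : R) : u < v -> mu1 `]u, v]%classic = (v - u)%:E.
  by move=> uv; rewrite lebesgue_measure_itv/= lte_fin uv -EFinD.
by rewrite EFinM -(e _ _ ab) -(e _ _ cd).
Qed.

(** If they differed at a point they would differ on a rectangle around it, which has positive
    measure. *)
Lemma cont_ae_eq f g : continuous f -> continuous g -> {ae mu, forall x : P, f x = g x} -> f = g.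
Proof.
move=> cf cg [N [mN N0 hN]]; apply/funext => x; apply/eqP; apply/negPn/negP => fg.
pose h y := f y - g y; have hx : 0 < `|h x| by rewrite normr_gt0 subr_eq0.
have ch : h y @[y --> x] --> h x by apply: cvgB; [exact: cf|exact: cg].
move/cvgrPdist_lt : ch => /(_ _ hx) /nbhs_ballP [d /= d0 hd].
have sub : rect (x.1 - d / 2) (x.1 + d / 2) (x.2 - d / 2) (x.2 + d / 2) `<=` N.
  move=> y [/= y1 y2]; apply: hN => /= e.
  have : ball x d y.
    move: y1 y2; rewrite !in_itv/= => /andP[a1 a2] /andP[a3 a4].
    by split; rewrite /ball/= ltr_norml; apply/andP; split; lra.
  by move=> /hd /=; rewrite /h e subrr subr0 ltxx.
have : (mu (rect (x.1 - d / 2) (x.1 + d / 2) (x.2 - d / 2) (x.2 + d / 2)) <= 0)%E.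
  by rewrite -N0 le_measure// inE//; exact: measurable_rect.
have ab : x.1 - d / 2 < x.1 + d / 2 by lra.
have ab' : x.2 - d / 2 < x.2 + d / 2 by lra.
by rewrite rect_measure// lee_fin leNgt mulr_gt0 ?subr_gt0.
Qed.

Lemma Hs_L2 F : Hs s F -> L2 mu F.
Proof.
move=> HF; have mF := wL2_meas ws HF.
apply: (L2_dom mF _ HF) => z; rewrite normrM (ger0_norm (powR_ge0 _ _)) ler_peMl//.
by rewrite powR_ge1 ?jb_ge1//; have h := hs; lra.
Qed.

Lemma Hs_L1 F : Hs s F -> L1 mu F /\ L1 mu (fun z => rad z * F z).
Proof.
move=> HF; have [LF _] := Hs_lam hs HF; have mF := wL2_meas ws HF.
split.
  apply: (L1_dom mF _ LF) => z; rewrite normrM (ger0_norm (lam_ge0 z)) ler_peMl// lam_ge1//.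
apply: (L1_dom _ _ LF); first by apply: measurable_funM => //; exact: measurable_rad.
by move=> z; rewrite !normrM (ger0_norm (lam_ge0 z)) (ger0_norm (rad_ge0 z)) ler_wpM2r// rad_le_lam.
Qed.

Lemma hartley_sup F x : Hs s F -> `|hartley F x| <= 2 * c2pi * Ks s * ns s F.
Proof.
move=> HF; have [LF _] := Hs_L1 HF; have [LlF nF] := Hs_lam hs HF.
apply: le_trans (hartley_bound x LF) _.
rewrite [leRHS](_ : _ = c2pi * (2 * (Ks s * ns s F))); last by ring.
apply: ler_wpM2l; first exact: ltW c2pi_gt0.
apply: ler_wpM2l => //; apply: le_trans nF; apply: le_Rintegral => //; try exact: L1_abs.
by move=> z _; rewrite normrM (ger0_norm (lam_ge0 z)) ler_peMl// lam_ge1.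
Qed.

Lemma velocityE alpha f F x : kern 1 0 (fraclap_symbol alpha) -> L2 mu f -> is_hart f F -> Hs s F ->
  velocity alpha f x = (c2pi * vel (fraclap_symbol alpha) F (fun z => z.2) x,
                        - (c2pi * vel (fraclap_symbol alpha) F (fun z => z.1) x)).
Proof.
move=> Km Lf hF HF; have mF := wL2_meas ws HF; have [LF _] := Hs_lam hs HF.
have [_ mm _ _ _] := Km; have e := fourierE Lf hF; have [m1 m2 _] := fourier_spec Lf.
have [HV _] := hartley_Bop x Km mF mF LF LF.
have ms := measurable_sin_d x; have mc := measurable_cos_d x.
have main (a : R * R -> R) : measurable_fun setT (a : P -> R) ->
  (forall z, `|a z| <= rad z) ->
  complex.Re (inverse_fourier (fun xi => (0 +i* a xi)%C * (fraclap_symbol alpha xi)%:C%C * fourier f xi) x) =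
  - (c2pi * vel (fraclap_symbol alpha) F a x).
  move=> ma ar; have [LV _] := HV a ma ar.
  rewrite /inverse_fourier /cintegral /= mul0r subr0 -mulrN; congr (_ * _).
  rewrite /vel -mulN1r -(RintegralZl _ measurableT LV); apply: ae_Rint.
  - apply: filterS e => z ->; rewrite /cplx/= /cos_d /sin_d.
    by move: (cos _) (sin _) (fraclap_symbol _ _) (evp _ _) (odp _ _) => *; ring.
  - rewrite (_ : (fun z => _) = (fun z => cos_d x z * (- (a z * fraclap_symbol alpha z * complex.Im (fourier f z))) -
        sin_d x z * (a z * fraclap_symbol alpha z * complex.Re (fourier f z)))); last first.
      apply/funext => z; rewrite /cos_d /sin_d; case: (fourier f z) => u v /=; ring.
    apply: measurable_funB; apply: measurable_funM => //.
      apply: (measurableT_comp (@oppr_measurable R setT)).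
      by apply: measurable_funM => //; exact: measurable_funM.
    by apply: measurable_funM => //; exact: measurable_funM.
  - exact: (L1_meas (L1Z (-1) LV)).
rewrite /velocity; congr pair; last exact: main meas_fst fst_le_rad.
rewrite (main (fun z => - z.2)).
- have [LV _] := HV _ meas_snd snd_le_rad.
  rewrite -mulrN; congr (_ * _); rewrite /vel -mulN1r -(RintegralZl _ measurableT); last first.
    have := L1Z (-1) LV; congr L1; apply/funext => z; ring.
  by apply: eq_Rintegral => z _; ring.
- by apply: (measurableT_comp (@oppr_measurable R setT)); exact: meas_snd.
- by move=> z; rewrite normrN snd_le_rad.
Qed.

Lemma gradientE f F x : Hs s F -> f = hartley F ->
  gradient f x = (c2pi * grd F (fun z => z.1) x, c2pi * grd F (fun z => z.2) x).
Proof.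
move=> HF ->; have [LF LrF] := Hs_L1 HF; have mF := wL2_meas ws HF.
have L (a : P -> R) : measurable_fun setT a -> (forall z, `|a z| <= rad z) -> L1 mu (fun z => a z * F z).
  move=> ma ar; apply: (L1_dom _ _ LrF); first exact: measurable_funM.
  by move=> z; rewrite !normrM (ger0_norm (rad_ge0 z)) ler_wpM2r.
have e1 (z : R * R) : dot ((1, 0) : R * R) z = z.1 by rewrite /dot/= mul1r mul0r addr0.
have e2 (z : R * R) : dot ((0, 1) : R * R) z = z.2 by rewrite /dot/= mul1r mul0r add0r.
rewrite /gradient; congr pair; rewrite D_hartley//.
- by congr (_ * _); apply: eq_Rintegral => z _; rewrite e1.
- by under [X in L1 _ X]eq_fun do rewrite e1; exact: L meas_fst fst_le_rad.
- by congr (_ * _); apply: eq_Rintegral => z _; rewrite e2.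
- by under [X in L1 _ X]eq_fun do rewrite e2; exact: L meas_snd snd_le_rad.
Qed.

(** The link between the pointwise equation and the equation F_t = Bop(F, F), through the explicit
    velocity and gradient and [hartley_Bop]. *)
Lemma rhsE alpha f F x : kern 1 0 (fraclap_symbol alpha) -> Hs (s + 1) F -> f = hartley F ->
  - dot (velocity alpha f x) (gradient f x) = hartley (Bop (fraclap_symbol alpha) F F) x.
Proof.
move=> Km HF fE; have [HF0 _] := Hs_le hs hp HF.
have [LF LrF] := Hs_L1 HF0; have LF2 := Hs_L2 HF0.
have [Lf hF] : L2 mu f /\ is_hart f F by rewrite fE; exact: hart_hartley.
have mF := wL2_meas ws HF0; have [LlF _] := Hs_lam hs HF0.
have [ok _ _] := est_s hs hp Km HF0 HF.
have [_ /(_ ok) ->] := hartley_Bop x Km mF mF LlF LlF.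
by rewrite (velocityE x Km Lf hF HF0) (gradientE x HF0 fE) /dot/=; ring.
Qed.

Lemma hartley_inj F G : Hs s F -> Hs s G -> hartley F = hartley G -> {ae mu, forall z : P, F z = G z}.
Proof.
move=> HF HG e; have [LF _] := Hs_L1 HF; have [LG _] := Hs_L1 HG.
have [L h1] := hart_hartley LF (Hs_L2 HF); have [_ h2] := hart_hartley LG (Hs_L2 HG).
by rewrite -e in h2; exact: hart_unique L h1 h2.
Qed.

(** By inversion [f] and the Hartley integral of its transform agree almost everywhere; both are
    continuous, hence they agree everywhere, as the pointwise equation requires. *)
Lemma representation f : in_H (s + 1) f -> continuous f ->
  [/\ L2 mu f, is_hart f (hart f), Hs (s + 1) (hart f), f = hartley (hart f) &
      Hnorm (s + 1) f = (ns (s + 1) (hart f))%:E].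
Proof.
move=> [/Lfun2P Lf fin] cf; have hF := hart_spec Lf; have [h1 h2] := HnormE (s + 1) Lf hF.
have HF := h2 fin; have [HF0 _] := Hs_le hs hp HF; have [LF LrF] := Hs_L1 HF0.
split => //; last exact: h1.
apply: cont_ae_eq => //; first exact: continuous_hartley.
exact: hart_pointwise Lf hF LF.
Qed.

End Representation.

Lemma quarter_sum {R : realType} (a b d : R) : a <= d / 4 -> b < d / 2 -> 0 < d -> a + b < d.
Proof. lra. Qed.

Lemma hartleyZ {R : realType} (c : R) (f : R * R -> R) xi :
  L1 (@lebesgue_measure R \x @lebesgue_measure R)%E (f : plane R -> R) ->
  hartley (fun x => c * f x) xi = c * hartley f xi.
Proof.
move=> Lf; rewrite /hartley mulrCA -(RintegralZl _ measurableT (L1_cas xi Lf)).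
by congr (_ * _); apply: eq_Rintegral => z _; rewrite mulrA.
Qed.

Lemma dist_between {R : realType} (a b u v d : R) : a <= u -> u <= b -> a <= v -> v <= b -> b - a <= d -> `|u - v| <= d.
Proof. by move=> *; rewrite ler_norml; apply/andP; split; lra. Qed.

(** * Solutions and flows *)

Section Within.
Context {R : realType} (T : R).
Implicit Types (f D : R -> R) (a b t e : R).

(* [f] is differentiable with derivative [D], one-sidedly at the endpoints. *)
Definition dwithin f D : Prop := forall t, 0 <= t -> t <= T -> forall e, 0 < e ->
  exists2 d, 0 < d & forall u, 0 <= u -> u <= T -> `|u - t| < d ->
    `|f u - f t - D t * (u - t)| <= e * `|u - t|.

Lemma dwithin_cont f D t e : dwithin f D -> 0 <= t -> t <= T -> 0 < e ->
  exists2 d, 0 < d & forall u, 0 <= u -> u <= T -> `|u - t| < d -> `|f u - f t| <= e.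
Proof.
move=> Hf t0 tT e0; have [d d0 hd] := Hf t t0 tT 1 ltr01.
have c0 : 0 < `|D t| + 1 by rewrite ltr_wpDl.
exists (Num.min d (e / (`|D t| + 1))); first by rewrite lt_min d0 divr_gt0.
move=> u u0 uT; rewrite lt_min => /andP[ud ue].
have h := hd u u0 uT ud.
have -> : f u - f t = (f u - f t - D t * (u - t)) + D t * (u - t) by ring.
apply: le_trans (ler_normD _ _) _; rewrite normrM.
apply: le_trans (lerD h (lexx _)) _.
by rewrite -mulrDl addrC mulrC -ler_pdivlMr// ltW.
Qed.

(** In the open interval [dwithin] is ordinary differentiability, and at the ends it gives the
    continuity that the mean value theorem asks for. *)
Lemma mvt_within f D a b : 0 <= a -> a < b -> b <= T -> dwithin f D ->
  exists2 c, a <= c <= b & f b - f a = D c * (b - a).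
Proof.
move=> a0 ab bT Hf.
have [c||c ci E] := @MVT_segment R f D a b (ltW ab).
- rewrite in_itv/= => /andP[ac cb].
  have c0 : 0 <= c by apply: le_trans a0 (ltW ac).
  have cT : c <= T by apply: le_trans (ltW cb) bT.
  have cv : h^-1 *: ((f \o shift c) (h *: (1:R)) - f c) @[h --> (0:R)^'] --> D c.
    apply/cvgrPdist_le => e e0; have [d d0 hd] := Hf c c0 cT e e0.
    near=> h.
    have h0 : h != 0 by near: h; exact: nbhs_dnbhs_neq.
    have /andP[h1 h2] : - Num.min d (Num.min (c - a) (b - c)) < h < Num.min d (Num.min (c - a) (b - c)).
      rewrite -ltr_norml; near: h; apply: dnbhs0_lt.
      by rewrite !lt_min d0 !subr_gt0 ac cb.
    rewrite /= [h *: 1]mulr1.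
    have hm : Num.min d (Num.min (c - a) (b - c)) <= d by rewrite ge_min lexx.
    have hm2 : Num.min d (Num.min (c - a) (b - c)) <= c - a by rewrite !ge_min lexx !orbT.
    have hm3 : Num.min d (Num.min (c - a) (b - c)) <= b - c by rewrite !ge_min lexx !orbT.
    have := hd (h + c); rewrite addrK => /(_ _ _ _)/wrap[||| H].
    + by lra.
    + by lra.
    + by rewrite ltr_norml; lra.
    rewrite distrC; have -> : h^-1 *: (f (h + c) - f c) - D c = h^-1 * (f (h + c) - f c - D c * h).
      by rewrite /GRing.scale/=; field.
    by rewrite normrM normfV ler_pdivrMl ?normr_gt0// [leRHS]mulrC.
  by apply: DeriveDef; [apply/cvg_ex; exists (D c)|exact: cvg_lim cv].
- apply/subspace_continuousP => t /=; rewrite in_itv/= => /andP[t1 t2].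
  apply/cvgrPdist_le => e e0.
  have [d d0 hd] := dwithin_cont Hf (le_trans a0 t1) (le_trans t2 bT) e0.
  apply/nbhs_ballP; exists d => //= u; rewrite /ball/= => ut; rewrite in_itv/= => /andP[u1 u2].
  by rewrite distrC; apply: hd; [exact: le_trans a0 u1|exact: le_trans u2 bT|rewrite distrC].
- by exists c => //; move: ci; rewrite in_itv.
Unshelve. all: by end_near. Qed.

(* A quantified form of the compactness of [0, T]. *)
Lemma interval_unif (Q : R -> R -> Prop) :
  (forall t, 0 <= t -> t <= T -> exists d N0 : R, 0 < d /\ forall u N, 0 <= u -> u <= T -> `|u - t| < d ->
     N0 <= N -> Q u N) ->
  exists N0 : R, forall u N, 0 <= u -> u <= T -> N0 <= N -> Q u N.
Proof.
move=> H; have /compact_near_coveringP/near_covering_withinP cpt := @segment_compact R 0 T.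
have [x|M [Mr hM]] := cpt R (pinfty_nbhs R) (fun N u => Q u N) _.
  rewrite /= in_itv/= => /andP[x0 xT]; have [d [N0 [d0 hd]]] := H x x0 xT.
  exists (ball x d, [set N | N0 <= N]) => /=.
    by split; [exact: nbhsx_ballx|exact: nbhs_pinfty_ge (num_real _)].
  move=> [u N] /= [xu N0N]; rewrite in_itv/= => /andP[u0 uT].
  by apply: hd => //; move: xu; rewrite /ball/= distrC.
exists (M + 1) => u N u0 uT MN.
apply: (hM N) => /=; last by rewrite in_itv/= u0 uT.
by apply: lt_le_trans MN; rewrite ltrDl.
Qed.

End Within.

Section SolutionFlow.
Context {R : realType} (s : R) (p : nat) (hs : 2 < s) (hp : s + 2 <= p%:R) (T : R).
Context (alpha : R) (Km : kern 1 0 (fraclap_symbol alpha)) (w0 : R * R -> R) (w : R -> R * R -> R).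
Context (sol : gSQG_solution alpha s T w0 w).
Local Notation mu := (@lebesgue_measure R \x @lebesgue_measure R)%E.
Implicit Types (F G : R * R -> R) (x z : R * R) (t u a b d e : R) (k j : nat).
Local Notation m := (fraclap_symbol alpha).
Local Notation gam t := (hart (w t)).
Local Notation B t := (Bop m (gam t) (gam t)).

Lemma sol_rep t : 0 <= t -> t <= T -> [/\ L2 mu (w t), is_hart (w t) (gam t), Hs (s + 1) (gam t),
  w t = hartley (gam t) & Hnorm (s + 1) (w t) = (ns (s + 1) (gam t))%:E].
Proof.
move=> t0 tT; have [[H1 _] H2 _ _] := sol; have tI : t \in `[0, T] by rewrite in_itv/= t0.
exact: (representation hs hp (H1 t tI) (H2 t tI)).
Qed.

Lemma sol_cont t e : 0 <= t -> t <= T -> 0 < e -> exists2 d, 0 < d & forall u, 0 <= u -> u <= T ->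
  `|u - t| < d -> ns (s + 1) (fun z => gam u z - gam t z) <= e.
Proof.
move=> t0 tT e0; have [[_ H1] _ _ _] := sol; have tI : t \in `[0, T] by rewrite in_itv/= t0.
have [Lt hT Ht _ _] := sol_rep t0 tT.
have nb : nbhs (0%E : \bar R) [set y | (y < e%:E)%E].
  by apply: open_nbhs_nbhs; split; [exact: open_ereal_lt_ereal|rewrite /= lte_fin].
have /nbhs_ballP [d d0 hd] := H1 t tI _ nb; exists d => // u u0 uT ud.
have [Lu hU Hu _ _] := sol_rep u0 uT.
have /= := hd u; rewrite /ball/= distrC in_itv/= u0 uT => /(_ ud erefl).
have [E1 _] := HnormE (s + 1) (L2B Lu Lt) (hartB Lu Lt hU hT).
by rewrite (E1 (wL2B Hu Ht)) lte_fin => /ltW.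
Qed.

Lemma sol_dwithin x : dwithin T (fun t => w t x) (fun t => hartley (B t) x).
Proof.
move=> t t0 tT e e0; have tI : t \in `[0, T] by rewrite in_itv/= t0.
have [_ _ Ht wE _] := sol_rep t0 tT.
have [_ _ _ /(_ t x tI)] := sol; rewrite (rhsE hs hp x Km Ht wE) => /cvgrPdist_le /(_ e e0).
move=> /nbhs_ballP [d d0 hd]; exists d => // u u0 uT ud.
have [->|ut] := eqVneq u t; first by rewrite !subrr mulr0 subrr normr0 mulr0.
have /= := hd u; rewrite /ball/= distrC in_itv/= u0 uT => /(_ ud ut erefl) h.
have ne : u - t != 0 by rewrite subr_eq0.
have -> : w u x - w t x - hartley (B t) x * (u - t) =
    - (hartley (B t) x - (u - t)^-1 * (w u x - w t x)) * (u - t) by field.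
by rewrite normrM normrN ler_wpM2r.
Qed.

End SolutionFlow.

(** * From pointwise equations to curves in H^s *)

Section Curve.
Context {R : realType} (s : R) (p : nat) (hs : 2 < s) (hp : s + 2 <= p%:R) (T : R) (T0 : 0 < T).
Context (m : R * R -> R) (Km : kern 1 0 m) (gam : R -> R * R -> R).
Local Notation P := (plane R).
Local Notation mu := (@lebesgue_measure R \x @lebesgue_measure R)%E.
Implicit Types (F G : R * R -> R) (x z : R * R) (t u a b d e : R) (k j : nat).
Local Notation K := (Kc s p).
Local Notation B t := (Bop m (gam t) (gam t)).
Let ws := weight_s hs hp.
Let ws1 := weight_s1 hs hp.
Let K0 : 0 <= K := Kc_ge0 s p.
Context (gamH : forall t, 0 <= t -> t <= T -> Hs (s + 1) (gam t)).
Context (gamC : forall t e, 0 <= t -> t <= T -> 0 < e -> exists2 d, 0 < d & forall u, 0 <= u -> u <= T ->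
  `|u - t| < d -> ns (s + 1) (fun z => gam u z - gam t z) <= e).
Context (gamD : forall x, dwithin T (fun t => hartley (gam t) x) (fun t => hartley (B t) x)).

(** Compactness of the time interval, with the parameter [N] of [interval_unif] playing the role of
    the bound itself. *)
Lemma curve_bound : exists2 Y, 0 <= Y & forall t, 0 <= t -> t <= T -> ns (s + 1) (gam t) <= Y.
Proof.
have [t t0 tT|Y hY] := @interval_unif R T (fun u N => ns (s + 1) (gam u) <= N).
  have [d d0 hd] := gamC t0 tT ltr01.
  exists d, (ns (s + 1) (gam t) + 1); split => // u N u0 uT ud hN.
  apply: le_trans hN; apply: le_trans (lerD (lexx _) (hd u u0 uT ud)).
  have := wnD (gamH t0 tT) (wL2B (gamH u0 uT) (gamH t0 tT)).
  by under [X in wn _ X <= _ -> _]eq_fun do rewrite addrC subrK.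
exists `|Y| => // t t0 tT; apply: hY => //; exact: ler_norm.
Qed.

(** Heine's theorem, with the inverse of the parameter of [interval_unif] as modulus of
    continuity. *)
Lemma curve_unif e : 0 < e -> exists2 d, 0 < d & forall t u, 0 <= t -> t <= T -> 0 <= u -> u <= T ->
  `|u - t| <= d -> ns (s + 1) (fun z => gam u z - gam t z) <= e.
Proof.
move=> e0; have e2 : 0 < e / 2 by rewrite divr_gt0.
have [t t0 tT|M hM] := @interval_unif R T (fun u N => forall v, 0 <= v -> v <= T ->
    `|v - u| <= N^-1 -> ns (s + 1) (fun z => gam v z - gam u z) <= e).
  have [d d0 hd] := gamC t0 tT e2.
  exists (d / 2), (4 / d); split; first by rewrite divr_gt0.
  move=> u N u0 uT ud hN v v0 vT vu.
  have N0 : 0 < N by apply: lt_le_trans hN; rewrite divr_gt0.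
  have Nd : N^-1 <= d / 4 by rewrite -[d / 4]invrK lef_pV2 ?posrE ?invr_gt0 ?divr_gt0// invf_div.
  have ud' : `|u - t| < d by apply: lt_le_trans ud _; exact: half_le.
  have vd' : `|v - t| < d.
    have -> : v - t = (v - u) + (u - t) by ring.
    apply: le_lt_trans (ler_normD _ _) _.
    exact: quarter_sum (le_trans vu Nd) ud d0.
  have tr := wn_triangle (gamH v0 vT) (gamH t0 tT) (gamH u0 uT).
  apply: le_trans tr _; rewrite [e]splitr; apply: lerD; first exact: hd.
  by rewrite wn_distC; exact: hd.
exists (`|M| + 1)^-1; first by rewrite invr_gt0 ltr_wpDl.
move=> t u t0 tT u0 uT ut; apply: (hM t (`|M| + 1)) => //.
by apply: le_trans (ler_norm _) _; rewrite lerDl.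
Qed.

Lemma curve_tails e : 0 < e -> exists N0 : R, forall N t, N0 <= N -> 0 <= t -> t <= T ->
  ns (s + 1) (fun z => gam t z - cut N (gam t) z) <= e.
Proof.
move=> e0; have e2 : 0 < e / 2 by rewrite divr_gt0.
have [t t0 tT|M hM] := @interval_unif R T
    (fun u N => ns (s + 1) (fun z => gam u z - cut N (gam u) z) <= e); last first.
  by exists M => N t MN t0 tT; exact: hM.
have [d d0 hd] := gamC t0 tT e2; have [N0 hN0] := tail_small ws1 (gamH t0 tT) e2.
exists d, N0; split => // u N u0 uT ud hN.
have Hd := wL2B (gamH u0 uT) (gamH t0 tT).
have [H1 h1] := wL2_tail N ws1 Hd; have [H2 _] := wL2_tail N ws1 (gamH t0 tT).
have := wnD H1 H2.
rewrite (_ : (fun z => _ + _) = (fun z => gam u z - cut N (gam u) z)); last first.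
  apply/funext => z; rewrite cutB.
  by move: (gam u z) (gam t z) (cut _ _ _) (cut _ _ _) => *; ring.
move=> h; apply: le_trans h _; rewrite [e]splitr; apply: lerD; last exact: hN0.
by apply: le_trans h1 _; exact: hd.
Qed.



Lemma curve_B : exists2 L, 0 <= L & forall t, 0 <= t -> t <= T -> Hs s (B t) /\ ns s (B t) <= L.
Proof.
have [Y Y0 hY] := curve_bound.
have c1 : 0 <= 2 * K by rewrite mulr_ge0.
exists (2 * K * Y * Y); first by apply: mulr_ge0 => //; exact: mulr_ge0.
move=> t t0 tT; have H := gamH t0 tT; have [H0 n0] := Hs_le hs hp H.
have [_ HB h] := est_s hs hp Km H0 H; split=> //; apply: le_trans h _; rewrite mul1r.
have hyt := hY t t0 tT; have n1 := le_trans n0 hyt.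
have p1 : 0 <= 2 * K * ns s (gam t) by exact: mulr_ge0 c1 (wn_ge0 _ _).
exact: ler_pM p1 (wn_ge0 _ _) (ler_wpM2l c1 n1) hyt.
Qed.

Lemma curve_B_unif e : 0 < e -> exists2 d, 0 < d & forall t u, 0 <= t -> t <= T -> 0 <= u -> u <= T ->
  `|u - t| <= d -> ns s (fun z => B u z - B t z) <= e.
Proof.
move=> e0; have [Y Y0 hY] := curve_bound.
have c1 : 0 <= 2 * K by rewrite mulr_ge0.
have c0 : 0 <= 2 * K * (Y + Y) by apply: mulr_ge0 => //; exact: addr_ge0.
have [d d0 hd] := curve_unif (small_gt0 c0 e0); exists d => // t u t0 tT u0 uT ut.
have [_ h] := Bop_sub hs hp Km (gamH u0 uT) (gamH t0 tT).
apply: le_trans h _.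
apply: le_trans (small_le c0 e0 (hd t u t0 tT u0 uT ut)).
apply: ler_wpM2r; first exact: wn_ge0.
by apply: ler_wpM2l => //; apply: lerD; exact: hY.
Qed.

(* Riemann sums of [B] over the [2 ^ k] equal parts of [a, b]. *)
Fixpoint rsum k a b z : R :=
  if k is k'.+1 then rsum k' a ((a + b) / 2) z + rsum k' ((a + b) / 2) b z else (b - a) * B a z.

Let mid a b : a <= b -> a <= (a + b) / 2 <= b. Proof. by move=> ab; apply/andP; split; lra. Qed.

Lemma Hs_rsum k a b : 0 <= a -> a <= b -> b <= T -> Hs s (rsum k a b).
Proof.
have [L L0 HB] := curve_B.
elim: k a b => [|k IH] a b a0 ab bT; first exact: (wL2Z _ (HB a a0 (le_trans ab bT)).1).
have /andP[h1 h2] := mid ab.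
exact: (wL2D (IH _ _ a0 h1 (le_trans h2 bT)) (IH _ _ (le_trans a0 h1) h2 bT)).
Qed.

Let Hsub F G : Hs s F -> Hs s G -> Hs s (fun z => F z - G z). Proof. exact: wL2B. Qed.

Lemma rsum_cst e a' k a b : 0 <= a -> a <= b -> b <= T -> 0 <= a' -> a' <= T ->
  (forall u, a <= u -> u <= b -> ns s (fun z => B u z - B a' z) <= e) ->
  ns s (fun z => rsum k a b z - (b - a) * B a' z) <= (b - a) * e.
Proof.
have [L L0 HB] := curve_B; move=> + + + a0' aT'.
elim: k a b => [|k IH] a b a0 ab bT he.
  have aT := le_trans ab bT; rewrite /=.
  under [X in ns _ X]eq_fun do rewrite -mulrBr.
  rewrite [leLHS]wnZ; last exact: Hsub (HB a a0 aT).1 (HB a' a0' aT').1.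
  rewrite ger0_norm ?subr_ge0//; apply: ler_wpM2l; first by rewrite subr_ge0.
  exact: he.
have /andP[h1 h2] := mid ab; set c := (a + b) / 2 in h1 h2 *.
have i1 := IH a c a0 h1 (le_trans h2 bT) (fun u hu hu' => he u hu (le_trans hu' h2)).
have i2 := IH c b (le_trans a0 h1) h2 bT (fun u hu hu' => he u (le_trans h1 hu) hu').
have q1 : Hs s (fun z => rsum k a c z - (c - a) * B a' z).
  by apply: Hsub; [exact: Hs_rsum a0 h1 (le_trans h2 bT)|exact: (wL2Z _ (HB a' a0' aT').1)].
have q2 : Hs s (fun z => rsum k c b z - (b - c) * B a' z).
  by apply: Hsub; [exact: Hs_rsum (le_trans a0 h1) h2 bT|exact: (wL2Z _ (HB a' a0' aT').1)].
have := le_trans (wnD q1 q2) (lerD i1 i2).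
rewrite -mulrDl (_ : c - a + (b - c) = b - a); last by ring.
congr (_ <= _); congr wn; apply/funext => z; rewrite /= -/c; ring.
Qed.

Lemma rsum_refine e d k j a b : (forall t u, 0 <= t -> t <= T -> 0 <= u -> u <= T -> `|u - t| <= d ->
    ns s (fun z => B u z - B t z) <= e) -> 0 <= a -> a <= b -> b <= T -> (b - a) / 2 ^+ k <= d ->
  ns s (fun z => rsum (j + k) a b z - rsum k a b z) <= (b - a) * e.
Proof.
move=> he; elim: k a b => [|k IH] a b a0 ab bT dk.
  rewrite addn0 [rsum 0 a b]/=; apply: rsum_cst => //; first exact: le_trans ab bT.
  move=> u au ub; apply: he => //; [exact: le_trans ab bT|exact: le_trans a0 au|exact: le_trans ub bT|].
  move: dk; rewrite expr0 divr1 ger0_norm ?subr_ge0//; apply: le_trans; exact: lerB.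
have /andP[h1 h2] := mid ab; rewrite addnS /=; set c := (a + b) / 2 in h1 h2 *.
have dk2 : (b - a) / 2 / 2 ^+ k <= d by move: dk; rewrite exprS invfM mulrA.
have e1 : c - a = (b - a) / 2 by rewrite /c; field.
have e2 : b - c = (b - a) / 2 by rewrite /c; field.
have i1 : ns s (fun z => rsum (j + k) a c z - rsum k a c z) <= (c - a) * e.
  by apply: IH => //; [exact: le_trans h2 bT|rewrite e1].
have i2 : ns s (fun z => rsum (j + k) c b z - rsum k c b z) <= (b - c) * e.
  by apply: IH => //; [exact: le_trans a0 h1|rewrite e2].
have q1 : Hs s (fun z => rsum (j + k) a c z - rsum k a c z).
  by apply: Hsub; exact: Hs_rsum a0 h1 (le_trans h2 bT).
have q2 : Hs s (fun z => rsum (j + k) c b z - rsum k c b z).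
  by apply: Hsub; exact: Hs_rsum (le_trans a0 h1) h2 bT.
have := le_trans (wnD q1 q2) (lerD i1 i2).
rewrite -mulrDl (_ : c - a + (b - c) = b - a); last by ring.
congr (_ <= _); congr wn; apply/funext => z; ring.
Qed.

Let C := 2 * c2pi * Ks s.
Let C0 : 0 <= C. Proof. by rewrite /C !mulr_ge0// ?Ks_ge0// ltW// c2pi_gt0. Qed.

Lemma rsum_hartley e d k a b x : (forall t u, 0 <= t -> t <= T -> 0 <= u -> u <= T -> `|u - t| <= d ->
    ns s (fun z => B u z - B t z) <= e) -> 0 <= e -> 0 <= a -> a <= b -> b <= T -> (b - a) / 2 ^+ k <= d ->
  `|hartley (gam b) x - hartley (gam a) x - hartley (rsum k a b) x| <= (b - a) * (C * e).
Proof.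
have [L L0 HB] := curve_B.
move=> he e0; elim: k a b => [|k IH] a b a0 ab bT dk.
  have aT := le_trans ab bT.
  move: ab; rewrite le_eqVlt => /orP[/eqP ab|ab].
    rewrite /= ab !subrr mul0r sub0r normrN /hartley Rintegral_eq0 ?mulr0 ?normr0//.
    by move=> y; rewrite !mul0r.
  have [c /andP[ac cb] E] := mvt_within a0 ab bT (gamD x).
  have c0 := le_trans a0 ac; have cT := le_trans cb bT.
  have [l1 _] := Hs_L1 hs hp (HB a a0 aT).1; have [l2 _] := Hs_L1 hs hp (HB c c0 cT).1.
  have -> : hartley (gam b) x - hartley (gam a) x - hartley (rsum 0 a b) x =
      (b - a) * hartley (fun z => B c z - B a z) x.
    rewrite (hartleyB x l2 l1) E [rsum 0 a b]/= (hartleyZ (b - a) x l1).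
    by move: (hartley _ _) (hartley _ _) => h1 h2; ring.
  have ba0 : 0 <= b - a by rewrite subr_ge0 ltW.
  rewrite normrM (ger0_norm ba0); apply: ler_wpM2l => //.
  apply: le_trans (hartley_sup hs hp x (Hsub (HB c c0 cT).1 (HB a a0 aT).1)) _.
  apply: ler_wpM2l => //; apply: he => //; move: dk; rewrite expr0 divr1.
  by rewrite ger0_norm ?subr_ge0//; apply: le_trans; exact: lerB.
have /andP[h1 h2] := mid ab; rewrite /=; set c := (a + b) / 2 in h1 h2 *.
have dk2 : (b - a) / 2 / 2 ^+ k <= d by move: dk; rewrite exprS invfM mulrA.
have e1 : c - a = (b - a) / 2 by rewrite /c; field.
have e2 : b - c = (b - a) / 2 by rewrite /c; field.
have i1 := IH a c a0 h1 (le_trans h2 bT).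
have i2 := IH c b (le_trans a0 h1) h2 bT.
rewrite e1 in i1; rewrite e2 in i2; have := lerD (i1 dk2) (i2 dk2).
rewrite -mulrDl -splitr; apply: le_trans; apply: le_trans (ler_normD _ _); rewrite le_eqVlt; apply/orP; left.
have [l1 _] := Hs_L1 hs hp (Hs_rsum k a0 h1 (le_trans h2 bT)).
have [l2 _] := Hs_L1 hs hp (Hs_rsum k (le_trans a0 h1) h2 bT).
by rewrite (hartleyD x l1 l2); apply/eqP; congr (`|_|); ring.
Qed.


Lemma rsum_pointwise a b e : 0 <= a -> a <= b -> b <= T -> 0 < e -> exists N : nat, forall k x, (N <= k)%N ->
  `|hartley (gam b) x - hartley (gam a) x - hartley (rsum k a b) x| <= e.
Proof.
move=> a0 ab bT e0; have c0 : 0 <= T * C by rewrite mulr_ge0// ltW.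
have [d d0 hd] := curve_B_unif (small_gt0 c0 e0).
have [N hN] := hh_small T d0; exists N => k x Nk.
have e1 := small_gt0 c0 e0; set e' := e / _ in hd e1.
have baT : b - a <= T by apply: le_trans bT; rewrite lerBlDr lerDl.
apply: le_trans (rsum_hartley x hd (ltW e1) a0 ab bT _) _.
  by apply: le_trans (hN k Nk); rewrite /time_step ler_pM2r// invr_gt0 exprn_gt0.
apply: le_trans (small_le c0 e0 (lexx _)).
by rewrite mulrA; apply: ler_wpM2r; [exact: ltW|apply: ler_wpM2r].
Qed.

(** The Riemann sums are Cauchy in H^s. Their transforms converge pointwise to that of the
    increment, so injectivity of the transform identifies the limit. *)
Lemma rsum_limit a b : 0 <= a -> a <= b -> b <= T ->
  forall e, 0 < e -> exists N : nat, forall n, (N <= n)%N ->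
    ns s (fun z => rsum n a b z - (gam b z - gam a z)) <= e.
Proof.
move=> a0 ab bT.
have Hr n : Hs s (rsum n a b) by exact: Hs_rsum.
have [e e0|G [HG hG]] := Hs_complete Hr.
  have e2 : 0 < e / 2 by rewrite divr_gt0.
  have [d d0 hd] := curve_B_unif (small_gt0 (ltW T0) e2).
  have e1 := small_gt0 (ltW T0) e2; set e' := e / 2 / _ in hd e1.
  have [N hN] := hh_small T d0; exists N.
  have baT : b - a <= T by apply: le_trans bT; rewrite lerBlDr lerDl.
  have main n : (N <= n)%N -> ns s (fun z => rsum n a b z - rsum N a b z) <= e / 2.
    move=> Nn; rewrite -(subnK Nn); apply: le_trans (rsum_refine _ hd a0 ab bT _) _.
      by apply: le_trans (hN N (leqnn _)); rewrite /time_step ler_pM2r// invr_gt0 exprn_gt0.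
    apply: le_trans (small_le (ltW T0) e2 (lexx _)).
    by apply: ler_wpM2r => //; exact: ltW.
  move=> i n Ni Nn; apply: le_trans (wn_triangle (Hr i) (Hr N) (Hr n)) _.
  rewrite [e]splitr; apply: lerD; first exact: main.
  by rewrite wn_distC; exact: main.
have aT := le_trans ab bT; have b0 := le_trans a0 ab.
have [Ha _] := Hs_le hs hp (gamH a0 aT); have [Hb _] := Hs_le hs hp (gamH b0 bT).
have [la _] := Hs_L1 hs hp Ha; have [lb _] := Hs_L1 hs hp Hb; have [lG _] := Hs_L1 hs hp HG.
have hE : {ae mu, forall z : P, G z = gam b z - gam a z}.
  apply: (hartley_inj hs hp HG (Hsub Hb Ha)); apply/funext => x; rewrite (hartleyB x lb la).
  apply/eqP; rewrite -subr_eq0 -normr_le0; apply/ler_addgt0Pl => e e0; rewrite addr0.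
  have e2 : 0 < e / 2 by rewrite divr_gt0.
  have [N1 h1] := rsum_pointwise a0 ab bT e2.
  have [N2 h2] := hG _ (small_gt0 C0 e2); pose n := maxn N1 N2.
  have [ln _] := Hs_L1 hs hp (Hr n).
  have -> : hartley G x - (hartley (gam b) x - hartley (gam a) x) =
     - (hartley (gam b) x - hartley (gam a) x - hartley (rsum n a b) x)
     - hartley (fun z => rsum n a b z - G z) x by rewrite (hartleyB x ln lG); ring.
  apply: le_trans (ler_normB _ _) _; rewrite normrN [e]splitr; apply: lerD.
    by apply: h1; exact: leq_maxl.
  apply: le_trans (hartley_sup hs hp x (Hsub (Hr n) HG)) _.
  by apply: (small_le C0 e2); apply: h2; exact: leq_maxr.
move=> e e0; have [N hN] := hG e e0; exists N => n Nn.
have q : {ae mu, forall z : P, rsum n a b z - (gam b z - gam a z) = rsum n a b z - G z}.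
  by apply: filterS hE => z ->.
by rewrite [leLHS](wn_ae (Hsub (Hr n) (Hsub Hb Ha)) (Hsub (Hr n) HG) q) hN.
Qed.

(** Differentiability in H^s without a vector-valued integral: the increment is a limit of Riemann
    sums, each close to [(b - a) * B a'] when [B] varies little. *)
Lemma curve_diff e : 0 < e -> exists2 d, 0 < d & forall a b a', 0 <= a -> a <= b -> b <= T ->
  a <= a' <= b -> b - a <= d ->
  ns s (fun z => gam b z - gam a z - (b - a) * B a' z) <= (b - a) * e.
Proof.
move=> e0; have [d d0 hd] := curve_B_unif e0; exists d => // a b a' a0 ab bT /andP[aa ab'] bad.
have [L L0 HB] := curve_B.
have aT := le_trans ab bT; have b0 := le_trans a0 ab.
have a0' := le_trans a0 aa; have aT' := le_trans ab' bT.
have [Ha _] := Hs_le hs hp (gamH a0 aT); have [Hb _] := Hs_le hs hp (gamH b0 bT).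
have Hd := Hsub Hb Ha; have HZ := wL2Z (b - a) (HB a' a0' aT').1.
apply/ler_addgt0Pl => r r0; have [N hN] := rsum_limit a0 ab bT r0.
have Hr := Hs_rsum N a0 ab bT.
have tr := wn_triangle Hd Hr HZ; apply: (le_trans tr); apply: lerD.
  by rewrite wn_distC; exact: hN.
apply: rsum_cst => // u au ub; apply: hd => //; [exact: le_trans a0 au|exact: le_trans ub bT|].
exact: (dist_between au ub aa ab' bad).
Qed.

Lemma curve_flow : exists2 Y, 0 <= Y & flow s T m Y gam.
Proof.
have [Y Y0 hY] := curve_bound; exists Y => //; split.
- by move=> t t0 tT; split; [exact: gamH|exact: hY].
- exact: curve_tails.
move=> e e0; have [d d0 hd] := curve_diff e0; exists d => // t u t0 tT u0 uT ut.
have [tu|/ltW tu] := leP t u.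
  move: ut; rewrite ger0_norm ?subr_ge0// => ut; rewrite mulrC.
  have := hd t u t t0 tu uT; rewrite lexx tu => /(_ isT ut).
  by congr (ns s _ <= _); apply/funext => z; ring.
move: ut; rewrite distrC ger0_norm ?subr_ge0// => ut; rewrite mulrC.
have := hd u t t u0 tu tT; rewrite lexx tu => /(_ isT ut).
rewrite /ns wn_distC -/(ns _ _).
by congr (ns s _ <= _); apply/funext => z; ring.
Qed.

End Curve.

Section SolutionIsFlow.
Context {R : realType} (s : R) (p : nat) (hs : 2 < s) (hp : s + 2 <= p%:R) (T : R) (T0 : 0 < T).
Context (alpha : R) (Km : kern 1 0 (fraclap_symbol alpha)) (w0 : R * R -> R) (w : R -> R * R -> R).
Context (sol : gSQG_solution alpha s T w0 w).

Lemma sol_curve : let gam t := hart (w t) in let m := fraclap_symbol alpha in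
  [/\ forall t, 0 <= t -> t <= T -> Hs (s + 1) (gam t),
      forall t e, 0 <= t -> t <= T -> 0 < e -> exists2 d, 0 < d & forall u, 0 <= u -> u <= T ->
        `|u - t| < d -> ns (s + 1) (fun z => gam u z - gam t z) <= e &
      forall x, dwithin T (fun t => hartley (gam t) x) (fun t => hartley (Bop m (gam t) (gam t)) x)].
Proof.
move=> gam m; split.
- by move=> t t0 tT; have [] := sol_rep hs hp sol t0 tT.
- by move=> t e; exact: (sol_cont hs hp sol).
move=> x t t0 tT e e0; have [d d0 hd] := sol_dwithin hs hp Km sol x t0 tT e0.
exists d => // u u0 uT ut; have := hd u u0 uT ut.
have [_ _ _ E1 _] := sol_rep hs hp sol t0 tT; have [_ _ _ E2 _] := sol_rep hs hp sol u0 uT.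
by rewrite (congr1 (fun f => f x) E1) (congr1 (fun f => f x) E2).
Qed.

Lemma sol_flow : exists2 Y, 0 <= Y & flow s T (fraclap_symbol alpha) Y (fun t => hart (w t)).
Proof.
have [h1 h2 h3] := sol_curve; exact: (curve_flow hs hp T0 Km h1 h2 h3).
Qed.

End SolutionIsFlow.

(** * From flows back to solutions *)

Section FlowSolution.
Context {R : realType} (s : R) (p : nat) (hs : 2 < s) (hp : s + 2 <= p%:R) (T : R) (T0 : 0 < T).
Context (alpha : R) (Km : kern 1 0 (fraclap_symbol alpha)).
Local Notation P := (plane R).
Local Notation mu := (@lebesgue_measure R \x @lebesgue_measure R)%E.
Implicit Types (F G : R * R -> R) (x z : R * R) (t u a b d e : R) (k j : nat).
Local Notation m := (fraclap_symbol alpha).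
Let ws := weight_s hs hp.
Let ws1 := weight_s1 hs hp.

Lemma hartley_ae F G : measurable_fun setT (F : P -> R) -> measurable_fun setT (G : P -> R) ->
  {ae mu, forall z : P, F z = G z} -> hartley F = hartley G.
Proof.
move=> mF mG e; apply/funext => x; rewrite /hartley; congr (_ * _).
have mc : measurable_fun setT ((fun z => cas (dot z x)) : P -> R).
  exact: measurable_cas_dot.
apply: ae_Rint; [by apply: filterS e => z ->|exact: measurable_funM|exact: measurable_funM].
Qed.

Lemma Hs_hartley F : Hs s F -> L2 mu (hartley F) /\ is_hart (hartley F) F.
Proof. by move=> HF; have [LF _] := Hs_L1 hs hp HF; exact: hart_hartley LF (Hs_L2 hs hp HF). Qed.

Lemma Hnorm_hartley r F : Hs s F -> Hs r F -> Hnorm r (hartley F) = (ns r F)%:E.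
Proof. by move=> HF Hr; have [Lf hF] := Hs_hartley HF; have [h _] := HnormE r Lf hF; exact: h. Qed.

Lemma Hnorm_hartleyB r F G : Hs s F -> Hs s G -> Hs r F -> Hs r G ->
  Hnorm r (fun x => hartley F x - hartley G x) = (ns r (fun z => F z - G z))%:E.
Proof.
move=> HF HG HrF HrG; have [lf _] := Hs_L1 hs hp HF; have [lg _] := Hs_L1 hs hp HG.
rewrite -(Hnorm_hartley (wL2B HF HG) (wL2B HrF HrG)); congr Hnorm.
by apply/funext => x; rewrite (hartleyB x lf lg).
Qed.

Context (Y : R) (gam : R -> R * R -> R) (fl : flow s T m Y gam).

Let gamH t : 0 <= t -> t <= T -> Hs (s + 1) (gam t).
Proof. by move=> t0 tT; have [h _ _] := fl; have [] := h t t0 tT. Qed.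
Let gamH0 t : 0 <= t -> t <= T -> Hs s (gam t).
Proof. by move=> t0 tT; have [] := Hs_le hs hp (gamH t0 tT). Qed.

(** [flow_lip] gives continuity in H^s; Bernstein below a fixed frequency and the uniform tails
    above it lift this to H^(s+1). *)
Lemma flow_cont e : 0 < e -> exists2 d, 0 < d & forall t u, 0 <= t -> t <= T -> 0 <= u -> u <= T ->
  `|u - t| <= d -> ns (s + 1) (fun z => gam u z - gam t z) <= e.
Proof.
move=> e0; have e3 : 0 < e / 3 by rewrite divr_gt0.
have [_ ht _] := fl; have [N0 hN0] := ht _ e3; pose N := `|N0|.
have N00 : 0 <= N by exact: normr_ge0.
have c0 : 0 <= 1 + N by rewrite addr_ge0.
have [d d0 hd] := flow_lip hs hp Km fl (small_gt0 c0 e3); exists d => // t u t0 tT u0 uT ut.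
have hu := hN0 N u (ler_norm _) u0 uT; have htt := hN0 N t (ler_norm _) t0 tT.
have Hd := wL2B (gamH0 u0 uT) (gamH0 t0 tT).
have [Hc _] := wL2_cut N ws Hd.
have [Hc1 nc] := Hs1_cut hs hp N00 Hc (cut_idem N _).
have [_ nc0] := wL2_cut N ws Hd.
have [q1 _] := wL2_tail N ws1 (gamH u0 uT); have [q2 _] := wL2_tail N ws1 (gamH t0 tT).
have q3 := wL2B q1 q2.
have E : ns (s + 1) (fun z => gam u z - gam t z) = ns (s + 1) (fun z => 
    (gam u z - cut N (gam u) z - (gam t z - cut N (gam t) z)) + cut N (fun z => gam u z - gam t z) z).
  congr wn; apply/funext => z; rewrite cutB.
  by move: (gam u z) (gam t z) (cut _ _ _) (cut _ _ _) => *; ring.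
rewrite E; have t1 := wnD q3 Hc1; apply: (le_trans t1).
have -> : e = e / 3 + e / 3 + e / 3 by field.
apply: lerD; first exact: le_trans (wnB q1 q2) (lerD hu htt).
apply: (le_trans nc); apply: (small_le c0 e3); apply: (le_trans nc0); exact: hd.
Qed.

(** The sup norm of a transform is controlled by H^s ([hartley_sup]), so differentiability in H^s
    implies the pointwise equation. *)
Lemma flow_solution w0 : in_H (s + 1) w0 -> {ae mu, forall z : P, gam 0 z = hart w0 z} ->
  gSQG_solution alpha s T w0 (fun t => hartley (gam t)).
Proof.
move=> [/Lfun2P L0 fin] e0; split.
- split=> t; rewrite in_itv/= => /andP[t0 tT].
    have [Lf _] := Hs_hartley (gamH0 t0 tT); split; first exact/Lfun2P.
    by rewrite (Hnorm_hartley (gamH0 t0 tT) (gamH t0 tT)) ltry.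
  move=> A hA; have /nbhs_ballP [r r0 hr] : nbhs (0 : R) (fun y => A y%:E) := hA.
  have r2 : 0 < r / 2 by rewrite divr_gt0.
  have [d d0 hd] := flow_cont r2; apply/nbhs_ballP; exists d => // u.
  rewrite /ball/= distrC in_itv/= => ut /andP[u0 uT].
  rewrite (Hnorm_hartleyB (gamH0 u0 uT) (gamH0 t0 tT) (gamH u0 uT) (gamH t0 tT)).
  apply: hr; rewrite /ball/= sub0r normrN ger0_norm ?wn_ge0//.
  have h := hd t u t0 tT u0 uT (ltW ut).
  by apply: le_lt_trans h _; rewrite ltr_pdivrMr// ltr_pMr// ltr1n.
- move=> t; rewrite in_itv/= => /andP[t0 tT]; have [l1 l2] := Hs_L1 hs hp (gamH0 t0 tT).
  exact: continuous_hartley.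
- have h0 := hart_spec L0; have [_ h2] := HnormE (s + 1) L0 h0.
  have H0 := h2 fin; have [H0' _] := Hs_le hs hp H0; have [l0 _] := Hs_L1 hs hp H0'.
  have g0 := gamH0 (lexx 0) (ltW T0).
  rewrite (hartley_ae (wL2_meas ws g0) (wL2_meas ws H0') e0).
  by apply: filterS (hart_pointwise L0 h0 l0) => x ->.
- move=> t x; rewrite in_itv/= => /andP[t0 tT].
  rewrite (rhsE hs hp x Km (gamH t0 tT) erefl).
  have [_ _ hdf] := fl; have c0 : 0 <= 2 * c2pi * Ks s.
    by rewrite !mulr_ge0// ?Ks_ge0// ltW// c2pi_gt0.
  apply/cvgrPdist_le => e e1; have [d d0 hd] := hdf _ (small_gt0 c0 e1).
  apply/nbhs_ballP; exists d => // u; rewrite /ball/= distrC => ut une; rewrite in_itv/= => /andP[u0 uT].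
  have [HB _] := flow_B hs hp Km fl t0 tT.
  have ne : u - t != 0 by rewrite subr_eq0.
  have [lt _] := Hs_L1 hs hp (gamH0 t0 tT); have [lu _] := Hs_L1 hs hp (gamH0 u0 uT).
  have [lB _] := Hs_L1 hs hp HB.
  have HZ := wL2Z (u - t) HB; have HS := wL2D (gamH0 t0 tT) HZ; have HD := wL2B (gamH0 u0 uT) HS.
  have := hartley_sup hs hp x HD.
  rewrite (hartleyB x lu (L1D lt (L1Z (u - t) lB))) (hartleyD x lt (L1Z (u - t) lB)) (hartleyZ (u - t) x lB).
  move=> h; have := le_trans h (ler_wpM2l c0 (hd t u t0 tT u0 uT (ltW ut))).
  move: (hartley _ _) (hartley _ _) (hartley _ _) => h1 h2 h3.
  have np : 0 < `|u - t| by rewrite normr_gt0.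
  rewrite mulrA => H; have {}H := le_trans H (ler_wpM2r (normr_ge0 _) (small_le c0 e1 (lexx _))).
  rewrite (_ : h1 - _ = - ((u - t)^-1 * (h3 - (h2 + (u - t) * h1)))); last by field.
  by rewrite normrN normrM normfV ler_pdivrMl// [leRHS]mulrC.
Qed.

End FlowSolution.

(** A discrete form of |phi'| <= c a phi, read in both directions of time so that any grid value
    bounds any other; the factor is the exponential of the discrete integral of [a]. *)
Lemma grid_growth {R : realType} (n : nat) (phi a : nat -> R) (h c eta : R) : 0 <= h -> 0 <= c -> 0 <= eta ->
  (forall k, 0 <= phi k) -> (forall k, 0 <= a k) ->
  (forall k, (k < n)%N -> phi k.+1 <= (1 + c * h * a k) * phi k + h * eta) ->
  (forall k, (k < n)%N -> phi k <= (1 + c * h * a k) * phi k.+1 + h * eta) ->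
  forall i j, (i <= n)%N -> (j <= n)%N ->
  phi j <= expR (c * (h * \sum_(k < n) a k)) * (phi i + n%:R * h * eta).
Proof.
move=> h0 c0 eta0 p0 a0 fw bw i j iN jN.
pose S u v : R := \sum_(u <= k < v) a k.
have S0 u v : 0 <= S u v by apply: sumr_ge0 => k _.
have ch : 0 <= c * h by exact: mulr_ge0.
have step x y q r k : 0 <= x -> 0 <= q -> y <= (1 + c * h * a k) * x + h * eta ->
    x <= expR (c * h * q) * r -> y <= expR (c * h * (q + a k)) * (r + h * eta).
  move=> x0 q0 yx xr; apply: le_trans yx _.
  have e1 : 1 + c * h * a k <= expR (c * h * a k) by exact: expR_ge1Dx.
  rewrite (mulrDr (expR _) r); apply: lerD; last first.
    rewrite ler_peMl//; first exact: mulr_ge0.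
    by rewrite -expR0 ler_expR mulr_ge0// addr_ge0.
  rewrite (mulrDr (c * h)) expRD [X in _ <= X * r]mulrC -(mulrA (expR (c * h * a k))).
  exact: le_trans (ler_wpM2r x0 e1) (ler_wpM2l (expR_ge0 _) xr).
have shift d r : r + d%:R * h * eta + h * eta = r + d.+1%:R * h * eta by rewrite -[d.+1%:R]natr1; ring.
have fwd d u : (u + d <= n)%N -> phi (u + d)%N <= expR (c * h * S u (u + d)%N) * (phi u + d%:R * h * eta).
  elim: d => [|d IH] ud; first by rewrite addn0 /S big_geq// mulr0 expR0 mul1r !mul0r addr0.
  rewrite addnS in ud *; rewrite -shift /S big_nat_recr ?leq_addr//=.
  by apply: step => //; [exact: S0|exact: fw|apply: IH; exact: ltnW].
have bwd d u : (u + d <= n)%N -> phi u <= expR (c * h * S u (u + d)%N) * (phi (u + d)%N + d%:R * h * eta).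
  elim: d u => [|d IH] u ud; first by rewrite addn0 /S big_geq// mulr0 expR0 mul1r !mul0r addr0.
  have un : (u < n)%N by apply: leq_trans ud; rewrite addnS ltnS leq_addr.
  rewrite -addSnnS in ud *; rewrite -shift /S big_ltn ?addSn ?ltnS ?leq_addr// addrC.
  by apply: (step (phi u.+1)) => //; [exact: S0|exact: bw|rewrite -addSn; exact: IH].
have fin d u v w : (u + d <= n)%N -> 0 <= w ->
    v <= expR (c * h * S u (u + d)%N) * (w + d%:R * h * eta) ->
    v <= expR (c * (h * \sum_(k < n) a k)) * (w + n%:R * h * eta).
  move=> ud w0 H; apply: le_trans H _.
  have dn : d%:R * h * eta <= n%:R * h * eta.
    by rewrite !ler_wpM2r// ler_nat; exact: leq_trans (leq_addl _ _) ud.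
  have dh0 : 0 <= d%:R * h * eta by rewrite !mulr_ge0.
  apply: ler_pM; [exact: expR_ge0|exact: addr_ge0| |by rewrite lerD2l].
  rewrite ler_expR -mulrA; apply: ler_wpM2l => //; apply: ler_wpM2l => //.
  rewrite -(big_mkord xpredT) (big_cat_nat (leq0n u) (leq_trans (leq_addr d u) ud)) /=.
  rewrite (big_cat_nat (leq_addr d u) ud) /=.
  by rewrite addrCA lerDl addr_ge0// sumr_ge0.
have [ij|/ltnW ji] := leqP i j.
  apply: (fin (j - i)%N i) => //; rewrite subnKC//.
  by have := fwd (j - i)%N i; rewrite subnKC//; apply.
apply: (fin (i - j)%N j) => //; rewrite subnKC//.
by have := bwd (i - j)%N j; rewrite subnKC//; apply.
Qed.

(** * The a priori bound *)

Section LowerSum.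
Context {R : realType} (T : R) (T0 : 0 < T).
Local Notation mu1 := (@lebesgue_measure R).
Implicit Types (y : nat -> R) (f : R -> \bar R) (j : nat).

(** The sum is at most the integral of a step function lying below [f], and integrals of nonnegative
    functions are monotone; this sidesteps the question whether the norms of the solution are
    measurable in time. *)
Lemma lower_sum j y f : (forall t, 0 <= t -> t <= T -> (0 <= f t)%E) ->
  (forall k t, (k < 2 ^ j)%N -> k%:R * time_step T j <= t -> t < k.+1%:R * time_step T j -> ((y k)%:E <= f t)%E) ->
  ((\sum_(k < 2 ^ j) (time_step T j * y k))%:E <= \int[mu1]_(t in `[0%R, T]%classic) f t)%E.
Proof.
move=> f0 yf; set h := time_step T j; have h0 : 0 < h := hh_gt0 T0 j.
pose cell k : set R := `[k%:R * h, k.+1%:R * h[%classic.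
(* Raising negative values to 0 keeps the step function below [f], which is nonnegative. *)
pose c k : R := Num.max (y k) 0; have c0 k : 0 <= c k by rewrite le_max lexx orbT.
have mcell k : measurable (cell k) by exact: measurable_itv.
pose g t : \bar R := (\sum_(k < 2 ^ j) (c k * \1_(cell k) t)%:E)%E.
have cellT k : (k < 2 ^ j)%N -> cell k `<=` `[0, T].
  move=> kj t; rewrite /cell/= !in_itv/= => /andP[t1 t2].
  have [_ kT] := kkT T0 kj; have [k0 _] := kkT T0 (ltnW kj).
  by rewrite (le_trans k0 t1) (le_trans (ltW t2) kT).
have mI k : measurable_fun (`[0, T]%classic : set R) (fun t => (\1_(cell k) t : R)) by exact: measurable_indic.
have int_c k : (k < 2 ^ j)%N -> (\int[mu1]_(t in `[0%R, T]%classic) (c k * \1_(cell k) t)%:E = (h * c k)%:E)%E.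
  move=> kj; under eq_integral do rewrite EFinM.
  rewrite ge0_integralZl_EFin//; last first.
    by have := mI k => /measurable_EFinP.
  rewrite (@integral_indic _ _ _ mu1 _ (measurable_itv _) _ (mcell k)) (_ : cell k `&` _ = cell k); last first.
    by apply: setIidl; exact: cellT.
  have lt : k%:R * h < k.+1%:R * h by rewrite ltr_pM2r// ltr_nat.
  have mE : mu1 (cell k) = h%:E.
    rewrite /cell/= lebesgue_measure_itv/= lte_fin lt -EFinD; congr EFin.
    by rewrite -[k.+1%:R]natr1; ring.
  by rewrite (mulrC h) EFinM; congr (_ * _)%E; exact: mE.
apply: (@le_trans _ _ (\int[mu1]_(t in `[0%R, T]%classic) g t)%E).
  have mc k : measurable_fun (`[0, T]%classic : set R) (fun t => (c k * \1_(cell k) t)%:E).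
    by have := measurable_funM (measurable_cst (c k)) (mI k) => /measurable_EFinP.
  rewrite /g (ge0_integral_sum mu1 (measurable_itv _) (fun k : 'I_(2 ^ j) => mc k)); last first.
    by move=> k t _; rewrite lee_fin mulr_ge0.
  rewrite (eq_bigr (fun k : 'I_(2 ^ j) => (h * c k)%:E)); last by move=> k _; exact: int_c.
  by rewrite sumEFin lee_fin ler_sum// => k _; rewrite ler_pM2l// le_max lexx.
apply: ge0_integral_le => t; rewrite /= in_itv/= => /andP[t0 tT].
  by apply: sume_ge0 => k _; rewrite lee_fin mulr_ge0.
rewrite /g; have [[k tk]|no] := pselect (exists k : 'I_(2 ^ j), cell k t); last first.
  rewrite big1 ?f0// => k _; rewrite indicE memNset ?mulr0// => tk; apply: no; by exists k.
rewrite (bigD1 k)//= big1; last first.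
  move=> i ik; rewrite indicE memNset ?mulr0// => ti; move/negP: ik; apply.
  apply/eqP/val_inj => /=; apply/eqP; rewrite eqn_leq.
  move: tk ti; rewrite /cell/= !in_itv/= => /andP[a1 a2] /andP[b1 b2].
  have := le_lt_trans a1 b2; have := le_lt_trans b1 a2.
  by rewrite !ltr_pM2r// !ltr_nat !ltnS => -> ->.
rewrite adde0 indicE mem_set// mulr1 /c; case: (leP (y k) 0) => _; first exact: f0.
by move: tk; rewrite /cell/= in_itv/= => /andP[]; exact: yf.
Qed.

End LowerSum.

Lemma energy_arith {R : realType} (h d i1 i2 g w K y b rr : R) : 0 < h -> `|d| = h -> `|i1| <= 2 * K * y * w ->
  `|i2| <= b -> g <= rr ->
  w + 2 * d * (i1 + i2) + h ^+ 2 * g <= (1 + 4 * K * h * y) * w + h * (2 * b + h * rr).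
Proof.
move=> h0 dh h1 h2 h3.
have a1 : d * (i1 + i2) <= h * (2 * K * y * w + b).
  apply: le_trans (ler_norm _) _; rewrite normrM dh; apply: ler_wpM2l; first exact: ltW.
  exact: le_trans (ler_normD _ _) (lerD h1 h2).
have a2 : h ^+ 2 * g <= h ^+ 2 * rr by apply: ler_wpM2l h3; exact: sqr_ge0.
apply: (@le_trans _ _ (w + 2 * (h * (2 * K * y * w + b)) + h ^+ 2 * rr)).
  by apply: lerD a2; rewrite lerD2l -mulrA; apply: ler_wpM2l.
by rewrite le_eqVlt; apply/orP; left; apply/eqP; ring.
Qed.

(** * Energy growth in H^(s+1) *)

Section Growth.
Context {R : realType} (s : R) (p : nat) (hs : 2 < s) (hp : s + 2 <= p%:R) (T : R) (T0 : 0 < T).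
Context (alpha : R) (Km : kern 1 0 (fraclap_symbol alpha)).
Local Notation P := (plane R).
Implicit Types (F G : R * R -> R) (x z : R * R) (t u v a b d e : R) (k j : nat).
Local Notation K := (Kc s p).
Local Notation m := (fraclap_symbol alpha).
Let ws := weight_s hs hp.
Let ws1 := weight_s1 hs hp.
Let K0 : 0 <= K := Kc_ge0 s p.

(* Comparable to <z>^s, so that the energy identity makes sense on H^(s+1), but equal to
   <z>^(s+1) below the frequency [r]. *)
Definition capw (r : R) a : R := Num.min (a `^ (s + 1)) (r * a `^ s).

Lemma weight_capw r : 0 < r -> weight p (capw r).
Proof. by move=> r0; apply: weight_min => //; exact: weightZ. Qed.

Lemma capw_s r F : 0 < r -> Hs s F -> wL2 (capw r) F /\ wn (capw r) F <= r * ns s F.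
Proof.
move=> r0 HF; have mF := wL2_meas ws HF.
have [|h1 h2] := wL2_le (F := fun z => r * F z) (weight_capw r0) ws mF (wL2Z r HF).
  move=> z; rewrite normrM (ger0_norm (ltW r0)) mulrCA mulrA; apply: ler_wpM2r => //.
  by rewrite /capw ge_min lexx orbT.
by split=> //; apply: le_trans h2 _; rewrite wnZ// ger0_norm// ltW.
Qed.

Lemma capw_s1 r F : 0 < r -> Hs (s + 1) F -> wn (capw r) F <= ns (s + 1) F.
Proof.
move=> r0 HF; have mF := wL2_meas ws1 HF.
have [|_ h2] := wL2_le (weight_capw r0) ws1 mF HF; last exact: h2.
by move=> z; apply: ler_wpM2r => //; rewrite /capw ge_min lexx.
Qed.

Lemma capw_cut N F : 0 <= N -> Hs (s + 1) F -> ns (s + 1) (cut N F) <= wn (capw (1 + N)) F.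
Proof.
move=> N0 HF; have r0 : 0 < 1 + N by rewrite ltr_wpDr.
have [HF0 _] := Hs_le hs hp HF; have [h1 _] := capw_s r0 HF0.
have mC : measurable_fun setT (cut N F : P -> R) by apply: measurable_cut; exact: wL2_meas ws HF0.
have [|_ h2] := wL2_le ws1 (weight_capw r0) mC h1; last exact: h2.
move=> z; rewrite /cut; case: (leP (rad z) N) => rN; last first.
  by rewrite mulr0 normr0 mulr0 mulr_ge0// /capw le_min powR_ge0 mulr_ge0 ?powR_ge0// ltW.
rewrite mulr1; apply: ler_wpM2r => //; rewrite /capw le_min lexx /= jb_s1 mulrC.
by apply: ler_wpM2r; [exact: powR_ge0|apply: le_trans (jb_le1rad z) _; rewrite lerD2l].
Qed.

(** [d] is [h] or [- h], as [grid_growth] needs backward steps too. The capped weight makes the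
    square of the increment finite although [Bop] is only in H^s; it comes with [h ^+ 2], so a fine
    grid makes it negligible whatever the cap [r]. *)
Lemma energy_step r F F' (h d e L y : R) : 0 < r -> Hs (s + 1) F -> Hs (s + 1) F' -> d != 0 -> `|d| = h ->
  ns s (Bop m F F) <= L -> ns s (fun z => F' z - (F z + d * Bop m F F z)) <= e * h -> 
  ns (s + 1) F <= y ->
  wn (capw r) F' ^+ 2 <= (1 + 4 * K * h * ns (s + 1) F) * wn (capw r) F ^+ 2 +
    h * (2 * (r * e * y) + h * (r * (L + e)) ^+ 2).
Proof.
move=> r0 HF HF' d0 dh BL Fe Fy.
have [HF0 n0] := Hs_le hs hp HF; have [HF0' _] := Hs_le hs hp HF'.
have [_ HB _] := est_s hs hp Km HF0 HF.
have h0 : 0 < h by rewrite -dh normr_gt0.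
pose q z := d^-1 * (F' z - (F z + d * Bop m F F z)); pose G z := Bop m F F z + q z.
have Hr : Hs s (fun z => F' z - (F z + d * Bop m F F z)) by exact: wL2B HF0' (wL2D HF0 (wL2Z d HB)).
have Hq : Hs s q by exact: wL2Z.
have nq : ns s q <= e.
  have -> : ns s q = h^-1 * ns s (fun z => F' z - (F z + d * Bop m F F z)).
    by rewrite /ns (wnZ _ Hr) normfV dh.
  by rewrite ler_pdivrMl// [leRHS]mulrC.
have HG : Hs s G by exact: wL2D.
have nG : ns s G <= L + e by exact: le_trans (wnD HB Hq) (lerD BL nq).
have EF : F' = (fun z => F z + d * G z).
  by apply/funext => z; rewrite /G /q mulrDr mulVKf//; ring.
have [WF _] := capw_s r0 HF0; have [WG gG] := capw_s r0 HG.
have [Wq gq] := capw_s r0 Hq; have [WB _] := capw_s r0 HB.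
have yF := capw_s1 r0 HF.
set W := capw r in WF WG gG Wq gq WB yF *.
have ip1 : `|wip W (Bop m F F) F| <= 2 * K * ns (s + 1) F * wn W F ^+ 2.
  have WJ : wL2 W (fun z => jb z * F z).
    by have [] := capw_s r0 (proj2 (Hs_jb s F) HF).
  have := est_e hs hp Km (weight_capw r0) HF0 HF0 WF WF WJ; rewrite mul1r -/W => H.
  apply: le_trans H _.
  have -> : K * (ns s F * wn W F + wn W F * ns s F) * wn W F = ns s F * (2 * K * wn W F ^+ 2) by ring.
  rewrite [leRHS](_ : _ = ns (s + 1) F * (2 * K * wn W F ^+ 2)); last by ring.
  by apply: ler_wpM2r n0; rewrite mulr_ge0 ?sqr_ge0// mulr_ge0.
have ip2 : `|wip W q F| <= r * e * y.
  apply: le_trans (wip_le Wq WF) _; apply: ler_pM (wn_ge0 _ _) (wn_ge0 _ _) _ (le_trans yF Fy).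
  by apply: le_trans gq _; apply: ler_wpM2l nq; exact: ltW.
rewrite EF (wn_add_sqr d WF WG) (wipDl WB Wq WF).
have g2 : wn W G ^+ 2 <= (r * (L + e)) ^+ 2.
  rewrite ler_sqr ?nnegrE ?wn_ge0//; first by apply: le_trans gG _; apply: ler_wpM2l nG; exact: ltW.
  by apply: le_trans (wn_ge0 _ _) (le_trans gG (ler_wpM2l (ltW r0) nG)).
have d2 : d ^+ 2 = h ^+ 2 by rewrite -dh real_normK ?num_real.
rewrite d2; exact: energy_arith.
Qed.

(** The least grid value of the norm is at most [M / T + 1]; its square, plus 1 for the accumulated
    errors, is multiplied by the exponential of [4 * K] times the discrete integral of the norm plus
    1, which is at most [M + 2 * T]. The final 3 pays for the square root, for going from the grid
    to [t], and for the frequencies beyond the cap. *)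
Definition sobolev_bound (M : R) : R := expR (4 * K * (M + 2 * T)) * ((M / T + 1) ^+ 2 + 1) + 3.

Context (Y : R) (gam : R -> R * R -> R) (fl : flow s T m Y gam).

(* The norm y in H^(s+1) obeys |y'| <= C y^2, so log y varies by at most C times the integral
   of y, while the minimum of y is at most the mean; both are read on a fine grid. *)
Lemma flow_sobolev_bound (f : R -> \bar R) (M : R) :
  (forall t, 0 <= t -> t <= T -> ((ns (s + 1) (gam t))%:E <= f t)%E) ->
  (\int[@lebesgue_measure R]_(t in `[0%R, T]%classic) f t <= M%:E)%E ->
  forall t, 0 <= t -> t <= T -> ns (s + 1) (gam t) <= sobolev_bound M.
Proof.
move=> yf fM t t0 tT; have [fH ft fd] := fl.
have gH u : 0 <= u -> u <= T -> Hs (s + 1) (gam u) by move=> u0 uT; have [] := fH u u0 uT.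
have f0 u : 0 <= u -> u <= T -> (0 <= f u)%E.
  by move=> u0 uT; apply: le_trans (yf u u0 uT); rewrite lee_fin wn_ge0.
have Y0 : 0 <= Y by have [_ h] := fH t t0 tT; exact: le_trans (wn_ge0 _ _) h.
pose L := 2 * K * Y ^+ 2; have L0 : 0 <= L by rewrite mulr_ge0 ?sqr_ge0// mulr_ge0.
have [N0 hN0] := ft 1 ltr01; pose N := `|N0|; have N00 : 0 <= N by exact: normr_ge0.
have tl := hN0 N t (ler_norm _) t0 tT; pose r := 1 + N.
have r0 : 0 < r by rewrite ltr_wpDr.
(* Chosen so that the errors of all the steps add up to [T * eta = 1]. *)
pose eta : R := T^-1; have eta0 : 0 < eta by rewrite invr_gt0.
have eta2 : 0 < eta / 2 by rewrite divr_gt0.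
have c1 : 0 <= 2 * (r * Y) by rewrite !mulr_ge0// ltW.
pose e := eta / 2 / (2 * (r * Y) + 1); have e0 : 0 < e := small_gt0 c1 eta2.
have c2 : 0 <= (r * (L + e)) ^+ 2 by exact: sqr_ge0.
have [d1 d10 hd1] := fd e e0; have [d2 d20 hd2] := flow_cont hs hp Km fl ltr01.
pose d3 := eta / 2 / ((r * (L + e)) ^+ 2 + 1); have d30 : 0 < d3 := small_gt0 c2 eta2.
have dm0 : 0 < Num.min d1 (Num.min d2 d3) by rewrite !lt_min d10 d20.
have [j hj] := hh_small T dm0; have := hj j (leqnn j); set h := time_step T j; rewrite !le_min => /and3P[hd hd' hd''].
have h0 : 0 < h := hh_gt0 T0 j.
pose y k := ns (s + 1) (gam (k%:R * h)); pose phi k := wn (capw r) (gam (k%:R * h)) ^+ 2.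
have tk k : (k <= 2 ^ j)%N -> 0 <= k%:R * h /\ k%:R * h <= T by move=> kj; have := kkT T0 kj; rewrite -/h.
have rest : 2 * (r * e * Y) + h * (r * (L + e)) ^+ 2 <= eta.
  rewrite [eta]splitr; apply: lerD; last by rewrite mulrC; apply: (small_le c2 eta2).
  by rewrite (_ : 2 * _ = 2 * (r * Y) * e); [exact: (small_le c1 eta2)|ring].
have step u v : 0 <= u -> u <= T -> 0 <= v -> v <= T -> v - u != 0 -> `|v - u| = h ->
    wn (capw r) (gam v) ^+ 2 <= (1 + 4 * K * h * ns (s + 1) (gam u)) * wn (capw r) (gam u) ^+ 2 + h * eta.
  move=> u0 uT v0 vT uv huv; have [Hu nu] := fH u u0 uT; have [_ nB] := flow_B hs hp Km fl u0 uT.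
  have nd := hd1 u v u0 uT v0 vT; rewrite huv in nd.
  apply: le_trans (energy_step r0 Hu (gH v v0 vT) uv huv nB (nd hd) nu) _.
  by rewrite lerD2l; apply: ler_wpM2l rest; exact: ltW.
have K4 : 0 <= 4 * K by rewrite mulr_ge0.
have y0 k : 0 <= y k by exact: wn_ge0.
have mono (b c q x : R) : 0 <= x -> q <= c ->
    (1 + 4 * K * h * q) * x + h * b <= (1 + 4 * K * h * c) * x + h * b.
  move=> x0 qc; rewrite lerD2r; apply: ler_wpM2r => //; rewrite lerD2l; apply: ler_wpM2l qc.
  by rewrite mulr_ge0// ltW.
have inc k : k.+1%:R * h - k%:R * h = h by rewrite -[k.+1%:R]natr1; ring.
(* [y k + 1] instead of [y k]: a backward step has its coefficient at the later end, where the norm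
   exceeds [y k] by at most 1. *)
have G := @grid_growth R (2 ^ j) phi (fun k => y k + 1) h (4 * K) eta (ltW h0) K4 (ltW eta0) _ _ _ _.
have {}G i k : (i <= 2 ^ j)%N -> (k <= 2 ^ j)%N ->
    phi k <= expR (4 * K * (h * \sum_(l < 2 ^ j) (y l + 1))) * (phi i + (2 ^ j)%:R * h * eta).
  apply: G => // {i k} [k|k|k kj|k kj]; [exact: sqr_ge0|by rewrite addr_ge0| |].
    have [a1 a2] := tk k (ltnW kj); have [b1 b2] := tk k.+1 kj.
    apply: le_trans (step (k%:R * h) _ a1 a2 b1 b2 _ _) _; rewrite ?inc ?gt_eqF ?gtr0_norm//.
    by apply: mono; [exact: sqr_ge0|rewrite lerDl].
  have [a1 a2] := tk k (ltnW kj); have [b1 b2] := tk k.+1 kj.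
  have inc' : k%:R * h - k.+1%:R * h = - h by rewrite -(inc k); ring.
  apply: le_trans (step (k.+1%:R * h) _ b1 b2 a1 a2 _ _) _; rewrite ?inc' ?oppr_eq0 ?gt_eqF ?normrN ?gtr0_norm//.
  apply: mono; first exact: sqr_ge0.
  have := hd2 _ _ a1 a2 b1 b2; rewrite inc gtr0_norm// => /(_ hd') H.
  have := wnD (gH _ a1 a2) (wL2B (gH _ b1 b2) (gH _ a1 a2)).
  under [X in wn _ X <= _ -> _]eq_fun do rewrite addrC subrK.
  by move=> H'; apply: le_trans H' _; rewrite lerD2l.
have hT : (2 ^ j)%:R * h = T by exact: hh_T.
have sc (b : R) : h * (\sum_(l < 2 ^ j) b) = T * b.
  by rewrite sumr_const card_ord -[b *+ _]mulr_natl mulrA [h * _]mulrC hT.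
(* On each cell the norm stays above [y l - 1], so this is a lower sum of the integral. *)
have sumM : h * \sum_(l < 2 ^ j) (y l - 1) <= M.
  rewrite -lee_fin; apply: le_trans fM; rewrite mulr_sumr.
  apply: (lower_sum T0 (y := fun k => y k - 1) f0) => k u kj ku uk.
  have [a1 a2] := tk k (ltnW kj); have [_ b2] := tk k.+1 kj.
  have u0 := le_trans a1 ku; have uT := le_trans (ltW uk) b2.
  apply: le_trans (yf u u0 uT); rewrite lee_fin lerBlDr.
  have uh : `|k%:R * h - u| <= d2.
    apply: le_trans hd'; rewrite distrC ger0_norm ?subr_ge0// lerBlDr.
    by apply: le_trans (ltW uk) _; rewrite -[k.+1%:R]natr1 mulrDl mul1r addrC.
  have H := hd2 u _ u0 uT a1 a2 uh.
  have := wnD (gH _ u0 uT) (wL2B (gH _ a1 a2) (gH _ u0 uT)).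
  under [X in wn _ X <= _ -> _]eq_fun do rewrite addrC subrK.
  by move=> H'; apply: le_trans H' _; rewrite lerD2l.
have sumA : h * \sum_(l < 2 ^ j) (y l + 1) <= M + 2 * T.
  have -> : \sum_(l < 2 ^ j) (y l + 1) = \sum_(l < 2 ^ j) (y l - 1) + \sum_(l < 2 ^ j) 2.
    by rewrite -big_split/=; apply: eq_bigr => l _; ring.
  by rewrite mulrDr sc (mulrC T); apply: lerD.
(* Otherwise every term of the lower sum [sumM] would exceed the mean [M / T]. *)
have [i ij yi] : exists2 i, (i < 2 ^ j)%N & y i <= M / T + 1.
  apply: contrapT => no; have : M < M; last by rewrite ltxx.
  apply: lt_le_trans sumM.
  have -> : M = h * \sum_(l < 2 ^ j) (M / T).
    by rewrite sc; field; rewrite gt_eqF.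
  have p0 : (0 < 2 ^ j)%N by rewrite expn_gt0.
  rewrite ltr_pM2l//; apply: ltr_sum => [|l _].
    by apply/hasP; exists (Ordinal p0) => //; rewrite mem_index_enum.
  by rewrite ltrBrDr ltNge; apply/negP => hl; apply: no; exists l.
pose k := time_index T j t; have kj : (k <= 2 ^ j)%N by exact: kk_max.
have [a1 a2] := tk k kj; have kt := kk_le T0 j t0; have tk' := kk_gt T0 j t.
have tkd : `|t - k%:R * h| <= d2.
  by apply: le_trans hd'; rewrite ger0_norm ?subr_ge0// lerBlDl ltW.
have Hd := hd2 _ _ a1 a2 t0 tT tkd.
pose X := expR (4 * K * (M + 2 * T)) * ((M / T + 1) ^+ 2 + 1).
have G1 : phi k <= X.
  apply: le_trans (G i k (ltnW ij) kj) _.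
  have -> : (2 ^ j)%:R * h * eta = 1 by rewrite hT /eta mulfV// gt_eqF.
  apply: ler_pM; [exact: expR_ge0|by rewrite addr_ge0// sqr_ge0| |].
    by rewrite ler_expR; apply: ler_wpM2l.
  rewrite lerD2r; have q1 : wn (capw r) (gam (i%:R * h)) <= M / T + 1.
    have [b1 b2] := tk i (ltnW ij); exact: le_trans (capw_s1 r0 (gH _ b1 b2)) yi.
  by rewrite /phi ler_sqr// nnegrE ?wn_ge0//; exact: le_trans (wn_ge0 _ _) q1.
have X0 : 0 <= X by apply: le_trans G1; exact: sqr_ge0.
(* The square root of [X] is at most [X + 1]. *)
have G2 : wn (capw r) (gam (k%:R * h)) <= X + 1.
  rewrite -ler_sqr ?nnegrE ?wn_ge0 ?addr_ge0//; apply: le_trans G1 _.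
  by rewrite sqrrD expr1n mulr1 -addrA -[leLHS]add0r; apply: lerD; [exact: sqr_ge0|rewrite mulr2n -addrA lerDl addr_ge0].
have Ht := gH t t0 tT; have Hk := gH _ a1 a2; have [Ht0 _] := Hs_le hs hp Ht; have [Hk0 _] := Hs_le hs hp Hk.
have Hdd := wL2B Ht Hk.
have G3 : wn (capw r) (gam t) <= X + 1 + 1.
  have [q1 _] := capw_s r0 Hk0; have [q2 _] := capw_s r0 (wL2B Ht0 Hk0).
  have := wnD q1 q2.
  under [X in wn _ X <= _ -> _]eq_fun do rewrite addrC subrK.
  move=> H'; apply: le_trans H' _; apply: lerD G2 _.
  exact: le_trans (capw_s1 r0 Hdd) Hd.
have [HC _] := wL2_cut N ws1 Ht; have [HT' _] := wL2_tail N ws1 Ht.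
have := wnD HC HT'.
under [X in wn _ X <= _ -> _]eq_fun do rewrite addrC subrK.
move=> H'; apply: le_trans H' _.
have -> : sobolev_bound M = X + 1 + 1 + 1 by rewrite /sobolev_bound -/X; ring.
by apply: lerD tl; exact: le_trans (capw_cut N00 Ht) G3.
Qed.

End Growth.

(** * Finiteness of the integral *)

Section L1Growth.
Context {R : realType}.
Local Notation P := (plane R).
Local Notation mu := (@lebesgue_measure R \x @lebesgue_measure R)%E.
Implicit Types (f g F G : R * R -> R) (x z : R * R) (c m : R * R -> R).

(** Extended valued, so that functions not yet known to be integrable can be estimated. *)
Definition l1 f : \bar R := (\int[mu]_x `|f x|%:E)%E.

Lemma l1_ge0 f : (0 <= l1 f)%E.
Proof. by apply: integral_ge0 => x _; rewrite lee_fin. Qed.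

Lemma l1D f g : measurable_fun setT (f : P -> R) -> measurable_fun setT (g : P -> R) ->
  (l1 (fun x => (f x + g x)%R) <= l1 f + l1 g)%E.
Proof.
move=> mf mg; rewrite /l1.
have mn h : measurable_fun setT (h : P -> R) -> measurable_fun setT (fun x : P => `|h x|%:E).
  by move=> mh; apply/measurable_EFinP; exact: measurableT_comp.
rewrite -ge0_integralD//; try exact: mn.
by apply: ge0_integral_le => x _; [rewrite lee_fin|rewrite -EFinD lee_fin ler_normD].
Qed.

Lemma l1Z a f : measurable_fun setT (f : P -> R) -> (l1 (fun x => (a * f x)%R) = `|a|%:E * l1 f)%E.
Proof.
move=> mf; rewrite /l1 -ge0_integralZl_EFin//.
- by apply: eq_integral => x _; rewrite normrM EFinM.
- by apply/measurable_EFinP; exact: measurableT_comp.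
Qed.

Lemma l1_fatou (f_ : nat -> R * R -> R) f (C : \bar R) : (forall n, measurable_fun setT (f_ n : P -> R)) ->
  (forall n, (l1 (f_ n) <= C)%E) -> (forall x, f_ n x @[n --> \oo] --> f x) -> (l1 f <= C)%E.
Proof.
move=> mf fC ff.
have mn n : measurable_fun setT (fun x : P => `|f_ n x|%:E).
  by apply/measurable_EFinP; exact: measurableT_comp (mf n).
have -> : l1 f = (\int[mu]_x limn_einf (fun n => `|f_ n x|%:E))%E.
  apply: eq_integral => x _; apply/esym/cvg_limn_einfE.
  by apply/cvg_EFin; [exact: nearW|exact: cvg_norm].
apply: (le_trans (@fatou _ _ _ mu setT measurableT _ mn _)); first by move=> n x _; rewrite lee_fin.
exact: limn_einf_le.
Qed.

Lemma l1_L1 f : L1 mu (f : P -> R) -> l1 f = (\int[mu]_x `|f x|)%:E.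
Proof. by move=> Lf; rewrite /l1 Rint_E//; exact: L1_abs. Qed.

Lemma l1_mul f g a b : L2 mu (f : P -> R) -> L2 mu (g : P -> R) -> nrm mu (f : P -> R) <= a ->
  nrm mu (g : P -> R) <= b -> (l1 (fun x => (f x * g x)%R) <= (a * b)%:E)%E.
Proof.
move=> Lf Lg fa gb; rewrite (l1_L1 (L2_mul Lf Lg)) lee_fin.
have := cauchy_schwarz (L2_abs Lf) (L2_abs Lg); rewrite !nrm_abs => H.
under eq_Rintegral do rewrite normrM.
by apply: le_trans H _; apply: ler_pM => //; exact: nrm_ge0.
Qed.

Let dotE x z : dot x z = dot z x :> R.
Proof. by rewrite /dot mulrC (mulrC x.2). Qed.

Lemma hartley_flip F x : hartley F (- x) = c2pi * \int[mu]_z (F z * dcas (dot x z)).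
Proof.
rewrite /hartley; congr (_ * _); apply: eq_Rintegral => z _; congr (_ * _).
by rewrite dotNx (dotE z) /cas /dcas cosN sinN.
Qed.

Lemma L1_dcas F x : L1 mu (F : P -> R) -> L1 mu (fun z : P => F z * dcas (dot x z)).
Proof.
move=> LF; have := L1_cas (- x) LF; congr (L1 _ _); apply/funext => z; congr (_ * _).
by rewrite dotNx (dotE z) /cas /dcas cosN sinN.
Qed.

Lemma velE m F c x : L1 mu (fun z : P => c z * m z * F z) -> L1 mu (fun z : P => c z * m z * F (- z)) ->
  c2pi * vel m F c x =
    2^-1 * (hartley (fun z => c z * m z * F (- z)) x - hartley (fun z => c z * m z * F z) (- x)).
Proof.
move=> h1 h2; rewrite hartley_flip /hartley -mulrBr mulrCA; congr (_ * _).
have q1 := L1_cas x h2; have q2 := L1_dcas x h1.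
rewrite -(RintegralB _ q1 q2)// -(RintegralZl _ measurableT (L1B q1 q2)).
apply: eq_Rintegral => z _; rewrite /evp /odp /cas /dcas /sin_d /cos_d (dotE z x).
by move: (cos _) (sin _) => C S; field.
Qed.

(** Covers the Riesz transforms, which give the SQG velocity: a multiplier bounded by 1 followed by
    an isometry. In Hartley form it is half the difference of a direct and a reflected term, each of
    norm at most that of [F]. *)
Lemma vel_L2 m F c : measurable_fun setT (m : P -> R) -> measurable_fun setT (c : P -> R) ->
  (forall z, `|c z * m z| <= 1) -> L1 mu (F : P -> R) -> L2 mu (F : P -> R) ->
  L2 mu ((fun x => c2pi * vel m F c x) : P -> R) /\ nrm mu ((fun x => c2pi * vel m F c x) : P -> R) <= nrm mu (F : P -> R).
Proof.
move=> mm mc cm LF LF2.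
have mcm : measurable_fun setT ((fun z => c z * m z) : P -> R) by exact: measurable_funM.
have dom (G : R * R -> R) z : `|c z * m z * G z| <= `|G z| by rewrite normrM ler_piMl.
have mN : measurable_fun setT ((fun z => F (- z)) : P -> R) := L2_meas (L2_refl LF2).
have L1N : L1 mu ((fun z => F (- z)) : P -> R) by exact: (mp_L1 (mp_opp (R := R)) LF).
have m1 : measurable_fun setT ((fun z => c z * m z * F z) : P -> R) := measurable_funM mcm (L1_meas LF).
have m2 : measurable_fun setT ((fun z => c z * m z * F (- z)) : P -> R) := measurable_funM mcm mN.
have a1 := L1_dom m1 (dom F) LF; have a2 := L2_dom m1 (dom F) LF2.
have b1 := L1_dom m2 (dom (fun z => F (- z))) L1N; have b2 := L2_dom m2 (dom (fun z => F (- z))) (L2_refl LF2).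
have [A1 hA] := hart_hartley a1 a2; have [B1 hB] := hart_hartley b1 b2.
have E : (fun x => c2pi * vel m F c x) = (fun x => 2^-1 * (hartley (fun z => c z * m z * F (- z)) x -
    hartley (fun z => c z * m z * F z) (- x))) by apply/funext => x; exact: velE.
rewrite E; have L := L2B B1 (L2_refl A1); split; first exact: L2Z.
rewrite (nrmZ _ L) ger0_norm// ler_pdivrMl//.
have R1 : nrm mu (hartley (fun z => c z * m z * F (- z)) : P -> R) <= nrm mu (F : P -> R).
  rewrite -(hart_isom B1 hB) -(nrm_refl (L2_meas LF2)).
  exact: (nrm_le m2 (dom (fun z => F (- z))) (L2_refl LF2)).
have R2 : nrm mu ((fun x => hartley (fun z => c z * m z * F z) (- x)) : P -> R) <= nrm mu (F : P -> R).
  rewrite (nrm_refl (L2_meas A1)) -(hart_isom A1 hA); exact: (nrm_le m1 (dom F) LF2).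
apply: le_trans (nrmB B1 (L2_refl A1)) _.
by apply: le_trans (lerD R1 R2) _; rewrite -mulr2n mulr_natl.
Qed.

Lemma grd_L2 F c : L1 mu (fun z : P => c z * F z) -> L2 mu (fun z : P => c z * F z) ->
  L2 mu ((fun x => c2pi * grd F c x) : P -> R) /\
  nrm mu ((fun x => c2pi * grd F c x) : P -> R) = nrm mu (fun z : P => c z * F z).
Proof.
move=> h1 h2; have [A1 hA] := hart_hartley h1 h2.
have E : (fun x => c2pi * grd F c x) = (fun x => hartley (fun z => c z * F z) (- x)).
  by apply/funext => x; rewrite hartley_flip.
by rewrite E; split; [exact: L2_refl|rewrite (nrm_refl (L2_meas A1)) (hart_isom A1 hA)].
Qed.

(** * L^1 bounds along the SQG flow *)

Section Transport.
Context (s : R) (p : nat) (hs : 2 < s) (hp : s + 2 <= p%:R) (T : R) (T0 : 0 < T).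
Context (m : R * R -> R) (Km : kern 1 0 m).
(* True of the SQG symbol, whose velocity operator is bounded on L^2. *)
Context (cm : forall c, (forall z, `|c z| <= rad z) -> forall z, `|c z * m z| <= 1).
Let ws := weight_s hs hp.

(** The nonlinear term consists of two products of a velocity component and a partial derivative,
    both in L^2, each estimated by Cauchy-Schwarz; hence the factor 2. *)
Lemma l1_hartley_Bop F Y : Hs (s + 1) F -> ns (s + 1) F <= Y ->
  (l1 (hartley (Bop m F F)) <= (2 * Y ^+ 2)%:E)%E.
Proof.
move=> HF FY; have [HF0 _] := Hs_le hs hp HF.
have [LF LrF] := Hs_L1 hs hp HF0; have LF2 := Hs_L2 hs hp HF0; have mF := wL2_meas ws HF0.
have [LlF _] := Hs_lam hs HF0; have [_ mm _ _ _] := Km.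
have [ok _ _] := est_s hs hp Km HF0 HF.
have p1 z : `|F z| <= `|jb z `^ (s + 1) * F z|.
  rewrite normrM (ger0_norm (powR_ge0 _ _)) ler_peMl// powR_ge1 ?jb_ge1//.
  by have h := hs; lra.
have p2 (c : R * R -> R) (cr : forall z, `|c z| <= rad z) z : `|c z * F z| <= `|jb z `^ (s + 1) * F z|.
  rewrite !normrM; apply: ler_wpM2r => //; apply: le_trans (cr z) _.
  apply: le_trans (rad_le_jb z) _; rewrite (ger0_norm (powR_ge0 _ _)).
  rewrite -[leLHS]powRr1 ?(le_trans ler01 (jb_ge1 z))//; apply: ler_powR; first exact: jb_ge1.
  by have h := hs; lra.
have nF : nrm mu (F : P -> R) <= Y by exact: le_trans (nrm_le mF p1 HF) FY.
have HV (c : R * R -> R) (mc : measurable_fun setT (c : P -> R)) (cr : forall z, `|c z| <= rad z) :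
    L2 mu ((fun x => c2pi * vel m F c x) : P -> R) /\ nrm mu ((fun x => c2pi * vel m F c x) : P -> R) <= Y.
  by have [a1 a2] := vel_L2 mm mc (cm cr) LF LF2; split=> //; exact: le_trans a2 nF.
have HG (c : R * R -> R) (mc : measurable_fun setT (c : P -> R)) (cr : forall z, `|c z| <= rad z) :
    L2 mu ((fun x => c2pi * grd F c x) : P -> R) /\ nrm mu ((fun x => c2pi * grd F c x) : P -> R) <= Y.
  have mcF : measurable_fun setT ((fun z => c z * F z) : P -> R) by exact: measurable_funM.
  have L : L1 mu (fun z : P => c z * F z).
    apply: (L1_dom mcF _ LrF) => z; rewrite !normrM (ger0_norm (rad_ge0 z)); exact: ler_wpM2r.
  have [a1 a2] := grd_L2 L (L2_dom mcF (p2 c cr) HF).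
  by split=> //; rewrite a2; apply: le_trans (nrm_le mcF (p2 c cr) HF) FY.
have [v1 v1n] := HV _ meas_fst fst_le_rad; have [v2 v2n] := HV _ meas_snd snd_le_rad.
have [g1 g1n] := HG _ meas_fst fst_le_rad; have [g2 g2n] := HG _ meas_snd snd_le_rad.
have E : hartley (Bop m F F) = (fun x => c2pi * vel m F (fun z => z.1) x * (c2pi * grd F (fun z => z.2) x) +
    - 1 * (c2pi * vel m F (fun z => z.2) x * (c2pi * grd F (fun z => z.1) x))).
  apply/funext => x; have [_ /(_ ok) ->] := hartley_Bop x Km mF mF LlF LlF.
  by move: (vel _ _ _ _) (vel _ _ _ _) (grd _ _ _) (grd _ _ _) => *; ring.
have m1 := L1_meas (L2_mul v1 g2); have m2 := L1_meas (L2_mul v2 g1).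
rewrite E; have mZ := L1_meas (L1Z (- 1) (L2_mul v2 g1)).
apply: (le_trans (l1D m1 mZ)); rewrite (l1Z (- 1) m2) normrN1 mul1e.
have YE : 2 * Y ^+ 2 = Y * Y + Y * Y by ring.
rewrite YE EFinD.
exact: leeD (l1_mul v1 g2 v1n g2n) (l1_mul v2 g1 v2n g1n).
Qed.

Context (gam : R -> R * R -> R).
Local Notation B t := (Bop m (gam t) (gam t)).
Context (gamH : forall t, 0 <= t -> t <= T -> Hs (s + 1) (gam t)).
Context (gamC : forall t e, 0 <= t -> t <= T -> 0 < e -> exists2 d, 0 < d & forall u, 0 <= u -> u <= T ->
  `|u - t| < d -> ns (s + 1) (fun z => gam u z - gam t z) <= e).
Context (gamD : forall x, dwithin T (fun t => hartley (gam t) x) (fun t => hartley (B t) x)).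

Lemma l1_rsum Q k a b : (forall t, 0 <= t -> t <= T -> (l1 (hartley (B t)) <= Q%:E)%E) ->
  0 <= a -> a <= b -> b <= T -> (l1 (hartley (rsum m gam k a b)) <= ((b - a) * Q)%:E)%E.
Proof.
move=> hQ; have [L L0 HB] := curve_B hs hp Km gamH gamC.
elim: k a b => [|k IH] a b a0 ab bT.
  have aT := le_trans ab bT; have [HBa _] := HB a a0 aT.
  have [lB _] := Hs_L1 hs hp HBa; have [lh _] := Hs_hartley hs hp HBa.
  have -> : hartley (rsum m gam 0 a b) = (fun x => (b - a) * hartley (B a) x).
    by apply/funext => x; rewrite -(hartleyZ (b - a) x lB).
  rewrite (l1Z (b - a) (L2_meas lh)) ger0_norm ?subr_ge0// EFinM.
  by apply: lee_wpmul2l; [rewrite lee_fin subr_ge0|exact: hQ].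
have h1 : a <= (a + b) / 2 by lra.
have h2 : (a + b) / 2 <= b by lra.
have q1 := Hs_rsum hs hp Km gamH gamC k a0 h1 (le_trans h2 bT).
have q2 := Hs_rsum hs hp Km gamH gamC k (le_trans a0 h1) h2 bT.
have [l1' _] := Hs_L1 hs hp q1; have [l2' _] := Hs_L1 hs hp q2.
have [n1 _] := Hs_hartley hs hp q1; have [n2 _] := Hs_hartley hs hp q2.
have -> : hartley (rsum m gam k.+1 a b) =
    (fun x => hartley (rsum m gam k a ((a + b) / 2)) x + hartley (rsum m gam k ((a + b) / 2) b) x).
  by apply/funext => x; rewrite -(hartleyD x l1' l2').
apply: (le_trans (l1D (L2_meas n1) (L2_meas n2))).
have -> : (b - a) * Q = ((a + b) / 2 - a) * Q + (b - (a + b) / 2) * Q by field.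
by rewrite EFinD; apply: leeD; apply: IH => //; [exact: le_trans h2 bT|exact: le_trans a0 h1].
Qed.

(** The increment is the pointwise limit of the transforms of Riemann sums of the nonlinear term,
    whose L^1 norms are at most [t * Q]; Fatou concludes. *)
Lemma l1_curve Q t : (forall t, 0 <= t -> t <= T -> (l1 (hartley (B t)) <= Q%:E)%E) ->
  0 <= t -> t <= T -> (l1 (hartley (gam t)) <= l1 (hartley (gam 0)) + (t * Q)%:E)%E.
Proof.
move=> hQ t0 tT; have HH u : 0 <= u -> u <= T -> Hs s (gam u).
  by move=> u0 uT; have [] := Hs_le hs hp (gamH u0 uT).
have g0 := HH 0 (lexx 0) (ltW T0); have gt' := HH t t0 tT.
have [n0 _] := Hs_hartley hs hp g0; have [nt _] := Hs_hartley hs hp gt'.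
have D : (l1 (fun x => hartley (gam t) x - hartley (gam 0) x)%R <= (t * Q)%:E)%E.
  apply: (@l1_fatou (fun k => hartley (rsum m gam k 0 t))) => [k|k|x].
  - have [h _] := Hs_hartley hs hp (Hs_rsum hs hp Km gamH gamC k (lexx 0) t0 tT); exact: L2_meas h.
  - by have := l1_rsum k hQ (lexx 0) t0 tT; rewrite subr0.
  apply/cvgrPdist_le => e e0.
  have [N hN] := rsum_pointwise hs hp T0 Km gamH gamC gamD (lexx 0) t0 tT e0.
  by exists N => // k Nk; exact: hN.
have E : hartley (gam t) = (fun x => hartley (gam 0) x + (hartley (gam t) x - hartley (gam 0) x)).
  by apply/funext => x; ring.
rewrite {1}E; apply: (le_trans (l1D (L2_meas n0) (L2_meas (L2B nt n0)))).
by rewrite leeD2l.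
Qed.

End Transport.
End L1Growth.

Section Finiteness.
Context {R : realType} (s : R) (p : nat) (hs : 2 < s) (hp : s + 2 <= p%:R) (T : R) (T0 : 0 < T).
Local Notation P := (plane R).
Local Notation mu := (@lebesgue_measure R \x @lebesgue_measure R)%E.
Implicit Types (f : R * R -> R).

Lemma L1normE f : L1norm f = l1 f.
Proof. by rewrite /L1norm Lnorm1. Qed.

(** At [alpha = 1 / 2] the symbol is 1 / |z| off the origin. *)
Lemma half_symbol_bound (c : R * R -> R) : (forall z, `|c z| <= rad z) ->
  forall z, `|c z * fraclap_symbol (1 / 2) z| <= 1.
Proof.
move=> cr z; rewrite normrM (ger0_norm (fraclap_ge0 _ _)).
apply: le_trans (ler_wpM2r (fraclap_ge0 _ _) (cr z)) _.
have := rad_ge0 z; rewrite le_eqVlt => /orP[/eqP <-|r0]; first by rewrite mul0r.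
by rewrite rad_fraclap// (_ : 2 * (1 / 2) - 1 = 0) ?powRr0//; field.
Qed.

(** The constants of the theorem use the real value of the integral; were it infinite, [fine] would
    send it to 0 and they would control nothing. *)
Lemma HL1_integral_fin w0 w : in_L1 w0 -> gSQG_solution (1 / 2) s T w0 w -> (HL1_integral s T w < +oo)%E.
Proof.
move=> L0 sol; have h38 : 3 / 8 <= 1 / 2 :> R by lra.
have Km := kern_sy h38 (lexx _).
have [gH gC gD] := sol_curve hs hp Km sol.
have [Y Y0 [fl _ _]] := sol_flow hs hp T0 Km sol.
have hQ t : 0 <= t -> t <= T ->
    (l1 (hartley (Bop (fraclap_symbol (1 / 2)) (hart (w t)) (hart (w t)))) <= (2 * Y ^+ 2)%:E)%E.
  move=> t0 tT; have [h1 h2] := fl t t0 tT.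
  exact: (l1_hartley_Bop hs hp Km half_symbol_bound h1 h2).
have rep t (t0 : 0 <= t) (tT : t <= T) := sol_rep hs hp sol t0 tT.
have l00 : l1 (w 0) = l1 w0.
  have [m0 _ _ _ _] := rep 0 (lexx 0) (ltW T0); have [_ _ e0 _] := sol.
  have ma h : measurable_fun setT (h : P -> R) -> measurable_fun setT (fun x : P => `|h x|%:E).
    by move=> mh; apply/measurable_EFinP; exact: measurableT_comp.
  have mw0 : measurable_fun setT (w0 : P -> R) by move: L0; rewrite /in_L1 inE => /andP[/=]; rewrite inE.
  have e1 : {ae mu, forall x : P, w 0 x = w0 x} := e0.
  have ea : {ae mu, forall x : P, setT x -> `|w 0 x|%:E = `|w0 x|%:E} by apply: filterS e1 => x -> .
  rewrite /l1; apply: ae_eq_integral; [exact: measurableT|exact: ma (L2_meas m0)|exact: ma|exact: ea].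
have fin0 : (l1 w0 < +oo)%E.
  move: L0; rewrite /in_L1 inE => /andP[_]; rewrite inE/= /finite_norm Lnorm1.
  by [].
have wb t : 0 <= t -> t <= T -> (l1 (w t) <= l1 w0 + (T * (2 * Y ^+ 2))%:E)%E.
  move=> t0 tT; have [_ _ _ E _] := rep t t0 tT; have [_ _ _ E0 _] := rep 0 (lexx 0) (ltW T0).
  rewrite -l00 E0 E; apply: le_trans (l1_curve hs hp T0 Km gH gC gD hQ t0 tT) _.
  by apply: leeD => //; rewrite lee_fin; apply: ler_wpM2r tT; rewrite mulr_ge0 ?sqr_ge0.
pose C : \bar R := (Y%:E + (l1 w0 + (T * (2 * Y ^+ 2))%:E))%E.
have C0 : (0 <= C)%E.
  apply: adde_ge0; first by rewrite lee_fin.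
  apply: adde_ge0; first exact: l1_ge0.
  by rewrite lee_fin; apply: mulr_ge0; [exact: ltW|apply: mulr_ge0 => //; exact: sqr_ge0].
apply: (@le_lt_trans _ _ (\int[@lebesgue_measure R]_(t in `[0%R, T]%classic) C)%E).
  apply: ge0_integral_le => t; rewrite /= in_itv/= => /andP[t0 tT].
    by have [_ _ _ _ ->] := rep t t0 tT; rewrite L1normE adde_ge0 ?l1_ge0 ?lee_fin ?wn_ge0.
  have [_ _ _ _ ->] := rep t t0 tT; rewrite L1normE; apply: leeD; last exact: wb.
  by have [_ h2] := fl t t0 tT; rewrite lee_fin.
rewrite integral_cst//= lebesgue_measure_itv/= lte_fin T0 oppr0 adde0.
have : C \is a fin_num.
  have F0 : l1 w0 \is a fin_num by rewrite ge0_fin_numE// l1_ge0.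
  by rewrite /C fin_numD; apply/andP; split => //; rewrite fin_numD; apply/andP; split.
by move=> Cf; apply: (lte_mul_pinfty C0 Cf); exact: ltry.
Qed.

End Finiteness.

(** * The stability theorem *)

Section Final.
Context {R : realType} (s : R) (p : nat) (hs : 2 < s) (hp : s + 2 <= p%:R) (T : R) (T0 : 0 < T).
Local Notation P := (plane R).
Local Notation mu := (@lebesgue_measure R \x @lebesgue_measure R)%E.
Implicit Types (f g : R * R -> R) (t : R).
Local Notation K := (Kc s p).

(** The limit defining [is_hart] involves [f] through integrals; here the version change is made on
    the inverse side, where [hart_ae] applies, and brought back by inversion. *)
Lemma hart_ae_eq f g : L2 mu f -> L2 mu g -> {ae mu, forall x : P, f x = g x} ->
  {ae mu, forall z : P, hart f z = hart g z}.
Proof.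
move=> Lf Lg e; have hf := hart_spec Lf; have [LF _] := hf.
have h := hart_inv LF (hart_ae LF (hart_inv Lf hf) Lg e).
exact: (hart_unique Lg h (hart_spec Lg)).
Qed.

Lemma sol_datum alpha w0 w : kern 1 0 (fraclap_symbol alpha) -> in_H (s + 1) w0 ->
  gSQG_solution alpha s T w0 w -> {ae mu, forall z : P, hart (w 0) z = hart w0 z}.
Proof.
move=> Km [/Lfun2P L0 _] sol; have [L _ _ _ _] := sol_rep hs hp sol (lexx 0) (ltW T0).
by apply: hart_ae_eq => //; have [_ _ e _] := sol.
Qed.

(** The error bound of [flow_perturb] divided by the gap [1 / 2 - alpha]; the 8 is that of
    [kern_diff]. *)
Definition gap_const (M : R) : R :=
  Cst s p T (sobolev_bound s p T M) * (2 * K * 8 * sobolev_bound s p T M ^+ 2).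

Lemma gap_const_ge0 M : 0 <= gap_const M.
Proof.
apply: mulr_ge0; first exact: Cst_ge0.
apply: mulr_ge0; last exact: sqr_ge0.
by apply: mulr_ge0 => //; apply: mulr_ge0 => //; exact: Kc_ge0.
Qed.

(** Replaces the inexplicit bound of [sol_flow], which comes from compactness, by one that depends
    only on [T] and the integral, besides [s] and [p]. *)
Lemma sol_flow_bound w0 w : in_L1 w0 -> gSQG_solution (1 / 2) s T w0 w ->
  flow s T (fraclap_symbol (1 / 2)) (sobolev_bound s p T (fine (HL1_integral s T w))) (fun t => hart (w t)).
Proof.
move=> L0 sol; have h38 : 3 / 8 <= 1 / 2 :> R by lra.
have Km := kern_sy h38 (lexx _); have [Y Y0 fl] := sol_flow hs hp T0 Km sol.
have [f1 f2 f3] := fl; split => // t t0 tT; have [h1 _] := f1 t t0 tT; split => //.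
pose f t := (Hnorm (s + 1) (w t) + L1norm (w t))%E.
have L0' t' : (0 <= L1norm (w t'))%E by rewrite L1normE l1_ge0.
have fy t' : 0 <= t' -> t' <= T -> ((ns (s + 1) (hart (w t')))%:E <= f t')%E.
  by move=> a b; rewrite /f; have [_ _ _ _ ->] := sol_rep hs hp sol a b; rewrite leeDl.
apply: (flow_sobolev_bound hs hp T0 Km fl fy _ t0 tT).
have fin := HL1_integral_fin hs hp T0 L0 sol.
rewrite fineK ?ge0_fin_numE//; apply: integral_ge0 => u; rewrite /= in_itv/= => /andP[a b].
by apply: le_trans (fy u a b); rewrite lee_fin wn_ge0.
Qed.

(** Uniqueness holds because every solution is a flow, whatever its bound, and two flows with the
    same datum coincide; their continuous representatives then agree at every point. *)
Lemma perturbed_solution alpha w0 w : in_H (s + 1) w0 -> in_L1 w0 -> gSQG_solution (1 / 2) s T w0 w ->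
  let D := gap_const (fine (HL1_integral s T w)) in
  3 / 8 <= alpha -> alpha <= 1 / 2 -> D * (1 / 2 - alpha) <= 1 / 2 ->
  exists wa, [/\ gSQG_solution alpha s T w0 wa,
    forall wa', gSQG_solution alpha s T w0 wa' -> forall t, 0 <= t -> t <= T -> wa' t = wa t &
    forall t, 0 <= t -> t <= T ->
      (Hnorm s (fun x => wa t x - w t x)%R <= (D * (1 / 2 - alpha))%:E)%E].
Proof.
move=> H0 L0 sol D a1 a2 small; have h38 : 3 / 8 <= 1 / 2 :> R by lra.
have Kh := kern_sy h38 (lexx _); have Ka := kern_sy a1 a2.
have fl := sol_flow_bound L0 sol; set Y := sobolev_bound _ _ _ _ in fl.
have DE : Cst s p T Y * (2 * K * (8 * (1 / 2 - alpha)) * Y ^+ 2) = D * (1 / 2 - alpha).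
  by rewrite /D /gap_const -/Y; ring.
have [|Y' [gam [fa ea near]]] := flow_perturb hs hp T0 Ka Kh (kern_diff a1 a2) fl; first by rewrite DE.
have e0 : {ae mu, forall z : P, gam 0 z = hart w0 z}.
  by apply: filterS2 ea (sol_datum Kh H0 sol) => z -> ->.
exists (fun t => hartley (gam t)); split.
- exact: (flow_solution hs hp T0 Ka fa H0 e0).
- move=> wa' sol' t t0 tT; have [Y2 _ fl'] := sol_flow hs hp T0 Ka sol'.
  have e1 : {ae mu, forall z : P, hart (wa' 0) z = gam 0 z}.
    by apply: filterS2 e0 (sol_datum Ka H0 sol') => z -> ->.
  have et := flow_unique hs hp T0 Ka fl' fa e1 t0 tT.
  have [_ _ g1 E _] := sol_rep hs hp sol' t0 tT; have [f1 _ _] := fa; have [g2 _] := f1 t t0 tT.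
  rewrite E; apply: hartley_ae et; [exact: wL2_meas (weight_s1 hs hp) g1|exact: wL2_meas (weight_s1 hs hp) g2].
move=> t t0 tT; have [_ _ g1 E _] := sol_rep hs hp sol t0 tT; have [f1 _ _] := fa.
have [g2 _] := f1 t t0 tT; have [g1' _] := Hs_le hs hp g1; have [g2' _] := Hs_le hs hp g2.
rewrite {1}E (Hnorm_hartleyB hs hp g2' g1' g2' g1') lee_fin -DE; exact: near.
Qed.

End Final.

(** [delta] and [C] are quantified before the data and the solution, as functions of [T] and the
    integral, which expresses that beyond the fixed [s] they depend on nothing else. *)
Theorem theorem1p3 (R : realType) (s : R) (hs : 2 < s) :
  exists delta C : R -> \bar R -> R,
  forall (T : R) (w0 : R * R -> R) (w : R -> R * R -> R),
    0 < T ->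
    in_H (s + 1) w0 -> in_L1 w0 ->
    gSQG_solution (1 / 2) s T w0 w ->
    let M := HL1_integral s T w in
    [/\ 0 < delta T M,
        0 < C T M &
        forall alpha : R, 0 < alpha < 1 / 2 -> 0 < 1 / 2 - alpha < delta T M ->
        exists wa : R -> R * R -> R,
          [/\ gSQG_solution alpha s T w0 wa,
              forall wa' : R -> R * R -> R, gSQG_solution alpha s T w0 wa' ->
                forall t : R, t \in `[0, T] -> wa' t = wa t &
              forall t : R, t \in `[0, T] ->
                (Hnorm s (fun x => wa t x - w t x)%R <=
                 (C T M * ((1 / 2 - alpha) +
                           (1 / 2 - alpha) * ln (1 / 2 - alpha) ^+ 2))%:E)%E]].
Proof.
(* [p] bounds the growth of all the weights; [s + 2] is the highest order in use, in the second
   argument of the minimum in [tw]. *)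
have [p hp] : exists p : nat, s + 2 <= p%:R.
  by exists (Num.bound (s + 2)); apply/ltW/archi_boundP; have h := hs; lra.
pose D T M := gap_const s p T (fine M).
have D0 T M : 0 <= D T M by exact: gap_const_ge0.
have D1 T M : 0 < 2 * (D T M + 1) by rewrite mulr_gt0// ltr_wpDl.
(* [1 / 8] keeps [alpha] above 3/8, the range of the symbol estimates; the other term makes the
   predicted distance at most 1/2. Adding 1 keeps the constants positive when [D] vanishes. *)
exists (fun T M => Num.min (1 / 8) (2 * (D T M + 1))^-1), (fun T M => D T M + 1).
move=> T w0 w T0 H0 L0 sol M; split.
- by rewrite lt_min invr_gt0 D1 andbT divr_gt0.
- by rewrite ltr_wpDl.
move=> alpha /andP[_ a2] /andP[e0]; rewrite lt_min => /andP[e1 e2].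
have a1 : 3 / 8 <= alpha by lra.
have small : D T M * (1 / 2 - alpha) <= 1 / 2.
  have h : (D T M + 1) * (1 / 2 - alpha) <= 1 / 2.
    rewrite ltW// mulrC -ltr_pdivlMr ?ltr_wpDl//; apply: lt_le_trans e2 _.
    by rewrite invfM mul1r.
  by apply: le_trans h; rewrite ler_pM2r// lerDl.
have [wa [w1 w2 w3]] := perturbed_solution hs hp T0 H0 L0 sol a1 (ltW a2) small.
exists wa; split => //.
- by move=> wa' sol' t; rewrite in_itv/= => /andP[t0 tT]; exact: w2.
move=> t; rewrite in_itv/= => /andP[t0 tT]; apply: le_trans (w3 t t0 tT) _; rewrite lee_fin.
(* The distance obtained is linear in the gap, so the logarithmic term only enlarges the right-hand
   side. *)
have q0 : 0 <= (1 / 2 - alpha) * ln (1 / 2 - alpha) ^+ 2 by rewrite mulr_ge0 ?sqr_ge0// ltW.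
by apply: ler_pM; [exact: D0|exact: ltW|rewrite lerDl|rewrite lerDl].
Qed.
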